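(* Let $r=r(n,k,\ell)$, defined for $\ell>0$ and $(k,n)$ satisfying condition $( * )$, be a function with property (R) (see context). Let $M$ be a closed non-arithmetic hyperbolic manifold and $k$ a non-negative integer such that $(k,\dim M)$ satisfies $( * )$. Then $M$ has a finite sheeted cover that has a $k$-good geodesic.
   Context: Condition $( * )$ on a pair $(k,n)$: one of the following holds: (1) $k=0$ and $n\ge 10$; (2) $k=1$ and $n\ge 12$; (3) $k=2p-4$ for some prime $p>2$, and $n\ge 3k+8$. A closed hyperbolic manifold is a closed manifold with a given Riemannian metric of constant sectional curvature $-1$; it is non-arithmetic if its fundamental group is a non-arithmetic lattice in the isometry group of hyperbolic space. Finite covers carry the lifted hyperbolic metric. For an embedded closed geodesic $\gamma$ in a closed hyperbolic manifold $M$: $\ell(\gamma)$ is its length; $\omega(\gamma)$ is the width of its normal geodesic tubular neighborhood; and $o(\gamma)=|\{f\in ISO(M): f(\gamma)=\gamma\}|$, where $ISO(M)$ is the (finite) isometry group of $M$. Given $r$, an embedded closed geodesic $\gamma$ in a closed hyperbolic manifold $M$, with orientable normal bundle, is called $k$-good if (i) $\omega(\gamma)\ge r(\dim M,k,\ell(\gamma))$, and (ii) $o(\gamma)$ is odd if $k=0,1$, and $o(\gamma)$ is odd and not divisible by $p$ if $k=2p-4$, $p>2$ prime. Property (R) of $r$ (a function $r$ with this property is known to exist and is fixed): whenever $(k,\dim M)$ satisfies $( * )$ and a closed hyperbolic manifold $M$ has a $k$-good geodesic, the maps $\pi_k(\kappa)$ and $H_k(\kappa)$ (reduced integral homology) induced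 by the quotient map $\kappa:\mathcal{MET}^{\,sec<0}(M)\to\mathcal{M}^{\,sec<0}(M)$ are non-zero (for $k=0$: $\pi_0(\kappa)$ is non-constant). Here $\mathcal{MET}^{\,sec<0}(M)$ is the space of Riemannian metrics on $M$ with negative sectional curvatures (smooth topology), $\mathcal{M}^{\,sec<0}(M)$ is its quotient by the action of $\mathbb{R}^+\times DIFF(M)$ by scaling and pushing forward, and homotopy groups are based at the given hyperbolic metric. *)

(* Defs.v *)
From HB Require Import structures.
From mathcomp Require Import all_boot all_order all_algebra.
From mathcomp Require Import finmap.
From mathcomp Require Import all_classical all_reals all_analysis.
From mathcomp Require mpoly.
From mathcomp Require Import freeg.

Set Implicit Arguments.
Unset Strict Implicit.
Unset Printing Implicit Defensive.

Import Order.TTheory GRing.Theory Num.Theory.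
Import numFieldNormedType.Exports.

Local Open Scope classical_set_scope.
Local Open Scope ring_scope.

(* Orbit spaces.  [E] is meant to be an equivalence relation; points of the   *)
(* quotient are the sets [E x], and the topology is the quotient topology.    *)

Definition quot (T : Type) (E : T -> set T) : Type :=
  {S : set T | exists x, S = E x}.

Definition quot_pi (T : Type) (E : T -> set T) (x : T) : quot E :=
  exist _ (E x) (ex_intro _ x erefl).

HB.instance Definition _ (T : Type) (E : T -> set T) := gen_eqMixin (quot E).
HB.instance Definition _ (T : Type) (E : T -> set T) :=
  gen_choiceMixin (quot E).

Section QuotTopology.
Variables (T : topologicalType) (E : T -> set T).

Definition quot_open : set (set (quot E)) :=
  [set U | open (@quot_pi T E @^-1` U)].

Lemma quot_openT : quot_open setT.
Proof. by rewrite /quot_open /= preimage_setT; exact: openT. Qed.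

Lemma quot_openI : setI_closed quot_open.
Proof. by move=> A B; exact: openI. Qed.

Lemma quot_open_bigU (I : Type) (f : I -> set (quot E)) :
  (forall i, quot_open (f i)) -> quot_open (\bigcup_i f i).
Proof. by move=> fo; apply: bigcup_open => i _; exact: fo. Qed.

HB.instance Definition _ :=
  isOpenTopological.Build (quot E) quot_openT quot_openI quot_open_bigU.

Lemma quot_pi_continuous : continuous (@quot_pi T E).
Proof. exact/continuousP. Qed.

End QuotTopology.

Section Homotopy.
Context {R : realType} {X : topologicalType}.

Definition path_joined (a b : X) : Prop :=
  exists p : R -> X,
    [/\ {within `[0, 1]%classic, continuous p}, p 0 = a & p 1 = b].

Definition cube (k : nat) : set 'rV[R]_k :=
  [set x | forall i, 0 <= x ord0 i <= 1].

Definition cube_boundary (k : nat) : set 'rV[R]_k :=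
  [set x | cube x /\ exists i, x ord0 i = 0 \/ x ord0 i = 1].

Definition spheroid (k : nat) (b : X) (f : 'rV[R]_k -> X) : Prop :=
  {within @cube k, continuous f} /\ (forall x, cube_boundary x -> f x = b).

Definition nullhomotopic (k : nat) (b : X) (f : 'rV[R]_k -> X) : Prop :=
  exists F : R * 'rV[R]_k -> X,
    [/\ {within `[0, 1]%classic `*` @cube k, continuous F},
        (forall x, cube x -> F (0, x) = f x),
        (forall x, cube x -> F (1, x) = b) &
        (forall t x, 0 <= t <= 1 -> cube_boundary x -> F (t, x) = b)].

End Homotopy.

Definition pi_nonzero (R : realType) (X Y : topologicalType) (k : nat)
    (f : X -> Y) (b : X) : Prop :=
  if k is 0%N then exists x y : X, ~ path_joined (R := R) (f x) (f y)
  else exists s : 'rV[R]_k -> X,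
         spheroid b s /\ ~ nullhomotopic (f b) (f \o s).

Section Homology.
Variable R : realType.

Definition simplex (k : nat) : set 'rV[R]_k.+1 :=
  [set x | (forall i, 0 <= x ord0 i) /\ \sum_i x ord0 i = 1].
Arguments simplex : clear implicits.

Definition face_row (k : nat) (i : 'I_k.+2) (x : 'rV[R]_k.+1) : 'rV[R]_k.+2 :=
  \row_j (if unlift i j is Some j' then x ord0 j' else 0).

Lemma face_row_simplex (k : nat) (i : 'I_k.+2) (x : simplex k) :
  face_row i (set_val x) \in simplex k.+1.
Proof.
rewrite inE; have := set_valP x; case=> x0 x1; split.
  by move=> j; rewrite mxE; case: unlift.
rewrite (bigD1_ord i)//= mxE unlift_none add0r -x1.
by apply: eq_bigr => j _; rewrite mxE liftK.
Qed.

Definition face (k : nat) (i : 'I_k.+2) (x : simplex k) : simplex k.+1 :=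
  exist _ (face_row i (set_val x)) (face_row_simplex i x).

Lemma face_row_continuous (k : nat) (i : 'I_k.+2) :
  continuous (@face_row k i).
Proof.
move=> x U [P nP sPU]; exists (fun a b => P a (fintype.lift i b)) => [a b|y Py].
  by have := nP a (fintype.lift i b); rewrite /= mxE liftK (ord1 a).
apply: sPU => a b; have := nP a b; rewrite !mxE ord1.
case: unliftP => [j ->|_] nPb; last exact: nbhs_singleton.
by have := Py ord0 j; rewrite (ord1 a).
Qed.

Lemma face_continuous (k : nat) (i : 'I_k.+2) : continuous (@face k i).
Proof.
apply: continuous_comp_initial => x.
apply: (@continuous_comp _ _ _ set_val (@face_row k i)).
  exact: initial_continuous.
exact: face_row_continuous.
Qed.

Definition singular (k : nat) (X : topologicalType) : Type :=
  {s : simplex k -> X | continuous s}.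

HB.instance Definition _ (k : nat) (X : topologicalType) :=
  gen_eqMixin (singular k X).
HB.instance Definition _ (k : nat) (X : topologicalType) :=
  gen_choiceMixin (singular k X).

Local Notation chain k X := {freeg (singular k X) / int}.

Lemma comp_continuous (X Y Z : topologicalType) (f : X -> Y) (g : Y -> Z) :
  continuous f -> continuous g -> continuous (g \o f).
Proof. by move=> fc gc x; apply: continuous_comp; [exact: fc|exact: gc]. Qed.

Definition singular_face (k : nat) (X : topologicalType) (i : 'I_k.+2)
    (s : singular k.+1 X) : singular k X :=
  exist _ (sval s \o @face k i)
    (comp_continuous (@face_continuous k i) (svalP s)).

Definition singular_push (k : nat) (X Y : topologicalType) (f : X -> Y)
    (fc : continuous f) (s : singular k X) : singular k Y :=
  exist _ (f \o sval s) (comp_continuous (svalP s) fc).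

Definition boundary (k : nat) (X : topologicalType) (c : chain k.+1 X) :
    chain k X :=
  fglift (fun s => \sum_(i < k.+2) (-1) ^+ i *: << singular_face i s >>) c.

Definition chain_push (k : nat) (X Y : topologicalType) (f : X -> Y)
    (fc : continuous f) (c : chain k X) : chain k Y :=
  fglift (fun s => << singular_push fc s >>) c.

(* Cycles of the augmented complex, i.e. for reduced homology. *)
Definition reduced_cycle (k : nat) (X : topologicalType) :
    chain k X -> Prop :=
  match k return chain k X -> Prop with
  | 0%N => fun c => deg c = 0
  | k'.+1 => fun c => boundary c = 0
  end.

Definition reduced_homology_nonzero (k : nat) (X Y : topologicalType)
    (f : X -> Y) (fc : continuous f) : Prop :=
  exists c : chain k X, reduced_cycle c /\
    ~ exists d : chain k.+1 Y, boundary d = chain_push fc c.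

End Homology.

Section Smooth.
Context {R : realType} {n : nat}.

Definition partial (V : normedModType R) (i : 'I_n) (f : 'cV[R]_n -> V) :
    'cV[R]_n -> V :=
  fun x => 'D_(delta_mx i ord0) f x.

Definition iter_partial (V : normedModType R) (s : seq 'I_n)
    (f : 'cV[R]_n -> V) : 'cV[R]_n -> V :=
  foldr (fun i g => partial i g) f s.

Definition smooth (V : normedModType R) (f : 'cV[R]_n -> V) : Prop :=
  forall s : seq 'I_n, continuous (iter_partial s f) /\
    forall (i : 'I_n) x, derivable (iter_partial s f) x (delta_mx i ord0).

End Smooth.

(* Riemannian metrics on R^n, as fields of Gram matrices. *)
Section Riemannian.
Context {R : realType} {n : nat}.
Implicit Types (g : 'cV[R]_n -> 'M[R]_n) (x u v w : 'cV[R]_n).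

Definition inner g x u v : R := (u^T *m g x *m v) ord0 ord0.

Definition riemannian g : Prop :=
  [/\ smooth g, (forall x, (g x)^T = g x) &
      (forall x u, u != 0 -> 0 < inner g x u u)].

Definition christoffel g (l i j : 'I_n) x : R :=
  2^-1 * \sum_m invmx (g x) l m *
    (partial i g x j m + partial j g x i m - partial m g x i j).

(* The coefficient of d_l in R(d_i, d_j) d_k, for the convention              *)
(* R(X, Y) Z = D_X D_Y Z - D_Y D_X Z - D_[X, Y] Z.                            *)
Definition riemann g (l i j k : 'I_n) x : R :=
  partial i (christoffel g l j k : 'cV[R]_n -> R^o) x
  - partial j (christoffel g l i k : 'cV[R]_n -> R^o) x
  + \sum_m (christoffel g l i m x * christoffel g m j k x
            - christoffel g l j m x * christoffel g m i k x).

Definition curvature_op g x u v w : 'cV[R]_n :=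
  \col_l \sum_i \sum_j \sum_k
    riemann g l i j k x * u i ord0 * v j ord0 * w k ord0.

Definition sec g x u v : R :=
  inner g x (curvature_op g x u v v) u /
  (inner g x u u * inner g x v v - inner g x u v ^+ 2).

Definition negatively_curved g : Prop :=
  forall x u v, \rank (row_mx u v) = 2 -> sec g x u v < 0.

End Riemannian.

(* Hyperbolic space H^n is R^n, in the global chart which projects the        *)
(* hyperboloid { (t, x) | - t^2 + |x|^2 = - 1, t > 0 } of R^(1+n) onto its    *)
(* space coordinate x.                                                        *)
Section Hyperbolic.
Context {R : realType} {n : nat}.
Implicit Types (x w : 'cV[R]_n) (A : 'M[R]_(1 + n)).

Definition lift_hyperboloid x : 'cV[R]_(1 + n) :=
  col_mx (Num.sqrt (1 + (x^T *m x) ord0 ord0))%:M x.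

Definition lorentz_form : 'M[R]_(1 + n) := block_mx (-1)%:M 0 0 1%:M.

(* The isometry group of H^n, O^+(n, 1). *)
Definition lorentz : set 'M[R]_(1 + n) :=
  [set A | A^T *m lorentz_form *m A = lorentz_form /\ 0 < A ord0 ord0].

(* Its identity component. *)
Definition lorentz0 : set 'M[R]_(1 + n) := [set A | lorentz A /\ \det A = 1].

Definition hact A x : 'cV[R]_n := dsubmx (A *m lift_hyperboloid x).

(* The pullback to the chart of the Minkowski form - dt^2 + |dx|^2. *)
Definition hmetric x : 'M[R]_n :=
  1%:M - (1 + (x^T *m x) ord0 ord0)^-1 *: (x *m x^T).

Definition hnorm x w : R := Num.sqrt (inner hmetric x w w).

Definition cosh (t : R) : R := (expR t + expR (- t)) / 2.
Definition sinh (t : R) : R := (expR t - expR (- t)) / 2.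

(* Riemannian exponential map of H^n: the geodesics of the hyperboloid are    *)
(* cosh(t) X + sinh(t) U and the chart is linear.                             *)
Definition hexp x w : 'cV[R]_n :=
  cosh (hnorm x w) *: x + (sinh (hnorm x w) / hnorm x w) *: w.

Definition hgeodesic x w (t : R) : 'cV[R]_n := hexp x (t *: w).

End Hyperbolic.

Section MatrixGroups.
Context {R : realType} {m : nat}.
Implicit Types (D G : set 'M[R]_m).

Definition mx_subgroup G : Prop :=
  [/\ G 1%:M, (forall A B, G A -> G B -> G (A *m B)) &
      (forall A, G A -> A \in unitmx /\ G (invmx A))].

Definition finite_index D G : Prop :=
  D `<=` G /\
  exists s : seq 'M[R]_m, forall A, G A -> exists2 B, B \in s & D (invmx B *m A).

Definition commensurable D G : Prop :=
  finite_index (D `&` G) D /\ finite_index (D `&` G) G.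

(* Real points of the subgroups of SL_m which are closed and defined over Q. *)
Definition algebraic_Q_group G : Prop :=
  mx_subgroup G /\
  exists ps : set (mpoly.mpoly (m * m) rat),
    forall A, G A <-> \det A = 1 /\
      forall p, ps p ->
        mpoly.meval (fun i => mxvec A ord0 i) (mpoly.map_mpoly ratr p) = 0.

Definition identity_component G : set 'M[R]_m := connected_component G 1%:M.

Definition semisimple G : Prop :=
  forall N : set 'M[R]_m,
    mx_subgroup N -> N `<=` identity_component G -> connected N ->
    (forall A B, N A -> N B -> A *m B = B *m A) ->
    (forall A B, identity_component G A -> N B -> N (A *m B *m invmx A)) ->
    N `<=` [set 1%:M].

Definition integer_points G : set 'M[R]_m :=
  [set A | G A /\ forall i j, A i j \is a Num.int].

End MatrixGroups.

(* The definition of arithmetic lattices in the isometry group of H^n: up to  *)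
(* commensurability, images of the integer points of a semisimple Q-group     *)
(* under a surjection with compact kernel onto the identity component.        *)
Definition arithmetic_lattice (R : realType) (n : nat) (G : set 'M[R]_(1 + n)) : Prop :=
  exists (m : nat) (H : set 'M[R]_m) (f : 'M[R]_m -> 'M[R]_(1 + n)),
    let H0 := identity_component H in
    [/\ algebraic_Q_group H /\ semisimple H,
        {within H0, continuous f},
        (forall A B, H0 A -> H0 B -> f (A *m B) = f A *m f B),
        f @` H0 = lorentz0 /\ compact [set A | H0 A /\ f A = 1%:M] &
        commensurable (f @` integer_points H0) G].

(* The closed hyperbolic manifolds of dimension n are the quotients M = G\H^n *)
(* for the subgroups G of Isom(H^n) below; G is the fundamental group of M.   *)
Section Manifold.
Context {R : realType} {n : nat}.
Variable G : set 'M[R]_(1 + n).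

Definition closed_hyperbolic : Prop :=
  [/\ mx_subgroup G /\ G `<=` lorentz,
      (forall A x, G A -> hact A x = x -> A = 1%:M),
      (forall K : set 'cV[R]_n, compact K ->
         finite_set [set A | G A /\ (hact A @` K) `&` K !=set0]) &
      (exists K : set 'cV[R]_n, compact K /\
         forall x, exists2 A, G A & K (hact A x))].

Definition horbit (x : 'cV[R]_n) : set 'cV[R]_n :=
  [set y | exists2 A, G A & y = hact A x].

Definition manifold : Type := quot horbit.
HB.instance Definition _ := Topological.on manifold.

Definition mproj (x : 'cV[R]_n) : manifold := quot_pi horbit x.

(* Lifts to H^n of the diffeomorphisms of M.  All diffeomorphisms lift, as    *)
(* H^n is the universal cover.                                                *)
Definition diffeo_lift (phi : 'cV[R]_n -> 'cV[R]_n) : Prop :=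
  [/\ smooth phi,
      (exists psi : 'cV[R]_n -> 'cV[R]_n,
         [/\ smooth psi, cancel phi psi & cancel psi phi]) &
      (forall x y, mproj x = mproj y <-> mproj (phi x) = mproj (phi y))].

(* phi^* h = a g *)
Definition pullback_eq (phi : 'cV[R]_n -> 'cV[R]_n)
    (h g : 'cV[R]_n -> 'M[R]_n) (a : R) : Prop :=
  forall x u v, inner h (phi x) ('d phi x u) ('d phi x v) = a * inner g x u v.

Definition isometry_group : set (manifold -> manifold) :=
  [set f | exists phi, [/\ diffeo_lift phi, pullback_eq phi hmetric hmetric 1 &
                           forall x, f (mproj x) = mproj (phi x)]].

(* Metrics on M are G-invariant metrics on H^n. *)
Definition MET : Type :=
  {g : 'cV[R]_n -> 'M[R]_n | [/\ riemannian g, negatively_curved g &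
     forall A, G A -> pullback_eq (hact A) g g 1]}.

HB.instance Definition _ := gen_eqMixin MET.
HB.instance Definition _ := gen_choiceMixin MET.

(* The smooth topology: compact convergence of all partial derivatives. *)
Definition MET_jet (g : MET) :
    prod_topology (fun _ : seq 'I_n => {family compact, 'cV[R]_n -> 'M[R]_n}) :=
  fun s => iter_partial s (sval g).

HB.instance Definition _ := Topological.copy MET (initial_topology MET_jet).

(* The metrics a phi_* g, for a > 0 and phi in DIFF(M). *)
Definition MET_orbit (g : MET) : set MET :=
  [set h | exists a phi, [/\ 0 < a, diffeo_lift phi &
                             pullback_eq phi (sval h) (sval g) a]].

Definition moduli : Type := quot MET_orbit.
HB.instance Definition _ := Topological.on moduli.

Definition kappa : MET -> moduli := @quot_pi MET MET_orbit.

Lemma kappa_continuous : continuous kappa.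
Proof. exact: quot_pi_continuous. Qed.

(* An embedded closed geodesic, given by a unit-speed parametrization of one  *)
(* of its lifts to H^n.  The last field says that the projection of the lift  *)
(* factors through an injective map on R / len Z.                             *)
Record closed_geodesic := ClosedGeodesic {
  cg_base : 'cV[R]_n;
  cg_dir : 'cV[R]_n;
  cg_length : R;
  cg_unit : inner hmetric cg_base cg_dir cg_dir = 1;
  cg_length_gt0 : 0 < cg_length;
  cg_embedded : forall s t,
    mproj (hgeodesic cg_base cg_dir s) = mproj (hgeodesic cg_base cg_dir t) <->
    exists z : int, t - s = z%:~R * cg_length
}.

Variable c : closed_geodesic.

Definition cg_line (t : R) : 'cV[R]_n := hgeodesic (cg_base c) (cg_dir c) t.

Definition cg_image : set manifold := [set mproj (cg_line t) | t in setT].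

Definition cg_normal (t : R) : set 'cV[R]_n :=
  [set w | inner hmetric (cg_line t) (derive1 cg_line t) w = 0].

(* The normal bundle of the lift carries a continuous frame (the columns of   *)
(* E) whose orientation is preserved by the deck transformations.             *)
Definition orientable_normal_bundle : Prop :=
  exists E : R -> 'M[R]_(n, n.-1),
    [/\ continuous E,
        (forall t, \rank (E t) = n.-1 /\ forall j, cg_normal t (col j (E t))) &
        (forall A s t, G A -> hact A (cg_line s) = cg_line t ->
           exists P : 'M[R]_(n.-1), 0 < \det P /\
             forall j, 'd (hact A) (cg_line s) (col j (E s)) =
                       col j (E t *m P))].

(* The normal exponential map of the geodesic embeds the open disc bundle of  *)
(* radius a into M.  This is injectivity (the points (s, w) and (t, w') of    *)
(* the lifted normal bundle being identified by deck transformations), since  *)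
(* in constant curvature -1 the normal exponential map is an immersion.       *)
Definition normal_tube (a : R) : Prop :=
  forall s t w w', cg_normal s w -> cg_normal t w' ->
    hnorm (cg_line s) w < a -> hnorm (cg_line t) w' < a ->
    mproj (hexp (cg_line s) w) = mproj (hexp (cg_line t) w') ->
    exists A, [/\ G A, hact A (cg_line s) = cg_line t &
                  'd (hact A) (cg_line s) w = w'].

Definition cg_width : \bar R :=
  ereal_sup [set a%:E | a in [set a | 0 < a /\ normal_tube a]].

Definition cg_symmetries : nat :=
  #|` fset_set [set f : {classic (manifold -> manifold)} |
                 isometry_group f /\ f @` cg_image = cg_image] |.

End Manifold.

Definition dim_condition (k n : nat) : Prop :=
  [\/ k = 0%N /\ (10 <= n)%N,
      k = 1%N /\ (12 <= n)%N |
      exists p, [/\ prime p, (2 < p)%N, k = (2 * p - 4)%N &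
                    (3 * k + 8 <= n)%N]].

Definition k_good (R : realType) (r : nat -> nat -> R -> R) (n k : nat)
    (G : set 'M[R]_(1 + n)) (c : closed_geodesic G) : Prop :=
  [/\ orientable_normal_bundle c,
      ((r n k (cg_length c))%:E <= cg_width c)%E,
      (k = 0%N \/ k = 1%N -> odd (cg_symmetries c)) &
      (forall p, prime p -> (2 < p)%N -> k = (2 * p - 4)%N ->
         odd (cg_symmetries c) /\ ~~ (p %| cg_symmetries c)%N)].

Definition has_k_good (R : realType) (r : nat -> nat -> R -> R) (n k : nat)
    (G : set 'M[R]_(1 + n)) : Prop :=
  exists c : closed_geodesic G, k_good r k c.

(* The base point of pi_k is the hyperbolic metric of M. *)
Definition property_R (R : realType) (r : nat -> nat -> R -> R) : Prop :=
  forall (n k : nat) (G : set 'M[R]_(1 + n)),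
    closed_hyperbolic G -> dim_condition k n -> has_k_good r k G ->
    (exists g0 : MET G, sval g0 = hmetric /\ pi_nonzero R k (@kappa R n G) g0)
    /\ reduced_homology_nonzero R k (@kappa_continuous R n G).

(* Finite covers of G\H^n are the G'\H^n, for G' of finite index in G. *)
Definition finite_cover (R : realType) (n : nat) (G' G : set 'M[R]_(1 + n)) :
    Prop :=
  closed_hyperbolic G' /\ finite_index G' G.

(* Main.v *)
(* A closed geodesic of a finite cover is the image of the axis of a loxodromic
   element of a finite index subgroup of G. The discrete groups of isometries
   containing G are uniformly discrete, so one of them, Lam, is maximal; let
   C be the orientation preserving part of the normal core of G in Lam.
   Combining large powers of a loxodromic element of C with an element moving
   its axis, one finds g in C whose axis has stabiliser <g> in Lam. Let S be
   the finitely generated ring containing the entries of Lam in a basis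
   adapted to this axis, and the inverses of the nonzero entries moving the
   axis of the elements of Lam of bounded size. A place of S with finite
   residue rings modulo powers of a prime q gives a valuation ring V of R
   containing S. Let f be the entry of least valuation of x0 - 1, for a power
   x0 of g with x0 = 1 mod q. The tile G' consists of the x in C whose entries
   moving the axis are divisible by f. Its elements of bounded size thus
   preserve the axis, so that the tubular neighbourhood is as wide as one
   wishes. If an isometry h normalises G' and preserves the axis, then
   V-linear combinations of conjugates of G' show that h has entries in V, so
   h normalises the principal congruence subgroup mod f, whose normaliser is
   discrete and contains Lam, hence is Lam: h is in <g>. Since every isometry
   of the cover comes from a Lorentz transformation normalising G', no
   nontrivial isometry preserves the geodesic, that is, o = 1. *)

From HB Require Import structures.
Require Import Defs.
From mathcomp Require Import all_boot all_order all_algebra.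
From mathcomp Require Import all_field finmap.
From mathcomp Require Import all_classical all_reals all_analysis.
From mathcomp Require Import ring lra zify.

Set Implicit Arguments.
Unset Strict Implicit.
Unset Printing Implicit Defensive.

Import Order.TTheory GRing.Theory Num.Theory.
Import numFieldNormedType.Exports.

Local Open Scope classical_set_scope.
Local Open Scope ring_scope.

(** * Minkowski space *)

Section Dot.
Context {R : realType} {k : nat}.
Implicit Types (x y z : 'cV[R]_k).

(** The width required of the geodesic depends on its length, so the length must be fixed before the
    radius of the tube. The cover therefore has to contain [g] itself, not only a power of it. A
    principal congruence subgroup would lose [g]; the tile restricts only the entries that move the
    axis, and for [g] these vanish. The price is that a Lorentz transformation h normalising the
    tile has no evident relation to [Lam], and its integrality must be recovered from that
    normalisation alone. The tool is (x0 - x0^-1)/f: it lies in so(n,1), and it has a unit entry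
    because f is an entry of least valuation and 2 is invertible (q is odd). Bracketing it with
    so(n,1) yields over V the root vectors joining each end to the complement of the axis. Brackets
    are available since every ad Z is a linear combination of operators Ad A with A in [G], an
    algebraic substitute for density. The entries of [Lam] are not known to be algebraic, so the
    place comes from a homomorphism to the algebraic numbers; it keeps the eigenvalue of [g] from
    becoming a root of unity, which makes f divide a power of q and gives the tile finite index. *)

Definition dot x y : R := (x^T *m y) ord0 ord0.

Lemma dotE x y : dot x y = \sum_i x i ord0 * y i ord0.
Proof. by rewrite /dot mxE; apply: eq_bigr => i _; rewrite mxE. Qed.

Lemma dotC x y : dot x y = dot y x.
Proof. by rewrite !dotE; apply: eq_bigr => i _; rewrite mulrC. Qed.

Lemma dotDl x y z : dot (x + y) z = dot x z + dot y z.
Proof. by rewrite !dotE -big_split; apply: eq_bigr => i _; rewrite mxE mulrDl. Qed.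

Lemma dotZl a x y : dot (a *: x) y = a * dot x y.
Proof. by rewrite !dotE big_distrr; apply: eq_bigr => i _; rewrite mxE /= mulrA. Qed.

Lemma dot_ge0 x : 0 <= dot x x.
Proof. by rewrite dotE; apply: sumr_ge0 => i _; rewrite -expr2 sqr_ge0. Qed.

Lemma dot_eq0 x : dot x x = 0 -> x = 0.
Proof.
rewrite dotE => /eqP; rewrite psumr_eq0; last first.
  by move=> i _; rewrite -expr2 sqr_ge0.
move=> /allP h; apply/matrixP => i j; rewrite (ord1 j) mxE.
by have := h i (mem_index_enum _); rewrite /= mulf_eq0 orbb => /eqP.
Qed.

Lemma entry_dot x i : x i ord0 ^+ 2 <= dot x x.
Proof.
rewrite dotE (bigD1 i)//= -expr2 lerDl; apply: sumr_ge0 => j _.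
by rewrite -expr2 sqr_ge0.
Qed.

End Dot.

Lemma discriminant_le (R : realType) (a b c : R) :
  (forall s, 0 <= a + 2 * s * b + s ^+ 2 * c) -> b ^+ 2 <= a * c.
Proof.
move=> h; have c0 : 0 <= c.
  case: (ltP c 0) => // c0.
  (* If c < 0 the polynomial is negative at this point: it is at least 1, and its product with - c
     exceeds |a| + 2 |b|. *)
  have := h ((`|a| + 2 * `|b| + 1) / - c + 1).
  set t := (_ / _) + 1.
  have t1 : 1 <= t.
    rewrite lerDr; apply: divr_ge0; last by rewrite oppr_ge0 ltW.
    by have := normr_ge0 a; have := normr_ge0 b; lra.
  have tc : t * - c = (`|a| + 2 * `|b| + 1) - c.
    by rewrite /t mulrDl divfK ?mul1r// oppr_eq0 lt_eqF.
  have -> : t ^+ 2 * c = - (t * (`|a| + 2 * `|b| + 1 - c)).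
    by rewrite -tc; ring.
  have ha : a <= t * `|a|.
    by rewrite (le_trans (ler_norm a))// ler_peMl.
  have hb : t * b <= t * `|b|.
    by rewrite ler_wpM2l ?ler_norm// (le_trans ler01).
  have tt : 0 < t * (1 - c) by apply: mulr_gt0; [exact: lt_le_trans t1|move: c0; lra].
  by move: ha hb tt; lra.
have [c00|cn0] := eqVneq c 0.
  have [->|b0] := eqVneq b 0; first by rewrite c00 mulr0 expr0n.
  have := h (- (a + 1) / (2 * b)); rewrite c00 mulr0 addr0.
  have -> : 2 * (- (a + 1) / (2 * b)) * b = - (a + 1) by field.
  by lra.
have cp : 0 < c by rewrite lt_def cn0.
have := h (- b / c).
have -> : a + 2 * (- b / c) * b + (- b / c) ^+ 2 * c = (a * c - b ^+ 2) / c.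
  by field.
by rewrite pmulr_lge0 ?invr_gt0// subr_ge0.
Qed.

Lemma dotCS (R : realType) k (x y : 'cV[R]_k) :
  dot x y ^+ 2 <= dot x x * dot y y.
Proof.
apply: discriminant_le => s; have := dot_ge0 (x + s *: y).
rewrite !(dotDl, dotZl) !(dotC _ (_ + _)) !(dotDl, dotZl) (dotC y x).
by move=> h; apply: (le_trans h); rewrite le_eqVlt; apply/orP; left; apply/eqP; ring.
Qed.

Section Minkowski.
Context {R : realType} {n : nat}.
Implicit Types (u v w X Y : 'cV[R]_(1 + n)) (A : 'M[R]_(1 + n)).

Local Notation J := (lorentz_form : 'M[R]_(1 + n)).

Definition mink u v : R := (u^T *m J *m v) ord0 ord0.
Local Notation B := mink.

Definition tc u : R := u ord0 ord0.
Definition sp u : 'cV[R]_n := dsubmx u.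

Lemma tcE u : tc u = usubmx u ord0 ord0.
Proof. by rewrite mxE; congr (u _ _); apply/val_inj. Qed.

Lemma col_tcsp u : u = col_mx (tc u)%:M (sp u).
Proof.
rewrite -[LHS]vsubmxK; congr col_mx; apply/matrixP => i j.
by rewrite !ord1 -tcE mxE eqxx mulr1n.
Qed.

Lemma mink_ext u v : tc u = tc v -> sp u = sp v -> u = v.
Proof. by move=> a b; rewrite (col_tcsp u) (col_tcsp v) a b. Qed.

Lemma minkE u v : B u v = dot (sp u) (sp v) - tc u * tc v.
Proof.
rewrite /mink (col_tcsp u) (col_tcsp v) tr_col_mx /lorentz_form.
rewrite mul_row_block mul_row_col !mulmx0 addr0 add0r mulmx1.
rewrite /sp !col_mxKd /tc /dot mxE addrC; congr (_ + _).
rewrite !mxE big_ord1 !mxE !big_ord1 !mxE eqxx.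
case: splitP => [j _|j /=]; last by rewrite add1n.
by rewrite (ord1 j) !mxE eqxx !mulr1n mulrN1 mulNr.
Qed.

Lemma minkC u v : B u v = B v u.
Proof. by rewrite !minkE dotC (mulrC (tc u)). Qed.

Lemma tcD u v : tc (u + v) = tc u + tc v. Proof. by rewrite /tc mxE. Qed.
Lemma tcZ a u : tc (a *: u) = a * tc u. Proof. by rewrite /tc mxE. Qed.
Lemma tcN u : tc (- u) = - tc u. Proof. by rewrite /tc mxE. Qed.
Lemma spD u v : sp (u + v) = sp u + sp v. Proof. by rewrite /sp linearD. Qed.
Lemma spZ a u : sp (a *: u) = a *: sp u. Proof. by rewrite /sp linearZ. Qed.

Lemma minkDl u v w : B (u + v) w = B u w + B v w.
Proof. by rewrite /mink linearD /= !mulmxDl mxE. Qed.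
Lemma minkZl a u v : B (a *: u) v = a * B u v.
Proof. by rewrite /mink linearZ /= -!scalemxAl mxE. Qed.
Lemma minkNl u v : B (- u) v = - B u v.
Proof. by rewrite -scaleN1r minkZl mulN1r. Qed.
Lemma mink0l v : B 0 v = 0.
Proof. by rewrite -(scale0r 0) minkZl mul0r. Qed.
Lemma minkBl u v w : B (u - v) w = B u w - B v w.
Proof. by rewrite minkDl minkNl. Qed.
Lemma minkDr u v w : B w (u + v) = B w u + B w v.
Proof. by rewrite !(minkC w) minkDl. Qed.
Lemma minkZr a u v : B u (a *: v) = a * B u v.
Proof. by rewrite !(minkC u) minkZl. Qed.
Lemma minkNr u v : B u (- v) = - B u v.
Proof. by rewrite !(minkC u) minkNl. Qed.
Lemma mink0r v : B v 0 = 0.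
Proof. by rewrite minkC mink0l. Qed.
Lemma minkBr u v w : B w (u - v) = B w u - B w v.
Proof. by rewrite minkDr minkNr. Qed.
Definition minkL := (minkDl, minkZl, minkNl, mink0l, minkDr, minkZr, minkNr, mink0r).

Lemma mink_sumr I (r : seq I) P (F : I -> 'cV[R]_(1 + n)) u :
  B u (\sum_(i <- r | P i) F i) = \sum_(i <- r | P i) B u (F i).
Proof. by rewrite /mink mulmx_sumr summxE. Qed.

Lemma lformK : J *m J = 1%:M.
Proof.
rewrite /lorentz_form mulmx_block !mulmx0 !mul0mx !addr0 add0r mulmx1.
by rewrite -scalar_mxM mulrNN mul1r -scalar_mx_block.
Qed.

Lemma lformT : J^T = J.
Proof. by rewrite /lorentz_form tr_block_mx !tr_scalar_mx !trmx0. Qed.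

Lemma mink_nondeg u : (forall v, B u v = 0) -> u = 0.
Proof.
move=> h; have : u^T *m J = 0.
  apply/matrixP => i j; rewrite (ord1 i) [RHS]mxE -(h (delta_mx j ord0)).
  by rewrite /mink -colE [RHS]mxE.
move=> /(congr1 (fun M => (M *m J)^T)).
by rewrite -mulmxA lformK mulmx1 trmxK mul0mx trmx0.
Qed.

Definition e0 : 'cV[R]_(1 + n) := col_mx 1%:M 0.

Lemma tc_e0 : tc e0 = 1.
Proof. by rewrite tcE col_mxKu mxE eqxx. Qed.
Lemma sp_e0 : sp e0 = 0.
Proof. by rewrite /sp col_mxKd. Qed.

Lemma mink_e0 u : B e0 u = - tc u.
Proof. by rewrite minkE tc_e0 sp_e0 mul1r dotC -(scale0r (sp u)) dotC dotZl mul0r sub0r. Qed.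

Lemma e0E : e0 = delta_mx ord0 ord0.
Proof.
apply/matrixP => i j; rewrite mxE (ord1 j); case: splitP => k ik.
  by rewrite !mxE !ord1 eqxx /= -val_eqE /= ik (ord1 k).
by rewrite !mxE -val_eqE /= ik.
Qed.

Lemma tc_mul A : tc (A *m e0) = A ord0 ord0.
Proof. by rewrite e0E -colE /tc mxE. Qed.

Definition causal u := B u u <= 0 /\ 0 < tc u.
(** Up to positive multiples these are the points at infinity of hyperbolic space; [hyp] is the
    hyperboloid itself. *)
Definition null u := B u u = 0 /\ 0 < tc u.
Definition hyp u := B u u = -1 /\ 0 < tc u.

Lemma hyp_causal u : hyp u -> causal u.
Proof. by case=> h ?; split=> //; rewrite h lerN10. Qed.
Lemma null_causal u : null u -> causal u.
Proof. by case=> h ?; split=> //; rewrite h. Qed.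
Hint Resolve hyp_causal null_causal : core.

Lemma hyp_e0 : hyp e0.
Proof. by split; rewrite ?mink_e0 tc_e0. Qed.
Hint Resolve hyp_e0 : core.

Lemma causalE u : causal u -> dot (sp u) (sp u) <= tc u ^+ 2.
Proof. by case; rewrite minkE expr2 subr_le0. Qed.

Lemma causal_dot u v : causal u -> causal v -> `|dot (sp u) (sp v)| <= tc u * tc v.
Proof.
move=> hu hv; have [_ u0] := hu; have [_ v0] := hv.
have uv0 : 0 <= tc u * tc v by apply: mulr_ge0; apply: ltW.
rewrite -(@ler_pXn2r _ 2)// ?nnegrE// real_normK ?num_real//.
apply: le_trans (dotCS _ _) _; rewrite exprMn.
by apply: ler_pM; rewrite ?dot_ge0// ?causalE.
Qed.

Lemma causal_le0 u v : causal u -> causal v -> B u v <= 0.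
Proof.
by move=> hu hv; rewrite minkE subr_le0 (le_trans (ler_norm _))// causal_dot.
Qed.

Lemma causalD u v : causal u -> causal v -> causal (u + v).
Proof.
move=> hu hv; have [u1 u0] := hu; have [v1 v0] := hv; split; last first.
  by rewrite tcD addr_gt0.
by rewrite !minkL (minkC v u); have := causal_le0 hu hv; lra.
Qed.

Lemma nullZ a u : 0 < a -> null u -> null (a *: u).
Proof. by move=> a0 [u1 u0]; split; rewrite ?tcZ ?mulr_gt0// !minkL u1 !mulr0. Qed.

Lemma null_neq0 u : null u -> u != 0.
Proof.
by move=> [_ h]; apply: contraTneq h => ->; rewrite /tc mxE ltxx.
Qed.

(** The multiple of u with the time coordinate of v differs from v by a null vector of time
    coordinate 0, hence by 0. *)
Lemma null_perp u v : null u -> null v -> B u v = 0 -> v = (tc v / tc u) *: u.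
Proof.
move=> [u1 u0] [v1 v0] uv; set a := tc v / tc u.
have tca : tc v = a * tc u by rewrite divfK ?gt_eqF.
apply: mink_ext; first by rewrite tcZ.
apply/eqP; rewrite -subr_eq0; apply/eqP/dot_eq0.
have : B (v - a *: u) (v - a *: u) = 0 by rewrite !minkL (minkC v u) uv u1 v1; ring.
by rewrite minkE tcD tcN tcZ tca subrr mul0r subr0 spD -scaleN1r !spZ scaleN1r.
Qed.

Lemma perp_ge0 X u : causal X -> B X u = 0 -> 0 <= B u u.
Proof.
move=> hX; rewrite minkE => /eqP; rewrite subr_eq0 => /eqP Xu.
have := dotCS (sp X) (sp u); rewrite Xu exprMn => cs.
have := causalE hX; have [_ X0] := hX => h.
rewrite minkE subr_ge0 -expr2.
have h1 : tc X ^+ 2 * tc u ^+ 2 <= tc X ^+ 2 * dot (sp u) (sp u).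
  by apply: le_trans cs _; apply: ler_wpM2r; rewrite ?dot_ge0.
by move: h1; rewrite ler_pM2l// exprn_gt0.
Qed.

Lemma perp_eq0 X u : hyp X -> B X u = 0 -> B u u = 0 -> u = 0.
Proof.
move=> hX; rewrite minkE => /eqP; rewrite subr_eq0 => /eqP Xu.
have := dotCS (sp X) (sp u); rewrite Xu exprMn => cs.
case: hX; rewrite minkE => /eqP; rewrite subr_eq => /eqP X1 X0.
rewrite minkE => /eqP; rewrite subr_eq0 => /eqP uu.
have u0 : tc u = 0.
  apply/eqP; case: (eqVneq (tc u) 0) => // un0.
  have u2 : 0 < tc u ^+ 2 by rewrite lt_def sqrf_eq0 un0 sqr_ge0.
  by move: cs; rewrite uu X1; nra.
apply: mink_ext; first by rewrite u0 /tc mxE.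
by rewrite [sp 0]linear0; apply: dot_eq0; rewrite uu u0 mul0r.
Qed.

Lemma perp_CS X u v : causal X -> B X u = 0 -> B X v = 0 ->
  B u v ^+ 2 <= B u u * B v v.
Proof.
move=> hX Xu Xv; apply: discriminant_le => s.
have := @perp_ge0 X (u + s *: v) hX; rewrite !minkL Xu Xv (minkC v u).
have -> : B u u + s * B u v + s * (B u v + s * B v v) =
  B u u + 2 * s * B u v + s ^+ 2 * B v v by ring.
by apply; rewrite mulr0 addr0.
Qed.

(** Reversed Cauchy-Schwarz: Y + (B X Y) X is orthogonal to X and so has nonnegative square norm.
    The number - B X Y is the hyperbolic cosine of the distance of X and Y, the form in which
    distances enter the proof. *)
Lemma hyp_mink X Y : hyp X -> hyp Y -> B X Y <= -1.
Proof.
move=> hX hY; have [X1 _] := hX; have [Y1 _] := hY.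
have le0 := causal_le0 (hyp_causal hX) (hyp_causal hY).
have := @perp_ge0 X (Y + B X Y *: X) (hyp_causal hX).
rewrite !minkL X1 Y1 (minkC Y X) => /(_ _).
by move=> /(_ ltac:(ring)); nra.
Qed.

Lemma hyp_mink_eq X Y : hyp X -> hyp Y -> B X Y = -1 -> X = Y.
Proof.
move=> hX hY XY; have [X1 _] := hX; have [Y1 _] := hY.
apply/eqP; rewrite -subr_eq0; apply/eqP; apply: (perp_eq0 hX).
  by rewrite !minkL X1 XY; ring.
by rewrite !minkL X1 XY Y1 (minkC Y X) XY; ring.
Qed.

Lemma lor_mink A u v : lorentz A -> B (A *m u) (A *m v) = B u v.
Proof.
by move=> [h _]; rewrite /mink trmx_mul -[in RHS]h !mulmxA.
Qed.

Definition linv A : 'M[R]_(1 + n) := J *m A^T *m J.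

Lemma lor_VA A : lorentz A -> linv A *m A = 1%:M.
Proof. by move=> [h _]; rewrite /linv -!mulmxA (mulmxA A^T) h lformK. Qed.

Lemma lor_unit A : lorentz A -> A \in unitmx.
Proof. by move=> /lor_VA /mulmx1_unit[]. Qed.

Lemma lor_AV A : lorentz A -> A *m invmx A = 1%:M.
Proof. by move=> /lor_unit; exact: mulmxV. Qed.

Lemma lor_VAi A : lorentz A -> invmx A *m A = 1%:M.
Proof. by move=> /lor_unit; exact: mulVmx. Qed.

Lemma lor_adj A u v : lorentz A -> B (invmx A *m u) v = B u (A *m v).
Proof. by move=> h; rewrite -(lor_mink _ _ h) mulmxA lor_AV// mul1mx. Qed.

Lemma lor_e0 A : lorentz A -> hyp (A *m e0).
Proof.
by move=> h; split; rewrite ?tc_mul; [rewrite lor_mink// mink_e0 tc_e0|case: h].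
Qed.

Lemma lor_tcV A : lorentz A -> (invmx A) ord0 ord0 = A ord0 ord0.
Proof.
move=> h; rewrite -!tc_mul; apply: oppr_inj.
by rewrite -!mink_e0 minkC lor_adj// mink_e0.
Qed.

(** A u pairs with [e0] as u pairs with the point A^-1 e0 of the hyperboloid, so its time coordinate
    is nonnegative. It could vanish only for u = 0, since the orthogonal complement of a point is
    positive definite. *)
Lemma lor_causal A u : lorentz A -> causal u -> causal (A *m u).
Proof.
move=> h hu; have [u1 u0] := hu; split; first by rewrite lor_mink.
rewrite -oppr_lt0 -mink_e0 minkC.
have -> : B (A *m u) e0 = B u (invmx A *m e0) by rewrite (minkC u) lor_adj// minkC.
have hV : hyp (invmx A *m e0).
  split; last by rewrite tc_mul lor_tcV//; case: h.
  by rewrite -(lor_mink _ _ h) mulmxA lor_AV// mul1mx mink_e0 tc_e0.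
have := causal_le0 hu (hyp_causal hV); rewrite le_eqVlt => /orP[/eqP h0|//].
have uu := perp_ge0 (hyp_causal hV) (etrans (minkC _ _) h0).
have : B u u = 0 by apply/eqP; rewrite eq_le u1 uu.
move/(perp_eq0 hV (etrans (minkC _ _) h0)) => uz.
by move: u0; rewrite uz /tc mxE ltxx.
Qed.

Lemma lor_hyp A u : lorentz A -> hyp u -> hyp (A *m u).
Proof.
move=> h hu; have [u1 u0] := hu; split; first by rewrite lor_mink.
by have [] := lor_causal h (hyp_causal hu).
Qed.

Lemma lor_null A u : lorentz A -> null u -> null (A *m u).
Proof.
move=> h hu; have [u1 u0] := hu; split; first by rewrite lor_mink.
by have [] := lor_causal h (null_causal hu).
Qed.

Lemma lor1 : lorentz (1%:M : 'M[R]_(1 + n)).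
Proof. by split; [rewrite trmx1 mul1mx mulmx1|rewrite mxE eqxx ltr01]. Qed.

Lemma lorM A A' : lorentz A -> lorentz A' -> lorentz (A *m A').
Proof.
move=> h h'; split.
  case: h => h _; case: h' => h' _.
  by rewrite trmx_mul -[in RHS]h' -[in RHS]h !mulmxA.
by rewrite -tc_mul -mulmxA; have [] := lor_hyp h (lor_e0 h').
Qed.

Lemma lorV A : lorentz A -> lorentz (invmx A).
Proof.
move=> h; split; last by rewrite lor_tcV//; case: h.
have := lor_AV h => AV; case: (h) => hA _.
by rewrite -[in LHS]hA !mulmxA -trmx_mul AV trmx1 mul1mx -!mulmxA AV mulmx1.
Qed.

Lemma mulmx_ext A A' : (forall u, A *m u = A' *m u) -> A = A'.
Proof.
move=> h; apply/matrixP => i j.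
by have := congr1 (fun M : 'cV_(1 + n) => M i ord0) (h (delta_mx j ord0)); rewrite -!colE !mxE.
Qed.

Lemma hyp_sp X : hyp X -> dot (sp X) (sp X) = tc X ^+ 2 - 1.
Proof. by case; rewrite minkE expr2 => h _; lra. Qed.

Lemma hyp_tc1 X : hyp X -> 1 <= tc X.
Proof.
move=> hX; have [_ X0] := hX; have := dot_ge0 (sp X); rewrite hyp_sp//; nra.
Qed.

Lemma entry_tcsp (u : 'cV[R]_(1 + n)) i b : 0 <= b -> `|tc u| <= b ->
  dot (sp u) (sp u) <= b ^+ 2 -> `|u i ord0| <= b.
Proof.
move=> b0 h1 h2; rewrite -[u]vsubmxK mxE; case: splitP => j _.
  by rewrite (ord1 j) -tcE.
rewrite -(@ler_pXn2r _ 2)// ?nnegrE// real_normK ?num_real//.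
exact: le_trans (entry_dot _ _) h2.
Qed.

Lemma lor_row_tc A u : lorentz A -> tc (A *m u) = - B (invmx A *m e0) u.
Proof. by move=> h; rewrite lor_adj// mink_e0 opprK. Qed.

(** The entry [A ord0 ord0] is the hyperbolic cosine of the displacement of [e0]. It bounds all
    entries, and so serves as the size of A in every finiteness statement below. The first column is
    a point of the hyperboloid; the other columns are unit vectors whose time coordinates are
    bounded through the first row, that is, through A^-1 e0. *)
Lemma lor_bound A i j : lorentz A -> `|A i j| <= 2 * A ord0 ord0.
Proof.
move=> h; have a1 : 1 <= A ord0 ord0 by rewrite -tc_mul; apply/hyp_tc1/lor_e0.
have [->|[k jk]] : j = ord0 \/ exists k, j = rshift 1 k.
  case: (splitP j) => k jk; [left|right; exists k]; apply/val_inj => //=.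
  by rewrite jk (ord1 k).
  have -> : A i ord0 = (A *m e0) i ord0 by rewrite e0E -colE mxE.
  have := @entry_tcsp (A *m e0) i (A ord0 ord0).
  rewrite tc_mul => h1; apply: (le_trans (h1 _ _ _)) => //.
  - by lra.
  - by rewrite ger0_norm//; lra.
  - by rewrite hyp_sp ?tc_mul; [lra|exact: lor_e0].
  - by lra.
set e := delta_mx j ord0 : 'cV[R]_(1 + n).
have tce : tc e = 0 by rewrite /tc mxE jk.
have spe : dot (sp e) (sp e) = 1.
  have -> : sp e = delta_mx k ord0.
    by apply/matrixP => a b; rewrite !mxE jk (inj_eq (@rshift_inj _ _)).
  rewrite dotE (bigD1 k)//= !mxE !eqxx mul1r big1 ?addr0// => l lk.
  by rewrite !mxE (negbTE lk) mul0r.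
have Be : B e e = 1 by rewrite minkE spe tce mul0r subr0.
have hV := lorV h; have hVe := lor_e0 hV.
have tA : tc (A *m e) ^+ 2 <= A ord0 ord0 ^+ 2 - 1.
  rewrite lor_row_tc// minkE tce mulr0 subr0 sqrrN (le_trans (dotCS _ _))//.
  by rewrite spe mulr1 hyp_sp// tc_mul lor_tcV.
have -> : A i j = (A *m e) i ord0 by rewrite /e -colE mxE.
have := @entry_tcsp (A *m e) i (A ord0 ord0).
move=> h1; apply: (le_trans (h1 _ _ _)) => //.
- by lra.
- rewrite -(@ler_pXn2r _ 2)// ?nnegrE// ?real_normK ?num_real//; lra.
- have : B (A *m e) (A *m e) = 1 by rewrite lor_mink.
  by rewrite minkE -expr2; lra.
- by lra.
Qed.

Lemma lor_tcM A A' : lorentz A -> lorentz A' ->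
  (A *m A') ord0 ord0 <= 2 * A ord0 ord0 * A' ord0 ord0.
Proof.
move=> h h'; rewrite -[leLHS]tc_mul -mulmxA lor_row_tc//.
have hX := lor_e0 (lorV h); have hY := lor_e0 h'.
rewrite minkE opprB !tc_mul lor_tcV//.
have := causal_dot (hyp_causal hX) (hyp_causal hY); rewrite !tc_mul lor_tcV//.
by rewrite ler_norml => /andP[]; lra.
Qed.

End Minkowski.
Arguments e0 {R n}.
Notation B := mink (only parsing).
#[export] Hint Resolve hyp_causal null_causal hyp_e0 lor1 lorM lorV lor_hyp lor_null : core.

(** * Discrete groups *)

Lemma pigeonhole (T : eqType) (s : seq T) (f : nat -> T) :
  (forall j, f j \in s) -> exists i j, (i < j)%N /\ f i = f j.
Proof.
move=> fs; apply: contrapT => H.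
have u : uniq (map f (iota 0 (size s).+1)).
  rewrite map_inj_in_uniq ?iota_uniq// => i j _ _ fij.
  by case: (ltngtP i j) => // ij; case: H; [exists i, j|exists j, i].
have sub : {subset map f (iota 0 (size s).+1) <= s} by move=> x /mapP[i _ ->].
by have := uniq_leq_size u sub; rewrite size_map size_iota ltnn.
Qed.

Lemma seq_argmin (T : eqType) (R : realDomainType) (f : T -> R) (x : T) (s : seq T) :
  x \in s -> exists2 y, y \in s & forall z, z \in s -> f y <= f z.
Proof.
elim: s x => // y s IH x _; case: s IH => [|z s] IH.
  by exists y; rewrite ?mem_head// => ?; rewrite inE => /eqP->.
have [w ws hw] := IH z (mem_head _ _).
have [le|/ltW le] := leP (f y) (f w).
  exists y; first exact: mem_head.
  by move=> t; rewrite inE => /orP[/eqP->//|/hw]; exact: le_trans.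
by exists w; [rewrite inE ws orbT|move=> t; rewrite inE => /orP[/eqP->//|/hw]].
Qed.

Lemma quad_continuous (R : realType) k (M : 'M[R]_k) :
  continuous (fun v : 'cV[R]_k => (v^T *m M *m v) ord0 ord0).
Proof.
have -> : (fun v : 'cV[R]_k => (v^T *m M *m v) ord0 ord0) =
    (fun v => \sum_j \sum_i (v i ord0 * M i j) * v j ord0).
  apply/funext => v; rewrite mxE; apply: eq_bigr => j _; rewrite mxE mulr_suml.
  by apply: eq_bigr => i _; rewrite mxE.
apply: continuous_big => [|j _]; first exact: add_continuous.
apply: continuous_big => [|i _]; first exact: add_continuous.
have c l : continuous (fun v : 'cV[R]_k => v l ord0) by exact: coord_continuous.
move=> v; apply: (@cvgM R _ (nbhs v)); last exact: c.
by apply: (@cvgM R _ (nbhs v)); [exact: c|exact: cvg_cst].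
Qed.

Lemma cV_box_compact (R : realType) k (M : R) :
  compact [set v : 'cV[R]_k | forall i, v i ord0 \in `[- M, M]].
Proof.
have -> : [set v : 'cV[R]_k | forall i, v i ord0 \in `[- M, M]] =
    (@trmx R 1 k) @` [set v : 'rV[R]_k | forall i, v ord0 i \in `[(- M), M]].
  apply/seteqP; split => v /=.
    by move=> h; exists v^T; rewrite ?trmxK// => i; rewrite mxE.
  by case=> w h <- i; rewrite mxE.
apply: continuous_compact; last first.
  by apply: (@rV_compact _ _ (fun=> `[(- M), M]%classic)) => _; exact: segment_compact.
apply: continuous_subspaceT => x U [P nP sPU].
exists (fun a b => P b a) => [a b|y Py]; first by have := nP b a; rewrite mxE.
by apply: sPU => a b; rewrite !mxE; exact: Py.
Qed.

Section Hyp.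
Context {R : realType} {n : nat}.
Implicit Types (u v w X Y Z : 'cV[R]_(1 + n)) (A : 'M[R]_(1 + n)).
Local Notation B := (@mink R n).

Lemma hyp_perp_CS X Y w : hyp X -> hyp Y -> B w Y = 0 ->
  B w X ^+ 2 <= B w w * (B X Y ^+ 2 - 1).
Proof.
move=> hX hY wY; have [X1 _] := hX; have [Y1 _] := hY.
have -> : B w X = B w (X + B X Y *: Y) by rewrite !minkL wY mulr0 addr0.
have := @perp_CS _ _ Y w (X + B X Y *: Y) (hyp_causal hY).
rewrite !minkL (minkC Y w) (minkC Y X) wY X1 Y1 mulrN1 subrr => /(_ erefl erefl).
by congr (_ <= _ * _); ring.
Qed.

(** The inequality cosh (d + d') <= 2 cosh d cosh d', from Cauchy-Schwarz in the complement of Y.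
    This coarse triangle inequality is enough wherever only bounds are wanted. *)
Lemma hyp_tri X Y Z : hyp X -> hyp Y -> hyp Z ->
  - B X Z <= 2 * B X Y * B Y Z.
Proof.
move=> hX hY hZ; have [X1 _] := hX; have [Y1 _] := hY; have [Z1 _] := hZ.
have xy := hyp_mink hX hY; have yz := hyp_mink hY hZ.
pose w := X + B X Y *: Y.
have wY : B w Y = 0 by rewrite !minkL Y1; ring.
have := hyp_perp_CS hZ hY wY.
have -> : B w w = B X Y ^+ 2 - 1.
  by rewrite !minkL X1 Y1 (minkC Y X); ring.
have -> : B w Z = B X Z + B X Y * B Y Z by rewrite !minkL.
rewrite (minkC Z Y) => h.
have : `|B X Z + B X Y * B Y Z| <= B X Y * B Y Z.
  have p0 : 0 <= B X Y * B Y Z by nra.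
  rewrite -(@ler_pXn2r _ 2)// ?nnegrE// real_normK ?num_real//.
  by apply: le_trans h _; nra.
by rewrite ler_norml => /andP[]; lra.
Qed.

Lemma lor_disp_bound A Z : lorentz A -> hyp Z ->
  A ord0 ord0 <= 4 * tc Z ^+ 2 * - B Z (A *m Z).
Proof.
move=> hA hZ; have hAZ := lor_hyp hA hZ; have hAe := lor_e0 hA.
have h0 := @hyp_e0 R n.
have t1 := hyp_tri h0 hZ hAe; rewrite !mink_e0 tc_mul opprK in t1.
have t2 := hyp_tri hZ hAZ hAe.
rewrite lor_mink// (minkC Z e0) mink_e0 in t2.
have z1 := hyp_tc1 hZ; have := hyp_mink hZ hAZ; have := hyp_mink hZ hAe => h1 h2.
by apply: le_trans t1 _; nra.
Qed.

Lemma hyp_compact (r : R) : compact [set X : 'cV[R]_(1 + n) | hyp X /\ tc X <= r].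
Proof.
have clq : closed [set X : 'cV[R]_(1 + n) | B X X = -1].
  apply: (@closed_comp _ _ (fun X => B X X) [set -1]); last exact: closed_eq.
  by move=> X _; exact: (@quad_continuous R (1 + n)).
have ctc : continuous (fun X : 'cV[R]_(1 + n) => tc X).
  by move=> X; exact: coord_continuous.
have cl1 : closed [set X : 'cV[R]_(1 + n) | 0 <= tc X].
  by apply: (@closed_comp _ _ (fun X => tc X) [set x | 0 <= x]); [move=> ? _; exact: ctc|exact: closed_ge].
have cl2 : closed [set X : 'cV[R]_(1 + n) | tc X <= r].
  by apply: (@closed_comp _ _ (fun X => tc X) [set x | x <= r]); [move=> ? _; exact: ctc|exact: closed_le].
have -> : [set X : 'cV[R]_(1 + n) | hyp X /\ tc X <= r] = [set X : 'cV[R]_(1 + n) | B X X = -1]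
   `&` ([set X | 0 <= tc X] `&` [set X | tc X <= r]).
  apply/seteqP; split => X /= [].
    by case=> X1 X0 h; split => //; split => //; exact: ltW.
  move=> X1 [X0 h]; split => //; split => //; rewrite lt_def X0 andbT.
  apply/eqP => t0; move: X1; rewrite minkE t0 mul0r subr0 => X1.
  by have := dot_ge0 (sp X); rewrite X1; lra.
apply: subclosed_compact (@cV_box_compact R (1 + n) `|r|) _.
  by apply: closedI => //; exact: closedI.
move=> X /= [X1 [X0 Xr]] i.
rewrite in_itv /= -ler_norml.
apply: (le_trans _ (ler_norm r)) => //.
apply: entry_tcsp; first exact: le_trans X0 _.
  by rewrite ger0_norm.
have : dot (sp X) (sp X) = tc X ^+ 2 - 1 by move: X1; rewrite minkE expr2; lra.
move=> ->; have r0 : 0 <= r := le_trans X0 Xr.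
have : tc X ^+ 2 <= r ^+ 2 by rewrite ler_pXn2r ?nnegrE.
by lra.
Qed.

End Hyp.

Section Powers.
Context {R : realType} {n : nat}.
Implicit Types (A : 'M[R]_(1 + n)).

Definition pw A (j : nat) : 'M[R]_(1 + n) := iter j (mulmx A) 1%:M.

Lemma pwS A j : pw A j.+1 = A *m pw A j. Proof. by []. Qed.
Lemma pwD A i j : pw A (i + j)%N = pw A i *m pw A j.
Proof.
elim: i => [|i IH]; first by rewrite mul1mx.
by rewrite pwS -mulmxA -IH.
Qed.
Lemma pw1 A : pw A 1 = A. Proof. by rewrite /pw /= mulmx1. Qed.
Lemma pwSr A j : pw A j.+1 = pw A j *m A.
Proof.
elim: j => [|j IH]; first by rewrite pw1 mul1mx.
by rewrite pwS [in LHS]IH mulmxA -pwS.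
Qed.
Lemma pw_eig A j (v : 'cV[R]_(1 + n)) a : A *m v = a *: v -> pw A j *m v = a ^+ j *: v.
Proof.
move=> h; elim: j => [|j IH]; first by rewrite mul1mx scale1r.
by rewrite pwS -mulmxA IH -scalemxAr h scalerA -exprSr.
Qed.
Lemma pw_lor A j : lorentz A -> lorentz (pw A j).
Proof. by move=> h; elim: j => [|j IH]; [exact: lor1|exact: lorM]. Qed.
Lemma pw_comm A C j : A *m C = C *m A -> pw A j *m C = C *m pw A j.
Proof.
move=> h; elim: j => [|j IH]; first by rewrite /= mul1mx mulmx1.
by rewrite pwS -mulmxA IH !mulmxA h.
Qed.
End Powers.

Section Groups.
Context {R : realType} {m : nat}.
Implicit Types (D : set 'M[R]_m) (A : 'M[R]_m).

Lemma gr1 D : mx_subgroup D -> D 1%:M. Proof. by case. Qed.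
Lemma grM D A A' : mx_subgroup D -> D A -> D A' -> D (A *m A').
Proof. by case=> _ h _; exact: h. Qed.
Lemma grV D A : mx_subgroup D -> D A -> D (invmx A).
Proof. by case=> _ _ h /h[]. Qed.
Lemma gr_unit D A : mx_subgroup D -> D A -> A \in unitmx.
Proof. by case=> _ _ h /h[]. Qed.
Lemma gr_conj D A A' : mx_subgroup D -> D A -> D A' -> D (A *m A' *m invmx A).
Proof. by move=> h a b; do !apply: grM => //; exact: grV. Qed.

End Groups.

Section Disc.
Context {R : realType} {n : nat}.
Implicit Types (u v w X Y Z : 'cV[R]_(1 + n)) (A : 'M[R]_(1 + n)).
Implicit Types (D G : set 'M[R]_(1 + n)).
Local Notation B := (@mink R n).

Definition disc D := [/\ mx_subgroup D, D `<=` lorentz &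
  forall r, finite_set [set A | D A /\ A ord0 ord0 <= r]].

Definition cocpt G (r0 : R) := forall X, hyp X -> exists2 A, G A & tc (A *m X) <= r0.

Lemma gr_pw D A j : mx_subgroup D -> D A -> D (pw A j).
Proof. by move=> h hA; elim: j => [|j IH]; [exact: gr1|exact: grM]. Qed.
Lemma disc_seq D r : disc D -> exists s : seq 'M[R]_(1 + n),
  forall A, (D A /\ A ord0 ord0 <= r) <-> A \in s.
Proof.
case=> _ _ /(_ r) /finite_seqP[s hs]; exists s => A.
by split => [h|h]; [have : [set A | D A /\ A ord0 ord0 <= r] A by []; rewrite hs|
  have : [set` s] A by []; rewrite -hs].
Qed.

Lemma disc_pigeon D r (f : nat -> 'M[R]_(1 + n)) : disc D ->
  (forall j, D (f j)) -> (forall j, (f j) ord0 ord0 <= r) ->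
  exists i j, (i < j)%N /\ f i = f j.
Proof.
move=> /(disc_seq r)[s hs] h1 h2.
by apply: (@pigeonhole _ s) => j; apply/hs.
Qed.

(** An element E of G moves any point to time coordinate at most r0, at the price of replacing A by
    E A E^-1. Discreteness of D leaves finitely many conjugates whose displacement at such a point
    does not exceed that of [e0] under A, so the infimum is attained: it is the least of finitely
    many minima over a compact set. *)
Lemma min_disp D G r0 A : disc D -> mx_subgroup G -> G `<=` D -> cocpt G r0 -> D A ->
  exists2 X, hyp X & forall Y, hyp Y -> - B X (A *m X) <= - B Y (A *m Y).
Proof.
move=> dD gG GD cG DA; have [gD Dl _] := dD.
pose f (C : 'M[R]_(1 + n)) Y := - B Y (C *m Y).
have [Z0 Z0r] : exists Z, hyp Z /\ tc Z <= r0.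
  by have [C GC hC] := cG e0 (hyp_e0); exists (C *m e0); split => //; apply/lor_hyp/hyp_e0/Dl/GD.
have mine C : exists2 Y, hyp Y /\ tc Y <= r0 &
    forall Z, hyp Z -> tc Z <= r0 -> f C Y <= f C Z.
  have [] := @compact_EVT_min _ R (f C) [set X | hyp X /\ tc X <= r0].
  - by exists Z0.
  - exact: hyp_compact.
  - apply: continuous_subspaceT => X.
    rewrite (_ : f C = fun v => (v^T *m (- (lorentz_form *m C)) *m v) ord0 ord0).
      exact: quad_continuous.
    by apply/funext => v; rewrite /f /mink mulmxN mulNmx [RHS]mxE !mulmxA.
  - by move=> Y; rewrite inE => hY h; exists Y => // Z h1 h2; apply: h; rewrite inE.
have [Ym hYm] := @choice _ _ (fun C Y => (hyp Y /\ tc Y <= r0) /\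
    forall Z, hyp Z -> tc Z <= r0 -> f C Y <= f C Z)
    (fun C => let: ex_intro2 Y a b := mine C in ex_intro _ Y (conj a b)).
pose c := A ord0 ord0; pose r1 := 4 * r0 ^+ 2 * c.
have [s hs] := disc_seq r1 dD.
pose T := [seq C <- s | `[< exists2 E, G E & C = E *m A *m invmx E >]].
have TP C : C \in T -> D C /\ exists2 E, G E & C = E *m A *m invmx E.
  by rewrite mem_filter => /andP[/asboolP h /hs[]].
have key Y : hyp Y -> f A Y <= c -> exists2 C, C \in T & f C (Ym C) <= f A Y.
  move=> hY fY; have [E GE hE] := cG Y hY; have lE := Dl _ (GD _ GE).
  pose C := E *m A *m invmx E.
  have fC : f C (E *m Y) = f A Y.
    by rewrite /f /C -!mulmxA (mulmxA (invmx E)) lor_VAi// mul1mx lor_mink.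
  have hEY := lor_hyp lE hY.
  have DC : D C by apply: gr_conj => //; exact: GD.
  exists C; last by rewrite -fC; have [_ ->] := hYm C.
  rewrite mem_filter; apply/andP; split; first by apply/asboolP; exists E.
  apply/hs; split => //; have := lor_disp_bound (Dl _ DC) hEY.
  rewrite -/(f C _) fC => /le_trans; apply; rewrite /r1.
  have t1 := hyp_tc1 hEY.
  have f1 : 1 <= f A Y by rewrite /f; have := hyp_mink hY (lor_hyp (Dl _ DA) hY); lra.
  apply: ler_pM => //; [|lra|].
    by apply: mulr_ge0 => //; rewrite sqr_ge0.
  by rewrite ler_pM2l// ler_pXn2r ?nnegrE//; lra.
have fe0 : f A e0 = c by rewrite /f mink_e0 tc_mul opprK.
have [C0 C0T hC0] := key e0 hyp_e0 ltac:(by rewrite fe0).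
have [C1 C1T hC1] := seq_argmin (fun C => f C (Ym C)) C0T.
have [_ [E GE C1E]] := TP _ C1T; have lE := Dl _ (GD _ GE).
have [[hY1 _] _] := hYm C1.
exists (invmx E *m Ym C1); first by apply: lor_hyp => //; exact: lorV.
have -> : - B (invmx E *m Ym C1) (A *m (invmx E *m Ym C1)) = f C1 (Ym C1).
  by rewrite lor_adj// /f C1E !mulmxA.
move=> Y hY; have [fY|/ltW fY] := leP (f A Y) c.
  by have [C CT hC] := key Y hY fY; exact: le_trans (hC1 _ CT) hC.
by apply: le_trans fY; apply: le_trans (hC1 _ C0T) _; rewrite -fe0.
Qed.

Definition lox A (lam : R) xi eta :=
  [/\ 1 < lam, null xi, null eta, A *m xi = lam *: xi & A *m eta = lam^-1 *: eta].

(** The first-order condition at a minimum, without derivatives: for small s of the sign of g the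
    linear term would win. *)
Lemma lin_zero (g c d : R) : 0 < d ->
  (forall s, `|s| <= d -> 0 <= - s * g + s ^+ 2 * c) -> g = 0.
Proof.
move=> d0 h; apply/eqP; case: (eqVneq g 0) => // g0.
have ng : 0 < `|g| by rewrite normr_gt0.
pose t := Num.min (d / `|g|) (2 * (`|c| + 1))^-1.
have c1 : 0 < 2 * (`|c| + 1) by have := normr_ge0 c; lra.
have t0 : 0 < t by rewrite lt_min divr_gt0// invr_gt0.
have := h (t * g); rewrite normrM (gtr0_norm t0).
have -> : t * `|g| <= d by rewrite -ler_pdivlMr// ge_min lexx.
move=> /(_ isT).
have -> : - (t * g) * g + (t * g) ^+ 2 * c = (t * g ^+ 2) * (t * c - 1) by ring.
have g2 : 0 < g ^+ 2 by rewrite lt_def sqrf_eq0 g0 sqr_ge0.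
rewrite (pmulr_rge0 _ (mulr_gt0 t0 g2)).
have : t * (2 * (`|c| + 1)) <= 1 by rewrite -ler_pdivlMr// mul1r ge_min lexx orbT.
have : t * c <= t * `|c| by rewrite ler_pM2l// ler_norm.
by lra.
Qed.

Lemma future X u : hyp X -> B u u = 0 -> B X u < 0 -> null u.
Proof.
move=> hX u0 Xu; split => //; case: (ltgtP (tc u) 0) => // [t|t].
  have : null (- u) by split; rewrite ?minkL ?u0 ?tcN ?oppr_gt0// !oppr0.
  by move=> /null_causal/(causal_le0 (hyp_causal hX)); rewrite minkL; lra.
move: Xu; rewrite (_ : u = 0) ?mink0r ?ltxx//.
apply: mink_ext; first by rewrite t /tc mxE.
by rewrite [sp 0]linear0; apply: dot_eq0; move: u0; rewrite minkE t mulr0 subr0.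
Qed.

(** At a point X of least displacement the first variation vanishes, which says that A X + A^-1 X is
    a multiple of X. So A preserves the plane of X and A X, with eigenvalues of sum 2 f and product
    1: a fixed point if f = 1, two null eigenvectors otherwise. Cocompactness of G thus excludes
    parabolic elements even in the larger group D. *)
Lemma dichotomy D G r0 A : disc D -> mx_subgroup G -> G `<=` D -> cocpt G r0 -> D A ->
  (exists2 X, hyp X & A *m X = X) \/ exists lam xi eta, lox A lam xi eta.
Proof.
move=> dD gG GD cG DA; have [gD Dl _] := dD; have lA := Dl _ DA.
have [X hX minX] := min_disp dD gG GD cG DA; have [X1 X0] := hX.
pose f := - B X (A *m X); pose W := A *m X + invmx A *m X.
have XW : B X W = - (2 * f) by rewrite minkDr (minkC X (invmx A *m X)) lor_adj// /f; ring.
have perp U : B X U = 0 -> B U W = 0.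
  move=> XU; have -> : B U W = B U (A *m X) + B X (A *m U).
    by rewrite minkDr (minkC U (invmx A *m X)) lor_adj.
  set g := B U (A *m X) + B X (A *m U); pose fU := - B U (A *m U); pose q := B U U.
  have qge : 0 <= q by exact: perp_ge0 (hyp_causal hX) XU.
  have main s : 0 < 1 - s ^+ 2 * q -> 0 < tc (X + s *: U) ->
      0 <= - s * g + s ^+ 2 * (fU + f * q).
    move=> sq tp; pose a := Num.sqrt (1 - s ^+ 2 * q).
    have a0 : 0 < a by rewrite sqrtr_gt0.
    have a2 : a ^+ 2 = 1 - s ^+ 2 * q by rewrite sqr_sqrtr// ltW.
    have hY : hyp (a^-1 *: (X + s *: U)).
      split; last by rewrite tcZ mulr_gt0// invr_gt0.
      rewrite !minkL X1 XU (minkC U X) XU -/q.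
      transitivity (- (1 - s ^+ 2 * q) / a ^+ 2); first by field; rewrite gt_eqF.
      by rewrite -a2 mulNr divff// expf_eq0 gt_eqF.
    have := minX _ hY; rewrite -/f.
    have -> : - B (a^-1 *: (X + s *: U)) (A *m (a^-1 *: (X + s *: U))) =
       (f - s * g + s ^+ 2 * fU) / a ^+ 2.
      by rewrite -scalemxAr mulmxDr -scalemxAr !minkL /f /g /fU; field; rewrite gt_eqF.
    by rewrite ler_pdivlMr ?exprn_gt0// a2; lra.
  (* For |s| <= 1/K the vector X + s U is timelike and points to the future, so it can be normalised
     to the hyperboloid. *)
  pose K := 1 + q + `|tc U| / tc X.
  have u0 : 0 <= `|tc U| / tc X by rewrite divr_ge0// ltW.
  have K0 : 0 < K by rewrite /K; lra.
  apply: (@lin_zero _ (fU + f * q) K^-1); first by rewrite invr_gt0.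
  move=> s sK; have sK1 : `|s| * K <= 1 by rewrite -ler_pdivlMr// mul1r.
  have s0 := normr_ge0 s.
  apply: main.
    have -> : s ^+ 2 = `|s| ^+ 2 by rewrite real_normK// num_real.
    have : `|s| * q <= 1 by move: sK1; rewrite /K; nra.
    have : `|s| * (1 + q) <= 1 by move: sK1; rewrite /K; nra.
    move: qge s0; set t := `|s|; nra.
  rewrite tcD tcZ.
  have : - (s * tc U) <= `|s| * `|tc U| by rewrite -normrM -normrN ler_norm.
  have -> : `|s| * `|tc U| = `|s| * (`|tc U| / tc X) * tc X by rewrite mulrA divfK// gt_eqF.
  have : `|s| * (`|tc U| / tc X) < 1.
    case: (ltgtP 0 `|s|) s0 => // [s0 _|<- _]; last by rewrite mul0r.
    by move: sK1; rewrite /K; nra.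
  move: X0; nra.
have WX : W = (2 * f) *: X.
  apply/eqP; rewrite -subr_eq0; apply/eqP/mink_nondeg => v.
  pose U := v + B X v *: X.
  have XU : B X U = 0 by rewrite !minkL X1; ring.
  have -> : v = U - B X v *: X by rewrite addrK.
  have := perp _ XU; rewrite (minkC U W) => h.
  by rewrite !minkBr !minkBl !minkZr !minkZl h XU X1 (minkC W X) XW; ring.
have A2 : A *m (A *m X) = (2 * f) *: (A *m X) - X.
  by rewrite scalemxAr -WX mulmxDr mulKVmx ?addrK ?lor_unit.
have f1 : 1 <= f by have := hyp_mink hX (lor_hyp lA hX); rewrite /f; lra.
have [f1'|fn1] := eqVneq f 1.
  left; exists X => //; apply/esym/hyp_mink_eq => //; first exact: lor_hyp.
  by rewrite -[LHS]opprK -/f f1'.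
right; pose s := Num.sqrt (f ^+ 2 - 1).
have f2 : 0 < f ^+ 2 - 1 by have : f != 1 by []; rewrite neq_lt => /orP[]; nra.
have s0 : 0 < s by rewrite sqrtr_gt0.
have s2 : s ^+ 2 = f ^+ 2 - 1 by rewrite sqr_sqrtr// ltW.
pose lam := f + s; pose mu := f - s.
have lm : lam * mu = 1.
  by transitivity (f ^+ 2 - s ^+ 2); [rewrite /lam /mu; ring|rewrite s2; ring].
have l1 : 1 < lam by rewrite /lam; lra.
have l0 : lam != 0 by rewrite gt_eqF//; lra.
have muE : lam^-1 = mu by apply: (mulfI l0); rewrite lm divff.
have m1 : mu < 1 by rewrite -muE invf_lt1//; lra.
have XAX : B X (A *m X) = - f by rewrite opprK.
exists lam, (A *m X - mu *: X), (lam *: X - A *m X); split => //.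
- apply: (future hX); rewrite !minkL ?X1 ?XAX; last by lra.
  by rewrite lor_mink// X1 (minkC _ X) XAX; rewrite /mu; nra.
- apply: (future hX); rewrite !minkL ?X1 ?XAX; last by rewrite /lam; lra.
  by rewrite lor_mink// X1 (minkC (A *m X) X) XAX; rewrite /lam; nra.
- rewrite mulmxBr -scalemxAr A2 scalerBr scalerA lm scale1r addrAC -scalerBl.
  by congr (_ *: _ - _); rewrite /lam /mu; ring.
- rewrite muE mulmxBr -scalemxAr A2 scalerBr scalerA (mulrC mu) lm scale1r.
  rewrite opprB addrCA -scalerBl; congr (_ + _).
  by rewrite -scaleNr; congr (_ *: _); rewrite /lam /mu; ring.
Qed.

End Disc.

(** * Loxodromic elements *)

Lemma bernoulli (R : realDomainType) (x : R) k : 0 <= x -> 1 + k%:R * x <= (1 + x) ^+ k.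
Proof.
move=> x0; elim: k => [|k IH]; first by rewrite mul0r addr0.
have k0 : 0 <= k%:R * x by rewrite mulr_ge0.
by rewrite exprS -natr1; nra.
Qed.

Lemma geom_unbounded (R : realType) (l C : R) : 1 < l -> exists k, C < l ^+ k.
Proof.
move=> l1; have l0 : 0 < l - 1 by lra.
have [k /ltW hk] : exists k : nat, C / (l - 1) < k%:R.
  exists (Num.truncn (Num.max (C / (l - 1)) 0)).+1.
  have [_ ] := andP (truncn_itv (ltac:(by rewrite le_max lexx orbT) : 0 <= Num.max (C / (l - 1)) 0)).
  by apply: le_lt_trans; rewrite le_max lexx.
exists k; have := bernoulli k (ltW l0); rewrite (addrC 1 (l - 1)) subrK => h.
by rewrite ler_pdivrMr// in hk; lra.
Qed.

Lemma geom_zero (R : realType) (l a C : R) : 1 < l ->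
  (forall k, `|l ^+ k * a| <= C) -> a = 0.
Proof.
move=> l1 h; apply/eqP; case: (eqVneq a 0) => // a0.
have na : 0 < `|a| by rewrite normr_gt0.
have [k hk] := geom_unbounded (C / `|a|) l1.
have := h k; rewrite normrM ger0_norm ?exprn_ge0//; last by lra.
by rewrite ltr_pdivrMr// in hk; lra.
Qed.

Lemma perp_exists (R : realType) k m (N : 'M[R]_(k, m)) : (m < k)%N ->
  exists2 w : 'cV[R]_k, w != 0 & w^T *m N = 0.
Proof.
move=> mk; have : kermx N != 0.
  by rewrite -mxrank_eq0 mxrank_ker subn_eq0 -ltnNge (leq_ltn_trans (rank_leq_col N)).
move=> h; exists (nz_row (kermx N))^T; first by rewrite trmx_eq0 nz_row_eq0.
rewrite trmxK; apply/sub_kermxP; exact: nz_row_sub.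
Qed.

Section Lox.
Context {R : realType} {n : nat}.
Implicit Types (u v w X Y Z xi eta : 'cV[R]_(1 + n)) (A K : 'M[R]_(1 + n)).
Implicit Types (D G : set 'M[R]_(1 + n)).
Local Notation B := (@mink R n).

Lemma lox_neg A lam xi eta : lox A lam xi eta -> B xi eta < 0.
Proof.
case=> l1 hx he Ax Ae.
have := causal_le0 (null_causal hx) (null_causal he); rewrite le_eqVlt => /orP[/eqP h|//].
have ex := null_perp hx he h; have [_ x0] := hx; have [_ e0] := he.
have : lam *: eta = lam^-1 *: eta.
  by rewrite -Ae {1 2}ex -scalemxAr Ax !scalerA mulrC.
move=> /eqP; rewrite -subr_eq0 -scalerBl scaler_eq0 (negbTE (null_neq0 he)) orbF.
rewrite subr_eq0 => /eqP l2.
have : lam^-1 < 1 by rewrite invf_lt1; lra.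
by lra.
Qed.

Lemma lox_scale A lam xi eta a b : 0 < a -> 0 < b -> lox A lam xi eta ->
  lox A lam (a *: xi) (b *: eta).
Proof.
move=> a0 b0 [l1 hx he Ax Ae]; split => //; try exact: nullZ.
  by rewrite -scalemxAr Ax !scalerA mulrC.
by rewrite -scalemxAr Ae !scalerA mulrC.
Qed.

Lemma lox_normal A lam xi eta : lox A lam xi eta ->
  exists a, [/\ 0 < a, lox A lam (a *: xi) eta & B (a *: xi) eta = - 2^-1].
Proof.
move=> h; have xe := lox_neg h; exists (- (2 * B xi eta)^-1).
have a0 : 0 < - (2 * B xi eta)^-1 by rewrite oppr_gt0 invr_lt0; lra.
split => //; first by rewrite -[X in lox _ _ _ X]scale1r; apply: lox_scale.
by rewrite minkZl; field; rewrite lt_eqF.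
Qed.

Lemma lox_inv A lam xi eta : lorentz A -> lox A lam xi eta -> lox (invmx A) lam eta xi.
Proof.
move=> lA [l1 hx he Ax Ae]; have l0 : lam != 0 by rewrite gt_eqF//; lra.
split => //.
  by rewrite -[LHS](scale1r) -(divff l0) -scalerA scalemxAr -Ae mulKmx ?lor_unit.
by rewrite -[LHS](scale1r) -(mulVf l0) -scalerA scalemxAr -Ax mulKmx ?lor_unit.
Qed.

Lemma lox_pw A lam xi eta k : lox A lam xi eta -> (0 < k)%N -> lox (pw A k) (lam ^+ k) xi eta.
Proof.
move=> [l1 hx he Ax Ae] k0; split => //; first by rewrite exprn_egt1// -lt0n.
  exact: pw_eig.
by rewrite (pw_eig _ Ae) exprVn.
Qed.

Lemma hyp_end xi eta : null xi -> null eta -> B xi eta = - 2^-1 -> hyp (xi + eta).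
Proof.
move=> [x1 x0] [e1 e0] xe; split; last by rewrite tcD addr_gt0.
by rewrite !minkL x1 e1 (minkC eta) xe; field.
Qed.

Lemma lox_null A lam xi eta v mu : lorentz A -> lox A lam xi eta -> null v ->
  A *m v = mu *: v ->
  (mu = lam /\ v = (tc v / tc xi) *: xi) \/ (mu = lam^-1 /\ v = (tc v / tc eta) *: eta).
Proof.
move=> lA h hv Av; have xe := lox_neg h; case: h => l1 hx he Ax Ae.
have l0 : lam != 0 by rewrite gt_eqF//; lra.
have e1 : mu * lam * B v xi = B v xi.
  by rewrite -[RHS](lor_mink _ _ lA) Av Ax minkZl minkZr mulrA.
have e2 : mu * lam^-1 * B v eta = B v eta.
  by rewrite -[RHS](lor_mink _ _ lA) Av Ae minkZl minkZr mulrA.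
have [x0|xn] := eqVneq (B v xi) 0.
  left; have vx := null_perp hx hv (etrans (minkC _ _) x0); split => //.
  apply: (mulIf l0); rewrite -[in RHS](mul1r lam).
  have [_ v0] := hv; have /eqP : mu *: v = lam *: v by rewrite -Av {1 2}vx -scalemxAr Ax !scalerA mulrC.
  by rewrite -subr_eq0 -scalerBl scaler_eq0 (negbTE (null_neq0 hv)) orbF subr_eq0 => /eqP->; rewrite mul1r.
right; have ml : mu = lam^-1.
  by apply: (mulIf l0); rewrite mulVf//; apply: (mulIf xn); rewrite mul1r.
split => //; apply: null_perp => //; rewrite minkC; apply/eqP.
case: (eqVneq (B v eta) 0) => // en; move: e2; rewrite ml => /eqP.
rewrite -{2}[B v eta]mul1r (inj_eq (mulIf en)) => /eqP.
have : lam^-1 < 1 by rewrite invf_lt1; lra.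
have : 0 < lam^-1 by rewrite invr_gt0; lra.
by nra.
Qed.

(** w splits into components along xi and eta and a vector w0 orthogonal to both. The powers of A
    multiply the first two by lam^k and lam^-k and preserve the norm of the third in a definite
    space, so its contribution stays bounded. *)
Lemma pw_growth A lam xi eta u w : lorentz A -> lox A lam xi eta ->
  exists C, forall k, `|B u (pw A k *m w) - lam ^+ k * (B w eta * B u xi / B xi eta)| <= C.
Proof.
move=> lA h; have [c [c0 h' xe2]] := lox_normal h.
have xe := lox_neg h; case: (h) => l1 hx he Ax Ae; case: h' => _ hx' _ _ _.
have hZ := hyp_end hx' he xe2; set Z := _ + eta in hZ.
pose w0 := w - (B w eta / B xi eta) *: xi - (B w xi / B xi eta) *: eta.
have xen : B xi eta != 0 by rewrite lt_eqF.
have w0x : B w0 xi = 0.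
  by rewrite !minkL (proj1 hx) (minkC eta); field.
have w0e : B w0 eta = 0.
  by rewrite !minkL (proj1 he); field.
have pV k : pw (invmx A) k *m pw A k = 1%:M.
  elim: k => [|k IH]; first by rewrite mulmx1.
  by rewrite pwSr pwS -mulmxA (mulmxA (invmx A)) lor_VAi// mul1mx.
have pl k := pw_lor k lA.
have w0k k v mu : B w0 v = 0 -> A *m v = mu *: v -> mu != 0 -> B (pw A k *m w0) v = 0.
  move=> wv Av mu0; apply: (mulfI (expf_neq0 k mu0)).
  by rewrite mulr0 -minkZr -(pw_eig k Av) lor_mink.
have l0 : lam != 0 by rewrite gt_eqF//; lra.
have Zk k : B Z (pw A k *m w0) = 0.
  by rewrite minkC minkDr minkZr (w0k _ _ lam)// (w0k _ _ lam^-1) ?invr_eq0// mulr0 addr0.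
pose u' := u + B u Z *: Z.
have Zu : B Z u' = 0 by rewrite minkDr minkZr (proj1 hZ) (minkC Z); ring.
have wE : w = w0 + (B w eta / B xi eta) *: xi + (B w xi / B xi eta) *: eta.
  by rewrite /w0 addrAC addrNK addrNK.
clearbody w0.
exists (`|B u eta * B w xi / B xi eta| + (1 + B u' u' * B w0 w0)) => k.
have -> : B u (pw A k *m w) = B u (pw A k *m w0) + lam ^+ k * (B w eta * B u xi / B xi eta)
   + lam^-1 ^+ k * (B u eta * B w xi / B xi eta).
  rewrite [in LHS]wE !mulmxDr -!scalemxAr (pw_eig k Ax) (pw_eig k Ae).
  rewrite !minkDr !minkZr; ring.
rewrite addrAC addrK addrC (le_trans (ler_normD _ _))// lerD//.
  rewrite normrM ler_piMl// normrX exprn_ile1// ger0_norm ?invr_ge0; try lra.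
  by rewrite invf_le1; lra.
have -> : B u (pw A k *m w0) = B u' (pw A k *m w0) by rewrite minkDl minkZl Zk mulr0 addr0.
have := perp_CS (hyp_causal hZ) Zu (Zk k); rewrite lor_mink// => hcs.
set t := B u' _ in hcs *; have t0 := sqr_ge0 (`|t| - 1).
by rewrite -(real_normK (num_real t)) in hcs; have := normr_ge0 t; nra.
Qed.

(** Because b fixes xi, the conjugates A^-k b A^k move the point Z of the axis by a bounded amount.
    By discreteness two of them agree, so b commutes with a power of A and maps eta to one of its
    ends; that end is not xi. *)
Lemma lox_share D A lam xi eta b beta : disc D -> D A -> D b -> lox A lam xi eta ->
  b *m xi = beta *: xi -> b *m eta = (tc (b *m eta) / tc eta) *: eta.
Proof.
move=> dD DA Db h bx; have [gD Dl _] := dD; have lA := Dl _ DA; have lb := Dl _ Db.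
have [c [c0 h' xe2]] := lox_normal h.
have xe := lox_neg h; case: (h) => l1 hx he Ax Ae; case: (h') => _ hx' _ Ax' _.
have hZ := hyp_end hx' he xe2; set Z := _ + eta in hZ.
have l0 : lam != 0 by rewrite gt_eqF//; lra.
have uk k : pw A k \in unitmx by exact/lor_unit/pw_lor.
pose f k := invmx (pw A k) *m b *m pw A k.
pose M := `|B (c *: xi) (b *m eta)| + `|B eta (b *m (c *: xi))| + `|B eta (b *m eta)|.
have fM k : (f k) ord0 ord0 <= 4 * tc Z ^+ 2 * M.
  have lf : lorentz (f k) by do !apply: lorM => //; [apply: lorV|]; exact: pw_lor.
  apply: le_trans (lor_disp_bound lf hZ) _.
  rewrite ler_wpM2l//; first by rewrite mulr_ge0// sqr_ge0.
  rewrite /f -!mulmxA minkC lor_adj; last exact: pw_lor.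
  rewrite /Z mulmxDr (pw_eig k Ax') (pw_eig k Ae) mulmxDr -!scalemxAr.
  have bxx : B (b *m xi) xi = 0 by rewrite bx minkZl (proj1 hx) mulr0.
  have -> : - B (lam ^+ k *: (c *: (b *m xi)) + lam^-1 ^+ k *: (b *m eta))
     (lam ^+ k *: (c *: xi) + lam^-1 ^+ k *: eta) =
     - (c * B xi (b *m eta)) - c * B eta (b *m xi) - (lam^-1 ^+ k) ^+ 2 * B eta (b *m eta).
    rewrite !(minkDl, minkDr, minkZl, minkZr) bxx (minkC xi) (minkC eta (b *m xi)) (minkC eta (b *m eta)) exprVn.
    by field; rewrite expf_neq0.
  rewrite /M -scalemxAr minkZl minkZr.
  have nl (x : R) : - x <= `|x| by rewrite -normrN ler_norm.
  apply: lerD; first by apply: lerD; exact: nl.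
  rewrite -mulrN (le_trans (ler_norm _))// normrM normrN ler_piMl//.
  rewrite normrX exprn_ile1// normrX exprn_ile1// ger0_norm ?invr_ge0; try lra.
  by rewrite invf_le1; lra.
have [i [j [ij fij]]] := disc_pigeon dD (fun k => ltac:(by apply: grM => //; [apply: grM => //; apply: grV => //|]; exact: gr_pw) : D (f k)) fM.
have k0 : (0 < j - i)%N by rewrite subn_gt0.
have comm : b *m pw A (j - i) = pw A (j - i) *m b.
  have e : pw A j = pw A (j - i) *m pw A i by rewrite -pwD subnK// ltnW.
  have e2 : pw A j *m invmx (pw A i) = pw A (j - i) by rewrite e mulmxK.
  have := congr1 (fun N => pw A j *m N *m invmx (pw A i)) fij.
  by rewrite /= /f !mulmxA mulmxV// mul1mx mulmxK// e2 -mulmxA e2.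
have hk := lox_pw h k0.
have : pw A (j - i) *m (b *m eta) = (lam ^+ (j - i))^-1 *: (b *m eta).
  by case: hk => _ _ _ _ ek; rewrite mulmxA -comm -mulmxA ek scalemxAr.
have be : null (b *m eta) by apply: lor_null.
case/(lox_null (pw_lor _ lA) hk be) => [[_ ex]|[_ //]].
have : B (b *m xi) (b *m eta) = 0 by rewrite bx ex minkZl minkZr (proj1 hx) !mulr0.
by rewrite lor_mink// => h0; move: xe; rewrite h0 ltxx.
Qed.

End Lox.

(** * Orbits of cocompact groups *)

Section Orbits.
Context {R : realType} {n : nat}.
Implicit Types (u v w X Y Z xi eta : 'cV[R]_(1 + n)) (A K : 'M[R]_(1 + n)).
Local Notation B := (@mink R n).
Variables (G : set 'M[R]_(1 + n)) (r0 : R).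
Hypotheses (dG : disc G) (cG : cocpt G r0) (n1 : (1 < n)%N).
Let gG : mx_subgroup G. Proof. by case: dG. Qed.
Let lG : G `<=` lorentz. Proof. by case: dG. Qed.

(** Every X lies at bounded distance from the orbit of Z, so orthogonality of w to that orbit bounds
    B w X on the whole hyperboloid. Letting X tend to a null direction nu gives B w nu = 0, and the
    null vectors e0 + e_i, e0 - e_i span the space. *)
Lemma orbit_spans Z w : hyp Z -> (forall A, G A -> B w (A *m Z) = 0) -> w = 0.
Proof.
move=> hZ wZ.
have w0 : 0 <= B w w.
  by apply: (perp_ge0 (hyp_causal hZ)); rewrite minkC -(mul1mx Z) wZ//; exact: gr1.
have bd X : hyp X -> B w X ^+ 2 <= B w w * (2 * r0 * tc Z) ^+ 2.
  move=> hX; have [A GA hA] := cG hX; have lA := lG GA.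
  have hY : hyp (invmx A *m Z) by apply: lor_hyp => //; exact: lorV.
  apply: le_trans (hyp_perp_CS hX hY (wZ _ (grV gG GA))) _.
  rewrite ler_wpM2l//; rewrite minkC lor_adj//.
  have hAX := lor_hyp lA hX.
  have := hyp_tri hZ (@hyp_e0 R n) hAX; have := hyp_mink hZ hAX.
  rewrite (minkC Z e0) !mink_e0 => h1 h2.
  have t1 := hyp_tc1 hAX; have t2 := hyp_tc1 hZ.
  have : - B Z (A *m X) <= 2 * r0 * tc Z by nra.
  by nra.
pose K := B w w * (2 * r0 * tc Z) ^+ 2.
have K0 : 0 <= K by rewrite mulr_ge0// sqr_ge0.
have wnu nu : null nu -> B w nu = 0.
  move=> hn; have [n1' n0] := hn; apply/eqP; case: (eqVneq (B w nu) 0) => // m0.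
  set m := B w nu in m0 *; set p := B w e0.
  (* The bound [bd] at the normalised vector e0 + t nu: the left side grows like t^2, the right side
     like t. *)
  have hb t : 0 <= t -> (p + t * m) ^+ 2 <= K * (1 + 2 * t * tc nu).
    move=> t0; have q0 : 0 < 1 + 2 * t * tc nu by rewrite ltr_pwDl// mulr_ge0 ?mulr_ge0// ltW.
    pose a := Num.sqrt (1 + 2 * t * tc nu).
    have a0 : 0 < a by rewrite sqrtr_gt0.
    have a2 : a ^+ 2 = 1 + 2 * t * tc nu by rewrite sqr_sqrtr// ltW.
    have hY : hyp (a^-1 *: (e0 + t *: nu)).
      split; last first.
        rewrite tcZ mulr_gt0 ?invr_gt0// tcD tcZ tc_e0 ltr_pwDl// mulr_ge0//; exact: ltW.
      rewrite !minkL n1' !mink_e0 (minkC nu e0) mink_e0 tc_e0.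
      transitivity (- (1 + 2 * t * tc nu) / a ^+ 2); first by field; rewrite gt_eqF.
      by rewrite -a2 mulNr divff// expf_eq0 gt_eqF.
    have := bd _ hY; rewrite minkZr minkDr minkZr -/p -/m exprMn exprVn a2 -/K.
    by rewrite ler_pdivrMl// (mulrC K).
  have m2 : 0 < m ^+ 2 by rewrite lt_def sqrf_eq0 m0 sqr_ge0.
  pose t := (2 * `|p * m| + 2 * K * tc nu + K + 1) / m ^+ 2 + 1.
  have Kt : 0 <= K * tc nu by rewrite mulr_ge0// ltW.
  have pm := normr_ge0 (p * m).
  have t1 : 1 <= t by rewrite lerDr divr_ge0 ?sqr_ge0//; lra.
  have tm : t * m ^+ 2 = 2 * `|p * m| + 2 * K * tc nu + K + 1 + m ^+ 2.
    by rewrite mulrDl mul1r divfK// gt_eqF.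
  have := hb t (le_trans ler01 t1).
  have : - (2 * (p * m)) <= 2 * `|p * m| by have := ler_norm (- (p * m)); rewrite normrN; lra.
  have -> : (p + t * m) ^+ 2 = p ^+ 2 + t * (2 * (p * m)) + t * (t * m ^+ 2) by ring.
  rewrite tm; have := sqr_ge0 p; nra.
pose nu s i : 'cV[R]_(1 + n) := e0 + s *: delta_mx (rshift 1 i) ord0.
have spd i : sp (delta_mx (rshift 1 i) ord0 : 'cV[R]_(1 + n)) = delta_mx i ord0.
  by apply/matrixP => a b; rewrite !mxE (inj_eq (@rshift_inj _ _)).
have tcd i : tc (delta_mx (rshift 1 i) ord0 : 'cV[R]_(1 + n)) = 0.
  by rewrite /tc mxE.
have hnu s i : s ^+ 2 = 1 -> null (nu s i).
  move=> s2; split; last by rewrite tcD tcZ tc_e0 tcd mulr0 addr0.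
  rewrite minkE /nu spD spZ sp_e0 add0r spd tcD tcZ tc_e0 tcd mulr0 addr0 mulr1.
  rewrite dotE (bigD1 i)//= big1 ?addr0 => [|j ji]; last by rewrite !mxE (negbTE ji) mulr0 mul0r.
  by rewrite !mxE !eqxx mulr1 -expr2 s2 subrr.
have i0 : 'I_n by exact: (Ordinal (ltnW n1)).
have we i : B w e0 = 0 /\ B w (delta_mx (rshift 1 i) ord0) = 0.
  have h1 := wnu _ (hnu 1 i (expr1n _ _)).
  have h2 := wnu _ (hnu (-1) i ltac:(by rewrite sqrrN expr1n)).
  by move: h1 h2; rewrite /nu !minkDr !minkZr; lra.
apply: mink_nondeg => v.
have -> : v = \sum_i v i ord0 *: delta_mx i ord0.
  by rewrite {1}[v]matrix_sum_delta; apply: eq_bigr => i _; rewrite big_ord1.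
rewrite mink_sumr big1// => i _; rewrite minkZr.
case: (splitP i) => j ij.
  have -> : i = ord0 by apply/val_inj; rewrite /= ij (ord1 j).
  by rewrite -e0E (proj1 (we i0)) mulr0.
have -> : i = rshift 1 j by apply/val_inj.
by rewrite (proj2 (we j)) mulr0.
Qed.

(** Otherwise all of G fixes the direction of xi, by [lox_share] also that of eta, and the orbit of
    a point of the axis stays in the plane of xi and eta. As n > 1, this contradicts
    [orbit_spans]. *)
Lemma orbit_moves_end A lam xi eta : G A -> lox A lam xi eta ->
  exists2 C, G C & B xi (C *m xi) != 0.
Proof.
move=> GA h; apply: contrapT => H.
have {}H C : G C -> B xi (C *m xi) = 0.
  by move=> GC; apply/eqP; apply: contra_notT H => H; exists C.
have [c [c0 h' xe2]] := lox_normal h.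
case: (h) => l1 hx he Ax Ae; case: (h') => _ hx' _ Ax' _.
have hZ := hyp_end hx' he xe2; set Z := _ + eta in hZ.
have Cx C : G C -> C *m xi = (tc (C *m xi) / tc xi) *: xi.
  by move=> GC; apply: null_perp => //; [apply: lor_null => //; exact: lG|exact: H].
have Ce C : G C -> C *m eta = (tc (C *m eta) / tc eta) *: eta.
  by move=> GC; exact: (lox_share dG GA GC h (Cx _ GC)).
have [w w0] := @perp_exists R (1 + n) (1 + 1) (lorentz_form *m row_mx xi eta) ltac:(by rewrite ltn_add2l).
rewrite mulmxA mul_mx_row => /eqP; rewrite -(row_mx0 _ 1 1 1).
move=> /eqP/eq_row_mx[wx we].
have {}wx : B w xi = 0 by rewrite /mink wx mxE.
have {}we : B w eta = 0 by rewrite /mink we mxE.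
move: w0; rewrite (orbit_spans hZ (w := w)) ?eqxx// => C GC.
by rewrite /Z mulmxDr -scalemxAr (Cx _ GC) (Ce _ GC) !minkDr !minkZr wx we !mulr0 addr0.
Qed.

(** If C0 moves xi, the directions of A^-k C0 xi converge to that of eta, so orthogonality to the
    orbit of xi passes to the orbit of eta and then to that of a point of the axis. *)
Lemma end_orbit_spans A lam xi eta w : G A -> lox A lam xi eta ->
  (forall C, G C -> B w (C *m xi) = 0) -> w = 0.
Proof.
move=> GA h wx; have lA := lG GA.
have [C0 GC0 hC0] := orbit_moves_end GA h.
have xe : B xi eta != 0 by rewrite lt_eqF// (lox_neg h).
have [c [c0 h' xe2]] := lox_normal h.
case: (h) => l1 hx he Ax Ae; case: (h') => _ hx' _ Ax' _.
have hZ := hyp_end hx' he xe2.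
have wC u : (forall C, G C -> B u (C *m xi) = 0) -> B u eta = 0.
  move=> ux; have [M hM] := pw_growth (C0 *m xi) u lA h.
  have : B u eta * B (C0 *m xi) xi / B xi eta = 0.
    apply: (geom_zero l1 (C := M)) => k; have := hM k.
    rewrite -lor_adj; last exact: pw_lor.
    rewrite mulmxA minkC ux ?sub0r ?normrN//.
    by apply: grM => //; apply: grV => //; exact: gr_pw.
  rewrite (minkC _ xi) => /eqP.
  by rewrite !mulf_eq0 invr_eq0 (negbTE hC0) (negbTE xe) !orbF => /eqP.
apply: (orbit_spans hZ) => C GC; rewrite mulmxDr minkDr -scalemxAr minkZr wx// mulr0 add0r.
rewrite -lor_adj; last exact: lG.
apply: wC => E GE; rewrite lor_adj; last exact: lG.
by rewrite mulmxA wx//; exact: grM.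
Qed.

Hypothesis fG : forall A X, G A -> hyp X -> A *m X = X -> A = 1%:M.

Lemma free_lox A : G A -> A = 1%:M \/ exists lam xi eta, lox A lam xi eta.
Proof.
move=> GA; have [[X hX AX]|h] := dichotomy dG gG (fun=> id) cG GA; last by right.
by left; exact: fG AX.
Qed.

Lemma free_null A v : G A -> null v -> A *m v = v -> A = 1%:M.
Proof.
move=> GA hv Av; have [//|[lam [xi [eta h]]]] := free_lox GA.
have [l1 _ _ _ _] := h; have := lox_null (lG GA) h hv (etrans Av (esym (scale1r v))).
have : lam^-1 < 1 by rewrite invf_lt1; lra.
by move=> li [] [e _]; [move: l1|move: li]; rewrite -e ltxx.
Qed.

End Orbits.

(** * The linear span of the adjoint action *)

(** Duality for a possibly infinite S: a family of maximal rank drawn from S spans it, and the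
    columns of its cokernel are the functionals to be tested. *)
Lemma span_dual (R : fieldType) N (S : 'rV[R]_N -> Prop) (v : 'rV[R]_N) :
  (forall c : 'cV[R]_N, (forall s, S s -> s *m c = 0) -> v *m c = 0) ->
  exists l : seq (R * 'rV[R]_N), (forall p, p \in l -> S p.2) /\
    v = \sum_(p <- l) p.1 *: p.2.
Proof.
move=> h.
pose P r := `[< exists k (M : 'M[R]_(k, N)), (forall i, S (row i M)) /\ \rank M = r >].
have exP : exists r, P r.
  exists 0%N; apply/asboolP; exists 0%N, 0; split; first by case.
  by rewrite mxrank0.
have ubP r : P r -> (r <= N)%N by move=> /asboolP[k [M [_ <-]]]; exact: rank_leq_col.
case: (ex_maxnP exP ubP) => r /asboolP[k [M [SM rM]]] maxr.
have sM s : S s -> (s <= M)%MS.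
  move=> Ss; have : P (\rank (col_mx M s)).
    apply/asboolP; exists (k + 1)%N, (col_mx M s); split => // i.
    case: (splitP i) => j ij.
      by rewrite (_ : i = lshift 1 j) ?rowKu//; apply/val_inj.
    rewrite (_ : i = rshift k j); last exact/val_inj.
    by rewrite rowKd (_ : row j s = s)//; apply/matrixP => a b; rewrite mxE !ord1.
  move=> /maxr; rewrite -rM => le.
  have sub : (M <= col_mx M s)%MS by rewrite -addsmxE addsmxSl.
  have : (M == col_mx M s)%MS by rewrite -(geq_leqif (mxrank_leqif_eq sub)).
  by move=> /andP[_]; rewrite col_mx_sub => /andP[].
have : (v <= M)%MS.
  rewrite submxE; apply/eqP/matrixP => i j; rewrite (ord1 i) [RHS]mxE.
  have -> : (v *m cokermx M) ord0 j = (v *m col j (cokermx M)) ord0 ord0.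
    by rewrite colE mulmxA -colE [RHS]mxE.
  rewrite h ?mxE// => s Ss; rewrite colE mulmxA.
  by have := sM s Ss; rewrite submxE => /eqP->; rewrite mul0mx.
case/submxP => D vD; exists [seq (D ord0 i, row i M) | i <- index_enum 'I_k].
split; first by move=> p /mapP[i _ ->]; exact: SM.
rewrite big_map vD mulmx_sum_row; apply: eq_bigr => i _ //.
Qed.

Section Wedge.
Context {R : realType} {n : nat}.
Implicit Types (a b c u v w p : 'cV[R]_(1 + n)) (A Z M : 'M[R]_(1 + n)).
Local Notation B := (@mink R n).

Fact wedge_key : unit. Proof. exact: tt. Qed.
(** The element of so(n,1) that corresponds to the bivector a ^ b. It is locked so that rewriting
    never unfolds it by accident. *)
Definition wedge a b : 'M[R]_(1 + n) := locked_with wedge_key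
  (a *m (b^T *m lorentz_form) - b *m (a^T *m lorentz_form)).

Lemma wedge_unlock a b : wedge a b = a *m (b^T *m lorentz_form) - b *m (a^T *m lorentz_form).
Proof. by rewrite /wedge unlock. Qed.

Lemma outer_act a b v : a *m (b^T *m lorentz_form) *m v = B b v *: a.
Proof.
rewrite -mulmxA; apply/matrixP => i j; rewrite (ord1 j) mxE big_ord1 [RHS]mxE mulrC.
by congr (_ * _); rewrite /mink.
Qed.

Lemma wedgeE a b v : wedge a b *m v = B b v *: a - B a v *: b.
Proof. by rewrite wedge_unlock mulmxBl !outer_act. Qed.

Lemma wedgeC a b : wedge a b = - wedge b a.
Proof. by rewrite !wedge_unlock opprB. Qed.

Lemma wedgeDr a b c : wedge a (b + c) = wedge a b + wedge a c.
Proof. by apply: mulmx_ext => v; rewrite [RHS]mulmxDl !wedgeE minkDl scalerDl scalerDr opprD addrACA. Qed.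

Lemma wedgeZr a b x : wedge a (x *: b) = x *: wedge a b.
Proof.
apply: mulmx_ext => v; rewrite -scalemxAl !wedgeE minkZl scalerBr !scalerA.
by rewrite (mulrC (B a v)).
Qed.

Lemma wedgeaa a : wedge a a = 0. Proof. by rewrite wedge_unlock subrr. Qed.

Lemma wedgeDl a b c : wedge (a + b) c = wedge a c + wedge b c.
Proof. by rewrite wedgeC wedgeDr opprD -!wedgeC. Qed.

Lemma wedgeZl a b x : wedge (x *: a) b = x *: wedge a b.
Proof. by rewrite wedgeC wedgeZr -scalerN -wedgeC. Qed.

Lemma wedge_conj A a b : lorentz A ->
  A *m wedge a b *m invmx A = wedge (A *m a) (A *m b).
Proof.
move=> lA; apply: mulmx_ext => v; rewrite -!mulmxA !wedgeE mulmxBr -!scalemxAr.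
by rewrite -!(minkC (invmx A *m v)) !(lor_adj _ _ lA) -!(minkC v).
Qed.

Definition skew Z := forall u v, B (Z *m u) v = - B u (Z *m v).

Lemma wedge_skew a b : skew (wedge a b).
Proof.
move=> u v; rewrite !wedgeE !minkBl !minkBr !minkZl !minkZr.
by rewrite (minkC b u) (minkC a u); ring.
Qed.

Definition ad Z M := Z *m M - M *m Z.

Lemma ad_wedge Z a b : skew Z -> ad Z (wedge a b) = wedge (Z *m a) b + wedge a (Z *m b).
Proof.
move=> sZ; apply: mulmx_ext => v.
rewrite [LHS]mulmxBl [RHS]mulmxDl -!mulmxA !wedgeE mulmxBr -!scalemxAr !sZ.
rewrite !scaleNr opprB opprK; apply/matrixP => i j; rewrite !mxE; ring.
Qed.

Lemma skew_ad Z Z' : skew Z -> skew Z' -> skew (ad Z Z').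
Proof.
move=> h h' u v; rewrite /ad !mulmxBl !minkBl !minkBr -!mulmxA !(h, h'); ring.
Qed.

Lemma skew_conj A Z : lorentz A -> skew Z -> skew (A *m Z *m invmx A).
Proof.
move=> lA h u v; rewrite -!mulmxA minkC -lor_adj// minkC h.
by rewrite (lor_adj _ _ lA).
Qed.

Lemma skew_self Z u : skew Z -> B u (Z *m u) = 0.
Proof. by move=> h; have := h u u; rewrite minkC; lra. Qed.

End Wedge.

Section AdSpan.
Context {R : realType} {n : nat}.
Implicit Types (a b c u v w xi eta : 'cV[R]_(1 + n)) (A Z M : 'M[R]_(1 + n)).
Local Notation B := (@mink R n).
Variables (G : set 'M[R]_(1 + n)).
Hypotheses (gG : mx_subgroup G) (lG : G `<=` lorentz).

(** F belongs to the linear span of the operators Ad A with A in G. The explicit list matters: its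
    coefficients are adjoined later to the ring over which the place is taken. *)
Definition adG (F : 'M[R]_(1 + n) -> 'M[R]_(1 + n)) :=
  exists l : seq (R * 'M[R]_(1 + n)), (forall p, p \in l -> G p.2) /\
    forall M, F M = \sum_(p <- l) p.1 *: (p.2 *m M *m invmx p.2).

Lemma adG_Ad A : G A -> adG (fun M => A *m M *m invmx A).
Proof.
move=> GA; exists [:: (1, A)]; split; first by move=> p; rewrite inE => /eqP->.
by move=> M; rewrite big_seq1 scale1r.
Qed.

Lemma adG_ext F F' : (forall M, F M = F' M) -> adG F -> adG F'.
Proof. by move=> h [l [lG' hl]]; exists l; split => // M; rewrite -h. Qed.

Lemma adG_D F F' : adG F -> adG F' -> adG (fun M => F M + F' M).
Proof.
move=> [l [h1 h2]] [l' [h1' h2']]; exists (l ++ l'); split.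
  by move=> p; rewrite mem_cat => /orP[/h1|/h1'].
by move=> M; rewrite big_cat h2 h2'.
Qed.

Lemma adG_Z x F : adG F -> adG (fun M => x *: F M).
Proof.
move=> [l [h1 h2]]; exists [seq (x * p.1, p.2) | p <- l]; split.
  by move=> p /mapP[q ql ->]; exact: (h1 q).
by move=> M; rewrite big_map h2 scaler_sumr; apply: eq_bigr => p _; rewrite scalerA.
Qed.

Lemma adG_comp F F' : adG F -> adG F' -> adG (fun M => F (F' M)).
Proof.
move=> [l [h1 h2]] [l' [h1' h2']].
exists [seq (p.1 * q.1, p.2 *m q.2) | p <- l, q <- l']; split.
  by move=> p /allpairsP[[p1 p2] [/h1 a /h1' b ->]]; exact: grM.
move=> M; rewrite h2 big_allpairs_dep /=; apply: eq_big_seq => p pl.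
rewrite h2' mulmx_sumr mulmx_suml scaler_sumr; apply: eq_big_seq => q ql /=.
rewrite -scalemxAr -scalemxAl scalerA; congr (_ *: _).
have up := gr_unit gG (h1 _ pl); have uq := gr_unit gG (h1' _ ql).
have -> : invmx (p.2 *m q.2) = invmx q.2 *m invmx p.2.
  have upq : p.2 *m q.2 \in unitmx by rewrite unitmx_mul up.
  apply: (can_inj (mulKmx upq)); rewrite mulmxV// mulmxA mulmxK// mulmxV//.
by rewrite !mulmxA.
Qed.

(** These Z form a Lie algebra stable under Ad G. It will turn out to contain every wedge
    ([qalg_full]), the statement that stands in for Zariski density of G. *)
Definition qalg Z := skew Z /\ adG (ad Z).

Lemma qalg_D Z Z' : qalg Z -> qalg Z' -> qalg (Z + Z').
Proof.
move=> [s h] [s' h']; split.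
  by move=> u v; rewrite !mulmxDl minkDl minkDr s s' opprD.
by apply: adG_ext (adG_D h h') => M; rewrite /ad mulmxDl mulmxDr opprD addrACA.
Qed.

Lemma qalg_Z x Z : qalg Z -> qalg (x *: Z).
Proof.
move=> [s h]; split.
  by move=> u v; rewrite -!scalemxAl minkZl minkZr s mulrN.
by apply: adG_ext (adG_Z x h) => M; rewrite /ad -scalemxAl -scalemxAr scalerBr.
Qed.

Lemma qalg_ad Z Z' : qalg Z -> qalg Z' -> qalg (ad Z Z').
Proof.
move=> [s h] [s' h']; split; first exact: skew_ad.
apply: adG_ext (adG_D (adG_comp h h') (adG_Z (-1) (adG_comp h' h))) => M.
rewrite scaleN1r /ad !(mulmxBl, mulmxBr) !mulmxA.
by apply/matrixP => i j; rewrite !mxE; ring.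
Qed.

Lemma qalg_conj A Z : G A -> qalg Z -> qalg (A *m Z *m invmx A).
Proof.
move=> GA [s h]; split; first exact: skew_conj (lG GA) s.
apply: adG_ext (adG_comp (adG_Ad GA) (adG_comp h (adG_Ad (grV gG GA)))) => M.
have uA := gr_unit gG GA.
by rewrite /ad invmxK mulmxBr mulmxBl !mulmxA mulmxK// mulmxV// mul1mx.
Qed.

End AdSpan.

(** * Boosts *)

Lemma norm_quarter (R : realFieldType) (x y z : R) :
  0 < x -> y <= x / 4 -> z <= 2 * (x / 4) -> x <= y + z -> False.
Proof. by move=> x0 hy hz h; lra. Qed.

Section Recurrence.
Context {R : realType}.

Lemma bounded_return (I : finType) (f : nat -> I -> R) (C e : R) : 0 < e ->
  (forall k i, `|f k i| <= C) ->
  exists j k, (j < k)%N /\ forall i, `|f k i - f j i| <= e.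
Proof.
move=> e0 fC.

pose N := Num.truncn (`|2 * C / e|).
pose g k : {ffun I -> 'I_N.+1} := [ffun i => inord (Num.truncn ((f k i + C) / e))].
have [j [k [jk gjk]]] := @pigeonhole _ (enum {ffun I -> 'I_N.+1}) g (fun k => mem_enum _ _).
exists j, k; split => // i.
have := congr1 (fun h : {ffun I -> 'I_N.+1} => val (h i)) gjk; rewrite !ffunE.
have b l : 0 <= (f l i + C) / e by apply: divr_ge0; [have := fC l i; rewrite ler_norml => /andP[]; lra|exact: ltW].
have lN l : (Num.truncn ((f l i + C) / e) < N.+1)%N.
  rewrite ltnS /N; apply: le_truncn; apply: le_trans (ler_norm _).
  rewrite ler_pM2r ?invr_gt0//; have := fC l i; rewrite ler_norml => /andP[]; lra.
rewrite /= !inordK// => E.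
have /andP[h1 h2] := truncn_itv (b j); have /andP[h3 h4] := truncn_itv (b k).
rewrite E in h1 h2; move: h1 h2 h3 h4; set t := Num.truncn _; rewrite -natr1 => h1 h2 h3 h4.
have ej : f j i + C = (f j i + C) / e * e by rewrite divfK// gt_eqF.
have ek : f k i + C = (f k i + C) / e * e by rewrite divfK// gt_eqF.
rewrite ler_norml; apply/andP; split; nra.
Qed.

End Recurrence.

Section Boost.
Context {R : realType} {n : nat}.
Implicit Types (u v w xi eta : 'cV[R]_(1 + n)) (A Z M : 'M[R]_(1 + n)).
Local Notation B := (@mink R n).
Variables (G : set 'M[R]_(1 + n)).
Hypotheses (gG : mx_subgroup G) (lG : G `<=` lorentz).

(** Coordinates of the operator sending M to A M A'. Relations between such operators thereby become
    relations between row vectors, to which [span_dual] applies. *)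
Definition tens A A' := mxvec ((mxvec A)^T *m mxvec A').

Lemma tens_op (I : Type) (s : seq I) (r : I -> R) (a b : I -> 'M[R]_(1 + n)) Z :
  tens Z 1%:M - tens 1%:M Z = \sum_(i <- s) r i *: tens (a i) (b i) ->
  forall M, ad Z M = \sum_(i <- s) r i *: (a i *m M *m b i).
Proof.
move=> h.
have tE A A' i j k l : tens A A' ord0 (mxvec_index (mxvec_index i j) (mxvec_index k l)) = A i j * A' k l.
  by rewrite /tens mxvecE mxE big_ord1 mxE !mxvecE.
have e i j k l : Z i j * (1%:M : 'M[R]_(1 + n)) k l - (1%:M : 'M[R]_(1 + n)) i j * Z k l =
    \sum_(x <- s) r x * (a x i j * b x k l).
  rewrite -!tE; have := congr1 (fun v : 'rV_(_) => v ord0 (mxvec_index (mxvec_index i j) (mxvec_index k l))) h.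
  by rewrite [LHS]mxE [X in _ + X]mxE => ->; rewrite summxE; apply: eq_bigr => x _; rewrite mxE tE.
have mm A A' M i l : (A *m M *m A') i l = \sum_k \sum_j (A i j * M j k) * A' k l.
  by rewrite mxE; apply: eq_bigr => k _; rewrite mxE mulr_suml.
move=> M; apply/matrixP => i l.
have -> : ad Z M = Z *m M *m 1%:M - 1%:M *m M *m Z by rewrite mulmx1 mul1mx.
rewrite [LHS]mxE [X in _ + X]mxE !mm summxE -sumrB.
under [RHS]eq_bigr do rewrite mxE mm mulr_sumr.
rewrite exchange_big /=; apply: eq_bigr => k _.
rewrite -sumrB; under [RHS]eq_bigr do rewrite mulr_sumr.
rewrite exchange_big /=; apply: eq_bigr => j _.
transitivity (M j k * (Z i j * (1%:M : 'M[R]_(1 + n)) k l - (1%:M : 'M[R]_(1 + n)) i j * Z k l)); first by ring.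
by rewrite e mulr_sumr; apply: eq_bigr => x _; ring.
Qed.

Lemma tensDl A A' M : tens (A + A') M = tens A M + tens A' M.
Proof. by rewrite /tens linearD [(_ + _)^T]linearD mulmxDl linearD. Qed.
Lemma tensDr A A' M : tens M (A + A') = tens M A + tens M A'.
Proof. by rewrite /tens linearD mulmxDr linearD. Qed.
Lemma tensZl x A M : tens (x *: A) M = x *: tens A M.
Proof. by rewrite /tens linearZ [(_ *: _)^T]linearZ -scalemxAl linearZ. Qed.
Lemma tensZr x A M : tens M (x *: A) = x *: tens M A.
Proof. by rewrite /tens linearZ -scalemxAr linearZ. Qed.

Lemma tens_bound (c : 'cV[R]_((1 + n) * (1 + n) * ((1 + n) * (1 + n)))) :
  exists2 L, 0 <= L & forall A A' x y, 0 <= x -> 0 <= y -> (forall i j, `|A i j| <= x) ->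
    (forall i j, `|A' i j| <= y) -> `|(tens A A' *m c) ord0 ord0| <= L * x * y.
Proof.
exists (\sum_i `|c i ord0|); first exact: sumr_ge0.
move=> A A' x y x0 y0 hA hA'; rewrite mxE -mulrA mulr_suml.
apply: le_trans (ler_norm_sum _ _ _) _; apply: ler_sum => i _.
rewrite normrM mulrC ler_wpM2l//.
case/mxvec_indexP: i => i j; rewrite /tens mxvecE mxE big_ord1 mxE.
case/mxvec_indexP: i => i i'; case/mxvec_indexP: j => j j'.
by rewrite !mxvecE normrM ler_pM.
Qed.

Lemma entry_mink (x : 'cV[R]_(1 + n)) i : x i ord0 = B (lorentz_form *m delta_mx i ord0) x.
Proof.
rewrite /mink trmx_mul lformT -!mulmxA (mulmxA lorentz_form) lformK mul1mx.
by rewrite trmx_delta -rowE mxE.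
Qed.

Fact proj_key : unit. Proof. exact: tt. Qed.
(** For B xi eta = -1, the orthogonal projection along the plane of xi and eta; the two outer
    products are minus the projections to the lines of xi and eta. *)
Definition proj xi eta : 'M[R]_(1 + n) := locked_with proj_key
  (1%:M + xi *m (eta^T *m lorentz_form) + eta *m (xi^T *m lorentz_form)).

Lemma proj_unlock xi eta :
  proj xi eta = 1%:M + xi *m (eta^T *m lorentz_form) + eta *m (xi^T *m lorentz_form).
Proof. by rewrite /proj unlock. Qed.

Lemma projC xi eta : proj eta xi = proj xi eta.
Proof. by rewrite !proj_unlock addrAC. Qed.

Lemma projE xi eta v : proj xi eta *m v = v + B eta v *: xi + B xi v *: eta.
Proof. by rewrite proj_unlock !mulmxDl mul1mx !outer_act. Qed.

Lemma proj_perp xi eta v : null xi -> null eta -> B xi eta = -1 ->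
  B (proj xi eta *m v) xi = 0 /\ B (proj xi eta *m v) eta = 0.
Proof.
move=> [x1 _] [e1 _] xe; rewrite projE !minkDl !minkZl x1 e1 (minkC eta xi) xe.
by rewrite (minkC eta v) (minkC xi v); split; ring.
Qed.

Lemma proj_comm A lam xi eta : lorentz A -> lox A lam xi eta ->
  A *m proj xi eta = proj xi eta *m A.
Proof.
move=> lA [l1 hx he Ax Ae]; have l0 : lam != 0 by rewrite gt_eqF//; lra.
apply: mulmx_ext => v; rewrite -!mulmxA !projE !mulmxDr -!scalemxAr Ax Ae !scalerA.
have -> : B eta (A *m v) = B eta v * lam.
  by apply: (mulIf (invr_neq0 l0)); rewrite mulfK// mulrC -minkZl -Ae lor_mink.
have -> // : B xi (A *m v) = B xi v * lam^-1.
by apply: (mulIf l0); rewrite mulfVK// mulrC -minkZl -Ax lor_mink.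
Qed.

Lemma proj_idem xi eta : null xi -> null eta -> B xi eta = -1 ->
  proj xi eta *m proj xi eta = proj xi eta.
Proof.
move=> hx he xe; apply: mulmx_ext => v; rewrite -mulmxA projE.
have [h1 h2] := proj_perp v hx he xe.
by rewrite (minkC eta) (minkC xi) h1 h2 !scale0r !addr0.
Qed.

Lemma pwV A k : A \in unitmx -> pw (invmx A) k *m pw A k = 1%:M.
Proof.
move=> uA; elim: k => [|k IH]; first by rewrite mulmx1.
by rewrite pwSr pwS -mulmxA (mulmxA (invmx A)) mulVmx// mul1mx.
Qed.

Lemma pw_inv A k : A \in unitmx -> invmx (pw A k) = pw (invmx A) k.
Proof.
move=> uA; have h := pwV k uA; have [_ u] := mulmx1_unit h.
by rewrite -[RHS]mulmx1 -(mulmxV u) mulmxA h mul1mx.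
Qed.

Lemma rho_bound A lam xi eta : lorentz A -> lox A lam xi eta -> B xi eta = -1 ->
  exists C, forall k i j, `|(pw A k *m proj xi eta) i j| <= C.
Proof.
move=> lA h xe; have [_ hx he _ _] := h.
have H i j : exists C, forall k, `|(pw A k *m proj xi eta) i j| <= C.
  have [C hC] := pw_growth (lorentz_form *m delta_mx i ord0) (proj xi eta *m delta_mx j ord0) lA h.
  exists C => k; have := hC k; have [_ ->] := proj_perp (delta_mx j ord0) hx he xe.
  by rewrite !mul0r mulr0 subr0 -entry_mink mulmxA -colE mxE.
have [C hC] := @choice _ _ _ (fun ij : 'I_(1 + n) * 'I_(1 + n) => H ij.1 ij.2).
exists (\sum_ij `|C ij|) => k i j; apply: le_trans (hC (i, j) k) _.
by apply: le_trans (ler_norm _) _; rewrite (bigD1 (i, j))//= lerDl sumr_ge0.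
Qed.

(** The functional l given by c vanishes on all Ad C. Write A^k = rho_k - lam^k P - lam^-k Q and
    A^-k = rho'_k - lam^-k P - lam^k Q with rho_k and rho'_k bounded, and expand 0 = l (A^k, A^-k)
    in powers of lam^k. The top coefficient gives l P Q = 0, and the next one shows that l P rho'_k
    + l rho_k Q tends to 0. Since rho_k and rho'_k return together arbitrarily close to N, the value
    at N is 0 too. *)
Lemma boost_half A lam xi eta (c : 'cV[R]_((1 + n) * (1 + n) * ((1 + n) * (1 + n)))) : G A -> lox A lam xi eta -> B xi eta = -1 ->
  (forall C, G C -> (tens C (invmx C) *m c) ord0 ord0 = 0) ->
  let P := xi *m (eta^T *m lorentz_form) in let Q := eta *m (xi^T *m lorentz_form) in
  let l a b := (tens a b *m c) ord0 ord0 in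
  l P Q = 0 /\ l P (proj xi eta) + l (proj xi eta) Q = 0.
Proof.
move=> GA h xe hc P Q l; have lA := lG GA; have uA := lor_unit lA.
have h' := lox_inv lA h; have ex : B eta xi = -1 by rewrite minkC.
have [l1 hx he Ax Ae] := h; have [_ _ _ Ae' Ax'] := h'.
have l0 : lam != 0 by rewrite gt_eqF//; lra.
set N := proj xi eta; have NE : proj eta xi = N by rewrite /N projC.
have [C1 hC1] := rho_bound lA h xe; have [C2 hC2] := rho_bound (lorV lA) h' ex.
rewrite NE in hC2.
pose rho k := pw A k *m N; pose rho' k := pw (invmx A) k *m N.
pose C := `|C1| + `|C2| + \sum_i \sum_j (`|P i j| + `|Q i j|).
have S0 : 0 <= \sum_i \sum_j (`|P i j| + `|Q i j|) by do !(apply: sumr_ge0 => ? _); rewrite addr_ge0.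
have C0 : 0 <= C by rewrite /C !addr_ge0.
have PQ i j : `|P i j| + `|Q i j| <= \sum_i \sum_j (`|P i j| + `|Q i j|).
  rewrite (bigD1 i)//= (bigD1 j)//= -addrA lerDl addr_ge0//; last first.
    by do !(apply: sumr_ge0 => ? _); rewrite addr_ge0.
  by do !(apply: sumr_ge0 => ? _); rewrite addr_ge0.
have CP i j : `|P i j| <= C.
  by have := PQ i j; have := normr_ge0 (Q i j); have := normr_ge0 C1; have := normr_ge0 C2; rewrite /C; lra.
have CQ i j : `|Q i j| <= C.
  by have := PQ i j; have := normr_ge0 (P i j); have := normr_ge0 C1; have := normr_ge0 C2; rewrite /C; lra.
have Cr k i j : `|rho k i j| <= C.
  by have := hC1 k i j; have := ler_norm C1; have := normr_ge0 C2; rewrite /C; lra.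
have Cr' k i j : `|rho' k i j| <= C.
  by have := hC2 k i j; have := ler_norm C2; have := normr_ge0 C1; rewrite /C; lra.
have [L L0 hL] := tens_bound c.
have lDl a b d : l (a + b) d = l a d + l b d by rewrite /l tensDl mulmxDl mxE.
have lDr a b d : l d (a + b) = l d a + l d b by rewrite /l tensDr mulmxDl mxE.
have lZl x a d : l (x *: a) d = x * l a d by rewrite /l tensZl -scalemxAl mxE.
have lZr x a d : l d (x *: a) = x * l d a by rewrite /l tensZr -scalemxAl mxE.
pose K := L * C * C; have K0 : 0 <= K by rewrite !mulr_ge0.
have lK (a b : 'M[R]_(1 + n)) : (forall i j, `|a i j| <= C) -> (forall i j, `|b i j| <= C) -> `|l a b| <= K.
  by move=> ha hb; exact: hL.
have pAP D mu k : D *m xi = mu *: xi -> pw D k *m P = mu ^+ k *: P.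
  by move=> Dx; rewrite /P mulmxA (pw_eig k Dx) scalemxAl.
have pAQ D mu k : D *m eta = mu *: eta -> pw D k *m Q = mu ^+ k *: Q.
  by move=> Dx; rewrite /Q mulmxA (pw_eig k Dx) scalemxAl.
have one : 1%:M = N - P - Q by rewrite /N proj_unlock -/P -/Q (addrAC _ P Q) !addrK.
have pwE k : pw A k = rho k - lam ^+ k *: P - lam^-1 ^+ k *: Q.
  by rewrite -[LHS]mulmx1 one !mulmxBr (pAP A lam)// (pAQ A lam^-1).
have pwE' k : pw (invmx A) k = rho' k - lam^-1 ^+ k *: P - lam ^+ k *: Q.
  by rewrite -[LHS]mulmx1 one !mulmxBr (pAP _ lam^-1)// (pAQ _ lam).
have eq0 k : 0 = l (rho k - lam ^+ k *: P - lam^-1 ^+ k *: Q) (rho' k - lam^-1 ^+ k *: P - lam ^+ k *: Q).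
  by rewrite -pwE -pwE' -pw_inv// /l hc//; exact: gr_pw.
have lNl a d : l (- a) d = - l a d by rewrite -scaleN1r lZl mulN1r.
have lNr a d : l d (- a) = - l d a by rewrite -scaleN1r lZr mulN1r.
pose p k := lam ^+ k; pose q k := lam^-1 ^+ k.
have pq k : p k * q k = 1 by rewrite /p /q -exprMn divff// expr1n.
have q0 k : 0 <= q k by rewrite exprn_ge0// invr_ge0 (le_trans ler01)// ltW.
have p1 k : 1 <= p k by rewrite exprn_ege1// ltW.
have q1 k : q k <= 1 by have := pq k; have := p1 k; have := q0 k; nra.
pose b k := l (rho k) (rho' k) + l P P + l Q Q - q k * l (rho k) P - q k * l Q (rho' k) + q k * q k * l Q P.
have bK k : `|b k| <= 6 * K.
  have le x y : 0 <= x -> x <= 1 -> `|y| <= K -> `|x * y| <= K.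
    by move=> x0 x1 yK; rewrite normrM (ger0_norm x0); apply: le_trans yK; rewrite ler_piMl.
  have qq : q k * q k <= 1 by rewrite mulr_ile1.
  have -> : 6 * K = K + K + K + K + K + K by ring.
  have qq0 : 0 <= q k * q k by rewrite mulr_ge0.
  rewrite /b; do 5![apply: le_trans (ler_normD _ _) _; apply: lerD;
    [|by rewrite ?normrN; try (by apply: lK); apply: le => //; apply: lK]].
  exact: lK.
pose a k := l P (rho' k) + l (rho k) Q.
have ab k : p k ^+ 2 * l P Q = p k * a k - b k.
  have := eq0 k; rewrite -/(p k) -/(q k) !(lDl, lDr, lNl, lNr, lZl, lZr) /a /b => e.
  have e2 : p k * (q k * l P P) = l P P by rewrite mulrA pq mul1r.
  have e3 : q k * (p k * l Q Q) = l Q Q by rewrite mulrA (mulrC (q k)) pq mul1r.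
  by move: e e2 e3; lra.
have aK k : `|a k| <= 2 * K.
  have -> : 2 * K = K + K by ring.
  by rewrite /a; apply: le_trans (ler_normD _ _) _; apply: lerD; apply: lK.
have lPQ : l P Q = 0.
  apply: (geom_zero l1 (C := 8 * K)) => k.
  have -> : lam ^+ k * l P Q = a k - q k * b k.
    have : q k * (p k ^+ 2 * l P Q) = q k * (p k * a k - b k) by rewrite ab.
    rewrite expr2 mulrBr !mulrA (mulrC (q k)) pq !mul1r => -> //.
  have -> : 8 * K = 2 * K + 6 * K by ring.
  apply: le_trans (ler_normB _ _) _; apply: lerD => //.
  by rewrite normrM (ger0_norm (q0 k)); apply: le_trans (bK k); rewrite ler_piMl.
split => //; have pa k : p k * `|a k| <= 6 * K.
  have -> : p k * `|a k| = `|p k * a k| by rewrite normrM ger0_norm//; apply: le_trans (p1 k).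
  by have := ab k; rewrite lPQ mulr0 => /esym/eqP; rewrite subr_eq0 => /eqP->.
set ai := l P N + l N Q; apply/eqP; case: (eqVneq ai 0) => // ain.
have na : 0 < `|ai| by rewrite normr_gt0.
pose W := L * C * ((1 + n)%:R * C) + 1.
have W0 : 0 < W by rewrite ltr_wpDl// !mulr_ge0.
(* So small that replacing rho_t and rho'_t by N changes the value by at most half of |ai|. *)
pose e := `|ai| / (4 * W); have e0 : 0 < e by rewrite divr_gt0// mulr_gt0.
have eW : e * W = `|ai| / 4 by rewrite /e invfM !mulrA divfK// gt_eqF.
(* This m makes |a t| at most a quarter of |ai| for all t >= m. Recurrence is applied along
   multiples of m, so that the return time t is at least m. *)
have [m hm] := geom_unbounded (24 * K / `|ai|) l1.
have [j [k [jk hjk]]] := @bounded_return R _ (fun k (ij : 'I_(1 + n) * 'I_(1 + n)) => rho (m * k)%N ij.1 ij.2) C e e0 (fun k ij => Cr _ _ _).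
pose t := (m * (k - j))%N.
have NN : N *m N = N by exact: proj_idem.
have Nrho i : N *m rho i = rho i.
  by rewrite /rho mulmxA -(pw_comm i (proj_comm lA h)) -mulmxA NN.
have mk : (m * k)%N = (m * j + t)%N by rewrite /t mulnBr subnKC// leq_mul2l ltnW ?orbT.
have small (a1 x : 'M[R]_(1 + n)) : (forall i j, `|x i j| <= e) -> (forall i j, `|a1 i j| <= C) ->
    forall i j, `|(a1 *m x) i j| <= (1 + n)%:R * C * e.
  move=> hx1 ha i1 j1; rewrite mxE; apply: le_trans (ler_norm_sum _ _ _) _.
  apply: (@le_trans _ _ (\sum_(i < 1 + n) C * e)).
    by apply: ler_sum => ? _; rewrite normrM ler_pM.
  by rewrite le_eqVlt; apply/orP; left; apply/eqP; rewrite sumr_const card_ord -mulr_natl; ring.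
have r1 : rho t - N = rho' (m * j)%N *m (rho (m * k)%N - rho (m * j)%N).
  rewrite mulmxBr /rho' -!mulmxA !Nrho /rho mk pwD !mulmxA pwV// !mul1mx //.
have r2 : rho' t - N = rho' (m * k)%N *m (rho (m * j)%N - rho (m * k)%N).
  rewrite mulmxBr /rho' -!mulmxA !Nrho /rho (mulmxA _ (pw A (m * k))) pwV// mul1mx.
  by rewrite mk (addnC _ t) pwD -mulmxA (mulmxA _ (pw A _)) pwV// mul1mx.
have sub_e (x y : 'M[R]_(1 + n)) i1 j1 : (x - y) i1 j1 = x i1 j1 - y i1 j1.
  by rewrite mxE [X in _ + X]mxE.
have d1 i1 j1 : `|(rho (m * k)%N - rho (m * j)%N) i1 j1| <= e.
  by rewrite sub_e; exact: (hjk (i1, j1)).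
have d2 i1 j1 : `|(rho (m * j)%N - rho (m * k)%N) i1 j1| <= e.
  by rewrite sub_e distrC; exact: (hjk (i1, j1)).
have s1 := small _ _ d1 (Cr' (m * j)%N); have s2 := small _ _ d2 (Cr' (m * k)%N).
have diff : `|a t - ai| <= 2 * (e * W).
  have -> : a t - ai = l P (rho' t - N) + l (rho t - N) Q.
    by rewrite lDr lDl lNl lNr /a /ai; ring.
  have ne0 : 0 <= (1 + n)%:R * C * e by apply: mulr_ge0; [exact: mulr_ge0|exact: ltW].
  have b1 : `|l P (rho' t - N)| <= L * C * ((1 + n)%:R * C * e).
    by apply: hL => // i1 j1; rewrite r2; exact: s2.
  have b2 : `|l (rho t - N) Q| <= L * ((1 + n)%:R * C * e) * C.
    by apply: hL => // i1 j1; rewrite r1; exact: s1.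
  apply: le_trans (ler_normD _ _) (le_trans (lerD b1 b2) _); rewrite -subr_ge0.
  have -> : 2 * (e * W) - (L * C * ((1 + n)%:R * C * e) + L * ((1 + n)%:R * C * e) * C) = 2 * e by rewrite /W; ring.
  by rewrite mulr_ge0// ltW.
have tm : (m <= t)%N by rewrite leq_pmulr// subn_gt0.
have at_ : `|a t| * (24 * K / `|ai|) <= 6 * K.
  apply: le_trans (pa t); rewrite mulrC ler_wpM2r//; apply: le_trans (ltW hm) _.
  by rewrite ler_weXn2l// ltW.
clearbody K.
have : `|a t| <= `|ai| / 4.
  case: (ltgtP 0 K) K0 => // [K0 _|K0 _].
    rewrite -(@ler_pM2r _ (24 * K / `|ai|)) ?divr_gt0// ?mulr_gt0//.
    apply: le_trans at_ _; rewrite le_eqVlt; apply/orP; left; apply/eqP; field; rewrite gt_eqF//.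
  apply: (@le_trans _ _ (p t * `|a t|)); first by rewrite ler_peMl.
  by apply: le_trans (pa t) _; rewrite -K0 mulr0 divr_ge0.
have := ler_distD (a t) 0 ai.
rewrite !sub0r !normrN; rewrite eW in diff => t1 t2.
by case: (norm_quarter na t2 diff t1).
Qed.

(** With 1 = N - P - Q, the functional at the operator ad (Q - P) expands into the expressions that
    [boost_half] annihilates for A and, with P and Q exchanged, for A^-1. *)
Lemma boost_dual A lam xi eta (c : 'cV[R]_((1 + n) * (1 + n) * ((1 + n) * (1 + n)))) :
  G A -> lox A lam xi eta -> B xi eta = -1 ->
  (forall C, G C -> (tens C (invmx C) *m c) ord0 ord0 = 0) ->
  (tens (wedge eta xi) 1%:M - tens 1%:M (wedge eta xi)) *m c = 0.
Proof.
move=> GA h xe hc; have lA := lG GA; have h' := lox_inv lA h.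
have ex : B eta xi = -1 by rewrite minkC.
have [h1 h2] := boost_half GA h xe hc.
have [h3 h4] := boost_half (grV gG GA) h' ex hc.
move: h1 h2 h3 h4; have -> : proj eta xi = proj xi eta by rewrite projC.
have : wedge eta xi = eta *m (xi^T *m lorentz_form) - xi *m (eta^T *m lorentz_form) by rewrite wedge_unlock.
set P := xi *m _; set Q := eta *m _; set N := proj xi eta => ZE h1 h2 h3 h4.
have one : 1%:M = N - P - Q by rewrite /N proj_unlock -/P -/Q (addrAC _ P Q) !addrK.
apply/matrixP => i j; rewrite !ord1 [RHS]mxE ZE one.
pose ll (a b : 'M[R]_(1 + n)) : R := (tens a b *m c) ord0 ord0.
have lDl a b d : ll (a + b) d = ll a d + ll b d by rewrite /ll tensDl mulmxDl mxE.
have lDr a b d : ll d (a + b) = ll d a + ll d b by rewrite /ll tensDr mulmxDl mxE.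
have lNl a d : ll (- a) d = - ll a d by rewrite -scaleN1r /ll tensZl -scalemxAl mxE mulN1r.
have lNr a d : ll d (- a) = - ll d a by rewrite -scaleN1r /ll tensZr -scalemxAl mxE mulN1r.
transitivity (ll (Q - P) (N - P - Q) - ll (N - P - Q) (Q - P)).
  by rewrite mulmxBl [LHS]mxE [X in _ + X]mxE.
change (ll P Q = 0) in h1; change (ll P N + ll N Q = 0) in h2.
change (ll Q P = 0) in h3; change (ll Q N + ll N P = 0) in h4.
clearbody ll N P Q; rewrite !(lDl, lDr, lNl, lNr); lra.
Qed.

Lemma boost_adG A lam xi eta : G A -> lox A lam xi eta -> B xi eta = -1 ->
  adG G (ad (wedge eta xi)).
Proof.
move=> GA h xe; set Z := wedge eta xi.
have [|l [hl lE]] := @span_dual R _ (fun s => exists2 C, G C & s = tens C (invmx C))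
  (tens Z 1%:M - tens 1%:M Z).
  move=> c hc; apply: (boost_dual GA h xe) => C GC.
  by rewrite hc ?mxE//; exists C.
exists [seq (p.1, get [set C | G C /\ p.2 = tens C (invmx C)]) | p <- l].
have hg p : p \in l -> [set C | G C /\ p.2 = tens C (invmx C)] (get [set C | G C /\ p.2 = tens C (invmx C)]).
  by move=> /hl[C GC pC]; apply: (@getI _ _ C).
split; first by move=> p /mapP[q /hg[? _] ->].
move=> M; rewrite big_map.
apply: (@tens_op _ l (fun p => p.1) (fun p => get [set C | G C /\ p.2 = tens C (invmx C)])
   (fun p => invmx (get [set C | G C /\ p.2 = tens C (invmx C)]))).
by rewrite lE; apply: eq_big_seq => p /hg[_ {1}->].
Qed.

End Boost.

(** * The adjoint action of so(n,1) lies in the span of the group *)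

Section Wedges.
Context {R : realType} {n : nat}.
Implicit Types (u v w xi eta : 'cV[R]_(1 + n)) (A Z M : 'M[R]_(1 + n)).
Local Notation B := (@mink R n).

Definition perp2 xi eta w := B w xi = 0 /\ B w eta = 0.

(* The weight spaces of [ad (eta /\ xi)]: the components of Z of weight 1 and -1 *)
(* are xi /\ (proj Z eta) and eta /\ (proj Z xi). *)
Lemma weight_decomp xi eta Z : null xi -> null eta -> B xi eta = -1 -> skew Z ->
  let N := proj xi eta in
  ad (wedge eta xi) Z = wedge xi (N *m (Z *m eta)) - wedge eta (N *m (Z *m xi)).
Proof.
move=> hx he xe sZ N; have ex : B eta xi = -1 by rewrite minkC.
have adC M M' : ad M M' = - ad M' M by rewrite /ad opprB.
rewrite adC ad_wedge// !projE.
have h1 : B eta (Z *m eta) = 0 by exact: skew_self.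
have h2 : B xi (Z *m xi) = 0 by exact: skew_self.
rewrite h1 h2 !scale0r !addr0 !wedgeDr !wedgeZr.
have -> : B xi (Z *m eta) = - B eta (Z *m xi) by rewrite -sZ minkC.
rewrite (wedgeC eta xi) (wedgeC (Z *m eta) xi).
by apply/matrixP => i j; rewrite !mxE; ring.
Qed.

Variables (G : set 'M[R]_(1 + n)).
Hypotheses (gG : mx_subgroup G) (lG : G `<=` lorentz).
Local Notation q := (qalg G).

Section Ends.
Variables (xi eta : 'cV[R]_(1 + n)).
Hypotheses (hx : null xi) (he : null eta) (xe : B xi eta = -1) (q0 : q (wedge eta xi)).
Let N := proj xi eta.

(** ad (eta ^ xi) acts by 1 and -1 on the two components, so its first and second iterates on Z are
    their difference and their sum. *)
Lemma qalg_weights Z : q Z -> q (wedge xi (N *m (Z *m eta))) /\ q (wedge eta (N *m (Z *m xi))).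
Proof.
move=> qZ; have [sZ _] := qZ; have q1 := qalg_ad gG q0 qZ.
have q2 := qalg_ad gG q0 q1; have [s1 _] := q1.
have := q2; rewrite weight_decomp//.
have := q1; rewrite !(weight_decomp hx he xe sZ) -/N.
set p := N *m _; set p' := N *m _ => qq.
have [px pe] : perp2 xi eta p by exact: proj_perp.
have [px' pe'] : perp2 xi eta p' by exact: proj_perp.
have NN x : perp2 xi eta x -> N *m x = x.
  by move=> [h1 h2]; rewrite projE (minkC eta) h2 (minkC xi) h1 !scale0r !addr0.
have -> : (wedge xi p - wedge eta p') *m eta = p.
  rewrite mulmxBl !wedgeE pe pe' xe (proj1 he) !scale0r !sub0r scaleN1r oppr0 subr0.
  by rewrite opprK.
have -> : (wedge xi p - wedge eta p') *m xi = - p'.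
  rewrite mulmxBl !wedgeE px px' (minkC eta) xe (proj1 hx) !scale0r !sub0r scaleN1r oppr0.
  by rewrite opprK sub0r.
rewrite mulmxN (NN p (conj px pe)) (NN p' (conj px' pe')) -(scaleN1r p') wedgeZr scaleN1r opprK => qs; split.
  have half (a b : 'M[R]_(1 + n)) : 2^-1 *: (a - b + (a + b)) = a.
    by apply/matrixP => i j; rewrite !mxE; field.
  by have := qalg_Z 2^-1 (qalg_D qq qs); rewrite half.
have half (a b : 'M[R]_(1 + n)) : 2^-1 *: (-1 *: (a - b) + (a + b)) = b.
  by apply/matrixP => i j; rewrite !mxE; field.
by have := qalg_Z 2^-1 (qalg_D (qalg_Z (-1) qq) qs); rewrite half.
Qed.

(** The component of weight 1 of [Z, xi ^ w] is xi ^ (N Z w) plus a multiple of xi ^ w. *)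
Lemma qalg_plus Z w : q Z -> perp2 xi eta w -> q (wedge xi w) -> q (wedge xi (N *m (Z *m w))).
Proof.
move=> qZ [wx we] qw; have [sZ _] := qZ.
have [] := qalg_weights (qalg_ad gG qZ qw); rewrite ad_wedge; last exact: sZ.
have -> : (wedge (Z *m xi) w + wedge xi (Z *m w)) *m eta =
   Z *m w - B (Z *m xi) eta *: w + B (Z *m w) eta *: xi.
  rewrite mulmxDl !wedgeE we xe scale0r sub0r scaleN1r opprK.
  by apply/matrixP => i j; rewrite !mxE; ring.
rewrite mulmxDr mulmxBr -!scalemxAr.
have -> : N *m xi = 0 by rewrite projE (proj1 hx) (minkC eta) xe scaleN1r scale0r addr0 subrr.
have -> : N *m w = w by rewrite projE (minkC eta) we (minkC xi) wx !scale0r !addr0.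
rewrite scaler0 addr0 wedgeDr -scaleNr wedgeZr => h _.
by have := qalg_D h (qalg_Z (B (Z *m xi) eta) qw); rewrite -addrA -scalerDl addNr scale0r addr0.
Qed.

Lemma qalg_mixed p p' : perp2 xi eta p -> perp2 xi eta p' -> q (wedge xi p) -> q (wedge eta p') ->
  q (wedge p p').
Proof.
move=> [px pe] [px' pe'] qp qp'.
have := qalg_ad gG qp qp'; rewrite ad_wedge; last exact: wedge_skew.
have -> : wedge xi p *m eta = p by rewrite wedgeE pe xe scale0r scaleN1r sub0r opprK.
have -> : wedge xi p *m p' = B p p' *: xi by rewrite wedgeE (minkC xi) px' scale0r subr0.
rewrite wedgeZr => h; have := qalg_D h (qalg_Z (- B p p') q0).
by rewrite -addrA -scalerDl subrr scale0r addr0.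
Qed.

(** The bracket of p ^ p' with xi ^ p is xi ^ ((B p' p) p - (B p p) p'), and B p p is nonzero
    because the complement of the axis is definite. *)
Lemma qalg_transfer p p' : perp2 xi eta p -> perp2 xi eta p' -> p != 0 ->
  q (wedge xi p) -> q (wedge eta p') -> q (wedge xi p').
Proof.
move=> hp hp' p0 qp qp'; have [px pe] := hp; have [px' pe'] := hp'.
have := qalg_ad gG (qalg_mixed hp hp' qp qp') qp; rewrite ad_wedge; last exact: wedge_skew.
have -> : wedge p p' *m xi = 0 by rewrite wedgeE px px' !scale0r subr0.
have -> : wedge p p' *m p = B p' p *: p - B p p *: p' by rewrite wedgeE.
have -> : wedge 0 p = 0 :> 'M[R]_(1 + n) by rewrite -(scale0r 0) wedgeZl scale0r.
rewrite add0r wedgeDr -scaleNr !wedgeZr => h.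
have pp : B p p != 0.
  apply: contra_neq p0; have hZ : hyp (2^-1 *: xi + eta).
    by apply: hyp_end => //; [exact: nullZ|rewrite minkZl xe mulrN1].
  by apply: (perp_eq0 hZ); rewrite minkC minkDr minkZr px pe mulr0 addr0.
have := qalg_Z (- (B p p)^-1) (qalg_D h (qalg_Z (- B p' p) qp)).
rewrite addrAC -scalerDl subrr scale0r add0r scalerA mulNr mulrN opprK (mulVf pp) scale1r => h2.
exact: h2.
Qed.

End Ends.

Section Generic.
Variable r0 : R.
Hypotheses (dG : disc G) (cG : cocpt G r0) (n1 : (1 < n)%N).

(** Conjugating eta ^ p' by an element of G that moves eta creates a nonzero component of the
    opposite weight. *)
Lemma qalg_nonzero A lam xi eta p' : G A -> lox A lam xi eta -> B xi eta = -1 ->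
  q (wedge eta xi) -> perp2 xi eta p' -> p' != 0 -> q (wedge eta p') ->
  exists2 p, perp2 xi eta p /\ p != 0 & q (wedge xi p).
Proof.
move=> GA h xe q0 [px' pe'] p0 qp'; have [l1 hx he Ax Ae] := h.
have lA := lG GA; have h' := lox_inv lA h.
have [C GC hC] := orbit_moves_end dG cG n1 (grV gG GA) h'.
have lC := lG GC; have GC' := grV gG GC.
pose Z := C *m wedge eta p' *m invmx C.
have qZ : q Z by exact: qalg_conj.
have [h1 _] := qalg_weights hx he xe q0 qZ.
have [hp1 hp2] := proj_perp (Z *m eta) hx he xe.
exists (proj xi eta *m (Z *m eta)) => //; split => //.
apply/eqP => P0; pose u := invmx C *m eta.
have hu : null u by apply: lor_null => //; exact: lorV.
(* Z eta is then a multiple of eta, so its preimage under C is null *)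
have : B (wedge eta p' *m u) (wedge eta p' *m u) = 0.
  have : Z *m eta = - B xi (Z *m eta) *: eta.
    have [sZ _] := qZ; move: P0; rewrite projE (skew_self eta sZ) scale0r addr0.
    by move/eqP; rewrite addr_eq0 -scaleNr => /eqP.
  rewrite /Z -!mulmxA -/u => e.
  have e2 : wedge eta p' *m u = - B xi (C *m (wedge eta p' *m u)) *: u.
    by rewrite /u scalemxAr -e mulKmx ?lor_unit.
  by rewrite e2 !minkZl !minkZr (proj1 hu) !mulr0.
have up : B eta u != 0 by rewrite minkC /u lor_adj// ; move: hC; rewrite minkC.
have pp : B p' p' != 0.
  apply: contra_neq p0; have hZ : hyp (2^-1 *: xi + eta).
    by apply: hyp_end => //; [exact: nullZ|rewrite minkZl xe mulrN1].
  by apply: (perp_eq0 hZ); rewrite minkC minkDr minkZr px' pe' mulr0 addr0.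
rewrite wedgeE !minkBl !minkBr !minkZl !minkZr (proj1 he) (minkC eta p') pe'.
rewrite !mulr0 !subr0 !sub0r opprK => /eqP.
by rewrite !mulf_eq0 (negbTE up) (negbTE pp).
Qed.

(** Let w be orthogonal to xi, eta and both weight spaces; this is preserved by the algebra. For T =
    C (eta ^ xi) C^-1 the vectors T w and T T w lie in a definite space and have opposite square
    norms, so T w = 0. Thus w is orthogonal to the orbits of both ends and is 0. So the two weight
    spaces span the complement of the axis; they coincide by [qalg_transfer], and brackets give the
    remaining wedges. *)
Lemma qalg_full A lam xi eta : G A -> lox A lam xi eta -> B xi eta = -1 ->
  forall u v, q (wedge u v).
Proof.
move=> GA h xe; have [l1 hx he Ax Ae] := h; have lA := lG GA; have h' := lox_inv lA h.
have ex : B eta xi = -1 by rewrite minkC.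
have GV := grV gG GA.
have q0 : q (wedge eta xi) by split; [exact: wedge_skew|exact: (boost_adG gG lG GA h xe)].
have q0' : q (wedge xi eta) by rewrite wedgeC -scaleN1r; exact: qalg_Z.
have hZ : hyp (2^-1 *: xi + eta).
  by apply: hyp_end => //; [exact: nullZ|rewrite minkZl xe mulrN1].
have pos w : perp2 xi eta w -> 0 <= B w w.
  by move=> [a b]; apply: (perp_ge0 (hyp_causal hZ)); rewrite minkC minkDr minkZr a b mulr0 addr0.
have pos0 w : perp2 xi eta w -> B w w = 0 -> w = 0.
  by move=> [a b]; apply: (perp_eq0 hZ); rewrite minkC minkDr minkZr a b mulr0 addr0.
have swap w : perp2 xi eta w -> perp2 eta xi w by case.
have swap' w : perp2 eta xi w -> perp2 xi eta w by case.
have Nsw : proj eta xi = proj xi eta by rewrite projC.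
pose Pp p := perp2 xi eta p /\ q (wedge xi p).
pose Pm p := perp2 xi eta p /\ q (wedge eta p).
have V2 w : perp2 xi eta w -> (forall p, Pp p -> B w p = 0) -> (forall p, Pm p -> B w p = 0) -> w = 0.
  (* the vectors orthogonal to both spaces form a subspace invariant under q *)
  move=> hw wp wm.
  have step Z : q Z -> forall w, perp2 xi eta w -> (forall p, Pp p -> B w p = 0) ->
     (forall p, Pm p -> B w p = 0) -> [/\ perp2 xi eta (Z *m w),
       (forall p, Pp p -> B (Z *m w) p = 0) & (forall p, Pm p -> B (Z *m w) p = 0)].
    move=> qZ {hw wp wm} {}w hw wp wm; have [sZ _] := qZ.
    have Np x : B w x = B w (proj xi eta *m x).
      rewrite projE !minkDr !minkZr (proj1 hw) (proj2 hw); ring.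
    have [w1 w2] := qalg_weights hx he xe q0 qZ.
    split; first split.
    - by rewrite sZ Np (wm _ (conj (proj_perp _ hx he xe) w2)) oppr0.
    - by rewrite sZ Np (wp _ (conj (proj_perp _ hx he xe) w1)) oppr0.
    - move=> p [hp qp]; have hN : Pp (proj xi eta *m (Z *m p)).
        by split; [exact: proj_perp|exact: qalg_plus].
      by rewrite sZ Np (wp _ hN) oppr0.
    - move=> p [hp qp]; have hN : Pm (proj xi eta *m (Z *m p)).
        by split; [exact: proj_perp|rewrite -Nsw; apply: qalg_plus => //; exact: swap].
      by rewrite sZ Np (wm _ hN) oppr0.
  apply: (orbit_spans dG cG n1 hZ) => C GC.
  have lC := lG GC; pose T := C *m wedge eta xi *m invmx C.
  have qT : q T by exact: qalg_conj.
  have TE v : T *m v = B (C *m xi) v *: (C *m eta) - B (C *m eta) v *: (C *m xi).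
    by rewrite /T wedge_conj// wedgeE.
  have [h1 h1p h1m] := step _ qT _ hw wp wm.
  have [h2 _ _] := step _ qT _ h1 h1p h1m.
  set x := B (C *m xi) w; set y := B (C *m eta) w.
  have xx : B (C *m xi) (C *m xi) = 0 by rewrite lor_mink// (proj1 hx).
  have ee : B (C *m eta) (C *m eta) = 0 by rewrite lor_mink// (proj1 he).
  have xe' : B (C *m xi) (C *m eta) = -1 by rewrite lor_mink.
  have n1' : B (T *m w) (T *m w) = 2 * x * y.
    rewrite TE -/x -/y !minkBl !minkBr !minkZl !minkZr xx ee (minkC (C *m eta) (C *m xi)) xe'; ring.
  have n2' : B (T *m (T *m w)) (T *m (T *m w)) = - (2 * x * y).
    have a1 : B (C *m xi) (T *m w) = - x by rewrite TE -/x -/y minkBr !minkZr xx xe'; ring.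
    have a2 : B (C *m eta) (T *m w) = y by rewrite TE -/x -/y minkBr !minkZr ee (minkC (C *m eta)) xe'; ring.
    rewrite TE a1 a2 !minkBl !minkBr !minkZl !minkZr xx ee (minkC (C *m eta) (C *m xi)) xe'; ring.
  have xy : 2 * x * y = 0.
    by apply/eqP; rewrite eq_le; have := pos _ h1; have := pos _ h2; rewrite n1' n2' oppr_ge0 => -> ->.
  have Tw : T *m w = 0 by apply: pos0 => //; rewrite n1'.
  have x0 : x = 0.
    have : B (C *m xi) (T *m w) = - x by rewrite TE -/x -/y minkBr !minkZr xx xe'; ring.
    by rewrite Tw mink0r => /esym/eqP; rewrite oppr_eq0 => /eqP.
  have y0 : y = 0.
    have : B (C *m eta) (T *m w) = y by rewrite TE -/x -/y minkBr !minkZr ee (minkC (C *m eta)) xe'; ring.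
    by rewrite Tw mink0r.
  by rewrite mulmxDr -scalemxAr minkDr minkZr minkC -/x x0 minkC -/y y0 mulr0 addr0.
have [w w0 hw] : exists2 w, w != 0 & perp2 xi eta w.
  have [w w0] := @perp_exists R (1 + n) (1 + 1) (lorentz_form *m row_mx xi eta) ltac:(by rewrite ltn_add2l).
  rewrite mulmxA mul_mx_row => /eqP; rewrite -(row_mx0 _ 1 1 1) => /eqP/eq_row_mx[wx we].
  by exists w => //; split; rewrite /mink ?wx ?we mxE.
have [[p [hp p0 qp]] [p' [hp' p0' qp']]] : (exists p, [/\ perp2 xi eta p, p != 0 & q (wedge xi p)]) /\
    (exists p, [/\ perp2 xi eta p, p != 0 & q (wedge eta p)]).
  have [p [hp p0 [qp|qp]]] : exists p, [/\ perp2 xi eta p, p != 0 & q (wedge xi p) \/ q (wedge eta p)].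
    apply: contrapT => H; move/eqP: w0; apply; apply: V2 => // p [hp qp].
      have [->|p0] := eqVneq p 0; first by rewrite mink0r.
      by case: H; exists p; split => //; left.
    have [->|p0] := eqVneq p 0; first by rewrite mink0r.
    by case: H; exists p; split => //; right.
  - split; first by exists p.
    have [p' [hp' p0'] qp'] := qalg_nonzero GV h' ex q0' (swap _ hp) p0 qp.
    by exists p'; split => //; exact: swap'.
  - split; last by exists p.
    by have [p' [hp' p0'] qp'] := qalg_nonzero GA h xe q0 hp p0 qp; exists p'.
have mp x : perp2 xi eta x -> q (wedge eta x) -> q (wedge xi x).
  by move=> hx' qx; apply: (@qalg_transfer xi eta _ _ _ _ p) => //.
have pm x : perp2 xi eta x -> q (wedge xi x) -> q (wedge eta x).
  by move=> hx' qx; apply: (@qalg_transfer eta xi _ _ _ _ p') => //; exact: swap.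
have full x : perp2 xi eta x -> q (wedge xi x).
  move=> hx'; have [|l [hl lE]] := @span_dual R (1 + n) (fun s => Pp s^T) x^T.
    move=> c hc; pose u := lorentz_form *m c.
    have cu (v : 'cV[R]_(1 + n)) : (v^T *m c) ord0 ord0 = B v u.
      by rewrite /mink /u -!mulmxA (mulmxA lorentz_form) lformK mul1mx.
    have cz : proj xi eta *m u = 0.
      have Np v : perp2 xi eta v -> B (proj xi eta *m u) v = B v u.
        by move=> [a b]; rewrite projE !minkDl !minkZl (minkC xi v) a (minkC eta v) b !mulr0 !addr0 minkC.
      have hc' v : Pp v -> B v u = 0 by move=> hv; rewrite -cu hc ?trmxK ?mxE.
      apply: V2; first exact: proj_perp.
        by move=> v [hv qv]; rewrite Np ?hc'.
      move=> v [hv qv]; have hPv : Pp v by split; [exact: hv|exact: (mp _ hv qv)].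
      by rewrite (Np v hv) (hc' v hPv).
    apply/matrixP => i j; rewrite !ord1 cu mxE.
    have : B x (proj xi eta *m u) = 0 by rewrite cz mink0r.
    by rewrite projE !minkDr !minkZr (proj1 hx') (proj2 hx') !mulr0 !addr0.
  rewrite -[x]trmxK lE linear_sum /= big_seq.
  elim/big_ind: _ => [|a b qa qb|s sl].
  - have -> : wedge xi 0 = 0 *: wedge eta xi by rewrite -(scale0r xi) wedgeZr wedgeaa scaler0 scale0r.
    exact: qalg_Z.
  - by rewrite wedgeDr; exact: qalg_D.
  - by rewrite linearZ /= wedgeZr; apply: qalg_Z; case: (hl _ sl).
have full' x : perp2 xi eta x -> q (wedge eta x) by move=> hx'; exact: (pm _ hx' (full _ hx')).
have full2 x y : perp2 xi eta x -> perp2 xi eta y -> q (wedge x y).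
  by move=> hx' hy'; exact: (qalg_mixed xe q0 hx' hy' (full _ hx') (full' _ hy')).
move=> u v.
have dec z : z = proj xi eta *m z - B eta z *: xi - B xi z *: eta.
  by rewrite projE addrAC addrK addrK.
rewrite (dec u) (dec v).
have pu := proj_perp u hx he xe; have pv := proj_perp v hx he xe.
rewrite -!scaleNr !(wedgeDl, wedgeDr, wedgeZl, wedgeZr) !wedgeaa !scaler0.
have qC x y : q (wedge x y) -> q (wedge y x) by rewrite (wedgeC x) => /(qalg_Z (-1)); rewrite scaleN1r opprK.
have qz : q 0 by have := qalg_Z 0 q0; rewrite scale0r.
have f1 a : perp2 xi eta a -> q (wedge a xi) by move=> ha; apply: qC; exact: full.
have f2 a : perp2 xi eta a -> q (wedge a eta) by move=> ha; apply: qC; exact: full'.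
set a := proj xi eta *m u in pu *; set b := proj xi eta *m v in pv *.
exact: (qalg_D (qalg_D (qalg_D (qalg_D (full2 _ _ pu pv) (qalg_Z _ (f1 _ pu))) (qalg_Z _ (f2 _ pu)))
  (qalg_D (qalg_D (qalg_Z _ (full _ pv)) qz) (qalg_Z _ (qalg_Z _ q0'))))
  (qalg_D (qalg_D (qalg_Z _ (full' _ pv)) (qalg_Z _ (qalg_Z _ q0))) qz)).
Qed.

End Generic.
End Wedges.

(** * Maximal discrete groups *)

Section Norm.
Context {R : realType} {m : nat}.
Implicit Types (A M N : 'M[R]_m).

Definition ebound (x : R) M := forall i j, `|M i j| <= x.

Lemma ebound_mul x y M N : ebound x M -> ebound y N -> ebound (m%:R * x * y) (M *m N).
Proof.
move=> hM hN i j; rewrite mxE; apply: le_trans (ler_norm_sum _ _ _) _.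
apply: (@le_trans _ _ (\sum_(k < m) x * y)).
  by apply: ler_sum => k _; rewrite normrM ler_pM.
by rewrite le_eqVlt; apply/orP; left; apply/eqP; rewrite sumr_const card_ord -(mulr_natl (x * y)) mulrA.
Qed.

Lemma ebound_sub x y M N : ebound x M -> ebound y N -> ebound (x + y) (M - N).
Proof.
move=> hM hN i j; rewrite mxE [X in _ + X]mxE.
by apply: le_trans (ler_normB _ _) _; apply: lerD.
Qed.

Lemma ebound_le x y M : x <= y -> ebound x M -> ebound y M.
Proof. by move=> xy h i j; exact: le_trans (h i j) xy. Qed.

Definition esize M : R := \sum_i \sum_j `|M i j|.

Lemma esize_ebound M : ebound (esize M) M.
Proof.
move=> i j; rewrite /esize (bigD1 i)//= (bigD1 j)//= -addrA lerDl addr_ge0//.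
  by apply: sumr_ge0.
by do 2![apply: sumr_ge0 => ? _].
Qed.

Lemma ebound_esize x M : ebound x M -> esize M <= (m * m)%:R * x.
Proof.
move=> h; apply: (@le_trans _ _ (\sum_(i < m) \sum_(j < m) x)).
  by apply: ler_sum => i _; apply: ler_sum => j _.
by rewrite !sumr_const !card_ord -mulrnA -(mulr_natl x).
Qed.

Lemma esize_ge0 M : 0 <= esize M.
Proof. by do 2![apply: sumr_ge0 => ? _]. Qed.

Lemma esize_eq0 M : esize M = 0 -> M = 0.
Proof.
move=> h; apply/matrixP => i j; rewrite mxE; apply/eqP; rewrite -normr_le0.
by rewrite -h; exact: esize_ebound.
Qed.

End Norm.

(** * Uniform discreteness of the discrete groups containing G *)

Section Uniform.
Context {R : realType} {n : nat}.
Implicit Types (u v w X Y xi eta : 'cV[R]_(1 + n)) (A C K Z M : 'M[R]_(1 + n)).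
Local Notation B := (@mink R n).
Variables (G : set 'M[R]_(1 + n)) (r0 : R).
Hypotheses (dG : disc G) (cG : cocpt G r0) (n1 : (1 < n)%N).
Hypothesis fG : forall A X, G A -> hyp X -> A *m X = X -> A = 1%:M.
Let gG : mx_subgroup G. Proof. by case: dG. Qed.
Let lG : G `<=` lorentz. Proof. by case: dG. Qed.

Lemma hyp_far : exists X : 'cV[R]_(1 + n), hyp X /\ r0 < tc X.
Proof.
pose i : 'I_n := Ordinal (ltnW n1); pose s := `|r0| + 1.
have s0 : 0 < s by rewrite /s; have := normr_ge0 r0; lra.
pose a := Num.sqrt (1 + s ^+ 2).
have p0 : 0 < 1 + s ^+ 2 by rewrite ltr_pwDl// sqr_ge0.
have a0 : 0 < a by rewrite sqrtr_gt0.
have a2 : a ^+ 2 = 1 + s ^+ 2 by rewrite sqr_sqrtr// ltW.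
exists (col_mx a%:M (s *: delta_mx i ord0)); split; last first.
  rewrite tcE col_mxKu mxE eqxx mulr1n.
  have := ler_norm r0; have : s < a by rewrite -(@ltr_pXn2r _ 2)// ?nnegrE ?ltW//; lra.
  by rewrite /s; lra.
split; last by rewrite tcE col_mxKu mxE eqxx mulr1n.
rewrite minkE tcE col_mxKu /sp col_mxKd mxE eqxx mulr1n.
rewrite dotE (bigD1 i)//= big1 ?addr0 => [|j ji]; last by rewrite !mxE (negbTE ji) mulr0 mul0r.
by rewrite !mxE !eqxx mulr1 -!expr2 a2; ring.
Qed.

Lemma exists_lox : exists A lam xi eta, [/\ G A, lox A lam xi eta & B xi eta = -1].
Proof.
have [A GA [lam [xi [eta h]]]] : exists2 A, G A & exists lam xi eta, lox A lam xi eta.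
  apply: contrapT => H; have [X [hX Xr]] := hyp_far.
  have [A GA] := cG hX; have [->|h] := free_lox dG cG fG GA.
    by rewrite mul1mx leNgt Xr.
  by move=> _; apply: H; exists A.
have [a [a0 h' e]] := lox_normal h.
exists A, lam, (2 *: (a *: xi)), eta; split => //; last by rewrite minkZl e; field.
by rewrite -[X in lox _ _ _ X]scale1r; apply: lox_scale.
Qed.

Lemma ad_span u v : exists l : seq (R * 'M[R]_(1 + n)), (forall p, p \in l -> G p.2) /\
  forall M, ad (wedge u v) M = \sum_(p <- l) p.1 *: (p.2 *m M *m invmx p.2).
Proof.
have [A [lam [xi [eta [GA h xe]]]]] := exists_lox.
by have [] := qalg_full gG lG dG cG n1 GA h xe u v.
Qed.

Lemma wedge_basis u v : wedge u v = \sum_i \sum_j (u i ord0 * v j ord0) *: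
  wedge (delta_mx i ord0) (delta_mx j ord0).
Proof.
have e z : z = \sum_i z i ord0 *: delta_mx i ord0 :> 'cV[R]_(1 + n).
  by rewrite {1}[z]matrix_sum_delta; apply: eq_bigr => i _; rewrite big_ord1.
have wsl I (r : seq I) F z : wedge (\sum_(i <- r) F i) z = \sum_(i <- r) wedge (F i) z.
  elim: r => [|i r IH]; last by rewrite !big_cons wedgeDl IH.
  by rewrite !big_nil -(scale0r 0) wedgeZl !scale0r.
have wsr I (r : seq I) F z : wedge z (\sum_(i <- r) F i) = \sum_(i <- r) wedge z (F i).
  by rewrite wedgeC wsl -sumrN; apply: eq_bigr => i _; rewrite -wedgeC.
rewrite {1}[u]e {1}[v]e wsl; apply: eq_bigr => i _; rewrite wsr; apply: eq_bigr => j _.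
by rewrite wedgeZl wedgeZr scalerA.
Qed.

(** By [ad_span] finitely many conjugates of M express all brackets of M with wedges, so commuting
    with those conjugates is enough. The set S depends only on G. *)
Lemma ad_test : exists S : seq 'M[R]_(1 + n), (forall C, C \in S -> G C) /\
  forall M N, (forall C, C \in S -> N *m (C *m M *m invmx C) = (C *m M *m invmx C) *m N) ->
    forall u v, N *m ad (wedge u v) M = ad (wedge u v) M *m N.
Proof.
have /choice[l hl] (ij : 'I_(1 + n) * 'I_(1 + n)) := ad_span (delta_mx ij.1 ord0) (delta_mx ij.2 ord0).
exists (flatten [seq [seq p.2 | p <- l ij] | ij <- enum {: 'I_(1 + n) * 'I_(1 + n)}]); split.
  by move=> C /flattenP[s /mapP[ij _ ->] /mapP[p pl ->]]; exact: (hl ij).1.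
move=> M N hMN u v.
have adD Z Z' : ad (Z + Z') M = ad Z M + ad Z' M.
  by rewrite /ad mulmxDl mulmxDr opprD addrACA.
have adZ x Z : ad (x *: Z) M = x *: ad Z M.
  by rewrite /ad -scalemxAl -scalemxAr scalerBr.
have Z0 : ad 0 M = 0 by rewrite /ad mul0mx mulmx0 subr0.
have base i j : N *m ad (wedge (delta_mx i ord0) (delta_mx j ord0)) M =
    ad (wedge (delta_mx i ord0) (delta_mx j ord0)) M *m N.
  rewrite (hl (i, j)).2 mulmx_sumr mulmx_suml; apply: eq_big_seq => p pl.
  rewrite -scalemxAr -scalemxAl hMN//; apply/flattenP; exists [seq p.2 | p <- l (i, j)].
    by apply/mapP; exists (i, j); rewrite ?mem_enum.
  by apply/mapP; exists p.
rewrite wedge_basis (big_morph (fun Z => ad Z M) adD Z0) mulmx_sumr mulmx_suml; apply: eq_bigr => i _.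
rewrite (big_morph (fun Z => ad Z M) adD Z0) mulmx_sumr mulmx_suml; apply: eq_bigr => j _.
by rewrite adZ -scalemxAr -scalemxAl base.
Qed.

(** The hypothesis says that (Ad K - 1)^2 vanishes on wedges. If K fixes a point X, it is orthogonal
    and unipotent on the complement of X, hence 1. If K is loxodromic, evaluation on xi ^ w gives
    (lam K - 1)^2 w = 0 for w orthogonal to the axis, where K preserves a definite form; this is
    impossible for lam > 1. *)
Lemma ad_rigid D K : disc D -> G `<=` D -> D K ->
  (forall u v, K *m ad (wedge u v) K = ad (wedge u v) K *m K) -> K = 1%:M.
Proof.
move=> dD GD DK hK; have [gD Dl _] := dD; have lK := Dl _ DK; have uK := lor_unit lK.
have key u v : wedge (K *m (K *m u)) (K *m (K *m v)) - wedge (K *m u) (K *m v) =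
    wedge (K *m u) (K *m v) - wedge u v.
  have e : wedge (K *m u) (K *m v) - wedge (K *m (K *m u)) (K *m (K *m v)) =
      wedge u v - wedge (K *m u) (K *m v).
    rewrite -!(wedge_conj _ _ lK); have := congr1 (fun M => M *m invmx K *m invmx K) (hK u v).
    by rewrite /ad /= !(mulmxBr, mulmxBl) !mulmxA !(mulmxK uK).
  by rewrite -opprB e opprB.
have [[X hX KX]|[lam [xi [eta h]]]] := dichotomy dD gG GD cG DK.
  have fix_perp u : B X u = 0 -> K *m u = u.
    move=> Xu; have XK w : B X (K *m w) = B X w by rewrite -{1}KX lor_mink.
    have q2 : K *m (K *m u) - K *m u = K *m u - u.
      have := congr1 (fun M => M *m X) (key u X); rewrite /= !KX !mulmxBl !wedgeE.
      rewrite !(minkC _ X) !XK Xu (proj1 hX) !scale0r !subr0.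
      by rewrite !scaleN1r -!opprD => /oppr_inj.
    apply/eqP; rewrite -subr_eq0; apply/eqP/(perp_eq0 hX); first by rewrite minkBr XK subrr.
    have := congr1 (fun w => B w (K *m u)) q2.
    rewrite /= !minkBl !minkBr !(lor_mink _ _ lK) (minkC (K *m u) u); lra.
  apply: mulmx_ext => v; rewrite mul1mx.
  have -> : v = (v + B X v *: X) - B X v *: X by rewrite addrK.
  rewrite mulmxBr -scalemxAr KX fix_perp// minkDr minkZr (proj1 hX); ring.
have xe := lox_neg h; case: (h) => l1 hx he Kx Ke.
have [w w0 [wx we]] : exists2 w, w != 0 & perp2 xi eta w.
  have [w w0] := @perp_exists R (1 + n) (1 + 1) (lorentz_form *m row_mx xi eta) ltac:(by rewrite ltn_add2l).
  rewrite mulmxA mul_mx_row => /eqP; rewrite -(row_mx0 _ 1 1 1) => /eqP/eq_row_mx[wx we].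
  by exists w => //; split; rewrite /mink ?wx ?we mxE.
have l0 : lam != 0 by rewrite gt_eqF//; lra.
have Ke0 z : B z eta = 0 -> B (K *m z) eta = 0.
  move=> ze; apply: (mulfI (invr_neq0 l0)); rewrite mulr0 -minkZr -Ke.
  by rewrite lor_mink.
have Kx0 z : B z xi = 0 -> B (K *m z) xi = 0.
  by move=> ze; apply: (mulfI l0); rewrite mulr0 -minkZr -Kx lor_mink.
pose q := (lam * lam) *: (K *m (K *m w)) - (2 * lam) *: (K *m w) + w.
have q0 : q = 0.
  have : wedge xi q = 0.
    have := key xi w; rewrite Kx -scalemxAr Kx !wedgeZl => /eqP; rewrite -subr_eq0 => /eqP e.
    rewrite /q !wedgeDr -scaleNr !wedgeZr -e.
    by apply/matrixP => i j; rewrite !mxE; ring.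
  move=> /(congr1 (fun M => M *m eta)); rewrite wedgeE mul0mx.
  have -> : B q eta = 0 by rewrite minkDl minkBl !minkZl we !Ke0 ?Ke0// !mulr0 subrr add0r.
  by rewrite scale0r sub0r => /eqP; rewrite oppr_eq0 scaler_eq0 lt_eqF//= => /eqP.
set c0 := B w w; pose c1 := B (K *m w) w; pose c2 := B (K *m (K *m w)) w.
have e1 : (lam * lam + 1) * c1 = 2 * lam * c0.
  have : B q (K *m w) = 0 by rewrite q0 mink0l.
  rewrite /q minkDl minkBl !minkZl !(lor_mink _ _ lK) (minkC w) -/c1 -/c0; lra.
have e2 : (lam * lam) * c2 - 2 * lam * c1 + c0 = 0.
  have : B q w = 0 by rewrite q0 mink0l.
  by rewrite /q minkDl minkBl !minkZl -/c1 -/c0 -/c2.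
have e3 : (lam * lam) * c0 - 2 * lam * c1 + c2 = 0.
  have : B q (K *m (K *m w)) = 0 by rewrite q0 mink0l.
  rewrite /q minkDl minkBl !minkZl !(lor_mink _ _ lK) (minkC w (K *m w)) -/c1 -/c0.
  by rewrite (minkC w) -/c2.
have c00 : c0 = 0.
  have L1 : lam * lam - 1 != 0 by rewrite gt_eqF// subr_gt0; move: l1; nra.
  have c20 : c2 = c0.
    apply: (mulfI L1); move: e2 e3; lra.
  have e4 : (lam * lam + 1) * ((lam * lam + 1) * c0 - 2 * lam * c1) = 0.
    by rewrite (_ : _ - _ = 0) ?mulr0//; move: e3; rewrite c20; lra.
  have e5 : (lam * lam - 1) * ((lam * lam - 1) * c0) = 0.
    transitivity ((lam * lam + 1) * ((lam * lam + 1) * c0 - 2 * lam * c1) +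
      2 * lam * ((lam * lam + 1) * c1 - 2 * lam * c0)); first by ring.
    by rewrite e4 e1; ring.
  by apply: (mulfI L1); apply: (mulfI L1); rewrite e5 !mulr0.
have [a [a0 h' xe2]] := lox_normal h; have [_ hx' _ _ _] := h'.
have hZ := hyp_end hx' he xe2.
by move: w0; rewrite (perp_eq0 hZ _ c00) ?eqxx// minkC minkDr minkZr wx we mulr0 addr0.
Qed.

(** The bound is the same for all D because the conjugating elements S come from G. Commutators of
    elements at distance d from 1 are at distance of order d^2: here c bounds the elements of S and
    their inverses, c2 the effect of conjugating by them, and Q d^2 the commutator. *)
Lemma uniform_discrete : exists2 e : R, 0 < e & forall D, disc D -> G `<=` D ->
  forall K, D K -> ebound e (K - 1%:M) -> K = 1%:M.
Proof.
have [S [SG hS]] := ad_test.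
pose c := \sum_(C <- S) (esize C + esize (invmx C)).
have c0 : 0 <= c by apply: sumr_ge0 => C _; rewrite addr_ge0 ?esize_ge0.
have cS C : C \in S -> ebound c C /\ ebound c (invmx C).
  move=> CS; have : esize C + esize (invmx C) <= c.
    by rewrite /c (big_rem C)//= lerDl sumr_ge0// => ? _; rewrite addr_ge0 ?esize_ge0.
  have := esize_ge0 C; have := esize_ge0 (invmx C) => h1 h2 h3.
  by split; apply: ebound_le (@esize_ebound _ _ _); lra.
pose N : R := (1 + n)%:R.
have N1 : 1 <= N by rewrite ler1n.
pose m : R := ((1 + n) * (1 + n))%:R.
have m1 : 1 <= m by rewrite /m natrM -/N; nra.
pose c2 := N * (N * c) * c.
have c20 : 0 <= c2 by rewrite !mulr_ge0//; lra.
pose Q := N * (N * (2 * (N * c2)) * 4) * (4 * c2).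
have Q0 : 0 <= Q by rewrite /Q !mulr_ge0//; lra.
pose W := Q + 1; have W1 : 1 <= W by rewrite /W; lra.
have m0 : 0 < m by lra.
have W0 : 0 < W by lra.
have mW0 : 0 < m * (W * m) by rewrite !mulr_gt0.
exists (m * (W * m))^-1; first by rewrite invr_gt0.
move=> D dD GD K0 DK0 hK0; apply: contrapT => /eqP K01.
have [gD Dl _] := dD.
(* Let K be a nontrivial element of D closest to 1: its commutators with conjugates by bounded elements
   are closer to 1, hence trivial. *)
have [s hs] := disc_seq 2 dD.
have e1 : (m * (W * m))^-1 <= 1 by rewrite invf_le1// mulr_ege1// mulr_ege1.
have close K : ebound 1 (K - 1%:M) -> K ord0 ord0 <= 2.
  move=> /(_ ord0 ord0); rewrite mxE [X in _ + X]mxE [1%:M _ _]mxE eqxx /= mulr1n.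
  by rewrite ler_norml => /andP[]; lra.
have K0s : K0 \in [seq K <- s | K != 1%:M].
  rewrite mem_filter K01; apply/hs; split => //; apply: close.
  exact: ebound_le hK0.
have [K] := seq_argmin (fun K => esize (K - 1%:M)) K0s.
rewrite mem_filter => /andP[K1 /hs[DK _]] minK.
have lK := Dl _ DK; have uK := lor_unit lK.
pose d := esize (K - 1%:M).
have dK : ebound d (K - 1%:M) by exact: esize_ebound.
have d0 : 0 < d.
  rewrite lt_def esize_ge0 andbT; apply: contra_neq K1 => /esize_eq0/eqP.
  by rewrite subr_eq0 => /eqP.
have dW : d * W <= m^-1 /\ d <= 1.
  have h : d <= m * (m * (W * m))^-1 by apply: le_trans (minK _ K0s) (ebound_esize hK0).
  have e : m^-1 = m * (m * (W * m))^-1 * W by field; rewrite !gt_eqF.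
  rewrite e; split; first by rewrite ler_pM2r.
  apply: le_trans h _; by rewrite ler_pdivrMr// mul1r; apply: ler_peMr; [exact: ltW|exact: mulr_ege1].
have dm1 : ebound 1 (K - 1%:M) by apply: ebound_le dK; case: dW.
have b4 A : lorentz A -> A ord0 ord0 <= 2 -> ebound 4 (invmx A).
  move=> lA h i j; apply: le_trans (lor_bound _ _ (lorV lA)) _; rewrite lor_tcV//; lra.
have comm C : C \in S -> K *m (C *m K *m invmx C) = (C *m K *m invmx C) *m K.
  move=> CS; set K' := C *m K *m invmx C.
  have [bC bV] := cS _ CS; have lC := lG (SG _ CS); have uC := lor_unit lC.
  have DK' : D K' by apply: gr_conj => //; apply: GD; exact: SG.
  have lK' := Dl _ DK'; have uK' := lor_unit lK'.
  pose X := K - 1%:M; pose Y := K' - 1%:M.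
  have YE : Y = C *m X *m invmx C.
    by rewrite /Y /K' /X mulmxBr mulmx1 mulmxBl mulmxV.
  have bY : ebound (c2 * d) Y.
    rewrite YE; have -> : c2 * d = N * (N * c * d) * c by rewrite /c2; ring.
    by apply: ebound_mul => //; exact: ebound_mul.
  have bE : ebound (2 * (N * c2) * (d * d)) (K *m K' - K' *m K).
    have -> : K *m K' - K' *m K = X *m Y - Y *m X.
      rewrite /X /Y !(mulmxBl, mulmxBr) !mulmx1 !mul1mx.
      by apply/matrixP => i j; rewrite !mxE; ring.
    have -> : 2 * (N * c2) * (d * d) = N * d * (c2 * d) + N * (c2 * d) * d by ring.
    by apply: ebound_sub; exact: ebound_mul.
  have bKV : ebound 4 (invmx K).
    by apply: b4 => //; exact: close.
  have K'V : invmx K' = C *m invmx K *m invmx C.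
    have h : (C *m invmx K *m invmx C) *m K' = 1%:M.
      by rewrite /K' !mulmxA mulmxKV// mulmxKV// mulmxV.
    by rewrite -[RHS]mulmx1 -(mulmxV uK') mulmxA h mul1mx.
  have bK'V : ebound (4 * c2) (invmx K').
    rewrite K'V; have -> : 4 * c2 = N * (N * c * 4) * c by rewrite /c2; ring.
    by apply: ebound_mul => //; exact: ebound_mul.
  pose T := K *m K' *m invmx K *m invmx K'.
  have TE : T - 1%:M = (K *m K' - K' *m K) *m invmx K *m invmx K'.
    by rewrite !mulmxBl mulmxK// mulmxV.
  have bT : ebound (Q * (d * d)) (T - 1%:M).
    rewrite TE; have -> : Q * (d * d) = N * (N * (2 * (N * c2) * (d * d)) * 4) * (4 * c2).
      by rewrite /Q; ring.
    by apply: ebound_mul => //; exact: ebound_mul.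
  have sT : esize (T - 1%:M) < d.
    apply: le_lt_trans (ebound_esize bT) _; rewrite -/m.
    have -> : m * (Q * (d * d)) = d * (d * Q * m) by ring.
    rewrite gtr_pMr//; case: dW => dW _.
    have : d * W * m <= 1 by rewrite -ler_pdivlMr// mul1r.
    have := mulr_gt0 d0 m0; rewrite /W; lra.
  have DT : D T by do !apply: grM => //; exact: grV.
  have T1 : T = 1%:M.
    apply/eqP; case: (eqVneq T 1%:M) => // Tn; have := sT; rewrite ltNge => /negP; case.
    apply: minK; rewrite mem_filter Tn; apply/hs; split => //; apply: close.
    by apply: ebound_le (@esize_ebound _ _ _); apply: le_trans (ltW sT) _; case: dW.
  have := congr1 (fun M => M *m K' *m K) T1.
  by rewrite /= /T mulmxKV// mulmxKV// mul1mx.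
have K1' : K = 1%:M.
  apply: (ad_rigid dD GD DK) => u v; apply: hS => C CS; exact: comm.
by rewrite K1' eqxx in K1.
Qed.

End Uniform.

(** * Subgroups of finite index *)

Section Index.
Context {R : realType} {m : nat}.
Implicit Types (D G : set 'M[R]_m) (A C : 'M[R]_m).

(** Finite index is handled through maps with finitely many values that separate cosets; [index_rep]
    recovers such a map from a subgroup of finite index. *)
Lemma index_by (T : eqType) (f : 'M[R]_m -> T) (ts : seq T) D G :
  D `<=` G -> (forall A, G A -> f A \in ts) ->
  (forall A C, G A -> G C -> f A = f C -> D (invmx C *m A)) -> finite_index D G.
Proof.
move=> DG ft h; split => //.
exists [seq get [set C | G C /\ f C = t] | t <- ts] => A GA.
have [GC fC] : [set C | G C /\ f C = f A] (get [set C | G C /\ f C = f A]).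
  by apply: (@getI _ _ A).
exists (get [set C | G C /\ f C = f A]); last exact: h.
by apply/mapP; exists (f A); rewrite ?ft.
Qed.

Lemma index_rep D G : mx_subgroup D -> mx_subgroup G -> finite_index D G ->
  exists f : 'M[R]_m -> 'M[R]_m, exists s : seq 'M[R]_m,
    (forall A, G A -> f A \in s) /\
    (forall A C, G A -> G C -> f A = f C -> D (invmx C *m A)).
Proof.
move=> gD gG [DG [s hs]].
exists (fun A => get [set C | C \in s /\ D (invmx C *m A)]), s.
have H A : G A -> [set C | C \in s /\ D (invmx C *m A)] (get [set C | C \in s /\ D (invmx C *m A)]).
  by move=> /hs[C Cs DC]; apply: (@getI _ _ C).
split=> [A /H[] //|A C GA GC e]; have [_ hA] := H _ GA; have [_ hC] := H _ GC.
move: hA hC; rewrite -e; set E := get _ => hA hC.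
have uE : E \in unitmx.
  by have := gr_unit gD hA; rewrite unitmx_mul unitmx_inv => /andP[].
have uC := gr_unit gG GC.
have -> : invmx C *m A = invmx (invmx E *m C) *m (invmx E *m A).
  have u : invmx E *m C \in unitmx := gr_unit gD hC.
  apply: (can_inj (mulKmx u)); rewrite mulKVmx//.
  by rewrite -mulmxA mulKVmx.
by apply: grM => //; exact: grV.
Qed.

Lemma finite_indexI D D' G : mx_subgroup D -> mx_subgroup D' -> mx_subgroup G ->
  finite_index D G -> finite_index D' G -> finite_index (D `&` D') G.
Proof.
move=> gD gD' gG iD iD'; have [f [s [fs hf]]] := index_rep gD gG iD.
have [f' [s' [fs' hf']]] := index_rep gD' gG iD'.
apply: (@index_by _ (fun A => (f A, f' A)) [seq (a, b) | a <- s, b <- s']).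
- by move=> A []; case: iD => h _ /h.
- by move=> A GA; apply/allpairsP; exists (f A, f' A); rewrite fs// fs'.
- by move=> A C GA GC [e e']; split; [exact: hf|exact: hf'].
Qed.

End Index.

Lemma lor_det (R : realType) n (A : 'M[R]_(1 + n)) : lorentz A -> \det A = 1 \/ \det A = -1.
Proof.
move=> lA; have [h _] := lA; have J0 : \det (@lorentz_form R n) != 0.
  by have := congr1 determinant (@lformK R n); rewrite det_mulmx det1 => e; apply: contra_eq_neq e => ->; rewrite mul0r eq_sym oner_eq0.
have := congr1 determinant h; rewrite !det_mulmx det_tr => e.
have : (\det A - 1) * (\det A + 1) = 0.
  apply: (mulfI J0); rewrite mulr0.
  by transitivity (\det A * \det (@lorentz_form R n) * \det A - \det (@lorentz_form R n)); [ring|rewrite e subrr].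
move=> /eqP; rewrite mulf_eq0 subr_eq0 addr_eq0 => /orP[]/eqP; by [left|right].
Qed.

Lemma separated_count (R : realType) m (C e : R) : 0 < e -> exists N, forall s : seq 'M[R]_m, uniq s ->
  (forall A, A \in s -> ebound C A) ->
  (forall A A', A \in s -> A' \in s -> ebound e (A - A') -> A = A') -> (size s <= N)%N.
Proof.
move=> e0; pose N := Num.truncn `|2 * C / e|.
exists #|{ffun 'I_m * 'I_m -> 'I_N.+1}| => s us bs sep.
pose g (A : 'M[R]_m) : {ffun 'I_m * 'I_m -> 'I_N.+1} :=
  [ffun i => inord (Num.truncn ((A i.1 i.2 + C) / e))].
rewrite -(size_map g) -(card_uniqP _); first exact: max_card.
rewrite map_inj_in_uniq// => A A' As A's gA; apply: sep => // i j.
have b E : E \in s -> 0 <= (E i j + C) / e.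
  by move=> Es; apply: divr_ge0; [have := bs E Es i j; rewrite ler_norml => /andP[]; lra|exact: ltW].
have lN E : E \in s -> (Num.truncn ((E i j + C) / e) < N.+1)%N.
  move=> Es; rewrite ltnS /N; apply: le_truncn; apply: le_trans (ler_norm _).
  by rewrite ler_pM2r ?invr_gt0//; have := bs E Es i j; rewrite ler_norml => /andP[]; lra.
have := congr1 (fun h : {ffun 'I_m * 'I_m -> 'I_N.+1} => nat_of_ord (h (i, j))) gA.
rewrite /= !ffunE /= !inordK ?lN// => E.
have /andP[h1 h2] := truncn_itv (b _ As); have /andP[h3 h4] := truncn_itv (b _ A's).
rewrite E in h1 h2; move: h1 h2 h3 h4; set t := Num.truncn _; rewrite -natr1 => h1 h2 h3 h4.
have ej : A i j + C = (A i j + C) / e * e by rewrite divfK// gt_eqF.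
have ek : A' i j + C = (A' i j + C) / e * e by rewrite divfK// gt_eqF.
rewrite mxE [X in _ + X]mxE ler_norml; apply/andP; split; nra.
Qed.

(** * Existence of a maximal discrete group, and the normal core *)

Section Maximal.
Context {R : realType} {n : nat}.
Implicit Types (u v w X Y xi eta : 'cV[R]_(1 + n)) (A C K Z M : 'M[R]_(1 + n)).
Local Notation B := (@mink R n).
Variables (G : set 'M[R]_(1 + n)) (r0 : R).
Hypotheses (dG : disc G) (cG : cocpt G r0) (n1 : (1 < n)%N).
Hypothesis fG : forall A X, G A -> hyp X -> A *m X = X -> A = 1%:M.
Let gG : mx_subgroup G. Proof. by case: dG. Qed.
Let lG : G `<=` lorentz. Proof. by case: dG. Qed.

(** Counting takes the place of Zorn's lemma. Uniform discreteness bounds the number of elements of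
    size at most r0 in a discrete group containing G, and a group attaining the maximum is maximal:
    an element A of a larger group is moved by some C in G to size at most r0, and C A outside the
    group would raise the count. *)
Lemma maximal_disc : exists L : set 'M[R]_(1 + n), [/\ disc L, G `<=` L &
  forall L', disc L' -> L `<=` L' -> L' `<=` L].
Proof.
have [e e0 he] := uniform_discrete dG cG n1 fG.
pose Nr : R := (1 + n)%:R; have N1 : 1 <= Nr by rewrite ler1n.
pose b := 2 * (`|r0| + 1); have b0 : 0 < b by rewrite /b; have := normr_ge0 r0; lra.
have Nb : 0 < Nr * b by rewrite mulr_gt0//; lra.
have [N hN] := @separated_count R (1 + n) b (e / (Nr * b)) (divr_gt0 e0 Nb).
pose P k := `[< exists D s, [/\ disc D, G `<=` D, uniq s,
  (forall A : 'M[R]_(1 + n), A \in s -> D A /\ A ord0 ord0 <= r0) & size s = k] >].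
have exP : exists k, P k by exists 0%N; apply/asboolP; exists G, [::]; split.
have ubP k : P k -> (k <= N)%N.
  move=> /asboolP[D [s [dD GD us hs <-]]]; have [gD Dl _] := dD.
  have bA A : lorentz A -> A ord0 ord0 <= r0 -> ebound b A.
    move=> lA h i j; apply: le_trans (lor_bound _ _ lA) _; have := ler_norm r0.
    by rewrite /b; lra.
  apply: hN => // [A /hs[DA hA]|A A' /hs[DA hA] /hs[DA' hA'] h]; first exact: bA (Dl _ DA) hA.
  have lA' := Dl _ DA'; have uA' := lor_unit lA'.
  suff : invmx A' *m A = 1%:M by move=> /(congr1 (mulmx A')); rewrite mulKVmx// mulmx1.
  apply: (he D dD GD); first by apply: grM => //; exact: grV.
  have -> : invmx A' *m A - 1%:M = invmx A' *m (A - A') by rewrite mulmxBr mulVmx.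
  have -> : e = Nr * b * (e / (Nr * b)) by rewrite mulrC divfK// gt_eqF.
  by apply: ebound_mul => //; apply: bA; [exact: lorV|rewrite lor_tcV].
case: (ex_maxnP exP ubP) => k /asboolP[D [s [dD GD us hs sk]]] maxk.
exists D; split => // D' dD' DD' A D'A; have [gD' D'l _] := dD'; have [gD _ _] := dD.
have [C GC hC] := cG (lor_e0 (D'l _ D'A)).
have D'CA : D' (C *m A) by apply: grM => //; exact/DD'/GD.
have hCA : (C *m A) ord0 ord0 <= r0 by rewrite -tc_mul -mulmxA.
have [CAs|CAs] := boolP (C *m A \in s).
  have [DCA _] := hs _ CAs.
  rewrite -(mulKmx (gr_unit gG GC) A); by apply: grM => //; apply: GD; exact: grV.
have : P k.+1.
  apply/asboolP; exists D', (C *m A :: s); split => //=.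
  - by move=> E /GD/DD'.
  - by rewrite CAs.
  - by move=> E; rewrite inE => /orP[/eqP->//|/hs[/DD' ? ?]].
  - by rewrite sk.
by move=> /maxk; rewrite ltnn.
Qed.

Variable Lam : set 'M[R]_(1 + n).
Hypotheses (dL : disc Lam) (GL : G `<=` Lam).
Let gL : mx_subgroup Lam. Proof. by case: dL. Qed.
Let lL : Lam `<=` lorentz. Proof. by case: dL. Qed.

Lemma coset_reps : exists s : seq 'M[R]_(1 + n), (forall C, C \in s -> Lam C) /\
  forall L, Lam L -> exists C A, [/\ C \in s, G A & L = C *m A].
Proof.
have [s hs] := disc_seq r0 dL; exists s; split; first by move=> C /hs[].
move=> L hL; have lLL := lL hL; have LV := grV gL hL.
have [A GA hA] := cG (lor_e0 (lorV lLL)); have lA := lG GA; have uA := lor_unit lA.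
exists (L *m invmx A), A; rewrite mulmxKV//; split => //; apply/hs; split.
  by apply: grM => //; apply: grV => //; exact: GL.
rewrite -lor_tcV; last by apply: lorM => //; exact: lorV.
have -> : invmx (L *m invmx A) = A *m invmx L.
  have u : L *m invmx A \in unitmx by rewrite unitmx_mul lor_unit// unitmx_inv.
  apply: (can_inj (mulKmx u)); rewrite mulmxV// mulmxA mulmxKV// mulmxV// lor_unit//.
by rewrite -tc_mul -mulmxA.
Qed.

(** The condition on the determinant is what will orient the normal bundle of the geodesic. *)
Definition core : set 'M[R]_(1 + n) :=
  [set x | \det x = 1 /\ forall L, Lam L -> G (invmx L *m x *m L)].

Lemma core_sub : core `<=` G.
Proof. by move=> x [_ /(_ _ (gr1 gL))]; rewrite invmx1 mul1mx mulmx1. Qed.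

Lemma core_group : mx_subgroup core.
Proof.
split.
- split; first exact: det1.
  by move=> L /(gr_unit gL) u; rewrite mulmx1 mulVmx//; exact: gr1.
- move=> x y [dx hx] [dy hy]; split; first by rewrite det_mulmx dx dy mulr1.
  move=> L hL; have u := gr_unit gL hL.
  have -> : invmx L *m (x *m y) *m L = (invmx L *m x *m L) *m (invmx L *m y *m L).
    by rewrite !mulmxA mulmxK.
  by apply: grM; [|exact: hx|exact: hy].
- move=> x hx; have ux := gr_unit gG (core_sub hx); split => //; case: hx => dx hx.
  split; first by rewrite det_inv dx invr1.
  move=> L hL; have u := gr_unit gL hL.
  have -> : invmx L *m invmx x *m L = invmx (invmx L *m x *m L).
    have u' : invmx L *m x *m L \in unitmx by rewrite !unitmx_mul unitmx_inv u ux.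
    apply: (can_inj (mulKmx u')); rewrite mulmxV// !mulmxA mulmxK// mulmxK// mulVmx//.
  by apply: grV => //; exact: hx.
Qed.

Lemma core_normal L x : Lam L -> core x -> core (L *m x *m invmx L).
Proof.
move=> hL [dx hx]; have u := gr_unit gL hL; split.
  by rewrite !det_mulmx det_inv dx mulr1 divff//; move: u; rewrite unitmxE unitfE.
move=> M hM; have := hx (invmx L *m M) (grM gL (grV gL hL) hM).
have -> // : invmx (invmx L *m M) = invmx M *m L.
  have u' : invmx L *m M \in unitmx by rewrite unitmx_mul unitmx_inv u (gr_unit gL hM).
  by apply: (can_inj (mulKmx u')); rewrite mulmxV// !mulmxA mulmxK ?mulVmx// (gr_unit gL hM).
by rewrite !mulmxA.
Qed.

(** The conjugates of G under Lam come from finitely many representatives C. Each subgroup [H C] has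
    finite index, since x in [H C] is detected by the finitely many cosets in which x C can lie. *)
Lemma core_index : finite_index core G.
Proof.
have [s [sL hs]] := coset_reps.
pose H C : set 'M[R]_(1 + n) := [set x | G x /\ G (invmx C *m x *m C)].
have gH C : C \in s -> mx_subgroup (H C).
  move=> Cs; have u := gr_unit gL (sL _ Cs); split.
  - by split; [exact: gr1|rewrite mulmx1 mulVmx//; exact: gr1].
  - move=> x y [gx hx] [gy hy]; split; first exact: grM.
    have -> : invmx C *m (x *m y) *m C = (invmx C *m x *m C) *m (invmx C *m y *m C).
      by rewrite !mulmxA mulmxK.
    exact: grM.
  - move=> x [gx hx]; have ux := gr_unit gG gx; split => //; split; first exact: grV.
    have -> : invmx C *m invmx x *m C = invmx (invmx C *m x *m C).
      have u' : invmx C *m x *m C \in unitmx by rewrite !unitmx_mul unitmx_inv u ux.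
      apply: (can_inj (mulKmx u')); rewrite mulmxV// !mulmxA mulmxK// mulmxK// mulVmx//.
    exact: grV.
have iH C : C \in s -> finite_index (H C) G.
  move=> Cs; have u := gr_unit gL (sL _ Cs).
  pose f x := get [set E | E \in s /\ exists2 A, G A & x *m C = E *m A].
  have hf x : G x -> [set E | E \in s /\ exists2 A, G A & x *m C = E *m A] (f x).
    move=> Gx; have [E [A [Es GA e]]] := hs (x *m C) (grM gL (GL Gx) (sL _ Cs)).
    by apply: (@getI _ _ E); split => //; exists A.
  apply: (@index_by _ _ _ f s); first by move=> x [].
    by move=> x /hf[].
  move=> x y Gx Gy e; have [Es [A GA hA]] := hf _ Gx; have [_ [A' GA' hA']] := hf _ Gy.
  rewrite -e in hA'; split; first by apply: grM => //; exact: grV.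
  have uE := gr_unit gL (sL _ Es); have uA' := gr_unit gG GA'.
  have -> : invmx C *m (invmx y *m x) *m C = invmx (y *m C) *m (x *m C).
    have u' : y *m C \in unitmx by rewrite unitmx_mul u (gr_unit gG Gy).
    apply: (can_inj (mulKmx u')); rewrite mulKVmx// !mulmxA mulmxK// mulmxV ?(gr_unit gG Gy)// mul1mx//.
  rewrite hA hA'.
  have -> : invmx (f x *m A') *m (f x *m A) = invmx A' *m A.
    have u' : f x *m A' \in unitmx by rewrite unitmx_mul uE.
    by apply: (can_inj (mulKmx u')); rewrite mulKVmx// -mulmxA mulKVmx.
  by apply: grM => //; exact: grV.
pose H0 : set 'M[R]_(1 + n) := [set x | G x /\ \det x = 1].
have gH0 : mx_subgroup H0.
  split; first by split; [exact: gr1|exact: det1].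
    by move=> x y [gx dx] [gy dy]; split; [exact: grM|rewrite det_mulmx dx dy mulr1].
  move=> x [gx dx]; split; first exact: gr_unit gx.
  by split; [exact: grV|rewrite det_inv dx invr1].
have iH0 : finite_index H0 G.
  apply: (@index_by _ _ _ (fun x => \det x) [:: 1; -1]); first by move=> x [].
    by move=> x /lG/lor_det[] ->; rewrite !inE eqxx ?orbT.
  move=> x y Gx Gy e; split; first by apply: grM => //; exact: grV.
  by rewrite det_mulmx det_inv e mulVf//; have := gr_unit gG Gy; rewrite unitmxE unitfE.
have key (t : seq 'M[R]_(1 + n)) : {subset t <= s} -> exists D, [/\ mx_subgroup D, finite_index D G &
    forall x, D x -> H0 x /\ forall C, C \in t -> H C x].
  elim: t => [|C t IH] ts; first by exists H0; split.
  have [x xt|D [gD iD hD]] := IH; first by apply: ts; rewrite inE xt orbT.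
  have Cs : C \in s by apply: ts; rewrite mem_head.
  exists (D `&` H C); split; [|exact: finite_indexI (gH _ Cs) gG iD (iH _ Cs)|].
    have [d1 d2 d3] := gD; have [c1 c2 c3] := gH _ Cs.
    split; [by split|by move=> x y [a b] [a' b']; split; [exact: d2|exact: c2]|].
    by move=> x [/d3[? ?] /c3[? ?]].
  move=> x [/hD[h0 h1] hC]; split => // E; rewrite inE => /orP[/eqP->//|]; exact: h1.
have [D [gD [DG iD] hD]] := key s (fun _ => id).
split; first exact: core_sub.
have [t ht] := iD; exists t => A GA; have [C Ct DC] := ht _ GA.
exists C => //; have [[_ d1] h] := hD _ DC; split => // L hL.
have [E [A' [Es GA' ->]]] := hs _ hL; have [_ hE] := h _ Es.
have uE := gr_unit gL (sL _ Es); have uA := gr_unit gG GA'.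
have -> : invmx (E *m A') = invmx A' *m invmx E.
  have u' : E *m A' \in unitmx by rewrite unitmx_mul uE.
  by apply: (can_inj (mulKmx u')); rewrite mulmxV// mulmxA mulmxK// mulmxV.
have -> : invmx A' *m invmx E *m (invmx C *m A) *m (E *m A') =
   invmx A' *m (invmx E *m (invmx C *m A) *m E) *m A' by rewrite !mulmxA.
by apply: grM => //; apply: grM => //; exact: grV.
Qed.

End Maximal.

(** * Places of finitely generated rings *)

Section Subring.
Context {R : fieldType}.
Implicit Types (S : set R) (x y a : R) (p q d r : {poly R}).

Definition subring S := [/\ S 1, (forall x y, S x -> S y -> S (x - y)) &
  (forall x y, S x -> S y -> S (x * y))].

Section Closure.
Variable S : set R.
Hypothesis rS : subring S.

Lemma sub1 : S 1. Proof. by case: rS. Qed.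
Lemma subB x y : S x -> S y -> S (x - y). Proof. by case: rS => _ h _; exact: h. Qed.
Lemma subM x y : S x -> S y -> S (x * y). Proof. by case: rS => _ _ h; exact: h. Qed.
Lemma sub0 : S 0. Proof. by rewrite -(subrr 1); apply: subB; exact: sub1. Qed.
Lemma subN x : S x -> S (- x). Proof. by move=> Sx; rewrite -sub0r; apply: subB => //; exact: sub0. Qed.
Lemma subD x y : S x -> S y -> S (x + y).
Proof. by move=> Sx Sy; rewrite -[y]opprK; apply: subB => //; exact: subN. Qed.
Lemma sub_sum I (s : seq I) (P : pred I) F : (forall i, P i -> S (F i)) -> S (\sum_(i <- s | P i) F i).
Proof. by move=> h; elim/big_ind: _ => [|x y|i]; [exact: sub0|exact: subD|exact: h]. Qed.
Lemma subX x k : S x -> S (x ^+ k).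
Proof. by move=> Sx; elim: k => [|k IH]; [exact: sub1|rewrite exprS; exact: subM]. Qed.
Lemma sub_nat k : S k%:R.
Proof. by elim: k => [|k IH]; [exact: sub0|rewrite -natr1; apply: subD => //; exact: sub1]. Qed.
Lemma sub_int (z : int) : S z%:~R.
Proof. by case: z => k; rewrite ?NegzE ?mulrNz; [|apply: subN]; exact: sub_nat. Qed.

Definition spoly p := forall i, S p`_i.

Lemma spolyC x : S x -> spoly x%:P.
Proof. by move=> Sx i; rewrite coefC; case: ifP => // _; exact: sub0. Qed.
Lemma spolyXn k : spoly 'X^k.
Proof. by move=> i; rewrite coefXn; exact: sub_nat. Qed.
Lemma spolyB p q : spoly p -> spoly q -> spoly (p - q).
Proof. by move=> hp hq i; rewrite coefB; exact: subB. Qed.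
Lemma spolyD p q : spoly p -> spoly q -> spoly (p + q).
Proof. by move=> hp hq i; rewrite coefD; exact: subD. Qed.
Lemma spolyM p q : spoly p -> spoly q -> spoly (p * q).
Proof. by move=> hp hq i; rewrite coefM; apply: sub_sum => j _; exact: subM. Qed.
Lemma spolyZ x p : S x -> spoly p -> spoly (x *: p).
Proof. by move=> hx hp i; rewrite coefZ; exact: subM. Qed.
Lemma spoly0 : spoly 0. Proof. by move=> i; rewrite coef0; exact: sub0. Qed.

Lemma pseudo_div d : spoly d -> d != 0 -> forall p, spoly p -> exists k q r,
  [/\ spoly q, spoly r, (size r < size d)%N & lead_coef d ^+ k *: p = q * d + r].
Proof.
move=> hd d0 p; move: {2}(size p) (leqnn (size p)) => m.
elim: m p => [|m IH] p pm hp.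
  exists 0%N, 0, p; split => //; first exact: spoly0.
    by apply: leq_ltn_trans pm _; rewrite lt0n size_poly_eq0.
  by rewrite scale1r mul0r add0r.
have [lt|ge] := ltnP (size p) (size d).
  by exists 0%N, 0, p; split; rewrite ?scale1r ?mul0r ?add0r//; exact: spoly0.
have sd : (0 < size d)%N by rewrite lt0n size_poly_eq0.
pose j := (size p - size d)%N; pose t := lead_coef p *: 'X^j.
have ht : spoly t by apply: spolyZ; [exact: hp|exact: spolyXn].
pose p' := lead_coef d *: p - t * d.
have hp' : spoly p' by apply: spolyB; [apply: spolyZ => //; exact: hd|exact: spolyM].
have sp' : (size p' <= m)%N.
  apply/leq_sizeP => i mi; rewrite coefB coefZ -scalerAl coefZ coefXnM.
  have ij : (j <= i)%N by apply: leq_trans mi; rewrite /j; lia.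
  rewrite ltnNge ij /=; have [ip|ip] := leqP (size p) i.
    rewrite (nth_default _ ip) nth_default ?mulr0 ?subrr//.
    by rewrite leq_subRL// /j subnK.
  have ip1 : i = (size p).-1.
    by apply/eqP; rewrite eqn_leq -ltnS (leq_trans ip (leqSpred _)) (leq_trans _ mi)// -ltnS prednK// (leq_trans sd).
  have -> : (i - j)%N = (size d).-1.
    by rewrite ip1 /j -subn1 subnAC subKn// subn1.
  by rewrite ip1 -/(lead_coef p) -/(lead_coef d) mulrC subrr.
have [k [q [r [hq hr rd e]]]] := IH _ sp' hp'.
exists k.+1, (q + (lead_coef d ^+ k) *: t), r; split => //.
  by apply: spolyD => //; apply: spolyZ => //; apply: subX; exact: hd.
rewrite exprSr -scalerA -(subrK (t * d) (lead_coef d *: p)) scalerDr e.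
by rewrite mulrDl (scalerAl _ t d) addrAC.
Qed.

Variable a : R.

Definition adj : set R := [set x | exists2 p, spoly p & x = p.[a]].

Lemma adj_subring : subring adj.
Proof.
split; first by exists 1; rewrite ?hornerC//; exact: spolyC sub1.
  by move=> _ _ [p hp ->] [q hq ->]; exists (p - q); rewrite ?hornerE//; exact: spolyB.
by move=> _ _ [p hp ->] [q hq ->]; exists (p * q); rewrite ?hornerE//; exact: spolyM.
Qed.

Lemma adj_sub : S `<=` adj.
Proof. by move=> x Sx; exists x%:P; rewrite ?hornerC//; exact: spolyC. Qed.

Lemma adj_gen : adj a.
Proof. by exists 'X^1; rewrite ?hornerXn ?expr1//; exact: (spolyXn 1). Qed.

(** A substitute for the norm of x. Take w of least size among the polynomials whose value at a is a
    nonzero multiple u(a) x. Dividing d by w leaves remainder 0, by minimality of w and of d; then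
    the quotient vanishes at a and has at least the size of d, which forces w to be a constant c. *)
Lemma adj_divides d : spoly d -> d != 0 -> d.[a] = 0 ->
  (forall p, spoly p -> p != 0 -> p.[a] = 0 -> (size d <= size p)%N) ->
  forall x, adj x -> x != 0 -> exists2 c, S c /\ c != 0 & exists2 y, adj y & x * y = c.
Proof.
move=> hd d0 da dmin x [p hp xp] x0.
pose P m := `[< exists u w, [/\ spoly u, spoly w, w.[a] = u.[a] * x, w.[a] != 0 & size w = m] >].
have exP : exists m, P m.
  exists (size p); apply/asboolP; exists 1, p; rewrite -xp hornerC mul1r.
  by split => //; exact: spolyC sub1.
case: (ex_minnP exP) => m /asboolP[u [w [hu hw wu w0 wm]]] minm.
have wn0 : w != 0 by apply: contra_neq w0 => ->; rewrite horner0.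
have lw0 : lead_coef w != 0 by rewrite lead_coef_eq0.
have wd : (size w < size d)%N.
  have [k [q [r [hq hr rd e]]]] := pseudo_div hd d0 hw.
  apply: leq_ltn_trans rd; rewrite wm; apply: minm; apply/asboolP.
  have er : r.[a] = lead_coef d ^+ k * w.[a].
    by have := congr1 (horner^~ a) e; rewrite /= !hornerE da mulr0 add0r.
  exists (lead_coef d ^+ k *: u), r; split => //.
  - by apply: spolyZ => //; apply: subX; exact: hd.
  - by rewrite er wu hornerZ mulrA.
  - by rewrite er mulf_neq0// expf_neq0// lead_coef_eq0.
have [k [q [r [hq hr rw e]]]] := pseudo_div hw wn0 hd.
have er : r.[a] = - (q.[a] * u.[a]) * x.
  have := congr1 (horner^~ a) e; rewrite /= !hornerE da mulr0 wu => /esym/eqP.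
  by rewrite addrC addr_eq0 mulrA -mulNr => /eqP.
have ra : r.[a] = 0.
  apply/eqP; apply: contraTT rw => rn; rewrite -leqNgt wm; apply: minm; apply/asboolP.
  exists (- (q * u)), r; split => //; first by rewrite -sub0r; apply: spolyB; [exact: spoly0|exact: spolyM].
  by rewrite er !hornerE.
have r0 : r = 0.
  apply/eqP; apply: contraTT (ltn_trans rw wd) => rn.
  by rewrite -leqNgt; exact: dmin.
rewrite r0 addr0 in e.
have qa : q.[a] = 0.
  have := congr1 (horner^~ a) e; rewrite /= !hornerE da mulr0 => /esym/eqP.
  by rewrite mulf_eq0 (negbTE w0) orbF => /eqP.
have qn0 : q != 0.
  apply: contra_neq d0 => q0; move: e; rewrite q0 mul0r => /eqP.
  by rewrite scaler_eq0 expf_eq0 (negbTE lw0) andbF /= => /eqP.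
have sq := dmin _ hq qn0 qa.
have : size (q * w) = size d by rewrite -e size_scale// expf_neq0.
rewrite size_mul// => sqw.
have sw1 : (size w <= 1)%N.
  move: sq; rewrite -sqw; case: (size w) => // t; rewrite addnS /= -[X in (_ <= X)%N]addn0 leq_add2l leqn0 => /eqP-> //.
have [c wc] := size_poly1P _ (ltac:(by rewrite eqn_leq sw1 lt0n size_poly_eq0) : size w == 1%N).
move=> wE; exists c; first by split => //; rewrite -[c](coefC _ 0) -wE; exact: hw.
by exists u.[a]; [exists u|rewrite mulrC -wu wE hornerC].
Qed.

End Closure.

(** ** Ring homomorphisms on subrings *)

(** A homomorphism on S is a total function whose values outside S carry no meaning. *)
Definition hom (C : comNzRingType) S (f : R -> C) :=
  [/\ f 1 = 1, (forall x y, S x -> S y -> f (x - y) = f x - f y) &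
      (forall x y, S x -> S y -> f (x * y) = f x * f y)].

Section Hom.
Variables (C : idomainType) (S : set R) (f : R -> C).
Hypotheses (rS : subring S) (hf : hom S f).

Lemma hom1 : f 1 = 1. Proof. by case: hf. Qed.
Lemma homB x y : S x -> S y -> f (x - y) = f x - f y. Proof. by case: hf => _ h _; exact: h. Qed.
Lemma homM x y : S x -> S y -> f (x * y) = f x * f y. Proof. by case: hf => _ _ h; exact: h. Qed.
Lemma hom0 : f 0 = 0.
Proof. by rewrite -(subrr 1) homB ?subrr//; exact: sub1. Qed.
Lemma homN x : S x -> f (- x) = - f x.
Proof. by move=> Sx; rewrite -sub0r homB// ?hom0 ?sub0r//; exact: sub0. Qed.
Lemma homD x y : S x -> S y -> f (x + y) = f x + f y.
Proof. by move=> Sx Sy; rewrite -[y in LHS]opprK homB ?homN ?opprK//; exact: subN. Qed.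
Lemma hom_sum I (s : seq I) (P : pred I) F : (forall i, P i -> S (F i)) ->
  f (\sum_(i <- s | P i) F i) = \sum_(i <- s | P i) f (F i).
Proof.
move=> h; have [] // : S (\sum_(i <- s | P i) F i) /\ f (\sum_(i <- s | P i) F i) = \sum_(i <- s | P i) f (F i).
elim/big_ind2: _ => [|x x' y y' [hx <-] [hy <-]|i Pi]; first by split; [exact: sub0|exact: hom0].
  by split; [exact: subD|rewrite homD].
by split => //; exact: h.
Qed.
Lemma homX x k : S x -> f (x ^+ k) = f x ^+ k.
Proof.
move=> Sx; elim: k => [|k IH]; first exact: hom1.
by rewrite !exprS homM ?IH//; exact: subX.
Qed.
Lemma hom_int (z : int) : f z%:~R = z%:~R.
Proof.
have n k : f k%:R = k%:R.
  elim: k => [|k IH]; first exact: hom0.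
  by rewrite -!natr1 homD ?IH ?hom1//; [exact: sub_nat|exact: sub1].
by case: z => k; rewrite ?NegzE ?mulrNz ?homN ?n//; exact: sub_nat.
Qed.

Local Notation m := (map_poly f).

Lemma hcoef p i : (m p)`_i = f p`_i.
Proof. by rewrite coef_map_id0// hom0. Qed.
Lemma hpolyB p q : spoly S p -> spoly S q -> m (p - q) = m p - m q.
Proof. by move=> hp hq; apply/polyP => i; rewrite coefB !hcoef coefB homB. Qed.
Lemma hpolyM p q : spoly S p -> spoly S q -> m (p * q) = m p * m q.
Proof.
move=> hp hq; apply/polyP => i; rewrite hcoef !coefM hom_sum.
  by apply: eq_bigr => j _; rewrite !hcoef homM.
by move=> j _; exact: subM.
Qed.
Lemma hpolyC x : S x -> m x%:P = (f x)%:P.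
Proof. by move=> Sx; apply/polyP => i; rewrite hcoef !coefC; case: ifP => // _; exact: hom0. Qed.
Lemma hpolyZ x p : S x -> spoly S p -> m (x *: p) = f x *: m p.
Proof. by move=> Sx hp; apply/polyP => i; rewrite coefZ !hcoef coefZ homM. Qed.

Lemma hom_adj a (b : C) :
  (forall p, spoly S p -> p.[a] = 0 -> (m p).[b] = 0) ->
  exists2 g, hom (adj S a) g & forall p, spoly S p -> g p.[a] = (m p).[b].
Proof.
move=> h; pose g x := (m (xget 0 [set p | spoly S p /\ x = p.[a]])).[b].
have gE p : spoly S p -> g p.[a] = (m p).[b].
  move=> hp; rewrite /g; case: xgetP => [q _ [hq e]|/(_ p)[]//].
  apply/eqP; rewrite -subr_eq0 -hornerN -hornerD -hpolyB//; apply/eqP/h; first exact: spolyB.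
  by rewrite !hornerE e subrr.
exists g => //; split.
- have -> : (1 : R) = (1%:P : {poly R}).[a] by rewrite hornerC.
  by rewrite gE ?hpolyC ?hornerC ?hom1//; [exact: sub1|apply: spolyC => //; exact: sub1].
- move=> _ _ [p hp ->] [q hq ->]; rewrite -hornerN -hornerD !gE//; last exact: spolyB.
  by rewrite hpolyB// !hornerE.
- move=> _ _ [p hp ->] [q hq ->]; rewrite -hornerM !gE//; last exact: spolyM.
  by rewrite hpolyM// !hornerE.
Qed.

End Hom.
End Subring.

(** ** Homomorphisms to the algebraic numbers *)

Section Alg.
Context {R : realType}.
Implicit Types (S : set R) (x y a : R) (p q d r : {poly R}).

(** The ring Z[l], with the last element of l adjoined first: in [rcons l lam] the element lam is
    adjoined directly to the integers. *)
Definition zring (l : seq R) : set R := foldr (fun a S => adj S a) (range (fun z : int => z%:~R)) l.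

Lemma range_int_subring : subring (range (fun z : int => z%:~R : R)).
Proof.
split; first by exists 1.
  by move=> _ _ [x _ <-] [y _ <-]; exists (x - y); rewrite // intrB.
by move=> _ _ [x _ <-] [y _ <-]; exists (x * y); rewrite // intrM.
Qed.

Lemma zring_subring l : subring (zring l).
Proof. by elim: l => [|a l IH]; [exact: range_int_subring|exact: adj_subring]. Qed.

Lemma zring_gen l a : a \in l -> zring l a.
Proof.
elim: l => // b l IH; rewrite inE => /orP[/eqP->|/IH h].
  exact/adj_gen/zring_subring.
exact/adj_sub/h/zring_subring.
Qed.

Definition algebraic S a := exists2 p, spoly S p & p != 0 /\ p.[a] = 0.

Lemma algebraic_min S a : algebraic S a -> exists d, [/\ spoly S d, d != 0, d.[a] = 0 &
  forall p, spoly S p -> p != 0 -> p.[a] = 0 -> (size d <= size p)%N].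
Proof.
move=> [p hp [p0 pa]].
pose P m := `[< exists d, [/\ spoly S d, d != 0, d.[a] = 0 & size d = m] >].
have exP : exists m, P m by exists (size p); apply/asboolP; exists p.
case: (ex_minnP exP) => m /asboolP[d [hd d0 da dm]] minm; exists d; split => // q hq q0 qa.
by rewrite dm; apply: minm; apply/asboolP; exists q.
Qed.

Lemma extend_algebraic S a d (f : R -> algC) : subring S -> spoly S d -> d != 0 -> d.[a] = 0 ->
  (forall p, spoly S p -> p != 0 -> p.[a] = 0 -> (size d <= size p)%N) ->
  hom S f -> f (lead_coef d) != 0 ->
  exists2 g, hom (adj S a) g & forall x, S x -> g x = f x.
Proof.
move=> rS hd d0 da dmin hf fd.
have sd : size (map_poly f d) = size d.
  by apply: size_poly_eq; rewrite -/(lead_coef d).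
have : size (map_poly f d) != 1%N.
  rewrite sd; apply/eqP => d1; have [c c0 dc] := size_poly1P _ (introT eqP d1).
  by move: da c0; rewrite dc hornerC => ->; rewrite eqxx.
move/closed_rootP => [b /rootP db].
have [|g hg gE] := @hom_adj _ _ S f rS hf a b.
  move=> p hp pa; have [k [q [r [hq hr rd e]]]] := pseudo_div rS hd d0 hp.
  have r0 : r = 0.
    apply/eqP; apply: contraTT rd => rn; rewrite -leqNgt; apply: dmin => //.
    by have := congr1 (horner^~ a) e; rewrite /= !hornerE da pa !mulr0 add0r.
  have := congr1 (map_poly f) e; rewrite r0 addr0.
  have Sk : S (lead_coef d ^+ k) by apply: subX => //; exact: hd.
  rewrite (hpolyZ rS hf)// (hpolyM rS hf)// => /(congr1 (horner^~ b)); rewrite /= hornerZ hornerM db mulr0 => /eqP.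
  rewrite mulf_eq0 (homX rS hf); last exact: hd.
  by rewrite expf_eq0 (negbTE fd) andbF /= => /eqP.
exists g => // x Sx; have := gE x%:P (spolyC rS Sx).
by rewrite hornerC (hpolyC rS hf)// hornerC.
Qed.

Lemma extend_transcendental S a (f : R -> algC) (b : algC) : subring S -> hom S f -> ~ algebraic S a ->
  exists2 g, hom (adj S a) g & forall p, spoly S p -> g p.[a] = (map_poly f p).[b].
Proof.
move=> rS hf na; apply: hom_adj => // p hp pa.
have [->|p0] := eqVneq p 0; first by rewrite map_poly0 horner0.
by case: na; exists p.
Qed.

Lemma nonroot (p : {poly algC}) : p != 0 -> exists2 c : nat, (1 < c)%N & p.[c%:R] != 0.
Proof.
move=> p0; apply: contrapT => H.
pose s : seq algC := [seq (c.+2)%:R | c <- iota 0 (size p)].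
have us : uniq s.
  rewrite map_inj_uniq ?iota_uniq// => i j /eqP; rewrite eqr_nat => /eqP[] //.
have rs : all (root p) s.
  apply/allP => _ /mapP[c _ ->]; apply/rootP/eqP; apply: contra_notT H => h.
  by exists c.+2.
by have := max_poly_roots p0 rs us; rewrite size_map size_iota ltnn.
Qed.

Lemma extend S a h : subring S -> adj S a h -> h != 0 -> exists2 c, S c /\ c != 0 &
  forall f : R -> algC, hom S f -> f c != 0 ->
    exists2 g, hom (adj S a) g & (forall x, S x -> g x = f x) /\ g h != 0.
Proof.
move=> rS ah h0; have [al|na] := pselect (algebraic S a).
  have [d [hd d0 da dmin]] := algebraic_min al.
  have [c [Sc c0] [y ay hy]] := adj_divides rS hd d0 da dmin ah h0.
  have ld : lead_coef d != 0 by rewrite lead_coef_eq0.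
  have Sld : S (lead_coef d) by exact: hd.
  exists (c * lead_coef d); first by split; [exact: subM|rewrite mulf_neq0].
  move=> f hf; rewrite (homM hf)// mulf_eq0 negb_or => /andP[fc fd].
  have [g hg gf] := extend_algebraic rS hd d0 da dmin hf fd.
  exists g => //; split => //; apply: contra_neq fc => gh.
  by rewrite -gf// -hy (homM hg)// gh mul0r.
case: ah => p hp hE; have p0 : p != 0 by apply: contra_neq h0 => p0; rewrite hE p0 horner0.
exists (lead_coef p); first by split; [exact: hp|rewrite lead_coef_eq0].
move=> f hf fp; have mp0 : map_poly f p != 0.
  by apply: contra_neq fp => /(congr1 (fun q : {poly algC} => q`_(size p).-1)); rewrite (hcoef rS hf) coef0.
have [b _ fb] := nonroot mp0.
have [g hg gE] := extend_transcendental b%:R rS hf na.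
exists g => //; split; last by rewrite hE gE.
by move=> x Sx; have := gE x%:P (spolyC rS Sx); rewrite hornerC (hpolyC rS hf)// hornerC.
Qed.

Definition no_unity (K : nzRingType) (x : K) := forall E, (0 < E)%N -> x ^+ E != 1.

Lemma hom_range_int : hom (range (fun z : int => z%:~R : R)) (fun x => (Num.floor x)%:~R : algC).
Proof.
split; first by rewrite floor1.
  by move=> _ _ [x _ <-] [y _ <-]; rewrite -intrB !intrKfloor intrB.
by move=> _ _ [x _ <-] [y _ <-]; rewrite -intrM !intrKfloor intrM.
Qed.

(** Only the image of lam has to be controlled, and lam is adjoined first. If it is algebraic, the
    homomorphism is injective on Z[lam]; if not, lam is sent to an integer greater than 1. The other
    generators follow by [extend]. *)
Lemma hom_algC l lam h : no_unity lam -> zring (rcons l lam) h -> h != 0 ->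
  exists2 f : R -> algC, hom (zring (rcons l lam)) f & f h != 0 /\ no_unity (f lam).
Proof.
move=> nu; elim: l h => [|a l IH] h zh h0; last first.
  have rS := zring_subring (rcons l lam).
  have [c [Sc c0] H] := extend rS zh h0.
  have [f hf [fc fu]] := IH c Sc c0; have [g hg [gf gh]] := H f hf fc.
  exists g => //; split => //; rewrite gf//; apply: zring_gen.
  by rewrite mem_rcons mem_head.
rewrite /= in zh *; set S := range _ in zh *; have rS : subring S by exact: range_int_subring.
set f0 := fun x : R => (Num.floor x)%:~R : algC.
have hf0 : hom S f0 by exact: hom_range_int.
have f0n x : S x -> x != 0 -> f0 x != 0.
  by move=> [z _ <-]; rewrite /f0 intrKfloor !intr_eq0.
have [al|na] := pselect (algebraic S lam).
  have [d [hd d0 da dmin]] := algebraic_min al.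
  have ld : lead_coef d != 0 by rewrite lead_coef_eq0.
  have [g hg gf] := extend_algebraic rS hd d0 da dmin hf0 (f0n _ (hd _) ld).
  have gn x : adj S lam x -> x != 0 -> g x != 0.
    move=> ax x0; have [c [Sc c0] [y ay hy]] := adj_divides rS hd d0 da dmin ax x0.
    by apply: contra_neq (f0n _ Sc c0) => gx; rewrite -gf// -hy (homM hg)// gx mul0r.
  exists g => //; split; first exact: gn.
  have rA := adj_subring rS lam; have al' := adj_gen rS lam.
  move=> E E0; rewrite -subr_eq0 -(homX rA hg)// -(hom1 hg) -(homB hg); last exact: sub1.
    apply: gn; last by rewrite subr_eq0 nu.
    by apply: subB => //; [exact: subX|exact: sub1].
  exact: subX.
case: zh => p hp hE; have p0 : p != 0 by apply: contra_neq h0 => p0; rewrite hE p0 horner0.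
have mp0 : map_poly f0 p != 0.
  have := f0n _ (hp (size p).-1); rewrite -/(lead_coef p) lead_coef_eq0 => /(_ p0).
  by apply: contra_neq => /(congr1 (fun q : {poly algC} => q`_(size p).-1)); rewrite (hcoef rS hf0) coef0.
have [b b1 fb] := nonroot mp0.
have [g hg gE] := extend_transcendental b%:R rS hf0 na.
exists g => //; split; first by rewrite hE gE.
move=> E E0; have -> : g lam = b%:R.
  have fX : map_poly f0 'X = 'X.
    apply/polyP => i; rewrite (hcoef rS hf0) !coefX.
    by case: (i == 1)%N; rewrite ?(hom1 hf0) ?(hom0 rS hf0).
  by have := gE 'X (fun i => spolyXn rS 1 i); rewrite hornerX fX hornerX.
by rewrite -natrX -[1]/(1%:R) eqr_nat; have := ltn_exp2l 0 E b1; rewrite expn0 E0; case: ltngtP.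
Qed.

End Alg.

(** ** Valuation rings *)

Lemma expr_sub (R : fieldType) (u : R) i k : u != 0 -> (i <= k)%N ->
  u^-1 ^+ i * u ^+ k = u ^+ (k - i).
Proof. by move=> u0 ik; rewrite exprVn -{1}(subnK ik) exprD mulrC mulfK// expf_neq0. Qed.

Section Valuation.
Context {R : realType}.
Implicit Types (V S : set R) (x y a : R) (p q d r : {poly R}).

Definition valring V := subring V /\ forall x, V x \/ V x^-1.

Variables (q : nat) (q_pr : prime q).
Local Notation Q := (q%:R : R).
Let Q0 : Q != 0. Proof. by rewrite pnatr_eq0 -lt0n prime_gt0. Qed.

Section Maximal.
Variable V : set R.
Hypotheses (rV : subring V) (VQ : ~ V Q^-1)
  (maxV : forall W, subring W -> V `<=` W -> ~ W Q^-1 -> W `<=` V).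

(** Otherwise the inverse of u = 1 - q v may be adjoined by maximality only if 1/q becomes a
    polynomial in 1/u. Clearing denominators puts u^k in q V, while u^k is also in 1 - q V; together
    these put 1/q in V. *)
Lemma max_unit v : V v -> V (1 - Q * v)^-1 /\ 1 - Q * v != 0.
Proof.
move=> Vv; have VQQ : V Q by exact: sub_nat.
have n0 : 1 - Q * v != 0.
  apply/eqP => /eqP; rewrite subr_eq0 => /eqP e; apply: VQ.
  by have -> : Q^-1 = v by apply: (mulfI Q0); rewrite divff.
split => //; apply: contrapT => nV; set u := 1 - Q * v in n0 nV *.
have Vu : V u by apply: subB => //; [exact: sub1|exact: subM].
have uE : u = 1 - Q * v by []; clearbody u.
have [p hp e] : adj V u^-1 Q^-1.
  apply: contrapT => h; apply: nV; apply: (maxV (adj_subring rV u^-1) (@adj_sub _ V rV u^-1) h).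
  exact: adj_gen.
(* clear denominators: u ^ k = Q c for some c in V *)
pose k := size p; pose c := \sum_(i < k) p`_i * u ^+ (k - i).
have Vc : V c by apply: sub_sum => // i _; apply: subM => //; exact: subX.
have uc : u ^+ k = Q * c.
  have : Q^-1 * u ^+ k = c.
    rewrite e horner_coef mulr_suml; apply: eq_bigr => i _; rewrite -mulrA; congr (_ * _).
    by rewrite expr_sub// ltnW.
  by move=> <-; rewrite mulrA divff// mul1r.
have [w Vw uw] : exists2 w, V w & u ^+ k = 1 - Q * w.
  elim: k {c Vc uc} => [|j [w Vw IH]]; first by exists 0; [exact: sub0|rewrite mulr0 subr0].
  exists (v + w - Q * v * w); last by rewrite exprS IH uE; ring.
  by apply: subB => //; [exact: subD|apply: subM => //; exact: subM].
apply: VQ; have -> : Q^-1 = c + w; last exact: subD.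
apply: (mulfI Q0); rewrite divff// mulrDr -uc uw; ring.
Qed.

(** Chevalley's argument. The relation for 1/y, multiplied by y^m and divided by the unit 1 - q d_0,
    writes y^m as q times a combination of lower powers of y; substituting this into the top term of
    p shortens the relation for y. *)
Lemma max_shorten y p d : y != 0 -> spoly V p -> spoly V d -> Q * p.[y] = 1 -> Q * d.[y^-1] = 1 ->
  (size d <= size p)%N -> exists s, [/\ spoly V s, (size s < size p)%N & Q * s.[y] = 1].
Proof.
move=> y0 hp hd ep ed dp; have VQQ : V Q by exact: sub_nat.
have p0 : (0 < size p)%N.
  rewrite lt0n size_poly_eq0; apply/eqP => p0; move: ep; rewrite p0 horner0 mulr0 => /eqP.
  by rewrite eq_sym oner_eq0.
have d0 : (0 < size d)%N.
  rewrite lt0n size_poly_eq0; apply/eqP => d0; move: ed; rewrite d0 horner0 mulr0 => /eqP.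
  by rewrite eq_sym oner_eq0.
pose m := (size p).-1; pose k := (size d).-1.
have km : (k <= m)%N by rewrite /k /m; move: d0 p0 dp; case: (size d) => // ?; case: (size p).
have [Vu u0] := max_unit (hd 0%N); set u := 1 - Q * d`_0 in Vu u0.
have uE : u = 1 - Q * d`_0 by []; clearbody u.
pose r := \sum_(i < k) d`_i.+1 *: 'X^(m - i.+1).
have hr : spoly V r.
  move=> i; rewrite coef_sum; apply: sub_sum => // j _; rewrite coefZ.
  by apply: subM => //; exact: spolyXn.
have sr : (size r <= m)%N.
  apply/leq_sizeP => j mj; rewrite coef_sum big1// => i _; rewrite coefZ coefXn.
  by case: eqP => [ej|_]; [move: mj km (ltn_ord i); rewrite ej; lia|rewrite mulr0].
have er : u * y ^+ m = Q * r.[y].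
  have : u = Q * \sum_(i < k) d`_i.+1 * y^-1 ^+ i.+1.
    move: ed; rewrite horner_coef -[in X in X -> _](prednK d0) big_ord_recl expr0 mulr1 mulrDr => ed.
    by rewrite uE -{1}ed addrAC subrr add0r.
  move=> ->; rewrite -mulrA; congr (_ * _); rewrite mulr_suml horner_sum; apply: eq_bigr => i _.
  rewrite hornerZ hornerXn -mulrA; congr (_ * _); by rewrite expr_sub//; apply: leq_trans km.
pose p' := p - lead_coef p *: 'X^m.
have sp' : (size p' <= m)%N.
  apply/leq_sizeP => i mi; rewrite coefB coefZ coefXn.
  have [->|ni] := eqVneq i m; first by rewrite mulr1 subrr.
  by rewrite mulr0 subr0 nth_default// -(prednK p0) ltn_neqAle eq_sym ni.
exists (p' + (u^-1 * (Q * lead_coef p)) *: r); split.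
- apply: spolyD => //; first by apply: spolyB => //; apply: spolyZ => //; [exact: hp|exact: spolyXn].
  by apply: spolyZ => //; apply: subM => //; apply: subM => //; exact: hp.
- rewrite -(prednK p0) ltnS; apply: leq_trans (size_polyD _ _) _.
  by rewrite geq_max sp' (leq_trans (size_scale_leq _ _)).
- apply: (mulfI u0); rewrite mulr1.
  transitivity (u * (Q * p.[y]) + Q * lead_coef p * (u * u^-1 * (Q * r.[y]) - u * y ^+ m)).
    by rewrite hornerD hornerZ /p' hornerD hornerN hornerZ hornerXn; ring.
  by rewrite ep divff// mul1r er subrr mulr0 addr0 mulr1.
Qed.

(** If neither x nor 1/x were in V, adjoining either one would give relations q p(x) = 1 and q
    d(1/x) = 1. Take both as short as possible: the longer of the two can still be shortened. *)
Lemma max_valring : valring V.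
Proof.
split => // x; apply: contrapT => /not_orP[nx nxV].
have x0 : x != 0 by apply/eqP => x0; apply: nx; rewrite x0; exact: sub0.
have key y : ~ V y -> exists p, [/\ spoly V p, Q * p.[y] = 1 &
    forall s, spoly V s -> Q * s.[y] = 1 -> (size p <= size s)%N].
  move=> ny; have [p hp e] : adj V y Q^-1.
    apply: contrapT => h; apply: ny; apply: (maxV (adj_subring rV y) (@adj_sub _ V rV y) h).
    exact: adj_gen.
  pose P m := `[< exists p, [/\ spoly V p, Q * p.[y] = 1 & size p = m] >].
  have exP : exists m, P m by exists (size p); apply/asboolP; exists p; rewrite -e divff.
  case: (ex_minnP exP) => m /asboolP[p' [hp' e' sp']] minm; exists p'; split => // s hs es.
  by rewrite sp'; apply: minm; apply/asboolP; exists s.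
have [p [hp ep minp]] := key _ nx; have [d [hd ed mind]] := key _ nxV.
have [dp|/ltnW pd] := leqP (size d) (size p).
  have [s [hs sp es]] := max_shorten x0 hp hd ep ed dp.
  by move: sp; rewrite ltnNge minp.
have [s [hs sp es]] := max_shorten (invr_neq0 x0) hd hp ed (ltac:(by rewrite invrK)) pd.
by move: sp; rewrite ltnNge mind.
Qed.

End Maximal.

Lemma exists_valring S : subring S -> ~ S Q^-1 -> exists V, [/\ valring V, S `<=` V & ~ V Q^-1].
Proof.
move=> rS SQ; pose T := {W : set R | [/\ subring W, S `<=` W & ~ W Q^-1]}.
pose le (W W' : T) := `[< sval W `<=` sval W' >].
have [] := @Zorn T le.
- by move=> W; apply/asboolP.
- by move=> W1 W2 W3 /asboolP h1 /asboolP h2; apply/asboolP => x /h1/h2.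
- move=> [W1 h1] [W2 h2] /asboolP /= h12 /asboolP /= h21; apply: eq_exist => /=.
  by apply/seteqP.
- move=> A totA; have [[W0 AW0]|nA] := pselect (exists W, A W); last first.
    exists (exist _ S (And3 rS (@subset_refl _ S) SQ)) => W AW; case: nA; by exists W.
  pose U : set R := \bigcup_(W in A) sval W.
  have hU : [/\ subring U, S `<=` U & ~ U Q^-1].
    split.
    - have two x y : U x -> U y -> exists2 W, A W & sval W x /\ sval W y.
        move=> [W AW Wx] [W' AW' Wy]; case: (totA W W' AW AW') => /asboolP h.
          by exists W' => //; split => //; exact: h.
        by exists W => //; split => //; exact: h.
      split; first by exists W0 => //; case: (svalP W0) => [[? _ _] _ _].
        move=> x y Ux Uy; have [W AW [Wx Wy]] := two _ _ Ux Uy; exists W => //.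
        by case: (svalP W) => r _ _; exact: subB.
      move=> x y Ux Uy; have [W AW [Wx Wy]] := two _ _ Ux Uy; exists W => //.
      by case: (svalP W) => r _ _; exact: subM.
    - by move=> x Sx; exists W0 => //; case: (svalP W0) => _ h _; exact: h.
    - by move=> [W _ WQ]; case: (svalP W) => _ _; exact.
  by exists (exist _ U hU) => W AW; apply/asboolP => x Wx; exists W.
move=> [V [rV SV VQ]] maxV; exists V; split => //; apply: max_valring => // W rW VW WQ.
have hW : [/\ subring W, S `<=` W & ~ W Q^-1] by split => // x /SV/VW.
by have := maxV (exist _ W hW) (introT (asboolP _) VW) => /(congr1 sval) /= ->.
Qed.

End Valuation.

(** ** Places with finite residue rings *)

Section Place.
Context {R : realType}.
Implicit Types (V S : set R) (x y a lam : R) (l : seq R) (z w : algC).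

Lemma hom_horner (C : idomainType) S (f : R -> C) p y : subring S -> hom S f -> spoly S p -> S y ->
  f p.[y] = (map_poly f p).[f y].
Proof.
move=> rS hf hp Sy; rewrite horner_coef (hom_sum rS hf); last first.
  by move=> i _; apply: subM => //; exact: subX.
rewrite (@horner_coef_wide _ (size p)); last exact: size_poly.
apply: eq_bigr => i _; rewrite (hcoef rS hf) (homM hf) ?(homX rS hf)//; exact: subX.
Qed.

Lemma spoly_int S (P : {poly int}) : subring S -> spoly S (map_poly intr P).
Proof. by move=> rS i; rewrite coef_map; exact: sub_int. Qed.

Lemma hom_horner_int (C : idomainType) S (f : R -> C) (P : {poly int}) y : subring S -> hom S f ->
  S y -> f (map_poly intr P).[y] = (map_poly intr P).[f y].
Proof.
move=> rS hf Sy; rewrite (hom_horner rS hf)//; last exact: spoly_int.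
by congr (_.[_]); apply/polyP => i; rewrite (hcoef rS hf) !coef_map (hom_int rS hf).
Qed.

Lemma sub_horner S p y : subring S -> spoly S p -> S y -> S p.[y].
Proof.
move=> rS hp Sy; rewrite horner_coef; apply: sub_sum => // i _.
by apply: subM => //; exact: subX.
Qed.

Lemma horner_diff S p x y : subring S -> spoly S p -> S x -> S y ->
  exists2 w, S w & p.[x] - p.[y] = (x - y) * w.
Proof.
move=> rS hp Sx Sy.
have [||k [q [r [hq hr rd e]]]] := @pseudo_div _ S rS ('X - y%:P) _ _ _ hp.
- by apply: spolyB => //; [exact: (spolyXn rS 1)|exact: spolyC].
- by rewrite polyXsubC_eq0.
move: e rd; rewrite lead_coefXsubC expr1n scale1r size_XsubC => e rd.
have rC (t : R) : r.[t] = r`_0 by rewrite (size1_polyC rd) hornerC coefC eqxx.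
exists q.[x]; first exact: sub_horner.
by rewrite e !hornerD !hornerM !hornerXsubC !rC subrr mulr0 add0r addrK mulrC.
Qed.

Lemma zring_hom_ind l (f : R -> algC) (T : algC -> Prop) :
  T 1 -> (forall z w, T z -> T w -> T (z - w)) -> (forall z w, T z -> T w -> T (z * w)) ->
  hom (zring l) f -> (forall a, a \in l -> T (f a)) -> forall x, zring l x -> T (f x).
Proof.
move=> T1 TB TM; have T0 : T 0 by rewrite -(subrr 1); exact: TB.
have TN z : T z -> T (- z) by move=> h; rewrite -sub0r; exact: TB.
have TD z w : T z -> T w -> T (z + w) by move=> hx hy; rewrite -[w]opprK; apply: TB => //; exact: TN.
elim: l => [|a l IH] hf ha x.
  move=> [z _ <-]; rewrite (hom_int range_int_subring hf).
  have Tn k : T k%:R by elim: k => [|k IH]; rewrite ?mulr0n// -natr1; exact: TD.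
  by case: z => k; rewrite ?NegzE ?mulrNz; [|apply: TN]; exact: Tn.
have rS := zring_subring l; have rA := zring_subring (a :: l).
have sub : zring l `<=` zring (a :: l) by exact: adj_sub.
have hf' : hom (zring l) f.
  split; first exact: hom1 hf.
    by move=> x' y' /sub hx /sub hy; exact: (homB hf).
  by move=> x' y' /sub hx /sub hy; exact: (homM hf).
have Sa : zring (a :: l) a by apply: zring_gen; rewrite mem_head.
have Ta : T (f a) by apply: ha; rewrite mem_head.
move=> [p hp ->]; rewrite (hom_horner rA hf)//; last by move=> i; exact/sub/hp.
rewrite horner_coef; have {}hp : spoly (zring l) p := hp.
elim/big_ind: _ => // i _; apply: (TM).
  by rewrite (hcoef rA hf); apply: IH => // b bl; apply: ha; rewrite inE bl orbT.
by elim: (nat_of_ord i) => // k IHk; rewrite exprS; exact: TM.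
Qed.

(** For a common denominator s of the coefficients of the minimal polynomial of z, the equation of s
    z is monic with integral coefficients. *)
Lemma Aint_multiple z : exists2 s : nat, (0 < s)%N & s%:R * z \in Aint.
Proof.
have [p [pE pm] _] := minCpolyP z.
pose s := (\prod_(i < size p) `|denq p`_i|)%N.
have s0 : (0 < s)%N by rewrite prodn_gt0// => i; rewrite absz_gt0 denq_neq0.
exists s => //; pose d := (size p).-1.
have p0 : p != 0 by exact: monic_neq0.
have sp : size p = d.+1 by rewrite prednK// lt0n size_poly_eq0.
have ip i : (i < size p)%N -> (s%:R * ratr p`_i : algC) \is a Num.int.
  move=> ip; have -> : (s%:R * ratr p`_i : algC) = ratr (s%:R * p`_i) by rewrite rmorphM /= rmorph_nat.
  suff /intrP[m ->] : s%:R * p`_i \is a Num.int by rewrite ratr_int.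
  rewrite /s (bigD1 (Ordinal ip))//= mulnC natrM -mulrA rpredM ?rpred_nat//.
  have -> : `|denq p`_i|%:R = (denq p`_i)%:~R :> rat by rewrite pmulrn absz_denq.
  by rewrite mulrC -numqE; apply/intrP; exists (numq p`_i).
pose Q : {poly algC} := \poly_(i < size p) (s%:R ^+ (d - i) * ratr p`_i).
have Qd : s%:R ^+ (d - d) * ratr p`_d = 1 :> algC.
  by rewrite subnn expr0 mul1r -/(lead_coef p) (monicP pm) rmorph1.
have sQ : size Q = size p.
  by rewrite size_poly_eq// -/d Qd oner_neq0.
apply: (@root_monic_Aint Q).
- apply/rootP; have : (minCpoly z).[z] = 0 by apply/rootP; exact: root_minCpoly.
  rewrite pE (@horner_coef_wide _ (size p)) ?size_map_poly// => e.
  rewrite horner_poly; transitivity (s%:R ^+ d * (\sum_(i < size p) (map_poly ratr p)`_i * z ^+ i) : algC).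
    rewrite mulr_sumr; apply: eq_bigr => i _; rewrite coef_map exprMn.
    have id : (i <= d)%N by rewrite -ltnS -sp.
    by rewrite -{2}(subnK id) exprD; ring.
  by rewrite e mulr0.
- by apply/monicP; rewrite /lead_coef sQ coef_poly sp ltnSn Qd.
- apply/polyOverP => i; rewrite coef_poly; case: ifP => ii; last exact: rpred0.
  have id : (i <= d)%N by rewrite -ltnS -sp.
  move: id; rewrite leq_eqVlt => /orP[/eqP->|id]; first by rewrite Qd rpred1.
  by rewrite -(subnSK id) exprSr -mulrA rpredM ?ip// rpredX// rpred_nat.
Qed.

Lemma Aint_monic z : z \in Aint -> exists2 P : {poly int}, P \is monic & (map_poly intr P).[z] = 0.
Proof.
move=> /floorpP[P PE]; exists P; last by rewrite -PE; apply/rootP; exact: root_minCpoly.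
have inj : injective (intr : int -> algC) by exact: intr_inj.
have := minCpoly_monic z; rewrite PE !monicE (lead_coef_map_inj inj)// => /eqP e.
by apply/eqP/inj; rewrite e.
Qed.

Lemma int_root_unit (P : {poly int}) z : P != 0 -> z != 0 -> (map_poly intr P).[z] = 0 ->
  exists2 P' : {poly int}, P'.[0] != 0 & (map_poly intr P').[z] = 0.
Proof.
move: {2}(size P) (leqnn (size P)) => m; elim: m P => [|m IH] P Pm P0 z0 Pz.
  by move: Pm; rewrite leqn0 size_poly_eq0 (negbTE P0).
have [P00|] := eqVneq P.[0] 0; last by exists P.
have /factor_theorem[P' PE] : root P 0 by apply/rootP.
rewrite subr0 in PE; have P'0 : P' != 0 by apply: contra_neq P0 => e; rewrite PE e mul0r.
apply: (IH P') => //; first by move: Pm; rewrite PE size_mulX.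
by move: Pz; rewrite PE rmorphM /= map_polyX hornerM hornerX => /eqP; rewrite mulf_eq0 (negbTE z0) orbF => /eqP.
Qed.

(* algebraic numbers integral at q *)
Definition qint (q : nat) z := exists2 s : nat, coprime q s & s%:R * z \in Aint.

Lemma Aint_natM (s : nat) z : z \in Aint -> s%:R * z \in Aint.
Proof. by move=> h; rewrite rpredM// Aint_Cnat// natr_nat. Qed.

Lemma qint1 q : qint q 1.
Proof. by exists 1%N; rewrite ?coprimen1// mulr1 Aint1. Qed.
Lemma qintB q z w : qint q z -> qint q w -> qint q (z - w).
Proof.
move=> [s cs hs] [t ct ht]; exists (s * t)%N; first by rewrite coprimeMr cs.
have -> : (s * t)%:R * (z - w) = t%:R * (s%:R * z) - s%:R * (t%:R * w) by rewrite natrM; ring.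
by rewrite rpredB// Aint_natM.
Qed.
Lemma qintM q z w : qint q z -> qint q w -> qint q (z * w).
Proof.
move=> [s cs hs] [t ct ht]; exists (s * t)%N; first by rewrite coprimeMr cs.
have -> : (s * t)%:R * (z * w) = (s%:R * z) * (t%:R * w) by rewrite natrM; ring.
by rewrite rpredM.
Qed.

Lemma qint_inv q : prime q -> ~ qint q (q%:R^-1).
Proof.
move=> q_pr [s cs hs]; have : (s%:R * q%:R^-1 : algC) \is a Num.int.
  by apply: Cint_rat_Aint hs; rewrite rpredM ?rpredV ?rpred_nat.
move=> /intrP[m hm]; have q0 : (q%:R : algC) != 0 by rewrite pnatr_eq0 -lt0n prime_gt0.
have : (s%:R : algC) = m%:~R * q%:R by rewrite -hm divfK.
rewrite !pmulrn -intrM => /intr_inj e.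
have : (q %| s)%N by rewrite -[q]/(`|q%:Z|%N) -[s]/(`|s%:Z|%N) e abszM dvdn_mull.
move=> qs; have := prime_gt1 q_pr; move: cs; rewrite /coprime (gcdn_idPl qs) => /eqP->.
by rewrite ltnn.
Qed.

Lemma place l lam : no_unity lam -> let L := rcons l lam in exists q V,
  [/\ prime q, (2 < q)%N, valring V & ~ V (q%:R)^-1] /\
  [/\ zring L `<=` V,
      (forall N, exists s : seq R, forall x, zring L x -> exists2 t, t \in s & V ((x - t) / q%:R ^+ N)) &
      (forall E, (0 < E)%N -> exists N, ~ V ((lam ^+ E - 1) / q%:R ^+ N))].
Proof.
move=> nu L; have rL : subring (zring L) by exact: zring_subring.
have [f hf [_ fu]] := hom_algC nu (sub1 rL) (oner_neq0 R).
have /choice[s hs] a : exists s : nat, (0 < s)%N /\ s%:R * f a \in Aint.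
  by have [s s0 hs] := Aint_multiple (f a); exists s.
(* The product makes q prime to every denominator [s a], the summand 2 makes it odd. *)
have [q qbig q_pr] := prime_above (\prod_(a <- L) s a + 2).
have q2 : (2 < q)%N by apply: leq_ltn_trans qbig; rewrite leq_addl.
have qs a : a \in L -> coprime q (s a).
  move=> aL; rewrite prime_coprime// gtnNdvd ?(hs a).1//.
  apply: leq_ltn_trans qbig; apply: leq_trans (leq_addr _ _).
  rewrite (big_rem a)//= leq_pmulr// prodn_gt0// => b; exact: (hs b).1.
have q0 : (q%:R : algC) != 0 by rewrite pnatr_eq0 -lt0n prime_gt0.
have Q0 : (q%:R : R) != 0 by rewrite pnatr_eq0 -lt0n prime_gt0.
have fq N : f (q%:R ^+ N) = q%:R ^+ N.
  rewrite (homX rL hf); last exact: sub_nat.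
  by have := hom_int rL hf q%:Z; rewrite -!pmulrn => ->.
have LQ N : zring L (q%:R ^+ N) by apply: subX => //; exact: sub_nat.
have fint x : zring L x -> qint q (f x).
  apply: (zring_hom_ind (qint1 q) (@qintB q) (@qintM q) hf) => a aL.
  by exists (s a); [exact: qs|exact: (hs a).2].
pose BB : set R := [set x | exists a N w, [/\ zring L a, x = a / q%:R ^+ N, qint q w & f a = w * q%:R ^+ N]].
have QN N : (q%:R ^+ N : R) != 0 by rewrite expf_neq0.
have rB : subring BB.
  split.
  - exists 1, 0%N, 1; split; rewrite ?expr0 ?divr1 ?mulr1//; [exact: sub1|exact: qint1|exact: hom1 hf].
  - move=> _ _ [a [N [w [La -> hw fa]]]] [b [M [v [Lb -> hv fb]]]].
    exists (a * q%:R ^+ M - b * q%:R ^+ N), (N + M)%N, (w - v); split.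
    + by apply: subB => //; exact: subM.
    + by rewrite exprD; field; rewrite !QN.
    + exact: qintB.
    + rewrite (homB hf) ?(homM hf)//; try exact: subM.
      by rewrite !fq fa fb exprD; ring.
  - move=> _ _ [a [N [w [La -> hw fa]]]] [b [M [v [Lb -> hv fb]]]].
    exists (a * b), (N + M)%N, (w * v); split.
    + exact: subM.
    + by rewrite exprD; field; rewrite !QN.
    + exact: qintM.
    + by rewrite (homM hf)// fa fb exprD; ring.
have BQ : ~ BB (q%:R)^-1.
  move=> [a [N [w [La e hw fa]]]]; apply: (qint_inv q_pr).
  have -> // : q%:R^-1 = w.
  have e2 : a * q%:R ^+ 1 = q%:R ^+ N.
    have -> : a = (q%:R)^-1 * q%:R ^+ N by rewrite e divfK.
    by rewrite expr1 mulrAC mulVf// mul1r.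
  have := congr1 f e2; rewrite (homM hf)// !fq fa expr1 => e3.
  have qN : (q%:R ^+ N : algC) != 0 by rewrite expf_neq0.
  apply: (mulIf q0); rewrite mulVf//; apply: (mulIf qN); rewrite mul1r -{1}e3; ring.
have [V [vV BV VQ]] := exists_valring q_pr rB BQ; have [rV vv] := vV.
have LV : zring L `<=` V.
  move=> x Lx; apply: BV; exists x, 0%N, (f x); split; rewrite ?expr0 ?divr1 ?mulr1//.
  exact: fint.
have ker x N : zring L x -> f x = 0 -> V (x / q%:R ^+ N).
  move=> Lx fx; apply: BV; exists x, N, 0; split => //; last by rewrite fx mul0r.
  by rewrite -(subrr 1); apply: qintB; exact: qint1.
exists q, V; split => //; split => //.
- move=> N.
  suff H l' : {subset l' <= L} -> zring l' `<=` zring L /\ exists s : seq R, forall x, zring l' x ->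
      exists2 t, t \in s & V ((x - t) / q%:R ^+ N).
    by have [_] := H L (fun=> id).
  elim: l' => [_|a l' IH sub].
    split; first by move=> _ [z _ <-]; exact: sub_int.
    exists [seq i%:R | i <- iota 0 (q ^ N)] => _ [z _ <-].
    have qN : (0 < q ^ N)%N by rewrite expn_gt0 prime_gt0.
    exists (`|(z %% (q ^ N)%:Z)%Z|%N)%:R.
      apply: map_f; rewrite mem_iota add0n /= -ltz_nat gez0_abs ?modz_ge0//; last by rewrite lt0r_neq0.
      by rewrite ltz_pmod.
    have -> : (`|(z %% (q ^ N)%:Z)%Z|%N)%:R = ((z %% (q ^ N)%:Z)%Z)%:~R :> R.
      by rewrite pmulrn gez0_abs// modz_ge0// lt0r_neq0.
    rewrite {1}(divz_eq z (q ^ N)%:Z) intrD addrK intrM -pmulrn natrX mulfK//.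
    exact: sub_int.
  have aL : a \in L by apply: sub; rewrite mem_head.
  have [sub' [t ht]] := IH (fun b bl => sub b (ltac:(by rewrite inE bl orbT))).
  have La : zring L a by exact: zring_gen.
  split.
    by move=> _ [p hp ->]; apply: sub_horner => // i; exact/sub'/hp.
  have rS := zring_subring l'.
  have [F Fm Fz] := Aint_monic (hs a).2.
  (* Modulo the kernel of f, y is a root of the monic integral F; modulo q^N, a equals t0 y, where
     t0 inverts [s a]. So a polynomial in a may be replaced by one in y of degree less than d, with
     coefficients taken from the finite list t. *)
  pose y := (s a)%:R * a; have Ly : zring L y by apply: subM => //; exact: sub_nat.
  have Fy : V ((map_poly intr F).[y] / q%:R ^+ N).
    apply: ker; first by apply: sub_horner => //; exact: spoly_int.
    rewrite (hom_horner_int F rL hf)// /y (homM hf)//; last exact: sub_nat.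
    by have := hom_int rL hf (s a)%:Z; rewrite -!pmulrn => ->.
  have yE : y = (s a)%:R * a by []; clearbody y.
  have [t0 [k tk]] : exists t0 k, (s a * t0 = k * q ^ N + 1)%N.
    have [t0 k e _] := egcdnP (q ^ N) (hs a).1.
    exists t0, k; rewrite mulnC e; congr (_ + _)%N.
    by apply/eqP; rewrite -/(coprime _ _) coprime_sym coprimeXl// qs.
  have Va := LV _ La; have Vy := LV _ Ly.
  pose d := size F; pose g (h : {ffun 'I_d -> 'I_(size t)}) := \sum_(i < d) nth 0 t (h i) * y ^+ i.
  exists [seq g h | h <- enum {ffun 'I_d -> 'I_(size t)}] => _ [p hp ->].
  have {}hp : spoly (zring l') p := hp.
  pose p' := \poly_(i < size p) (p`_i * t0%:R ^+ i).
  have hp' : spoly (zring l') p'.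
    move=> i; rewrite coef_poly; case: ifP => _; last exact: sub0.
    by apply: subM => //; apply: subX => //; exact: sub_nat.
  have p'y : p'.[y] = p.[t0%:R * y].
    by rewrite horner_poly horner_coef; apply: eq_bigr => i _; rewrite exprMn mulrA.
  have F0 : map_poly intr F != 0 :> {poly R}.
    by rewrite map_poly_eq0_id0 ?monic_neq0// (monicP Fm) oner_neq0.
  have lF : lead_coef (map_poly intr F : {poly R}) = 1.
    by rewrite lead_coef_map_inj ?(monicP Fm)//; exact: intr_inj.
  have sF : size (map_poly intr F : {poly R}) = d by rewrite size_map_inj_poly//; exact: intr_inj.
  have [k' [u [r [hu hr rd e]]]] := pseudo_div rS (spoly_int F rS) F0 hp'.
  rewrite lF expr1n scale1r sF in e rd.
  have hVp : spoly V p by move=> i; exact/LV/sub'/hp.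
  have hVu : spoly V u by move=> i; exact/LV/sub'/hu.
  have Vt0y : V (t0%:R * y) by apply: subM => //; exact: sub_nat.
  have [w Vw ew] := horner_diff rV hVp Va Vt0y.
  have /choice[h hh] (i : 'I_d) : exists j : 'I_(size t), V ((r`_i - nth 0 t j) / q%:R ^+ N).
    have [x xt hx] := ht _ (hr i); have xi : (index x t < size t)%N by rewrite index_mem.
    by exists (Ordinal xi); rewrite /= nth_index.
  exists (g (finfun h)); first by apply: map_f; rewrite mem_enum.
  have ry : r.[y] = \sum_(i < d) r`_i * y ^+ i by rewrite (@horner_coef_wide _ d)// ltnW.
  have -> : (p.[a] - g (finfun h)) / q%:R ^+ N =
     - (a * k%:R * w) + u.[y] * ((map_poly intr F).[y] / q%:R ^+ N) +
     \sum_(i < d) ((r`_i - nth 0 t (h i)) / q%:R ^+ N) * y ^+ i.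
    have e1 : p.[a] = (a - t0%:R * y) * w + u.[y] * (map_poly intr F).[y] + r.[y].
      by rewrite -ew -addrA -hornerM -hornerD -e p'y subrK.
    have e2 : a - t0%:R * y = - (a * k%:R) * q%:R ^+ N.
      have : ((s a * t0)%:R : R) = (k * q ^ N + 1)%:R by rewrite tk.
      rewrite natrM natrD natrM natrX => e2; rewrite yE.
      have -> : t0%:R * ((s a)%:R * a) = ((s a)%:R * t0%:R) * a by ring.
      by rewrite e2; ring.
    have e3 : \sum_(i < d) ((r`_i - nth 0 t (h i)) / q%:R ^+ N) * y ^+ i = (r.[y] - g (finfun h)) / q%:R ^+ N.
      rewrite ry /g -sumrB mulr_suml; apply: eq_bigr => i _; rewrite ffunE; ring.
    by rewrite e3 e1 e2; field; rewrite QN.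
  apply: subD => //; last first.
    by apply: sub_sum => // i _; apply: subM => //; exact: subX.
  apply: subD => //; last by apply: subM => //; exact: sub_horner.
  by apply: subN => //; do 2![apply: subM => //]; exact: sub_nat.
- move=> E E0; pose x := lam ^+ E - 1.
  have Ll : zring L lam by apply: zring_gen; rewrite mem_rcons mem_head.
  have Lx : zring L x by apply: subB => //; [exact: subX|exact: sub1].
  have fx : f x != 0.
    rewrite /x (homB hf); [|exact: subX|exact: sub1].
    by rewrite (homX rL hf)// (hom1 hf) subr_eq0 fu.
  (* A nonzero algebraic number satisfies an integral equation with nonzero constant term. If x were
     divisible in V by all powers of q, this constant term would be too, and 1/q would lie in V. *)
  have [c c0 hc] := Aint_multiple (f x).
  have [P Pm Pz] := Aint_monic hc.
  have cz : c%:R * f x != 0 by rewrite mulf_neq0// pnatr_eq0 -lt0n.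
  have [P' P'0 P'z] := int_root_unit (monic_neq0 Pm) cz Pz.
  pose y := c%:R * x; have Ly : zring L y by apply: subM => //; exact: sub_nat.
  have Py N : V ((map_poly intr P').[y] / q%:R ^+ N).
    apply: ker; first by apply: sub_horner => //; exact: spoly_int.
    rewrite (hom_horner_int P' rL hf)// /y (homM hf)//; last exact: sub_nat.
    by have := hom_int rL hf c%:Z; rewrite -!pmulrn => ->.
  have hVP : spoly V (map_poly intr P') by exact: spoly_int.
  have [w Vw ew] := horner_diff rV hVP (LV _ Ly) (sub0 rV).
  have P0 : (map_poly intr P' : {poly R}).[0] = (P'.[0])%:~R by rewrite -(rmorph0 intr) horner_map.
  rewrite subr0 P0 in ew; apply: contrapT => H; apply: VQ.
  have {}H N : V (x / q%:R ^+ N) by apply: contrapT => h; apply: H; exists N.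
  have {}H N : V ((P'.[0])%:~R / q%:R ^+ N).
    have -> : (P'.[0])%:~R / q%:R ^+ N = (map_poly intr P').[y] / q%:R ^+ N - c%:R * (x / q%:R ^+ N) * w.
      have -> : (P'.[0])%:~R = (map_poly intr P').[y] - y * w by rewrite -ew subKr.
      by rewrite /y; field; rewrite QN.
    by apply: subB => //; apply: subM => //; apply: subM => //; exact: sub_nat.
  set m := P'.[0] in P'0 H.
  have m0 : (0 < `|m|)%N by rewrite absz_gt0.
  have [m' cm' em] := pfactor_coprime q_pr m0; set k := logn q `|m| in em.
  have m'0 : (0 < m')%N by move: m0; rewrite em muln_gt0 => /andP[].
  have {}H : V (m'%:R / q%:R).
    have -> : m'%:R / q%:R = `|m|%:R / q%:R ^+ k.+1 :> R.
      by rewrite em natrM natrX exprS; field; rewrite Q0 QN.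
    have [e|e] : `|m|%:R = m%:~R :> R \/ `|m|%:R = - m%:~R :> R.
      by rewrite pmulrn; case: (m) => j /=; [left|right; rewrite NegzE mulrNz opprK].
    - by rewrite e.
    - by rewrite e mulNr; exact: subN.
  have [u v euv _] := egcdnP q m'0.
  have e1 : (u * m' = v * q + 1)%N by rewrite euv; congr (_ + _)%N; apply/eqP; rewrite -/(coprime _ _) coprime_sym.
  have -> : (q%:R)^-1 = u%:R * (m'%:R / q%:R) - v%:R :> R.
    have := congr1 (fun j : nat => j%:R : R) e1; rewrite natrM natrD natrM => e2.
    by rewrite mulrA e2; field; rewrite Q0.
  by apply: subB => //; [apply: subM => //|]; exact: sub_nat.
Qed.

End Place.

(** * Generation of cocompact groups by elements of bounded size *)

Section Generation.
Context {R : realType} {n : nat}.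
Implicit Types (u v w X Y Z : 'cV[R]_(1 + n)) (A : 'M[R]_(1 + n)) (D : set 'M[R]_(1 + n)).
Local Notation B := (@mink R n).

(* Move a point Y of the geodesic from e0 to A e0, at bounded distance from e0, back near e0. *)
Lemma disc_halve D r0 A : mx_subgroup D -> D `<=` lorentz -> cocpt D r0 -> D A ->
  8 * r0 <= A ord0 ord0 ->
  exists C, [/\ D C, C ord0 ord0 <= 1 + 8 * r0 ^+ 2 & (invmx C *m A) ord0 ord0 <= A ord0 ord0 / 2].
Proof.
move=> gD lD cD DA ha.
have lA := lD _ DA; have hO := hyp_e0 (R := R) (n := n).
have r1 : 1 <= r0.
  have [C DC h] := cD e0 hO.
  by apply: le_trans h; apply: hyp_tc1; apply: lor_hyp (lD _ DC) hO.
have hZ := lor_e0 lA; have tZ := tc_mul A; set Z := A *m e0 in hZ tZ.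
move: ha; rewrite -tZ; set a := tc Z; move=> ha.
(* y is the positive root of the equation [ye], which puts Y on the hyperboloid. As y a <= 4 r0, Y
   stays at bounded distance from [e0], while - B Y Z is about a / (8 r0): the factor 2 r0 of the
   triangle inequality still leaves at most a / 2. *)
pose x : R := (8 * r0)^-1; pose y : R := Num.sqrt (x ^+ 2 * a ^+ 2 + (1 - x ^+ 2)) - x * a.
have x0 : 0 < x by rewrite invr_gt0; lra.
have xr : x * r0 = 8^-1 by rewrite /x; field; lra.
have a8 : 8 <= a by lra.
have x1 : x <= 8^-1 by nra.
have ye : y ^+ 2 + 2 * x * a * y = 1 - x ^+ 2.
  have : (y + x * a) ^+ 2 = x ^+ 2 * a ^+ 2 + (1 - x ^+ 2).
    by rewrite subrK sqr_sqrtr//; nra.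
  by move=> e; rewrite -[RHS](addrK (x ^+ 2 * a ^+ 2)) (addrC (1 - _)) -e; ring.
have y0 : 0 < y.
  rewrite subr_gt0 -[X in X < _]ger0_norm ?mulr_ge0 ?(ltW x0)//; last lra.
  by rewrite -sqrtr_sqr ltr_sqrt; nra.
have ya : y * a <= 4 * r0.
  have h1 : 2 * (x * (a * y)) <= 1 by nra.
  have -> : y * a = 8 * r0 * (x * (a * y)) by rewrite /x; field; lra.
  nra.
clearbody y x.
pose Y := x *: e0 + y *: Z.
have OO : B e0 e0 = -1 :> R by case: hO.
have ZZ : B Z Z = -1 by case: hZ.
have OZ : B e0 Z = - a by rewrite mink_e0.
have hY : hyp Y.
  split; last by rewrite tcD !tcZ tc_e0 -/a; nra.
  by rewrite /Y !(minkDl, minkDr, minkZl, minkZr) (minkC Z) OO ZZ OZ; nra.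
have [C DC hC] := cD Y hY; have lC := lD _ DC.
have tY : tc Y = x + y * a by rewrite tcD !tcZ tc_e0 mulr1.
have YZ : B Y Z = - (x * a + y) by rewrite /Y !minkL OZ ZZ; ring.
have hCO := lor_hyp lC hO; have hCZ := lor_hyp lC hZ; have hCY := lor_hyp lC hY.
have tCY : 1 <= tc (C *m Y) by exact: hyp_tc1.
exists (invmx C); split; first exact: grV.
  rewrite lor_tcV// -tc_mul.
  have := hyp_tri hO hCY hCO; rewrite !mink_e0 lor_mink// (minkC Y) mink_e0 tY; nra.
rewrite invmxK -tc_mul -mulmxA -/Z.
have := hyp_tri hO hCY hCZ; rewrite !mink_e0 lor_mink// YZ => h; apply: le_trans (_ : 2 * r0 * (x * a + y) <= _).
  apply: le_trans (_ : 2 * tc (C *m Y) * (x * a + y) <= _); first lra.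
  rewrite ler_wpM2r//; nra.
have -> : 2 * r0 * (x * a + y) = 2 * (x * r0) * a + 2 * r0 * y by ring.
rewrite xr; nra.
Qed.

(** Repeated use of [disc_halve] ends at size R1. The conclusion is stated for any multiplicatively
    closed P, the form in which integrality of entries spreads from generators to the group. *)
Lemma disc_gen D r0 : mx_subgroup D -> D `<=` lorentz -> cocpt D r0 ->
  exists R1 : R, forall P : set 'M[R]_(1 + n), (forall A A', P A -> P A' -> P (A *m A')) ->
    (forall A, D A -> A ord0 ord0 <= R1 -> P A) -> D `<=` P.
Proof.
move=> gD lD cD; pose R1 := Num.max (8 * r0) (1 + 8 * r0 ^+ 2).
exists R1 => P PM PR.
have key k A : D A -> A ord0 ord0 <= 2 ^+ k * R1 -> P A.
  elim: k A => [|k IH] A DA hA; first by apply: PR; rewrite // -[R1]mul1r.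
  have [h|/ltW h] := leP (A ord0 ord0) R1; first exact: PR.
  have h8 : 8 * r0 <= A ord0 ord0 by apply: le_trans h; rewrite le_max lexx.
  have [C [DC C1 C2]] := disc_halve gD lD cD DA h8.
  rewrite -[A](mulKVmx (gr_unit gD DC)); apply: PM.
    by apply: PR => //; apply: le_trans C1 _; rewrite le_max lexx orbT.
  apply: IH; first by apply: grM => //; exact: grV.
  by apply: le_trans C2 _; rewrite ler_pdivrMr// mulrAC -exprSr.
have R10 : 0 < R1 by rewrite lt_max orbC ltr_pwDl// mulr_ge0// sqr_ge0.
move=> A DA; have [k hk] := geom_unbounded (A ord0 ord0 / R1) (ltr1n R 2).
by apply: (key k) => //; rewrite -ler_pdivrMr// ltW.
Qed.
End Generation.

(** * Finite subsets that decide linear conditions *)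

Lemma finite_rows (R : fieldType) N (S : 'rV[R]_N -> Prop) :
  exists k (A : 'M[R]_(k, N)), (forall i, S (row i A)) /\ forall s, S s -> (s <= A)%MS.
Proof.
pose Q r := `[< exists k (A : 'M[R]_(k, N)), (forall i, S (row i A)) /\ \rank A = r >].
have Q0 : exists r, Q r.
  by exists 0%N; apply/asboolP; exists 0%N, 0; split => [[]//|]; rewrite mxrank0.
have QN r : Q r -> (r <= N)%N by move=> /asboolP[k [A [_ <-]]]; exact: rank_leq_col.
have [r /asboolP[k [A [SA rA]]] rmax] := ex_maxnP Q0 QN.
exists k, A; split => // s Ss.
have le : (A <= col_mx s A)%MS by rewrite -addsmxE addsmxSr.
have : (col_mx s A <= A)%MS.
  rewrite -(geq_leqif (mxrank_leqif_sup le)) rA; apply: rmax; apply/asboolP.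
  exists (1 + k)%N, (col_mx s A); split => // i.
  case: (split_ordP i) => j ->; last by rewrite rowKd.
  by rewrite rowKu; have -> : row j s = s by apply/rowP => a; rewrite mxE ord1.
by rewrite col_mx_sub => /andP[].
Qed.

(** Commuting with K is a linear condition on x, so a finite subset with the same span suffices. *)
Lemma finite_commutant (R : fieldType) m (X : 'M[R]_m -> Prop) :
  exists s : seq 'M[R]_m, (forall x, x \in s -> X x) /\
    forall K, (forall x, x \in s -> K *m x = x *m K) -> forall x, X x -> K *m x = x *m K.
Proof.
have [k [A [SA hA]]] := finite_rows (fun v => X (vec_mx v)).
exists [seq vec_mx (row i A) | i <- enum 'I_k]; split; first by move=> x /mapP[i _ ->]; exact: SA.
move=> K hK x Xx.
have /submxP[c e] : (mxvec x <= A)%MS by apply: hA; rewrite /= mxvecK.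
have -> : x = \sum_i c ord0 i *: vec_mx (row i A).
  apply: (can_inj mxvecK); rewrite e mulmx_sum_row linear_sum; apply: eq_bigr => i _.
  by rewrite linearZ /= vec_mxK.
rewrite mulmx_sumr mulmx_suml; apply: eq_bigr => i _.
by rewrite -scalemxAr -scalemxAl hK//; apply: map_f; rewrite mem_enum.
Qed.

(** * Bases adapted to an axis *)

Section Basis.
Context {R : realType} {n : nat}.
Implicit Types (u v w X Y Z xi eta : 'cV[R]_(1 + n)).
Local Notation B := (@mink R n).

(** A vector orthogonal to xi, eta and the earlier ones exists by counting dimensions. Its square
    norm is positive because it is orthogonal to the point xi/2 + eta of the hyperboloid. *)
Lemma orthonormal_exists xi eta k : null xi -> null eta -> B xi eta = -1 -> (k < n)%N ->
  exists vs : nat -> 'cV[R]_(1 + n),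
    [/\ forall i j, (i < k)%N -> (j < k)%N -> B (vs i) (vs j) = (i == j)%:R,
        forall i, (i < k)%N -> B (vs i) xi = 0 & forall i, (i < k)%N -> B (vs i) eta = 0].
Proof.
move=> nx ne xe; elim: k => [|k IH] kn; first by exists (fun=> 0); split.
have [vs [h1 h2 h3]] := IH (ltnW kn).
pose es j := if j == k then xi else if j == k.+1 then eta else vs j.
pose N := \matrix_(i < 1 + n, j < k.+2) (lorentz_form *m es j) i ord0.
have [w w0 wN] := perp_exists N (kn : (k.+2 < 1 + n)%N).
have hw j : (j < k.+2)%N -> B w (es j) = 0.
  move=> jk; have := congr1 (fun M : 'rV[R]_(k.+2) => M ord0 (Ordinal jk)) wN; rewrite !mxE => e.
  by rewrite /mink -mulmxA mxE -[RHS]e; apply: eq_bigr => i _; rewrite [N _ _]mxE.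
have wx : B w xi = 0 by have := hw k; rewrite /es eqxx; apply; rewrite ltnW.
have we : B w eta = 0 by have := hw k.+1; rewrite /es eqn_leq ltnn /= eqxx; apply.
have wv j : (j < k)%N -> B w (vs j) = 0.
  move=> jk; have := hw j; rewrite /es !ltn_eqF ?(ltnW jk)//; last exact: ltnW.
  by apply; apply: ltnW; exact: ltnW.
have hX : hyp (2^-1 *: xi + eta).
  apply: hyp_end => //; first by apply: nullZ.
  by rewrite minkZl xe mulrN1.
have wX : B (2^-1 *: xi + eta) w = 0 by rewrite minkDl minkZl ![B _ w]minkC wx we mulr0 addr0.
have ww : 0 < B w w.
  rewrite lt_neqAle (perp_ge0 (hyp_causal hX) wX) andbT eq_sym.
  by apply: contra_neqN w0 => /eqP; exact: perp_eq0 hX wX.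
pose c := (Num.sqrt (B w w))^-1.
exists (fun j => if j == k then c *: w else vs j); split.
- move=> i j; rewrite (ltnS i k) (leq_eqVlt i k) (ltnS j k) (leq_eqVlt j k).
  case: eqP => [->|_] /= hi; case: eqP => [->|_] /= hj; rewrite ?eqxx.
  + by rewrite minkZl minkZr mulrA -invfM -expr2 sqr_sqrtr ?mulVf ?gt_eqF// ltW.
  + by rewrite minkZl wv// mulr0 gtn_eqF.
  + by rewrite minkC minkZl wv// mulr0 ltn_eqF.
  + exact: h1.
- move=> i; rewrite (ltnS i k) (leq_eqVlt i k); case: eqP => [_ _|_ /=]; last exact: h2.
  by rewrite minkZl wx mulr0.
- move=> i; rewrite (ltnS i k) (leq_eqVlt i k); case: eqP => [_ _|_ /=]; last exact: h3.
  by rewrite minkZl we mulr0.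
Qed.

(** The Gram relations make the n + 1 vectors [es] independent, so only 0 is orthogonal to all of
    them; this is applied to the difference of the two sides of the expansion. *)
Lemma adapted_basis xi eta : (0 < n)%N -> null xi -> null eta -> B xi eta = -1 ->
  exists vs : 'I_n.-1 -> 'cV[R]_(1 + n),
    [/\ forall i j, B (vs i) (vs j) = (i == j)%:R,
        forall i, B (vs i) xi = 0, forall i, B (vs i) eta = 0 &
        forall u, u = - B eta u *: xi - B xi u *: eta + \sum_i B (vs i) u *: vs i].
Proof.
move=> n0 nx ne xe; have ltn1 : (n.-1 < n)%N by rewrite ltn_predL.
have [vs [h1 h2 h3]] := orthonormal_exists nx ne xe ltn1.
exists (fun i => vs i); split => [i j|i|i|u]; [exact: h1|exact: h2|exact: h3|].
have B0 u' : B xi u' = 0 -> B eta u' = 0 -> (forall i, (i < n.-1)%N -> B (vs i) u' = 0) -> u' = 0.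
  move=> ux ue uv; apply/eqP; apply/negPn/negP => u0.
  pose es (j : 'I_(1 + n)) := if j == 0%N :> nat then xi else if j == n :> nat then eta else vs j.-1.
  pose P := \matrix_(i < 1 + n, j < 1 + n) es j i ord0.
  have es0 : es ord0 = xi by [].
  have esn : es ord_max = eta by rewrite /es /= (gtn_eqF n0) eqxx.
  have esv (j : 'I_(1 + n)) : j != ord0 -> j != ord_max -> es j = vs j.-1 /\ (j.-1 < n.-1)%N.
    move=> /negPf j0 /negPf jn; rewrite /es -!val_eqE /= in j0 jn *; rewrite j0 jn; split => //.
    by move: (ltn_ord j) j0 jn; case: (nat_of_ord j) => [|a] // ha _ /eqP an; lia.
  have uP : (lorentz_form *m u')^T *m P = 0.
    apply/matrixP => i j; rewrite ord1 !mxE.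
    transitivity (B u' (es j)).
      rewrite minkC /mink -mulmxA mxE; apply: eq_bigr => k _; rewrite [in RHS]mxE.
      by rewrite [P _ _]mxE [LHS]mulrC; congr (_ * _); rewrite mxE.
    have [->|j0] := eqVneq j ord0; first by rewrite es0 minkC.
    have [->|jn] := eqVneq j ord_max; first by rewrite esn minkC.
    by have [-> jl] := esv j j0 jn; rewrite minkC uv.
  have : \det P^T == 0.
    rewrite det_tr; apply/det0P; exists (lorentz_form *m u')^T => //.
    apply: contra u0 => /eqP/(congr1 trmx); rewrite trmxK trmx0 => /(congr1 (mulmx lorentz_form)).
    by rewrite mulmxA lformK mul1mx mulmx0 => ->.
  move=> /det0P[v v0 vP]; case/negP: v0; apply/eqP.
  have vs0 : \sum_j v ord0 j *: es j = 0.
    apply/matrixP => i j; rewrite ord1 summxE [RHS]mxE.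
    have := congr1 (fun M : 'rV[R]_(1 + n) => M ord0 i) vP; rewrite !mxE => e; rewrite -[RHS]e; apply: eq_bigr => k _.
    by rewrite (ord1 j) !mxE.
  have one w j : (forall k, k != j -> B w (es k) = 0) -> B w (es j) != 0 -> v ord0 j = 0.
    move=> hw /negPf wj; have := congr1 (B w) vs0; rewrite mink_sumr mink0r (bigD1 j)//= big1.
      by rewrite addr0 minkZr => /eqP; rewrite mulf_eq0 wj orbF => /eqP.
    by move=> k /hw e; rewrite minkZr e mulr0.
  have [xx _] := nx; have [ee _] := ne.
  apply/rowP => j; rewrite [RHS]mxE.
  have nm : (ord0 : 'I_(1 + n)) != ord_max by rewrite -val_eqE /= eq_sym -lt0n.
  have [->|j0] := eqVneq j ord0.
    apply: (one eta); last by rewrite es0 minkC xe oppr_eq0 oner_eq0.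
    move=> k k0; have [->|kn] := eqVneq k ord_max; first by rewrite esn.
    by have [-> kl] := esv k k0 kn; rewrite minkC h3.
  have [->|jn] := eqVneq j ord_max.
    apply: (one xi); last by rewrite esn xe oppr_eq0 oner_eq0.
    move=> k kn; have [->|k0] := eqVneq k ord0; first by rewrite es0.
    by have [-> kl] := esv k k0 kn; rewrite minkC h2.
  have [ej jl] := esv j j0 jn.
  apply: (one (vs j.-1)); last by rewrite ej h1// eqxx oner_eq0.
  move=> k kj; have [->|k0] := eqVneq k ord0; first by rewrite es0 h2.
  have [->|kn] := eqVneq k ord_max; first by rewrite esn h3.
  have [-> kl] := esv k k0 kn; rewrite h1//.
  suff -> : (j.-1 == k.-1) = false by [].
  apply/negP => /eqP e; case/negP: kj; rewrite -val_eqE /=; apply/eqP.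
  by move: j0 k0; rewrite -!val_eqE /=; lia.
have [xx _] := nx; have [ee _] := ne.
apply/eqP; rewrite -subr_eq0; apply/eqP; apply: B0.
- rewrite minkBr minkDr mink_sumr big1 => [|i _]; last by rewrite minkZr (minkC xi) h2 ?mulr0.
  by rewrite minkBr !minkZr xx xe; ring.
- rewrite minkBr minkDr mink_sumr big1 => [|i _]; last by rewrite minkZr (minkC eta) h3 ?mulr0.
  by rewrite minkBr !minkZr ee (minkC eta xi) xe; ring.
- move=> i hi; rewrite minkBr minkDr minkBr !minkZr h2// h3// !mulr0 subr0 add0r mink_sumr.
  rewrite (bigD1 (Ordinal hi))//= big1 => [|j ji]; first by rewrite minkZr h1// eqxx mulr1 addr0 subrr.
  rewrite minkZr h1// eq_sym; move: ji; rewrite -val_eqE /= => /negPf ->; exact: mulr0.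
Qed.
End Basis.

(** * Congruence subgroups relative to an axis *)

Lemma ord_avoid d (a b : 'I_d) : (2 < d)%N -> exists c : 'I_d, c != a /\ c != b.
Proof.
move=> d2; have [[c hc]|h] := pselect (exists c : 'I_d, c \notin [:: a; b]).
  by exists c; move: hc; rewrite !inE negb_or => /andP[].
have : (size (enum 'I_d) <= size [:: a; b])%N.
  apply: uniq_leq_size; first exact: enum_uniq.
  by move=> c _; apply/negPn/negP => hc; apply: h; exists c.
by rewrite size_enum_ord leqNgt d2.
Qed.

Lemma finite_by (T : finType) (R : realType) m (A : set 'M[R]_m) (f : 'M[R]_m -> T) :
  (forall x y, A x -> A y -> f x = f y -> x = y) -> finite_set A.
Proof.
move=> inj; pose h t := get [set x | A x /\ f x = t].
apply: (@sub_finite_set _ _ [set` codom h]); last exact: finite_seq.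
move=> x Ax /=; apply/codomP; exists (f x).
have [] : [set y | A y /\ f y = f x] (h (f x)) by apply: (@getI _ _ x).
by move=> Ah e; apply: inj.
Qed.

(** The scalars form an arbitrary set V, so that the same lemmas serve for modules over a valuation
    ring and, with [setT], for real subspaces. *)
Definition vmod {R : realType} {m} (V : set R) (W : set 'M[R]_m) :=
  [/\ W 0, forall x Z, V x -> W Z -> W (x *: Z) & forall Z Z', W Z -> W Z' -> W (Z + Z')].

Section Adapted.
Context {R : realType} {n : nat}.
Implicit Types (u v w : 'cV[R]_(1 + n)) (A M N Z K : 'M[R]_(1 + n)) (V : set R).
Local Notation B := (@mink R n).
Variables (xi eta : 'cV[R]_(1 + n)) (vs : 'I_n.-1 -> 'cV[R]_(1 + n)).
Definition adapted := [/\ null xi, null eta, B xi eta = -1, (3 < n)%N &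
  [/\ forall i j, B (vs i) (vs j) = (i == j)%:R,
        forall i, B (vs i) xi = 0, forall i, B (vs i) eta = 0 &
        forall u, u = - B eta u *: xi - B xi u *: eta + \sum_i B (vs i) u *: vs i]].
Hypothesis ad0 : adapted.
Let xx : B xi xi = 0. Proof. by case: ad0 => -[]. Qed.
Let ee : B eta eta = 0. Proof. by case: ad0 => _ []. Qed.
Let xe : B xi eta = -1. Proof. by case: ad0. Qed.
Let ex : B eta xi = -1. Proof. by rewrite minkC. Qed.
Let n3 : (3 < n)%N. Proof. by case: ad0. Qed.
Let vv i j : B (vs i) (vs j) = (i == j)%:R. Proof. by case: ad0 => _ _ _ _ []. Qed.
Let vx i : B (vs i) xi = 0. Proof. by case: ad0 => _ _ _ _ []. Qed.
Let ve i : B (vs i) eta = 0. Proof. by case: ad0 => _ _ _ _ []. Qed.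
Let xv i : B xi (vs i) = 0. Proof. by rewrite minkC. Qed.
Let ev i : B eta (vs i) = 0. Proof. by rewrite minkC. Qed.
Let dec u : u = - B eta u *: xi - B xi u *: eta + \sum_i B (vs i) u *: vs i.
Proof. by case: ad0 => _ _ _ _ []. Qed.

(** The bracket of Z with p ^ v_k is p ^ (al v_k + Z v_k). Brackets with v_a ^ v_b isolate one
    coefficient t of it, and division by the unit t leaves p ^ v_b. Three different indices are used
    in this, whence n > 3. *)
Lemma root_half V (NN : set 'M[R]_(1 + n)) p Z al : vmod V NN -> (forall l, B (vs l) p = 0) ->
  (forall a b Z, NN Z -> NN (ad (wedge (vs a) (vs b)) Z)) ->
  (forall k Z, NN Z -> NN (ad (wedge p (vs k)) Z)) -> subring V ->
  NN Z -> skew Z -> Z *m p = al *: p ->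
  (al != 0 /\ V al^-1) \/ (exists l k, B (vs l) (Z *m vs k) != 0 /\ V (B (vs l) (Z *m vs k))^-1) ->
  forall l, NN (wedge p (vs l)).
Proof.
move=> [N0 NZ ND] vp hvv hpv rV NNZ sZ Zp unit.
have V1 : V (-1) by apply: subN => //; exact: sub1.
have act a b w : NN (wedge p w) -> NN (wedge p (B (vs b) w *: vs a - B (vs a) w *: vs b)).
  move=> /(hvv a b); rewrite ad_wedge; last exact: wedge_skew.
  by rewrite !wedgeE !vp !scale0r subrr -[X in wedge X w](scale0r 0) wedgeZl scale0r add0r.
have st k : NN (wedge p (al *: vs k + Z *m vs k)).
  have := NZ _ _ V1 (hpv k _ NNZ); rewrite scaleN1r /ad opprB => h.
  suff -> : wedge p (al *: vs k + Z *m vs k) = Z *m wedge p (vs k) - wedge p (vs k) *m Z by [].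
  by rewrite -/(ad Z (wedge p (vs k))) ad_wedge// Zp wedgeZl wedgeDr wedgeZr.
have d2 : (2 < n.-1)%N by move: n3; case: (n) => //.
(* On the diagonal Z contributes 0 by skewness and the coefficient is al; off the diagonal al
   contributes 0 and the coefficient is an entry of Z. *)
have [k [m [tm Vt]]] : exists k m, let t := B (vs m) (al *: vs k + Z *m vs k) in t != 0 /\ V t^-1.
  case: unit => [[a0 Va]|[m [k [m0 Vm]]]].
    have d0 : (0 < n.-1)%N by apply: leq_trans d2.
    exists (Ordinal d0), (Ordinal d0); rewrite /= minkDr minkZr vv eqxx mulr1 minkC.
    by rewrite -(minkC (vs _)) skew_self// addr0.
  exists k, m; rewrite /= minkDr minkZr vv.
  case: (eqVneq m k) m0 Vm => [->|_]; first by rewrite skew_self// eqxx.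
  by rewrite mulr0 add0r.
set t := B _ _ in tm Vt; set w := _ + _ in t tm Vt *.
have far b : b != m -> NN (wedge p (vs b)).
  move=> bm; have [a [ab am]] := ord_avoid b m d2.
  have /(act b a) := act a m _ (st k); rewrite -/w -/t.
  rewrite !minkBr !minkZr !vv eqxx (negPf am) (eq_sym b a) (negPf ab) (negPf bm).
  rewrite !mulr0 !subr0 mulr1 scale0r subr0 => /(NZ _ _ Vt).
  by rewrite -wedgeZr scalerA mulVf// scale1r.
move=> l; have [->|] := eqVneq l m; last exact: far.
have [a [am _]] := ord_avoid m m d2.
have := act m a _ (far a am).
by rewrite !vv eqxx eq_sym (negPf am) scale0r subr0 scale1r.
Qed.

Definition bs := [:: xi, eta & [seq vs i | i <- enum 'I_n.-1]].
Lemma bs_cases u : u \in bs -> [\/ u = xi, u = eta | exists i, u = vs i].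
Proof.
by rewrite !inE => /orP[/eqP|/orP[/eqP|/mapP[i _ ->]]]; [constructor 1|constructor 2|constructor 3; exists i].
Qed.
Lemma bs_xi : xi \in bs. Proof. exact: mem_head. Qed.
Lemma bs_eta : eta \in bs. Proof. by rewrite !inE eqxx orbT. Qed.
Lemma bs_vs i : vs i \in bs.
Proof. by rewrite 2!inE map_f ?orbT// mem_enum. Qed.

(** The entries of M in the adapted basis, read off through B, all lie in c V: [cm V 1] is
    integrality and [cm V f] is congruence to 0 modulo f. *)
Definition cm V (c : R) M := forall u w, u \in bs -> w \in bs -> V (B u (M *m w) / c).

Lemma cmD V c M N : subring V -> cm V c M -> cm V c N -> cm V c (M + N).
Proof. by move=> rV h h' u w ub wb; rewrite mulmxDl minkDr mulrDl; apply: subD; auto. Qed.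
Lemma cmZ V c x M : subring V -> V x -> cm V c M -> cm V c (x *: M).
Proof. by move=> rV Vx h u w ub wb; rewrite -scalemxAl minkZr -mulrA; apply: subM; auto. Qed.
Lemma cmN V c M : subring V -> cm V c M -> cm V c (- M).
Proof. by move=> rV h; rewrite -scaleN1r; apply: cmZ => //; apply: subN => //; exact: sub1. Qed.
Lemma cmB V c M N : subring V -> cm V c M -> cm V c N -> cm V c (M - N).
Proof. by move=> rV h h'; apply: cmD => //; exact: cmN. Qed.
Lemma cmC V c c' M : subring V -> c != 0 -> V (c / c') -> cm V c M -> cm V c' M.
Proof.
move=> rV c0 cc h u w ub wb; have -> : B u (M *m w) / c' = B u (M *m w) / c * (c / c').
  by rewrite mulrA divfK.
by apply: subM; auto.
Qed.

Lemma cmM V a b M N : subring V -> cm V a M -> cm V b N -> cm V (a * b) (M *m N).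
Proof.
move=> rV h h' u w ub wb; rewrite -mulmxA [N *m w]dec !mulmxDr mulmx_sumr !minkDr mink_sumr.
rewrite mulmxN minkNr -!scalemxAr !minkZr.
have t x e : x \in bs -> e \in bs -> V (B x (N *m w) * B u (M *m e) / (a * b)).
  move=> xb eb; have -> : B x (N *m w) * B u (M *m e) / (a * b) =
      (B x (N *m w) / b) * (B u (M *m e) / a) by rewrite invfM; ring.
  by apply: subM; auto.
rewrite !mulrDl mulr_suml; apply: subD => //; last by apply: sub_sum => // i _; rewrite -scalemxAr minkZr; apply: t; exact: bs_vs.
by rewrite !mulNr; apply: subD => //; apply: subN => //; apply: t; rewrite ?bs_xi ?bs_eta.
Qed.

Lemma cm1 V : subring V -> cm V 1 1%:M.
Proof.
move=> rV u w /bs_cases hu /bs_cases hw; rewrite mul1mx divr1.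
have V0 := sub0 rV; have V1 := sub1 rV; have VN := subN rV V1.
by case: hu hw => [->|->|[i ->]] [->|->|[j ->]]; rewrite ?xx ?ee ?xe ?ex ?vx ?ve ?xv ?ev//
  vv; case: eqP.
Qed.

Lemma cm_outer V a b : subring V -> a \in bs -> b \in bs -> cm V 1 (a *m (b^T *m lorentz_form)).
Proof.
move=> rV ab bb u w ub wb; rewrite outer_act minkZr divr1; apply: subM => //.
  by have := cm1 rV bb wb; rewrite mul1mx divr1.
by have := cm1 rV ub ab; rewrite mul1mx divr1.
Qed.

Lemma cm_lorV V c A : lorentz A -> cm V c A -> cm V c (invmx A).
Proof. by move=> lA h u w ub wb; rewrite minkC lor_adj//; exact: h. Qed.

Lemma cm_conj V c A M : subring V -> lorentz A -> cm V 1 A -> cm V c M ->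
  cm V c (A *m M *m invmx A).
Proof.
move=> rV lA cA cM; rewrite -[c]mulr1 -[X in X * 1]mul1r.
by apply: cmM => //; [exact: cmM|exact: cm_lorV].
Qed.

(** The infinitesimal translation along the axis. A matrix commuting with it has both ends as
    eigenvectors ([ad_axD0]). *)
Definition axD := wedge eta xi.
Lemma axD_xi : axD *m xi = xi. Proof. by rewrite /axD wedgeE xx ex scale0r scaleN1r opprK add0r. Qed.
Lemma axD_eta : axD *m eta = - eta. Proof. by rewrite /axD wedgeE ee xe scale0r scaleN1r subr0. Qed.
Lemma cm_axD V : subring V -> cm V 1 axD.
Proof. by move=> rV; rewrite /axD wedge_unlock; apply: cmB => //; apply: cm_outer; rewrite ?bs_xi ?bs_eta. Qed.

Lemma ext_bs M N : (forall u, u \in bs -> M *m u = N *m u) -> M = N.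
Proof.
move=> h; apply: mulmx_ext => u; rewrite [u]dec !mulmxDr !mulmxN !mulmx_sumr -!scalemxAr.
rewrite !h ?bs_xi ?bs_eta//; congr (_ + _); apply: eq_bigr => i _.
by rewrite -!scalemxAr h ?bs_vs.
Qed.

Lemma ad_axD0 A : ad axD A = 0 -> exists a b, A *m xi = a *: xi /\ A *m eta = b *: eta.
Proof.
move=> /eqP; rewrite subr_eq0 => /eqP e.
exists (- B eta (A *m xi)), (- B xi (A *m eta)); split.
  have := congr1 (mulmx^~ xi) e; rewrite -!mulmxA axD_xi {1}/axD wedgeE => e1.
  have := congr1 (B xi) e1; rewrite !(minkBr, minkZr) xx xe mulr0 subr0 mulrN1 => e2.
  have x0 : B xi (A *m xi) = 0 by lra.
  by rewrite -[LHS]e1 x0 scale0r sub0r scaleNr.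
have := congr1 (mulmx^~ eta) e; rewrite -!mulmxA axD_eta {1}/axD wedgeE mulmxN => e1.
have := congr1 (B eta) e1; rewrite !(minkBr, minkZr, minkNr) ee ex mulr0 mulrN1 => e2.
have x0 : B eta (A *m eta) = 0 by lra.
by rewrite -[LHS]opprK -e1 x0 scale0r subr0 scaleNr.
Qed.

Lemma scalar_centralizer K : lorentz K ->
  (forall l, K *m wedge xi (vs l) = wedge xi (vs l) *m K) ->
  (forall l, K *m wedge eta (vs l) = wedge eta (vs l) *m K) -> K = 1%:M.
Proof.
move=> lK hx he; have d0 : (0 < n.-1)%N by move: n3; case: (n) => // -[].
have sq p q l : B p p = 0 -> B p q = -1 -> B (vs l) p = 0 -> B (vs l) q = 0 ->
    K *m wedge p (vs l) = wedge p (vs l) *m K ->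
    K *m vs l = wedge p (vs l) *m (K *m q) /\ K *m p = - B p (K *m q) *: p.
  move=> pp pq lp lq hK.
  have e1 : K *m vs l = wedge p (vs l) *m (K *m q).
    by rewrite mulmxA -hK -mulmxA wedgeE lq pq scale0r sub0r scaleN1r opprK.
  split => //; have e2 : K *m p = wedge p (vs l) *m (K *m vs l).
    by rewrite mulmxA -hK -mulmxA wedgeE vv eqxx (minkC p) lp scale0r subr0 scale1r.
  rewrite e2 e1 !wedgeE minkBr !minkZr minkBr !minkZr lp vv eqxx (minkC p (vs l)) lp pp.
  by rewrite !mulr0 mulr1 sub0r subrr scale0r subr0.
have [_ kx] := sq xi eta (Ordinal d0) xx xe (vx _) (ve _) (hx _).
have [_ ke] := sq eta xi (Ordinal d0) ee ex (ve _) (vx _) (he _).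
set s := - B xi _ in kx.
have {}ke : K *m eta = s *: eta.
  rewrite ke; congr (_ *: _); rewrite kx minkZr ex mulrN1 opprK /s ke minkZr xe mulrN1 kx minkZr ex.
  by rewrite mulrN1 !opprK.
have kv l : K *m vs l = s *: vs l.
  have [-> _] := sq xi eta l xx xe (vx _) (ve _) (hx _).
  by rewrite ke -scalemxAr wedgeE ve xe scale0r sub0r scaleN1r opprK.
have Ks : K = s%:M.
  by apply: ext_bs => u /bs_cases[->|->|[l ->]]; rewrite mul_scalar_mx.
have s0 : 0 < s by case: lK => _; rewrite Ks mxE eqxx.
have : B (K *m xi) (K *m eta) = -1 by rewrite lor_mink.
rewrite kx ke minkZl minkZr xe => e; rewrite Ks; congr (_%:M).
nra.
Qed.

End Adapted.

(** Since 1/f is not in V, f has positive valuation, and so does f s. Hence a + f s has the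
    valuation of a, which is at most 0. *)
Lemma val_unit (R : realType) (V : set R) (a f s : R) : valring V -> a != 0 -> V a^-1 -> V s ->
  f != 0 -> ~ V f^-1 -> a + f * s != 0 /\ V (a + f * s)^-1.
Proof.
move=> [rV vV] a0 Va Vs f0 nf; set y := a + f * s.
have [y0|y0] := eqVneq y 0.
  case: nf; have -> : f^-1 = - s * a^-1.
    have e : a = - (f * s) by rewrite -[RHS]add0r -y0 /y addrK.
    by rewrite e invrN mulrNN -[LHS]mulr1 -(divff (x := f * s)) -?[f * s == 0]oppr_eq0 -?e//; field; apply/andP; split => //; apply: contra_neq a0 => s0; rewrite e s0 mulr0 oppr0.
  by apply: subM => //; apply: subN.
split => //; have [//|Vy] := vV y^-1; rewrite invrK in Vy.
have ea : a = y - f * s by rewrite addrK.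
have ay : 1 - f / y * s = a / y by rewrite ea; move: y0; clearbody y => y0; field.
have [h|h] := vV (f / y).
  have -> : y^-1 = a^-1 * (1 - f / y * s).
    by rewrite ay mulrA mulVf// mul1r.
  by apply: subM => //; apply: subB => //; [exact: sub1|exact: subM].
case: nf; have -> : f^-1 = a^-1 * ((f / y)^-1 - s).
  have -> : (f / y)^-1 - s = a / f by rewrite ea; move: y0; clearbody y => y0; field; exact/andP.
  by rewrite mulrA mulVf// mul1r.
by apply: subM => //; exact: subB.
Qed.

Lemma val_sq (R : realType) (V : set R) (a : R) : valring V -> V (a ^+ 2) -> V a.
Proof.
move=> [rV vV] V2; have [//|Va] := vV a.
have [->|a0] := eqVneq a 0; first exact: sub0.
by have -> : a = a ^+ 2 * a^-1; [rewrite expr2 mulfK|exact: subM].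
Qed.

(** * The tile and the transformations normalising it *)

Section Tile.
Context {R : realType} {n : nat}.
Implicit Types (u v w : 'cV[R]_(1 + n)) (A M N Z K x : 'M[R]_(1 + n)).
Local Notation B := (@mink R n).
Variables (G Lam : set 'M[R]_(1 + n)) (r0 : R).
Hypotheses (dG : disc G) (cG : cocpt G r0).
Hypothesis fG : forall A X, G A -> hyp X -> A *m X = X -> A = 1%:M.
Hypotheses (dL : disc Lam) (GL : G `<=` Lam).
Hypothesis maxL : forall L', disc L' -> Lam `<=` L' -> L' `<=` Lam.
Variables (xi eta : 'cV[R]_(1 + n)) (vs : 'I_n.-1 -> 'cV[R]_(1 + n)) (V : set R).
Hypothesis ad0 : adapted xi eta vs.
Local Notation bs := (bs xi eta vs).
Local Notation cm := (cm xi eta vs V).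
Hypotheses (vV : valring V) (two : V 2^-1) (LamV : forall A, Lam A -> cm 1 A).
Hypothesis AD : forall u w, u \in bs -> w \in bs -> exists l : seq (R * 'M[R]_(1 + n)),
  (forall p, p \in l -> V p.1 /\ G p.2) /\
  forall M, ad (wedge u w) M = \sum_(p <- l) p.1 *: (p.2 *m M *m invmx p.2).
Variables (x0 : 'M[R]_(1 + n)) (f mu : R).
Hypotheses (cx0 : core G Lam x0) (x0x : x0 *m xi = mu *: xi) (x0e : x0 *m eta = mu^-1 *: eta).
Hypotheses (f0 : f != 0) (nf : ~ V f^-1) (fx0 : cm f (x0 - 1%:M)).
Hypothesis fu : exists u w, [/\ u \in bs, w \in bs & B u ((x0 - 1%:M) *m w) = f].
Let rV : subring V. Proof. by case: vV. Qed.
Let gG : mx_subgroup G. Proof. by case: dG. Qed.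
Let lG : G `<=` lorentz. Proof. by case: dG. Qed.
Let gL : mx_subgroup Lam. Proof. by case: dL. Qed.
Let lL : Lam `<=` lorentz. Proof. by case: dL. Qed.
Let n3 : (3 < n)%N. Proof. by case: ad0. Qed.
Let gC : mx_subgroup (core G Lam). Proof. exact (core_group dG dL). Qed.
Let CL : core G Lam `<=` Lam. Proof. by move=> x /(core_sub dL)/GL. Qed.
Let lC : core G Lam `<=` lorentz. Proof. by move=> x /CL/lL. Qed.

Definition principal : set 'M[R]_(1 + n) := [set x | core G Lam x /\ cm f (x - 1%:M)].
(* ad (axD xi eta) x collects the entries of x that move the axis: those are required to be divisible by f. *)
Definition tile : set 'M[R]_(1 + n) := [set x | core G Lam x /\ cm f (ad (axD xi eta) x)].

Lemma cm_inv1 x : core G Lam x -> cm f (x - 1%:M) -> cm f (invmx x - 1%:M).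
Proof.
move=> cx h; have -> : invmx x - 1%:M = - ((x - 1%:M) *m invmx x).
  by rewrite mulmxBl mul1mx mulmxV ?(gr_unit gC cx)// opprB.
apply: cmN => //; rewrite -[f]mulr1; apply: (cmM ad0) => //.
by apply: LamV; apply: CL; apply: grV gC cx.
Qed.

Lemma principal_conj A x : Lam A -> principal x -> principal (A *m x *m invmx A).
Proof.
move=> LA [cx fx]; split; first exact (core_normal dL LA cx).
have -> : A *m x *m invmx A - 1%:M = A *m (x - 1%:M) *m invmx A.
  by rewrite mulmxBr mulmxBl mulmx1 mulmxV// (gr_unit gL LA).
by apply: (cm_conj ad0) => //; [exact: lL|exact: LamV].
Qed.

Lemma principal_tile : principal `<=` tile.
Proof.
move=> x [cx fx]; split => //.
have -> : ad (axD xi eta) x = ad (axD xi eta) (x - 1%:M).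
  by rewrite /ad mulmxBr mulmxBl mulmx1 mul1mx opprB addrA subrK.
have h := cm_axD ad0 rV.
by apply: cmB => //; [rewrite -[f]mul1r|rewrite -[f]mulr1]; apply: (cmM ad0).
Qed.

Lemma tile_group : mx_subgroup tile.
Proof.
have h := cm_axD ad0 rV.
split.
- by apply: principal_tile; split; [exact: gr1 gC|rewrite subrr => u w _ _; rewrite mul0mx mink0r mul0r; exact: sub0].
- move=> x y [cx fx] [cy fy]; split; first exact: grM.
  have -> : ad (axD xi eta) (x *m y) = ad (axD xi eta) x *m y + x *m ad (axD xi eta) y.
    by rewrite /ad mulmxBl mulmxBr !mulmxA addrA subrK.
  by apply: cmD => //; [rewrite -[f]mulr1|rewrite -[f]mul1r]; apply: (cmM ad0) => //; apply/LamV/CL.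
- move=> x [cx fx]; have ux := gr_unit gC cx; split => //; split; first exact: grV.
  have -> : ad (axD xi eta) (invmx x) = - (invmx x *m ad (axD xi eta) x *m invmx x).
    by rewrite /ad mulmxBr mulmxBl !mulmxA mulVmx// mul1mx -(mulmxA _ x) mulmxV// mulmx1 opprB.
  have c1 : cm 1 (invmx x) by apply: LamV; apply: CL; exact: grV gC cx.
  by apply: cmN => //; rewrite -[f]mulr1 -[X in X * 1]mul1r; do 2! apply: (cmM ad0) => //.
Qed.

(** The V-module generated by the matrices (x - 1)/f with x in the principal congruence subgroup,
    given as an intersection: a V-linear property of its elements is proved by instantiating W with
    the module of all matrices having that property. *)
Definition congr_span Z := forall W, vmod V W ->
  (forall x, principal x -> W (f^-1 *: (x - 1%:M))) -> W Z.

Lemma congr_span_mod : vmod V congr_span.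
Proof.
split=> [W [] //|x Z Vx hZ W mW hW|Z Z' h h' W mW hW]; have [W0 WZ WD] := mW.
  by apply: WZ => //; exact: hZ.
by apply: WD; [exact: h|exact: h'].
Qed.

Lemma congr_span_conj A Z : Lam A -> congr_span Z -> congr_span (A *m Z *m invmx A).
Proof.
move=> LA hZ W [W0 WZ WD] hW.
apply: (hZ [set Z | W (A *m Z *m invmx A)]).
  split => [|x Z' Vx h|Z1 Z2 h1 h2] /=; first by rewrite mulmx0 mul0mx.
    by rewrite -scalemxAr -scalemxAl; exact: WZ.
  by rewrite mulmxDr mulmxDl; exact: WD.
move=> x px /=; rewrite -scalemxAr -scalemxAl.
have -> : A *m (x - 1%:M) *m invmx A = A *m x *m invmx A - 1%:M.
  by rewrite mulmxBr mulmxBl mulmx1 mulmxV// (gr_unit gL LA).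
by apply: hW; exact: principal_conj.
Qed.

Lemma congr_span_ad u w Z : u \in bs -> w \in bs -> congr_span Z -> congr_span (ad (wedge u w) Z).
Proof.
move=> ub wb hZ; have [l [hl ->]] := AD ub wb; have [h0 h1 h2] := congr_span_mod.
rewrite big_seq; elim/big_ind: _ => // p /hl[Vp Gp].
by apply: h1 => //; apply: congr_span_conj => //; exact: GL.
Qed.

(** The skew counterpart of (x0 - 1)/f: it lies in so(n,1) and is congruent to 2 (x0 - 1)/f modulo
    f. As 2 is invertible and (x0 - 1)/f has an entry equal to 1, some entry of Z0 has its inverse
    in V. *)
Let Z0 := f^-1 *: (x0 - invmx x0).
Let al := f^-1 * (mu - mu^-1).

Lemma mu_neq0 : mu != 0.
Proof.
apply: contra_not_neq nf => m0; have [[xx tx] _ _ _ _] := ad0.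
have := gr_unit gC cx0 => ux.
have : xi = 0 by rewrite -[xi](mulKmx ux) x0x m0 scale0r mulmx0.
by move=> h; move: tx; rewrite h /tc mxE ltxx.
Qed.

Lemma x0Vx : invmx x0 *m xi = mu^-1 *: xi.
Proof.
have := gr_unit gC cx0 => ux; apply: (can_inj (mulKmx ux)).
by rewrite mulKVmx// -scalemxAr x0x scalerA mulVf ?scale1r// mu_neq0.
Qed.

Lemma x0Ve : invmx x0 *m eta = mu *: eta.
Proof.
have := gr_unit gC cx0 => ux; apply: (can_inj (mulKmx ux)).
by rewrite mulKVmx// -scalemxAr x0e scalerA mulfV ?scale1r// mu_neq0.
Qed.

Lemma Z0_skew : skew Z0.
Proof.
have l0 := lC cx0.
move=> u w; rewrite /Z0 -!scalemxAl !mulmxBl minkZl minkZr minkBl minkBr lor_adj//.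
have -> : B (x0 *m u) w = B u (invmx x0 *m w) by rewrite minkC -lor_adj// minkC.
ring.
Qed.

Lemma Z0x : Z0 *m xi = al *: xi.
Proof. by rewrite /Z0 -scalemxAl mulmxBl x0x x0Vx -scalerBl scalerA. Qed.
Lemma Z0e : Z0 *m eta = (- al) *: eta.
Proof. by rewrite /Z0 -scalemxAl mulmxBl x0e x0Ve -scalerBl scalerA /al -mulrN opprB. Qed.

Lemma x0_principal : principal x0. Proof. by split. Qed.
Lemma x0V_principal : principal (invmx x0).
Proof. by split; [exact: grV gC cx0|exact: cm_inv1]. Qed.

Lemma Z0_split : Z0 = f^-1 *: (x0 - 1%:M) + (-1) *: (f^-1 *: (invmx x0 - 1%:M)).
Proof. by rewrite scalerA mulN1r scaleNr -scalerBr opprB addrA subrK. Qed.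

Lemma Z0_span : congr_span Z0.
Proof.
have V1 : V (-1) by apply: subN => //; exact: sub1.
rewrite Z0_split => W [W0 WZ WD] hW; apply: WD; first exact: hW x0_principal.
by apply: WZ => //; exact: hW x0V_principal.
Qed.

Lemma Z0_unit : exists u w, [/\ u \in bs, w \in bs, B u (Z0 *m w) != 0 & V (B u (Z0 *m w))^-1].
Proof.
have [u [w [ub wb fE]]] := fu; exists u, w.
pose Y := f^-1 *: (x0 - 1%:M).
have ux := gr_unit gC cx0.
have -> : Z0 = 2 *: Y + Y *m (invmx x0 - 1%:M).
  rewrite /Y -scalemxAl mulmxBr mulmx1 mulmxBl mul1mx mulmxV// /Z0 scalerA mulrC -scalerA -scalerDr.
  congr (_ *: _); rewrite scaler_nat mulr2n; apply/matrixP => i j; rewrite !mxE; ring.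
have cY : cm 1 Y.
  by move=> a b ha hb; rewrite /Y -scalemxAl minkZr divr1 mulrC; exact: fx0.
have h : V (B u (Y *m (invmx x0 - 1%:M) *m w) / f).
  by rewrite -[f]mul1r; apply: (cmM ad0) => //; apply: cm_inv1.
set s := _ / f in h; have e1 : B u (Y *m (invmx x0 - 1%:M) *m w) = f * s by rewrite /s mulrC divfK.
have e2 : B u (Y *m w) = 1 by rewrite /Y -scalemxAl minkZr fE mulVf.
rewrite mulmxDl minkDr -scalemxAl minkZr e2 e1 mulr1.
have [] := @val_unit R V 2 f s vV _ two h f0 nf; first by rewrite pnatr_eq0.
by [].
Qed.

(** Z0 scales xi and eta by al and - al; with skewness this kills its entries between the axis and
    the complement, so the unit sits in al or in the complementary block. *)
Lemma Z0_unit_block : (al != 0 /\ V al^-1) \/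
  (exists l k, B (vs l) (Z0 *m vs k) != 0 /\ V (B (vs l) (Z0 *m vs k))^-1).
Proof.
have [u [w [ub wb u0 uV]]] := Z0_unit; have [[xx _] [ee _] xe _ [vv vx ve dec]] := ad0.
have s0 a b c : Z0 *m a = c *: a -> B a b = 0 -> B a (Z0 *m b) = 0.
  by move=> h ab; have := Z0_skew a b; rewrite h minkZl ab mulr0 => /eqP; rewrite eq_sym oppr_eq0 => /eqP.
case: (bs_cases ub) u0 uV => [->|->|[i ->]]; case: (bs_cases wb) => [->|->|[j ->]].
- by rewrite Z0x minkZr xx mulr0 eqxx.
- rewrite Z0e minkZr xe mulrNN mulr1 => a0 Va; by left.
- by rewrite (s0 _ _ _ Z0x) ?eqxx// minkC vx.
- rewrite Z0x minkZr minkC xe mulrN1 oppr_eq0 invrN => a0 Va; left; split => //.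
  by rewrite -[_^-1]opprK; apply: subN.
- by rewrite Z0e minkZr ee mulr0 eqxx.
- by rewrite (s0 _ _ _ Z0e) ?eqxx// minkC ve.
- by rewrite Z0x minkZr vx mulr0 eqxx.
- by rewrite Z0e minkZr ve mulr0 eqxx.
- by move=> h1 h2; right; exists i, j.
Qed.

(** Used twice: with V' = V for the module [congr_span], and with all of R as scalars for a
    commutant. *)
Lemma Z0_roots (V' : set R) (NN : set 'M[R]_(1 + n)) : subring V' -> V `<=` V' -> vmod V' NN ->
  (forall u w Z, u \in bs -> w \in bs -> NN Z -> NN (ad (wedge u w) Z)) -> NN Z0 ->
  forall l, NN (wedge xi (vs l)) /\ NN (wedge eta (vs l)).
Proof.
move=> rV' VV' mN hN N0 l; have [_ _ _ _ [vv vx ve dec]] := ad0.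
have bv i : vs i \in bs by exact: bs_vs.
split.
  apply: (root_half ad0 (Z := Z0) (al := al) mN) => //.
  - by move=> a b Z; apply: hN.
  - by move=> k Z; apply: hN => //; exact: bs_xi.
  - exact: Z0_skew.
  - exact: Z0x.
  - have [[a b]|[i [j [a b]]]] := Z0_unit_block; [left|right]; first by split => //; exact: VV'.
    by exists i, j; split => //; exact: VV'.
apply: (root_half ad0 (Z := Z0) (al := - al) mN) => //.
- by move=> a b Z; apply: hN.
- by move=> k Z; apply: hN => //; exact: bs_eta.
- exact: Z0_skew.
- exact: Z0e.
- have [[a b]|[i [j [a b]]]] := Z0_unit_block; [left|right].
    by rewrite oppr_eq0 invrN; split => //; apply: subN => //; exact: VV'.
  by exists i, j; split => //; exact: VV'.
Qed.

(** The matrices all of whose G-conjugates commute with K form a real subspace stable under Ad G,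
    hence under brackets with wedges. It contains Z0 and therefore all root vectors. *)
Lemma principal_centralizer K : lorentz K -> (forall x, principal x -> K *m x = x *m K) -> K = 1%:M.
Proof.
move=> lK hK; pose C : set 'M[R]_(1 + n) := [set Z | forall A, G A ->
  K *m (A *m Z *m invmx A) = (A *m Z *m invmx A) *m K].
have mC : vmod setT C.
  split=> [A GA|c Z _ hZ A GA|Z Z' h h' A GA].
  - by rewrite mulmx0 mul0mx mulmx0 mul0mx.
  - by rewrite -scalemxAr -scalemxAl -scalemxAr hZ// -scalemxAl.
  - by rewrite mulmxDr mulmxDl mulmxDr h// h'// mulmxDl.
have [_ CZ CD] := mC.
have C1 Z : C Z -> K *m Z = Z *m K.
  by move=> /(_ 1%:M (gr1 gG)); rewrite invmx1 mulmx1 mul1mx.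
have CG A Z : G A -> C Z -> C (A *m Z *m invmx A).
  move=> GA hZ A' GA'; have -> : A' *m (A *m Z *m invmx A) *m invmx A' =
      (A' *m A) *m Z *m invmx (A' *m A).
    have u' : A' *m A \in unitmx by apply: (gr_unit gG); exact: grM.
    apply: (can_inj (mulmxK u')); rewrite mulmxKV// -!mulmxA mulmxA.
    by rewrite (mulKmx (gr_unit gG GA')) mulVmx ?(gr_unit gG GA)// mulmx1 !mulmxA.
  by apply: hZ; exact: grM.
have Cp x : principal x -> C (f^-1 *: (x - 1%:M)).
  move=> px; apply: CZ => // A GA; have [cx _] := px.
  rewrite mulmxBr mulmxBl mulmxBr mulmxBl hK; last exact: principal_conj (GL GA) px.
  by rewrite mulmx1 mulmxV ?(gr_unit gG GA)// mulmx1 mul1mx.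
have roots := @Z0_roots setT C _ _ mC.
have {}roots l : C (wedge xi (vs l)) /\ C (wedge eta (vs l)).
  apply: roots => //.
    move=> u w Z ub wb CZ'; have [s [hs ->]] := AD ub wb.
    rewrite big_seq; elim/big_ind: _ => [|Z1 Z2|p /hs[_ Gp]]; [by case: mC|exact: CD|].
    by apply: CZ => //; exact: CG.
  rewrite Z0_split; apply: CD; first exact: Cp x0_principal.
  by apply: CZ => //; exact: Cp x0V_principal.
by apply: (scalar_centralizer ad0) => // l; apply: C1; have [] := roots l.
Qed.

Let principal_normalizer : set 'M[R]_(1 + n) := [set h | [/\ lorentz h,
  forall x, principal x -> principal (h *m x *m invmx h) &
  forall x, principal x -> principal (invmx h *m x *m h)]].

Lemma principal_normalizer_group : mx_subgroup principal_normalizer.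
Proof.
split.
- by split => [|x|x]; rewrite ?invmx1 ?mulmx1 ?mul1mx//; exact: lor1.
- move=> g h [lg g1 g2] [lh h1 h2]; have ug := lor_unit lg; have uh := lor_unit lh.
  have iM : invmx (g *m h) = invmx h *m invmx g.
    have u' : g *m h \in unitmx by rewrite unitmx_mul ug.
    by apply: (can_inj (mulKmx u')); rewrite mulmxV// mulmxA mulmxK// mulmxV.
  split; first exact: lorM.
    move=> x px; rewrite iM; have -> : g *m h *m x *m (invmx h *m invmx g) =
      g *m (h *m x *m invmx h) *m invmx g by rewrite !mulmxA.
    by apply/g1/h1.
  move=> x px; rewrite iM; have -> : invmx h *m invmx g *m x *m (g *m h) =
    invmx h *m (invmx g *m x *m g) *m h by rewrite !mulmxA.
  by apply/h2/g2.
- move=> h [lh h1 h2]; split; first exact: lor_unit.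
  by split; rewrite ?invmxK//; exact: lorV.
Qed.

(** By [principal_centralizer] a normalising h is determined by its conjugates of finitely many
    elements of the principal subgroup. For h of bounded size these conjugates are elements of Lam
    of bounded size, so they take finitely many values. *)
Lemma principal_normalizer_disc : disc principal_normalizer.
Proof.
split; [exact: principal_normalizer_group|by move=> h []|move=> r].
have [s [sX hs]] := finite_commutant principal.
pose M := \sum_(x <- s) x ord0 ord0.
have xM x : x \in s -> x ord0 ord0 <= M.
  move=> xs; rewrite /M (big_rem x xs) /= lerDl big_seq; apply: sumr_ge0 => y /mem_rem/sX[cy _].
  by rewrite -tc_mul; apply: le_trans ler01 (hyp_tc1 (lor_e0 (lC cy))).
have [t ht] := disc_seq (4 * r ^+ 2 * M) dL.
pose F (h : 'M[R]_(1 + n)) : {ffun 'I_(size s) -> 'I_(size t).+1} :=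
  [ffun i : 'I_(size s) => inord (index (h *m nth 1%:M s i *m invmx h) t)].
apply: (finite_by (f := F)) => h k [[lh h1 _] hr] [[lk k1 _] kr] /ffunP e.
have mem g x : lorentz g -> g ord0 ord0 <= r -> x \in s -> principal (g *m x *m invmx g) ->
    g *m x *m invmx g \in t.
  move=> lg gr xs [cg _]; apply/ht; split; first exact: CL.
  have [cx _] := sX x xs; have lx := lC cx.
  have g1 : 1 <= g ord0 ord0 by rewrite -tc_mul; apply: hyp_tc1; apply: lor_e0.
  have x1 : 1 <= x ord0 ord0 by rewrite -tc_mul; apply: hyp_tc1; apply: lor_e0.
  apply: le_trans (lor_tcM (lorM lg lx) (lorV lg)) _; rewrite lor_tcV//.
  have h3 := lor_tcM lg lx; have h4 := xM x xs.
  move: (g ord0 ord0) (x ord0 ord0) ((g *m x) ord0 ord0) g1 x1 gr h3 h4 => a b c a1 b1 ar h3 h4.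
  have a0 : 0 <= a by exact: le_trans a1.
  have -> : 4 * r ^+ 2 * M = 2 * (2 * r * M) * r by ring.
  apply: le_trans (_ : 2 * (2 * a * b) * a <= _); first by rewrite ler_wpM2r// ler_pM2l.
  have b0 : 0 <= b by exact: le_trans b1.
  apply: (ler_pM _ _ _ ar) => //; first by rewrite !mulr_ge0.
  by rewrite ler_pM2l//; apply: (ler_pM _ _ _ h4); rewrite ?mulr_ge0// ler_pM2l.
have hk x : x \in s -> h *m x *m invmx h = k *m x *m invmx k.
  move=> xs; have px := sX x xs; have xi' : (index x s < size s)%N by rewrite index_mem.
  have := e (Ordinal xi'); rewrite !ffunE /= nth_index// => /(congr1 val) /=.
  have m1 := mem h x lh hr xs (h1 x px); have m2 := mem k x lk kr xs (k1 x px).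
  rewrite !inordK ?(ltnS _ (size t)) ?index_size// => e'.
  by rewrite -(nth_index 0 m1) e' nth_index.
have uh := lor_unit lh; have uk := lor_unit lk.
have : invmx k *m h = 1%:M.
  apply: principal_centralizer; first exact: lorM (lorV lk) lh.
  apply: hs => x xs; have := hk x xs => /(congr1 (mulmx^~ h)); rewrite mulmxKV// => e1.
  by rewrite -mulmxA e1 !mulmxA mulVmx// mul1mx.
by move=> /(congr1 (mulmx k)); rewrite mulKVmx// mulmx1.
Qed.

Lemma principal_normalizer_sub h : lorentz h ->
  (forall x, principal x -> principal (h *m x *m invmx h)) ->
  (forall x, principal x -> principal (invmx h *m x *m h)) -> Lam h.
Proof.
move=> lh h1 h2; apply: maxL principal_normalizer_disc _ _ _ => [A LA|]; last by split.
split; [exact: lL|by move=> x; exact: principal_conj|].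
move=> x px; have := principal_conj (grV gL LA) px; by rewrite invmxK.
Qed.

(** W is the V-module of those Z for which the axis-moving entries of h Z h^-1 are in V. It contains
    each (x - 1)/f, because h conjugates the principal subgroup into the tile, hence all of
    [congr_span]. The given root vector is conjugated to c p ^ (h v_l), whose entry at p' and v_k is
    the asserted number up to sign. *)
Lemma tile_normalizer_entry h p p' c l k : lorentz h ->
  (forall x, tile x -> tile (h *m x *m invmx h)) ->
  (p = xi /\ p' = eta) \/ (p = eta /\ p' = xi) ->
  B xi (h *m vs l) = 0 -> B eta (h *m vs l) = 0 ->
  congr_span (wedge (c *: (invmx h *m p)) (vs l)) ->
  V (c * B (h *m vs l) (vs k)).
Proof.
move=> lh ht hp hx he hs.
have [[xx _] [ee _] xe _ [vv vx ve dec]] := ad0.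
pose W : set 'M[R]_(1 + n) := [set Z | cm 1 (ad (axD xi eta) (h *m Z *m invmx h))].
have WW : W (wedge (c *: (invmx h *m p)) (vs l)).
  apply: hs => [|x px].
    split=> [|x Z Vx hZ|Z Z' h1 h2] u w ub wb.
    - by rewrite mulmx0 mul0mx /ad mulmx0 mul0mx subrr mul0mx mink0r mul0r; exact: sub0.
    - rewrite -scalemxAr -scalemxAl /ad -scalemxAr -scalemxAl -scalerBr -scalemxAl minkZr -mulrA.
      by apply: subM => //; apply: hZ.
    - rewrite mulmxDr (mulmxDl (h *m Z)).
      have -> D X Y : ad D (X + Y) = ad D X + ad D Y :> 'M[R]_(1 + n).
        by rewrite /ad mulmxDr [X in _ - X]mulmxDl opprD addrACA.
      rewrite mulmxDl minkDr mulrDl.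
      by apply: subD => //; [exact: h1|exact: h2].
  have [_ h1] := ht x (principal_tile px); move=> u w ub wb; have := h1 u w ub wb.
  have -> : h *m (f^-1 *: (x - 1%:M)) *m invmx h = f^-1 *: (h *m x *m invmx h - 1%:M).
    by rewrite -scalemxAr -scalemxAl mulmxBr mulmxBl mulmx1 mulmxV ?lor_unit.
  have -> D c' Y : ad D (c' *: (Y - 1%:M)) = c' *: ad D Y :> 'M[R]_(1 + n).
    by rewrite /ad -scalemxAr -scalemxAl -scalerBr mulmxBr mulmxBl mulmx1 mul1mx opprB addrA subrK.
  by rewrite -scalemxAl minkZr mulrC divr1.
have bp : p' \in bs by case: hp => -[_ ->]; [exact: bs_eta|exact: bs_xi].
have := WW p' (vs k) bp (bs_vs _ _ _ _).
rewrite wedge_conj// -scalemxAr mulKVmx ?lor_unit// divr1 ad_wedge; last exact: wedge_skew.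
have -> : axD xi eta *m (h *m vs l) = 0 by rewrite /axD wedgeE hx he !scale0r subrr.
rewrite -[X in _ + wedge _ X](scale0r 0) wedgeZr scale0r addr0 -scalemxAr wedgeZl -scalemxAl minkZr.
have Vop (x : R) : V (- x) -> V x by move=> h'; rewrite -[x]opprK; apply: subN.
case: hp bp => -[-> ->] _.
  rewrite (axD_xi ad0) wedgeE minkBr !minkZr (minkC eta xi) xe (minkC xi) vx mul0r subr0 mulrN1 mulrN.
  exact: Vop.
rewrite (axD_eta ad0) -scaleN1r wedgeZl -scalemxAl minkZr wedgeE minkBr !minkZr xe (minkC eta) ve.
by rewrite mul0r subr0 mulrN1 mulN1r opprK.
Qed.

Definition preserves h a := (h *m xi = a *: xi /\ h *m eta = a^-1 *: eta) \/
   (h *m xi = a *: eta /\ h *m eta = a^-1 *: xi).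

(** h maps the complement of the axis to itself, and the image of one v_l is a unit vector there
    with coordinates b_k. Since a b_k and b_k / a are in V and the b_k^2 sum to 1, the squares of a
    and 1/a are in V, hence a and 1/a, hence all entries of h. Then h preserves congruence modulo f
    and normalises the principal subgroup. *)
Lemma tile_normalizer h a : lorentz h -> a != 0 -> preserves h a ->
  (forall x, tile x -> tile (h *m x *m invmx h)) ->
  (forall x, tile x -> tile (invmx h *m x *m h)) -> Lam h.
Proof.
move=> lh a0 pr t1 t2; have uh := lor_unit lh.
have [[xx _] [ee _] xe _ [vv vx ve dec]] := ad0.
have roots l : congr_span (wedge xi (vs l)) /\ congr_span (wedge eta (vs l)).
  apply: (Z0_roots (V' := V)) => //; [exact: congr_span_mod|by move=> *; exact: congr_span_ad|exact: Z0_span].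
have hV (p q : 'cV[R]_(1 + n)) (c : R) : h *m p = c *: q -> c != 0 -> p = c *: (invmx h *m q).
  by move=> e c0; rewrite scalemxAr -e mulKmx.
have zero p q c l : h *m p = c *: q -> c != 0 -> B (vs l) p = 0 -> B q (h *m vs l) = 0.
  move=> e c0 lp; have := lor_mink p (vs l) lh; rewrite e minkZl (minkC p) lp => /eqP.
  by rewrite mulf_eq0 (negPf c0) => /eqP.
have ai : a^-1 != 0 by rewrite invr_eq0.
have [zx ze] : (forall l, B xi (h *m vs l) = 0) /\ (forall l, B eta (h *m vs l) = 0).
  case: pr => -[h1 h2]; split => l.
  - exact: zero h1 a0 (vx l).
  - exact: zero h2 ai (ve l).
  - exact: zero h2 ai (ve l).
  - exact: zero h1 a0 (vx l).
have ent l k : V (a * B (h *m vs l) (vs k)) /\ V (a^-1 * B (h *m vs l) (vs k)).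
  have [r1 r2] := roots l.
  case: pr => -[h1 h2]; split.
  - apply: (tile_normalizer_entry (p := xi) (p' := eta)) => //; first by left.
    by rewrite -(hV _ _ _ h1 a0).
  - apply: (tile_normalizer_entry (p := eta) (p' := xi)) => //; first by right.
    by rewrite -(hV _ _ _ h2 ai).
  - apply: (tile_normalizer_entry (p := eta) (p' := xi)) => //; first by right.
    by rewrite -(hV _ _ _ h1 a0).
  - apply: (tile_normalizer_entry (p := xi) (p' := eta)) => //; first by left.
    by rewrite -(hV _ _ _ h2 ai).
have d0 : (0 < n.-1)%N by move: n3; case: (n) => // -[].
pose l0 := Ordinal d0.
have sum1 : \sum_k B (h *m vs l0) (vs k) ^+ 2 = 1.
  have : B (h *m vs l0) (h *m vs l0) = 1 by rewrite lor_mink// vv eqxx.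
  rewrite {2}[h *m vs l0]dec zx ze !oppr0 !scale0r subr0 add0r mink_sumr => <-.
  by apply: eq_bigr => k _; rewrite minkZr (minkC (vs k)) expr2.
have Va c : (forall k, V (c * B (h *m vs l0) (vs k))) -> V c.
  move=> hc; apply: val_sq vV _; rewrite -[c ^+ 2]mulr1 -sum1 mulr_sumr.
  by apply: sub_sum => // k _; rewrite -exprMn; apply: subX.
have VA : V a by apply: Va => k; have [] := ent l0 k.
have VAi : V a^-1 by apply: Va => k; have [] := ent l0 k.
have hE l k : V (B (h *m vs l) (vs k)).
  by rewrite -[B _ _](mulKf a0); apply: subM => //; have [] := ent l k.
have ch : cm 1 h.
  have V0 := sub0 rV; have VN (x : R) : V x -> V (x * -1) by move=> Vx; rewrite mulrN1; apply: subN.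
  move=> u w ub /bs_cases hw; rewrite divr1.
  case: hw => [->|->|[l ->]].
  - by case: pr => -[-> _]; rewrite minkZr; case: (bs_cases ub) => [->|->|[k ->]];
      rewrite ?xx ?ee ?(minkC eta xi) ?xe ?vx ?ve ?mulr0//; exact: VN.
  - by case: pr => -[_ ->]; rewrite minkZr; case: (bs_cases ub) => [->|->|[k ->]];
      rewrite ?xx ?ee ?(minkC eta xi) ?xe ?vx ?ve ?mulr0//; exact: VN.
  - by case: (bs_cases ub) => [->|->|[k ->]]; rewrite ?zx ?ze// minkC.
apply: principal_normalizer_sub => // x px; have [cx fx] := px.
  have [c1 _] := t1 x (principal_tile px); split => //.
  have -> : h *m x *m invmx h - 1%:M = h *m (x - 1%:M) *m invmx h.
    by rewrite mulmxBr mulmxBl mulmx1 mulmxV.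
  exact: (cm_conj ad0).
have [c1 _] := t2 x (principal_tile px); split => //.
have -> : invmx h *m x *m h - 1%:M = invmx h *m (x - 1%:M) *m invmx (invmx h).
  by rewrite mulmxBr mulmxBl mulmx1 invmxK mulVmx.
by apply: (cm_conj ad0) => //; [exact: lorV|exact: cm_lorV].
Qed.

Lemma tile_index (T : finType) (F : 'M[R]_(1 + n) -> T) :
  (forall A C, G A -> G C -> F A = F C -> cm f (A - C)) -> finite_index tile G.
Proof.
move=> hF; have [F0 [s [Fs hF0]]] := index_rep gC gG (core_index dG cG dL GL).
apply: (@index_by _ _ _ (fun A => (F0 A, F A)) [seq (a, t) | a <- s, t <- enum T]).
- by move=> x [/(core_sub dL)].
- by move=> A GA; apply: allpairs_f; [exact: Fs|rewrite mem_enum].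
move=> A C GA GC [e1 e2]; apply: principal_tile; split; first exact: hF0.
have uC := gr_unit gG GC.
have -> : invmx C *m A - 1%:M = invmx C *m (A - C) by rewrite mulmxBr mulVmx.
rewrite -[f]mul1r; apply: (cmM ad0) => //; last exact: hF.
by apply: LamV; apply: GL; exact: grV.
Qed.

End Tile.

Lemma val_argmin (R : realType) (V : set R) (s : seq R) y : valring V -> y \in s -> y != 0 ->
  exists f, [/\ f \in s, f != 0 & forall x, x \in s -> V (x / f)].
Proof.
move=> vV; have [rV _] := vV; elim: s y => [//|a s IH] y.
have [a0|a0] := eqVneq a 0.
  rewrite inE => /orP[/eqP->|ys] y0; first by rewrite a0 eqxx in y0.
  have [f [fs f0 hf]] := IH y ys y0; exists f; split => //; first by rewrite inE fs orbT.
  by move=> x; rewrite inE => /orP[/eqP->|/hf//]; rewrite a0 mul0r; exact: sub0.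
have [[x [xs x0]]|h] := pselect (exists x, x \in s /\ x != 0); last first.
  exists a; split => //; first exact: mem_head.
  move=> x; rewrite inE => /orP[/eqP->|xs]; first by rewrite divff//; exact: sub1.
  have [->|x0] := eqVneq x 0; first by rewrite mul0r; exact: sub0.
  by case: h; exists x.
have [f [fs f0 hf]] := IH x xs x0.
move=> _ _; have [_ vd] := vV; have [h|h] := vd (a / f).
  exists f; split => //; first by rewrite inE fs orbT.
  by move=> z; rewrite inE => /orP[/eqP->|/hf].
rewrite invf_div in h; exists a; split => //; first exact: mem_head.
move=> z; rewrite inE => /orP[/eqP->|zs]; first by rewrite divff//; exact: sub1.
by have -> : z / a = z / f * (f / a); [rewrite mulrA divfK|apply: subM => //; exact: hf].
Qed.

Lemma val_two (R : realType) (V : set R) q : valring V -> prime q -> (2 < q)%N ->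
  ~ V q%:R^-1 -> V 2^-1.
Proof.
move=> vV qp q2 nq; have [rV vd] := vV; have [//|] := vd 2^-1; rewrite invrK => V2.
have e : q%:R = 1 + 2 * (q./2)%:R :> R.
  rewrite -[in LHS](odd_double_half q).
  have [q2'|->] := even_prime qp; first by rewrite q2' in q2.
  by rewrite /= natrD -mul2n natrM.
have q0 : q%:R != 0 :> R by rewrite pnatr_eq0 -lt0n prime_gt0.
set k := (q./2)%:R in e; have Vk : V k by exact: sub_nat.
have [h|h] := vd (q%:R / 2).
  have -> : 2^-1 = q%:R / 2 - k by rewrite e; field.
  exact: subB.
case: nq; rewrite invf_div in h; have -> : q%:R^-1 = 1 - k * (2 / q%:R).
  by move: q0; rewrite e => q0; field.
by apply: subB => //; [exact: sub1|exact: subM].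
Qed.

Lemma no_unity_gt1 (R : realType) (x : R) : 1 < x -> no_unity x.
Proof. by move=> x1 E E0; rewrite gt_eqF// exprn_egt1// -lt0n. Qed.

Definition cyc {R : realType} {n} (g : 'M[R]_(1 + n)) : set 'M[R]_(1 + n) :=
  [set h | exists j, h = pw g j \/ h = pw (invmx g) j].

(** * Construction of the tile from a place *)

Section ExistsTile.
Context {R : realType} {n : nat}.
Implicit Types (u v w : 'cV[R]_(1 + n)) (A M N Z K x : 'M[R]_(1 + n)).
Local Notation B := (@mink R n).

Lemma cm_residues xi eta vs (V W : set R) (D : set 'M[R]_(1 + n)) q : @adapted R n xi eta vs ->
  (forall A, D A -> cm xi eta vs W 1 A) ->
  (exists s : seq R, forall x : R, W x -> exists2 t, t \in s & V ((x - t) / q)) -> subring V ->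
  exists (T : finType) (F : 'M[R]_(1 + n) -> T),
    forall A C, D A -> D C -> F A = F C -> cm xi eta vs V q (A - C).
Proof.
move=> ad0 DW [s hs] rV; pose b := bs xi eta vs.
pose r (x : R) := get [set t | t \in s /\ V ((x - t) / q)].
have hr (x : R) : W x -> r x \in s /\ V ((x - r x) / q).
  by move=> /hs[t ts Vt]; apply: (@getI _ [set t | t \in s /\ V ((x - t) / q)] t).
pose F (A : 'M[R]_(1 + n)) : {ffun 'I_(size b) * 'I_(size b) -> 'I_(size s).+1} :=
  [ffun p : 'I_(size b) * 'I_(size b) => inord (index (r (B (nth xi b p.1) (A *m nth xi b p.2))) s)].
exists _, F => A C DA DC /ffunP e u w ub wb.
have iu : (index u b < size b)%N by rewrite index_mem.
have iw : (index w b < size b)%N by rewrite index_mem.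
have := e (Ordinal iu, Ordinal iw); rewrite !ffunE /= !nth_index//.
have hA := DW A DA u w ub wb; have hC := DW C DC u w ub wb; rewrite divr1 in hA; rewrite divr1 in hC.
have [rA VA] := hr _ hA; have [rC VC] := hr _ hC.
move=> /(congr1 val) /=; rewrite !inordK ?(ltnS _ (size s)) ?index_size// => e'.
have rr : r (B u (A *m w)) = r (B u (C *m w)) by rewrite -(nth_index 0 rA) e' nth_index.
rewrite mulmxBl minkBr; have -> : (B u (A *m w) - B u (C *m w)) / q =
  (B u (A *m w) - r (B u (A *m w))) / q - (B u (C *m w) - r (B u (C *m w))) / q.
  by rewrite rr; ring.
exact: subB.
Qed.

Lemma cm_zero xi eta vs M : @adapted R n xi eta vs ->
  (forall u w, u \in bs xi eta vs -> w \in bs xi eta vs -> B u (M *m w) = 0) -> M = 0.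
Proof.
move=> ad0 h; have [_ _ _ _ [_ _ _ dec]] := ad0.
apply: (ext_bs ad0) => w wb; rewrite mul0mx [LHS]dec.
rewrite !h ?bs_xi ?bs_eta// !oppr0 !scale0r subr0 add0r big1// => i _.
by rewrite h ?scale0r//; exact: bs_vs.
Qed.

Variables (G Lam : set 'M[R]_(1 + n)) (r0 : R).
Hypotheses (dG : disc G) (cG : cocpt G r0) (n3 : (3 < n)%N).
Hypothesis fG : forall A X, G A -> hyp X -> A *m X = X -> A = 1%:M.
Hypotheses (dL : disc Lam) (GL : G `<=` Lam).
Hypothesis maxL : forall L', disc L' -> Lam `<=` L' -> L' `<=` Lam.
Let gL : mx_subgroup Lam. Proof. by case: dL. Qed.
Let lL : Lam `<=` lorentz. Proof. by case: dL. Qed.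

Lemma exists_tile g lam xi eta R0 : core G Lam g -> lox g lam xi eta -> B xi eta = -1 ->
  (forall h a, Lam h -> a != 0 -> preserves xi eta h a -> cyc g h) ->
  exists G', [/\ mx_subgroup G', G' `<=` core G Lam, finite_index G' G, G' g &
    forall A, G' A -> A ord0 ord0 <= R0 -> cyc g A] /\
    forall h a, lorentz h -> a != 0 -> preserves xi eta h a ->
      (forall x, G' x -> G' (h *m x *m invmx h)) -> (forall x, G' x -> G' (invmx h *m x *m h)) ->
      cyc g h.
Proof.
move=> cg hg xe hI; have [lam1 nx ne gx ge] := hg.
have n0 : (0 < n)%N by apply: leq_trans n3.
have [vs [h1 h2 h3 h4]] := adapted_basis n0 nx ne xe.
have ad0 : adapted xi eta vs by split.
pose b := bs xi eta vs.
have cL : cocpt Lam r0 by move=> X /cG[A /GL]; exists A.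
have [R1 gen] := disc_gen gL lL cL.
have [S1 hS1] := disc_seq R1 dL; have [S2 hS2] := disc_seq R0 dL.
pose ent (A : 'M[R]_(1 + n)) := [seq B u (A *m w) | u <- b, w <- b].
have ent_mem A u w : u \in b -> w \in b -> B u (A *m w) \in ent A by move=> ub wb; apply/allpairsP; exists (u, w).
have n1 : (1 < n)%N by apply: leq_trans n3.
have adl u w := cid (ad_span dG cG n1 fG u w).
pose cf u w := unzip1 (sval (adl u w)).
pose D := axD xi eta.
(* The entries of generators of Lam, the coefficients that express brackets by conjugations, and the
   inverses of the axis-moving entries of the elements of size at most R0. The inverse of a zero
   entry is 0 by convention, which adds nothing. *)
pose l := flatten [seq ent A | A <- S1] ++ (flatten [seq cf u w | u <- b, w <- b] ++
  flatten [seq map GRing.inv (ent (ad D A)) | A <- S2]).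
have [q [V [[q_pr q2 vV nq] [LV res big]]]] := place l (no_unity_gt1 lam1).
have [rV vd] := vV; have rW := zring_subring (rcons l lam).
set W := zring (rcons l lam) in LV res rW.
have lW (x : R) : x \in l -> W x by move=> xl; apply: zring_gen; rewrite mem_rcons inE xl orbT.
have LamW A : Lam A -> cm xi eta vs W 1 A.
  apply: gen A => [A C hA hC|A LA hA].
    by rewrite -[1]mulr1; exact: (cmM ad0).
  move=> u w ub wb; rewrite divr1; apply: lW; rewrite mem_cat; apply/orP; left.
  apply/flattenP; exists (ent A); last exact: ent_mem.
  by apply: map_f; apply/hS1.
have LamV A : Lam A -> cm xi eta vs V 1 A by move=> LA u w ub wb; apply: LV; exact: LamW.
have two := val_two vV q_pr q2 nq.
have q0 : q%:R != 0 :> R by rewrite pnatr_eq0 -lt0n prime_gt0.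
have AD u w : u \in b -> w \in b -> exists l : seq (R * 'M[R]_(1 + n)),
  (forall p, p \in l -> V p.1 /\ G p.2) /\
  forall M, ad (wedge u w) M = \sum_(p <- l) p.1 *: (p.2 *m M *m invmx p.2).
  move=> ub wb; exists (sval (adl u w)); have [e1 e2] := svalP (adl u w).
  split=> // p pl; split; last exact: e1.
  apply: LV; apply: lW; rewrite mem_cat mem_cat; apply/orP; right; apply/orP; left.
  by apply/flattenP; exists (cf u w); [by apply/allpairsP; exists (u, w)|exact: map_f].
have Lg : Lam g by apply/GL/(core_sub dL).
have lg := lL Lg; have ug := lor_unit lg.
have [T [F hF]] := cm_residues ad0 LamW (res 1%N) rV; rewrite expr1 in hF.
have [i [j [ij Fij]]] := @pigeonhole T (enum T) (fun j => F (pw g j)) (fun j => mem_enum T _).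
pose E := (j - i)%N; have E0 : (0 < E)%N by rewrite subn_gt0.
pose x0 := pw g E.
have Lp k : Lam (pw g k) by exact: gr_pw.
have qx0 : cm xi eta vs V q%:R (x0 - 1%:M).
  have -> : x0 - 1%:M = invmx (pw g i) *m (pw g j - pw g i).
    rewrite mulmxBr mulVmx ?(gr_unit gL (Lp i))//; congr (_ - _).
    by rewrite -(subnKC (ltnW ij)) pwD mulKmx ?(gr_unit gL (Lp i)).
  rewrite -[q%:R]mul1r; apply: (cmM ad0) => //; first by apply: LamV; exact: grV.
  exact: hF.
have gC := core_group dG dL.
have cx0 : core G Lam x0 by exact: gr_pw.
have x0x : x0 *m xi = lam ^+ E *: xi by exact: pw_eig.
have x0e : x0 *m eta = (lam ^+ E)^-1 *: eta by rewrite -exprVn; exact: pw_eig.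
have bx : xi \in b by exact: bs_xi.
have be : eta \in b by exact: bs_eta.
have lE : lam ^+ E - 1 != 0 by rewrite subr_eq0 no_unity_gt1.
have e1 : B eta ((x0 - 1%:M) *m xi) = - (lam ^+ E - 1).
  by rewrite mulmxBl mul1mx x0x minkBr minkZr minkC xe; ring.
have e0 : B eta ((x0 - 1%:M) *m xi) != 0 by rewrite e1 oppr_eq0.
have [f [/allpairsP[[u0 w0] /= [ub0 wb0 fE]] f0 hf]] := val_argmin vV (ent_mem (x0 - 1%:M) _ _ be bx) e0.
have fx0 : cm xi eta vs V f (x0 - 1%:M) by move=> u w ub wb; apply: hf; exact: ent_mem.
have fq : V (f / q%:R) by rewrite fE; exact: qx0.
have nf : ~ V f^-1.
  move=> Vf; apply: nq; have -> : q%:R^-1 = f^-1 * (f / q%:R) by rewrite mulKf.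
  exact: subM.
have [N hN] := big E E0.
(* Up to sign lam^E - 1 is an entry of x0 - 1, so f divides it; it is not divisible by q^N, so it
   divides q^N. Congruence modulo q^N thus implies congruence modulo f, and the tile has finite
   index. *)
have qf : V (q%:R ^+ N / f).
  have -> : q%:R ^+ N / f = q%:R ^+ N / (lam ^+ E - 1) * - (B eta ((x0 - 1%:M) *m xi) / f).
    by rewrite e1 mulNr opprK mulrA divfK.
  apply: subM => //; last by apply: subN => //; exact: fx0.
  by have [|] := vd ((lam ^+ E - 1) / q%:R ^+ N); [move=> /hN|rewrite invf_div].
have fu : exists u w, [/\ u \in b, w \in b & B u ((x0 - 1%:M) *m w) = f] by exists u0, w0.
exists (tile G Lam xi eta vs V f); split; [split|].
- exact: (tile_group dG dL GL).
- by move=> x [].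
- have [T' [F' hF']] := cm_residues ad0 LamW (res N) rV.
  apply: (tile_index dG cG dL GL ad0 vV LamV (F := F')) => A C GA GC e.
  apply: (cmC rV _ qf); first by rewrite expf_neq0.
  by apply: hF'; rewrite //; exact: GL.
- split => //; have -> : ad (axD xi eta) g = 0; last by move=> u w _ _; rewrite mul0mx mink0r mul0r; exact: sub0.
  have c : g *m axD xi eta *m invmx g = axD xi eta.
    by rewrite /axD wedge_conj// ge gx wedgeZl wedgeZr scalerA mulVf ?scale1r// gt_eqF// (lt_trans ltr01).
  by rewrite /ad -{1}c mulmxKV// subrr.
- move=> A [cA fA] A0; have LA : Lam A by apply/GL/(core_sub dL).
  have ad0A : ad (axD xi eta) A = 0.
    (* A nonzero axis-moving entry of A would be divisible by f and have its inverse in V, which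
       would put 1/f in V. *)
    apply: (cm_zero ad0) => u w ub wb; apply/eqP/negPn/negP => z0; apply: nf.
    have -> : f^-1 = (B u (ad (axD xi eta) A *m w))^-1 * (B u (ad (axD xi eta) A *m w) / f).
      by rewrite mulKf.
    apply: subM => //; last exact: fA.
    apply: LV; apply: lW; rewrite 2!mem_cat; apply/orP; right; apply/orP; right.
    apply/flattenP; exists (map GRing.inv (ent (ad D A))); first by apply: map_f; apply/hS2.
    by apply: map_f; exact: ent_mem.
  have [a [a' [ax ae]]] := ad_axD0 ad0 ad0A.
  have aa : a * a' = 1.
    by have := lor_mink xi eta (lL LA); rewrite ax ae minkZl minkZr xe mulrA mulrN1 => /oppr_inj.
  have a0 : a != 0 by apply: contra_eq_neq aa => ->; rewrite mul0r eq_sym oner_eq0.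
  apply: (hI A a) => //; left; split => //; rewrite ae; congr (_ *: _).
  by rewrite -[a'](mulKf a0) aa mulr1.
- move=> h a lh a0 pr t1 t2; apply: (hI h a) => //.
  by apply: (tile_normalizer dG dL GL maxL ad0 vV two LamV AD cx0 x0x x0e f0 nf fx0 fu lh a0 pr).
Qed.
End ExistsTile.

(** * Axes with small stabiliser *)

Lemma floor_power (R : realType) (l a : R) : 1 < l -> 0 < a ->
  exists j, 1 <= l ^+ j * a <= l \/ 1 <= l^-1 ^+ j * a <= l.
Proof.
move=> l1 a0; have l0 : 0 < l by exact: lt_trans l1.
have [h|h] := leP 1 a.
  have [k hk] := geom_unbounded a l1.
  have ex : exists k, `[< a <= l ^+ k.+1 >].
    by exists k; apply/asboolP; apply: (le_trans (ltW hk)); rewrite ler_weXn2l// ltW.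
  have [j /asboolP hj jmin] := ex_minnP ex; exists j; right.
  rewrite exprVn mulrC ler_pdivlMr ?ler_pdivrMr ?exprn_gt0// mul1r -exprS hj andbT.
  case: j jmin {hj} => [|j] jmin; first by rewrite expr0.
  rewrite leNgt; apply/negP => /ltW hj; have := jmin j; rewrite ltnn => H.
  by have := H (introT (asboolP _) hj).
have [k hk] := geom_unbounded a^-1 l1.
have ex : exists k, `[< 1 <= l ^+ k * a >].
  by exists k; apply/asboolP; rewrite -ler_pdivrMr// mul1r ltW.
have [j /asboolP hj jmin] := ex_minnP ex; exists j; left; rewrite hj /=.
case: j jmin hj => [|j] jmin hj; first by rewrite expr0 mul1r in hj; move: h; rewrite ltNge hj.
rewrite exprS -mulrA -[leRHS]mulr1 ler_pM2l// leNgt; apply/negP => /ltW h'.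
by have := jmin j (introT (asboolP _) h'); rewrite ltnn.
Qed.

Lemma pos_gap (R : realDomainType) (T : eqType) (f : T -> R) (s : seq T) :
  exists2 c, 0 < c <= 1 & forall x, x \in s -> 0 < f x -> c <= f x.
Proof.
elim: s => [|a s [c /andP[c0 c1] IH]]; first by exists 1; rewrite ?ltr01 ?lexx.
have [h|h] := ltP 0 (f a).
  exists (Num.min c (f a)); first by rewrite lt_min c0 h ge_min c1.
  by move=> x; rewrite inE => /orP[/eqP->|/IH h'] fx; rewrite ge_min ?lexx ?orbT// h'.
exists c; rewrite ?c0// => x; rewrite inE => /orP[/eqP->|/IH//] fa.
by move: h; rewrite leNgt fa.
Qed.

(** * Configurations of points at infinity *)

Section Ends.
Context {R : realType} {n : nat}.
Implicit Types (u v w X Y P Q xi eta : 'cV[R]_(1 + n)) (A h k : 'M[R]_(1 + n)).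
Local Notation B := (@mink R n).

Lemma causal_ub u v : causal u -> causal v -> - B u v <= 2 * (tc u * tc v).
Proof. by move=> cu cv; rewrite minkE; have := causal_dot cu cv; rewrite ler_norml => /andP[h _]; lra. Qed.

Lemma lor_tc_ub A v : lorentz A -> causal v -> tc (A *m v) <= 2 * (A ord0 ord0 * tc v).
Proof.
move=> lA cv; rewrite lor_row_tc// -(lor_tcV lA) -tc_mul; apply: causal_ub => //.
by apply: hyp_causal; apply: lor_hyp (lorV lA) (hyp_e0 (n := n)).
Qed.

Lemma lor_entry_ub A u v : lorentz A -> causal u -> causal v ->
  - B u (A *m v) <= 4 * (tc u * tc v) * A ord0 ord0.
Proof.
move=> lA cu cv; apply: le_trans (causal_ub cu (lor_causal lA cv)) _.
have h := lor_tc_ub lA cv; have [_ tu] := cu.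
have -> : 4 * (tc u * tc v) * A ord0 ord0 = 2 * (tc u * (2 * (A ord0 ord0 * tc v))) by ring.
by rewrite ler_pM2l// ler_pM2l.
Qed.

(* For null vectors with time coordinate 1, - 2 B u v is the squared distance of the points at infinity. *)
Lemma chordal u v w : null u -> null v -> null w -> tc u = 1 -> tc v = 1 -> tc w = 1 ->
  - B u w <= 2 * - B u v + 2 * - B v w.
Proof.
move=> [uu _] [vv _] [ww _] tu tv tw.
have t0 : tc (u - 2 *: v + w) = 0 by rewrite !tcD tcN tcZ tu tv tw; ring.
have := dot_ge0 (sp (u - 2 *: v + w)).
have -> : dot (sp (u - 2 *: v + w)) (sp (u - 2 *: v + w)) = B (u - 2 *: v + w) (u - 2 *: v + w).
  by rewrite minkE t0 mulr0 subr0.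
rewrite !(minkDl, minkDr, minkNl, minkNr, minkZl, minkZr) uu vv ww (minkC v u) (minkC w u) (minkC w v).
lra.
Qed.

Lemma null_decomp xi eta v : B xi eta = -1 -> null xi -> null eta ->
  let w := v + B eta v *: xi + B xi v *: eta in
  [/\ B w xi = 0, B w eta = 0 & v = - B eta v *: xi - B xi v *: eta + w].
Proof.
move=> xe [xx _] [ee _] w; split.
- by rewrite /w !(minkDl, minkZl) xx (minkC eta xi) xe (minkC v); ring.
- by rewrite /w !(minkDl, minkZl) ee xe (minkC v); ring.
- by rewrite /w !scaleNr; apply/matrixP => i j; rewrite !mxE; ring.
Qed.

(** For the square roots x, y of the two products this says |x - y| <= 1 <= x + y: Ptolemy's
    inequality for the chordal distances of four points at infinity. It is Cauchy-Schwarz for the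
    components of p and q orthogonal to xi and eta. *)
Lemma ptolemy xi eta p q : null xi -> null eta -> null p -> null q -> B xi eta = -1 -> B p q = -1 ->
  (B xi q * B eta p + B xi p * B eta q - 1) ^+ 2 <= 4 * (B xi q * B eta p) * (B xi p * B eta q).
Proof.
move=> nx ne np nq xe pq.
have [px pe ep] := null_decomp p xe nx ne; have [qx qe eq] := null_decomp q xe nx ne.
set w := _ + _ in px pe ep; set w' := _ + _ in qx qe eq; clearbody w w'.
have [xx tx] := nx; have [ee te] := ne.
have cX : causal (xi + eta) by apply: causalD; exact: null_causal.
have := perp_CS (X := xi + eta) (u := w) (v := w') cX.
have [pp _] := np; have [qq _] := nq.
move=> /(_ _ _)/wrap[]; [by rewrite minkC minkDr px pe addr0|by rewrite minkC minkDr qx qe addr0|].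
have e1 : B w w = 2 * (B xi p * B eta p).
  have : B p p = 0 by [].
  rewrite {1 2}ep !(minkDl, minkDr, minkNl, minkNr, minkZl, minkZr) xx ee xe (minkC eta xi) xe.
  rewrite (minkC xi w) (minkC eta w) px pe; lra.
have e2 : B w' w' = 2 * (B xi q * B eta q).
  have : B q q = 0 by [].
  rewrite {1 2}eq !(minkDl, minkDr, minkNl, minkNr, minkZl, minkZr) xx ee xe (minkC eta xi) xe.
  rewrite (minkC xi w') (minkC eta w') qx qe; lra.
have e3 : B w w' = B xi q * B eta p + B xi p * B eta q - 1.
  move: pq; rewrite {1}ep {1}eq !(minkDl, minkDr, minkNl, minkNr, minkZl, minkZr) xx ee xe (minkC eta xi) xe.
  rewrite (minkC xi w') (minkC eta w') qx qe px pe; lra.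
rewrite e1 e2 e3; lra.
Qed.

(** The four numbers to be bounded, A, Bt, Gm and D in the proof, are coefficients of an element
    after translations along the axis by mu and nu. The two ratio hypotheses make A comparable with
    D and Bt with Gm, up to L, while the products A D and Bt Gm are unaffected by the translations
    and bounded by assumption. *)
Lemma balanced_bound (al be ga de mu nu L : R) : 0 < al -> 0 < be -> 0 < ga -> 0 < de ->
  0 < mu -> 0 < nu -> 1 <= L -> al * de < 1 -> be * ga <= 4 ->
  1 <= nu ^+ 4 * (al * ga / (de * be)) <= L -> 1 <= mu ^+ 4 * (ga * de / (be * al)) <= L ->
  [/\ mu^-1 * nu * al <= L, mu^-1 * nu^-1 * be <= 2, mu * nu * ga <= 2 * L & mu * nu^-1 * de <= L].
Proof.
move=> a0 b0 g0 d0 m0 n0 L1 ad bg /andP[h1 h2] /andP[h3 h4].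
pose A := mu^-1 * nu * al; pose Bt := mu^-1 * nu^-1 * be; pose Gm := mu * nu * ga; pose D := mu * nu^-1 * de.
have A0 : 0 < A by rewrite !mulr_gt0// invr_gt0.
have B0 : 0 < Bt by rewrite !mulr_gt0// invr_gt0.
have G0 : 0 < Gm by rewrite !mulr_gt0// invr_gt0.
have D0 : 0 < D by rewrite !mulr_gt0// invr_gt0.
rewrite -/A -/Bt -/Gm -/D.
have [n' m'] : nu != 0 /\ mu != 0 by rewrite !gt_eqF.
have [a' b' g' d'] : [/\ al != 0, be != 0, ga != 0 & de != 0] by rewrite !gt_eqF.
have e1 : nu ^+ 4 * (al * ga / (de * be)) = (A * Gm) / (D * Bt).
  by rewrite /A /Bt /Gm /D; field; rewrite ?a' ?b' ?g' ?d' ?m' ?n'.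
have e2 : mu ^+ 4 * (ga * de / (be * al)) = (Gm * D) / (Bt * A).
  by rewrite /A /Bt /Gm /D; field; rewrite ?a' ?b' ?g' ?d' ?m' ?n'.
have e3 : A * D = al * de by rewrite /A /D; field; rewrite ?m' ?n'.
have e4 : Bt * Gm = be * ga by rewrite /Bt /Gm; field; rewrite ?m' ?n'.
rewrite -e3 in ad; rewrite -e4 in bg.
move: h1 h2 h3 h4; rewrite e1 e2.
rewrite !(ler_pdivlMr _ _ (mulr_gt0 _ _))// !(ler_pdivrMr _ _ (mulr_gt0 _ _))// !mul1r.
clear e1 e2 e3 e4; clearbody A Bt Gm D; move=> h1 h2 h3 h4.
have BG : Bt <= Gm.
  have h5 := ler_pM (ltW (mulr_gt0 D0 B0)) (ltW (mulr_gt0 B0 A0)) h1 h3.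
  have : 0 < A * D by rewrite mulr_gt0.
  move: h5; have -> : D * Bt * (Bt * A) = Bt ^+ 2 * (A * D) by ring.
  have -> : A * Gm * (Gm * D) = Gm ^+ 2 * (A * D) by ring.
  by move=> h5 p0; move: h5; rewrite ler_pM2r// ler_pXn2r// nnegrE ltW.
have GB : Gm <= L * Bt.
  have h5 := ler_pM (ltW (mulr_gt0 A0 G0)) (ltW (mulr_gt0 G0 D0)) h2 h4.
  have : 0 < A * D by rewrite mulr_gt0.
  move: h5; have -> : A * Gm * (Gm * D) = Gm ^+ 2 * (A * D) by ring.
  have -> : L * (D * Bt) * (L * (Bt * A)) = (L * Bt) ^+ 2 * (A * D) by ring.
  have L0 : 0 < L by lra.
  by move=> h5 p0; move: h5; rewrite ler_pM2r// ler_pXn2r// nnegrE ?mulr_ge0 ?ltW.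
have AD : A ^+ 2 <= L * D ^+ 2.
  rewrite leNgt; apply/negP => lt.
  have h5 := ler_pM (ltW (mulr_gt0 A0 G0)) (ltW (mulr_gt0 B0 A0)) h2 h3.
  have : 0 < Gm * Bt by rewrite mulr_gt0.
  move: h5; have -> : A * Gm * (Bt * A) = A ^+ 2 * (Gm * Bt) by ring.
  have -> : L * (D * Bt) * (Gm * D) = L * D ^+ 2 * (Gm * Bt) by ring.
  by move=> h5 p0; move: h5; rewrite ler_pM2r// leNgt lt.
have DA : D ^+ 2 <= L * A ^+ 2.
  rewrite leNgt; apply/negP => lt.
  have h5 := ler_pM (ltW (mulr_gt0 G0 D0)) (ltW (mulr_gt0 D0 B0)) h4 h1.
  have : 0 < Gm * Bt by rewrite mulr_gt0.
  move: h5; have -> : Gm * D * (D * Bt) = D ^+ 2 * (Gm * Bt) by ring.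
  have -> : L * (Bt * A) * (A * Gm) = L * A ^+ 2 * (Gm * Bt) by ring.
  by move=> h5 p0; move: h5; rewrite ler_pM2r// leNgt lt.
have AD1 : (A * D) ^+ 2 <= 1 by have := mulr_gt0 A0 D0; move: (A * D) ad => p ? ?; nra.
have L0 : 0 < L by lra.
have AL : A ^+ 2 * A ^+ 2 <= L.
  apply: le_trans (ler_wpM2l (sqr_ge0 A) AD) _.
  have -> : A ^+ 2 * (L * D ^+ 2) = L * (A * D) ^+ 2 by ring.
  by rewrite -[leRHS]mulr1 ler_pM2l.
have DL : D ^+ 2 * D ^+ 2 <= L.
  apply: le_trans (ler_wpM2l (sqr_ge0 D) DA) _.
  have -> : D ^+ 2 * (L * A ^+ 2) = L * (A * D) ^+ 2 by ring.
  by rewrite -[leRHS]mulr1 ler_pM2l.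
have big (p : R) : L < p -> L < p ^+ 2 * p ^+ 2.
  move=> Lp; have p1 : p < p ^+ 2 by nra.
  apply: (lt_trans Lp); apply: (lt_trans p1).
  by move: (p ^+ 2) p1 => q pq; nra.

have B4 := le_trans (ler_wpM2l (ltW B0) BG) bg.
have B2 : Bt <= 2 by move: (Bt) B4 => q; nra.
split.
- by rewrite leNgt; apply/negP => lt; have := big _ lt; rewrite ltNge AL.
- exact: B2.
- apply: le_trans GB _; rewrite mulrC ler_pM2r; last lra.
  exact: B2.
- by rewrite leNgt; apply/negP => lt; have := big _ lt; rewrite ltNge DL.
Qed.

Lemma eig_adj A e v (mu : R) : lorentz A -> A *m e = mu *: e -> mu != 0 -> B e (A *m v) = mu^-1 * B e v.
Proof. by move=> lA h m0; rewrite -(lor_mink e v lA) h minkZl mulrA mulVf// mul1r. Qed.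

Lemma balance A (lam : R) xi eta (a : R) p : lorentz A -> lox A lam xi eta -> (0 < p)%N -> 0 < a ->
  exists y mu, [/\ cyc A y, 0 < mu, y *m xi = mu *: xi, y *m eta = mu^-1 *: eta &
    1 <= mu ^+ p * a <= lam ^+ p].
Proof.
move=> lA hA p0 a0; have [l1 _ _ hx he] := hA; have [_ _ _ he' hx'] := lox_inv lA hA.
have l0 : 0 < lam by exact: lt_trans l1.
have lp1 : 1 < lam ^+ p by rewrite exprn_egt1// -lt0n.
have [j [h|h]] := floor_power lp1 a0.
  exists (pw A j), (lam ^+ j); split.
  - by exists j; left.
  - exact: exprn_gt0.
  - exact: pw_eig.
  - by rewrite -exprVn; exact: pw_eig.
  - by rewrite -exprM mulnC exprM.
exists (pw (invmx A) j), (lam ^- j); split.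
- by exists j; right.
- by rewrite invr_gt0 exprn_gt0.
- by rewrite -exprVn; exact: pw_eig.
- by rewrite invrK; exact: pw_eig.
- by rewrite -exprVn -exprM mulnC exprM exprVn.
Qed.

Lemma cyc_group D A y : mx_subgroup D -> D A -> cyc A y -> D y.
Proof. by move=> gD DA [j [->|->]]; apply: gr_pw => //; exact: grV. Qed.

Lemma null_mink_le0 u v : null u -> null v -> 0 <= - B u v.
Proof. by move=> nu nv; rewrite oppr_ge0; apply: causal_le0; exact: null_causal. Qed.

(** The product does not change when h is multiplied on either side by powers of x. If it lies
    strictly between 0 and 1, [ptolemy] bounds the complementary product, and suitable powers bring
    h to bounded size; so only finitely many values occur in that range. The value 0 means that h
    maps xi to the direction of e1 or eta to that of e2. *)
Lemma end_gap D x (lam : R) xi eta e1 e2 : disc D -> D x -> lox x lam xi eta -> B xi eta = -1 ->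
  (e1 = xi /\ e2 = eta) \/ (e1 = eta /\ e2 = xi) ->
  exists2 s0 : R, 0 < s0 & forall h, D h -> B e1 (h *m xi) * B e2 (h *m eta) < s0 ->
    B e1 (h *m xi) * B e2 (h *m eta) = 0.
Proof.
move=> dD Dx hx xe he; have [gD lD _] := dD; have lx := lD _ Dx.
have [l1 nx ne ex ee] := hx; have l0 : 0 < lam by exact: lt_trans l1.
have hxe : exists y, D y /\ lox y lam e1 e2.
  by case: he => -[-> ->]; [exists x|exists (invmx x); split; [exact: grV|exact: lox_inv]].
have [x' [Dx' hx']] := hxe; have lx' := lD _ Dx'.
have n1 : null e1 by case: he => -[-> _].
have n2 : null e2 by case: he => -[_ ->].
have e12 : B e1 e2 = -1 by case: he => -[-> ->] //; rewrite minkC.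
pose Z := 2^-1 *: xi + eta.
have hZ : hyp Z by apply: hyp_end => //; [exact: nullZ|rewrite minkZl xe mulrN1].
have [S hS] := disc_seq (4 * tc Z ^+ 2 * (4 + 4 * lam ^+ 4)) dD.
have [s0 /andP[s00 s01] gap] := pos_gap (fun h => B e1 (h *m xi) * B e2 (h *m eta)) S.
exists s0 => // h Dh hs; have lh := lD _ Dh.
have npx := lor_null lh nx; have npe := lor_null lh ne.
pose al := - B e1 (h *m xi); pose de := - B e2 (h *m eta).
pose be := - B e1 (h *m eta); pose ga := - B e2 (h *m xi).
have al0 : 0 <= al by exact: null_mink_le0.
have de0 : 0 <= de by exact: null_mink_le0.
have be0 : 0 <= be by exact: null_mink_le0.
have ga0 : 0 <= ga by exact: null_mink_le0.
have sE : B e1 (h *m xi) * B e2 (h *m eta) = al * de by rewrite /al /de mulrNN.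
rewrite sE in hs *.
have pt : (be * ga + al * de - 1) ^+ 2 <= 4 * (be * ga) * (al * de).
  have := ptolemy n1 n2 npx npe e12; rewrite lor_mink// => /(_ xe).
  by rewrite /be /ga /al /de !mulrNN.
have [//|ad0] := eqVneq (al * de) 0.
have adp : 0 < al * de by rewrite lt_neqAle eq_sym ad0 mulr_ge0.
have ad1 : al * de < 1 by exact: lt_le_trans s01.
have bg0 : 0 < be * ga.
  rewrite lt_neqAle mulr_ge0// andbT eq_sym; apply: contra_neqN ad0 => /eqP bg.
  by apply/eqP; move: pt; rewrite bg; nra.
have bg4 : be * ga <= 4 by move: pt adp ad1 bg0; move: (be * ga) (al * de) => p r; nra.
have pos (p q : R) : 0 <= p -> 0 <= q -> 0 < p * q -> 0 < p /\ 0 < q.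
  by move=> p0 q0 pq; split; rewrite lt_neqAle eq_sym ?p0 ?q0 andbT; apply: contraTneq pq => ->; rewrite ?mul0r ?mulr0 ltxx.
have [ap dp] := pos _ _ al0 de0 adp; have [bp gp] := pos _ _ be0 ga0 bg0.
have r10 : 0 < al * ga / (de * be) by rewrite divr_gt0 ?mulr_gt0.
have r20 : 0 < ga * de / (be * al) by rewrite divr_gt0 ?mulr_gt0.
have [z [nu [cz nu0 zx ze hnu]]] := balance lx hx (isT : (0 < 4)%N) r10.
have [y [mu [cy mu0 yx ye hmu]]] := balance lx' hx' (isT : (0 < 4)%N) r20.
have Dz := cyc_group gD Dx cz; have Dy := cyc_group gD Dx' cy.
have ly := lD _ Dy.
have L1 : 1 <= lam ^+ 4 by rewrite exprn_ege1// ltW.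
have [b1 b2 b3 b4] := balanced_bound ap bp gp dp mu0 nu0 L1 ad1 bg4 hnu hmu.
pose e := y *m h *m z.
have De : D e by apply: grM => //; exact: grM.
have mu0' : mu != 0 by rewrite gt_eqF.
have mV0 : mu^-1 != 0 by rewrite invr_eq0.
have E1 : B e1 (e *m xi) = - (mu^-1 * nu * al).
  by rewrite /e -!mulmxA zx -!scalemxAr minkZr (eig_adj _ ly yx)// /al; ring.
have E2 : B e1 (e *m eta) = - (mu^-1 * nu^-1 * be).
  by rewrite /e -!mulmxA ze -!scalemxAr minkZr (eig_adj _ ly yx)// /be; ring.
have E3 : B e2 (e *m xi) = - (mu * nu * ga).
  by rewrite /e -!mulmxA zx -!scalemxAr minkZr (eig_adj _ ly ye)// invrK /ga; ring.
have E4 : B e2 (e *m eta) = - (mu * nu^-1 * de).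
  by rewrite /e -!mulmxA ze -!scalemxAr minkZr (eig_adj _ ly ye)// invrK /de; ring.
have eS : e \in S.
  apply/hS; split => //; apply: le_trans (lor_disp_bound (lD _ De) hZ) _.
  have tZ : 0 <= tc Z by case: hZ => _ /ltW.
  rewrite ler_wpM2l ?mulr_ge0//.
  have p1 : 0 <= mu^-1 * nu * al by rewrite !mulr_ge0 ?invr_ge0 ?(ltW mu0) ?(ltW nu0).
  have p2 : 0 <= mu^-1 * nu^-1 * be by rewrite !mulr_ge0 ?invr_ge0 ?(ltW mu0) ?(ltW nu0).
  have p3 : 0 <= mu * nu * ga by rewrite !mulr_ge0 ?invr_ge0 ?(ltW mu0) ?(ltW nu0).
  have p4 : 0 <= mu * nu^-1 * de by rewrite !mulr_ge0 ?invr_ge0 ?(ltW mu0) ?(ltW nu0).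
  have -> : B Z (e *m Z) = 4^-1 * B xi (e *m xi) + 2^-1 * B xi (e *m eta) + 2^-1 * B eta (e *m xi)
      + B eta (e *m eta).
    by rewrite /Z mulmxDr -scalemxAr !(minkDl, minkDr, minkZl, minkZr); field.
  case: he E1 E2 E3 E4 => -[-> ->] -> -> -> ->; clear -b1 b2 b3 b4 p1 p2 p3 p4 L1;
  move: (mu^-1 * nu * al) (mu^-1 * nu^-1 * be) (mu * nu * ga) (mu * nu^-1 * de) (lam ^+ 4)
    b1 b2 b3 b4 p1 p2 p3 p4 L1 => a b c d L *; lra.
have es : B e1 (e *m xi) * B e2 (e *m eta) = al * de.
  by rewrite E1 E4; field; rewrite mu0' gt_eqF.
by have := gap e eS; rewrite es => /(_ adp); rewrite leNgt hs.
Qed.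
End Ends.

(** The left sides are the displacement of c P + Q under a map that fixes, respectively exchanges,
    the directions of P and Q, with b = B P Q. The zeros are B P P and B Q Q, kept so that the
    statement matches the expanded goal. *)
Lemma disp_bound (R : realType) (c b a a' w : R) : c * b = - 2^-1 -> 0 < c -> 0 < a -> 0 < a' ->
  c <= w -> c^-1 <= w -> 1 <= w ->
  - (c * (c * (a * 0)) + c * (a' * b) + (c * (a * b) + a' * 0)) <= w * ((a + a') / 2) /\
  - (c * (c * (a * b)) + c * (a' * 0) + (c * (a * 0) + a' * b)) <= w * ((a + a') / 2).
Proof.
move=> cb c0 a0 a0' cw cw' w1; split.
  have -> : - (c * (c * (a * 0)) + c * (a' * b) + (c * (a * b) + a' * 0)) = - (c * b) * (a + a') by ring.
  have i : 1 * (a + a') <= w * (a + a') by rewrite ler_pM2r// addr_gt0.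
  rewrite cb opprK; lra.
have -> : - (c * (c * (a * b)) + c * (a' * 0) + (c * (a * 0) + a' * b)) = - (c * b) * (c * a + c^-1 * a').
  by field; rewrite gt_eqF.
rewrite cb opprK; have i1 : c * a <= w * a by rewrite ler_pM2r.
have i2 : c^-1 * a' <= w * a' by rewrite ler_pM2r.
lra.
Qed.

Lemma sq_shift (R : fieldType) (T b c : R) : T != 0 -> T * b = T^-1 * c -> b * T ^+ 2 = c.
Proof.
move=> T0 e; have -> : b * T ^+ 2 = T * (T * b) by ring.
by rewrite e mulrA mulfV ?mul1r.
Qed.

Lemma eps_bound1 (R : realType) (l b T d : R) : 1 < l -> 0 < T -> 0 <= - b ->
  - (l * b * T) <= d -> - b * T <= d.
Proof.
move=> l1 T0 b0 h; have p0 := mulr_ge0 b0 (ltW T0).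
have l1' : 0 <= l - 1 by rewrite subr_ge0 ltW.
have := mulr_ge0 l1' p0; lra.
Qed.

Lemma half_sum_sqr (R : realType) (a b l : R) : a * b = 1 -> 1 < l -> a ^+ 2 <= l -> b ^+ 2 <= l ->
  ((a + b) / 2) ^+ 2 <= l.
Proof.
move=> ab l1 al bl; have -> : ((a + b) / 2) ^+ 2 = (a ^+ 2 + b ^+ 2 + 2 * (a * b)) / 4 by field.
by rewrite ab; lra.
Qed.

(** * The axis of x^m u *)

Section Axis.
Context {R : realType} {n : nat}.
Implicit Types (v w X Y P Q xi eta : 'cV[R]_(1 + n)) (A c g h k u x y : 'M[R]_(1 + n)).
Local Notation B := (@mink R n).
Variables (G Lam : set 'M[R]_(1 + n)) (r0 : R).
Hypotheses (dG : disc G) (cG : cocpt G r0) (n1 : (1 < n)%N).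
Hypothesis fG : forall A X, G A -> hyp X -> A *m X = X -> A = 1%:M.
Hypotheses (dL : disc Lam) (GL : G `<=` Lam).
Local Notation C := (core G Lam).
Let gL : mx_subgroup Lam. Proof. by case: dL. Qed.
Let lL : Lam `<=` lorentz. Proof. by case: dL. Qed.
Let gC : mx_subgroup C. Proof. exact (core_group dG dL). Qed.
Let CL : C `<=` Lam. Proof. by move=> x /(core_sub dL)/GL. Qed.
Let lC : C `<=` lorentz. Proof. by move=> x /CL/lL. Qed.

Lemma core_fix c v : C c -> null v -> c *m v = v -> c = 1%:M.
Proof. by move=> /(core_sub dL) Gc; exact: (free_null dG cG fG Gc). Qed.

(** Both y and h x h^-1 lie in the normal subgroup C and scale w by the same factor, so y^-1 h x
    h^-1 fixes a null vector and is 1 by freeness. *)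
Lemma core_conj h x y v w a (mu : R) : Lam h -> C x -> C y -> null w -> a != 0 -> mu != 0 ->
  h *m v = a *: w -> x *m v = mu *: v -> y *m w = mu *: w -> h *m x = y *m h.
Proof.
move=> Lh Cx Cy nw a0 m0 hv xv yw; have uh := gr_unit gL Lh; have uy := gr_unit gC Cy.
have Vh : invmx h *m w = a^-1 *: v.
  by apply: (can_inj (mulKmx uh)); rewrite mulKVmx// -scalemxAr hv scalerA mulVf// scale1r.
have Vy : invmx y *m w = mu^-1 *: w.
  by apply: (can_inj (mulKmx uy)); rewrite mulKVmx// -scalemxAr yw scalerA mulVf// scale1r.
have Cz : C (invmx y *m (h *m x *m invmx h)).
  by apply: (grM gC); [exact: grV gC Cy|exact (core_normal dL Lh Cx)].
have := core_fix Cz nw; rewrite -!mulmxA Vh -!scalemxAr xv -!scalemxAr hv -!scalemxAr Vy.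
have -> : a^-1 *: (mu *: (a *: (mu^-1 *: w))) = w.
  by rewrite !scalerA (_ : _ * _ = 1) ?scale1r//; field; rewrite ?a0 ?m0.
move=> /(_ erefl).
move=> /(congr1 (mulmx y)); rewrite mulKVmx// mulmx1 => /(congr1 (mulmx^~ h)).
by rewrite -!mulmxA mulVmx// mulmx1.
Qed.

Lemma zero_eig h v : lorentz h -> null v -> B v (h *m v) = 0 -> exists2 a, a != 0 & h *m v = a *: v.
Proof.
move=> lh nv e; have nh := lor_null lh nv; have [_ tv] := nv; have [_ th] := nh.
exists (tc (h *m v) / tc v); last exact: null_perp.
by rewrite mulf_neq0// ?invr_eq0 gt_eqF.
Qed.

Section Main.
Variables (x u : 'M[R]_(1 + n)) (lam : R) (xi eta : 'cV[R]_(1 + n)).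
Hypotheses (Cx : C x) (hx : lox x lam xi eta) (xe : B xi eta = -1).
Hypotheses (Cu : C u) (u1 : B xi (u *m xi) != 0) (u2 : B eta (u *m xi) != 0).
Let lx : lorentz x. Proof. exact: lC. Qed.
Let lu : lorentz u. Proof. exact: lC. Qed.
Let nx : null xi. Proof. by case: hx. Qed.
Let ne : null eta. Proof. by case: hx. Qed.
Let l1 : 1 < lam. Proof. by case: hx. Qed.
Let l0 : 0 < lam. Proof. exact: lt_trans l1. Qed.

(** Take g = x^m u with m large; its ends P and Q are close to xi and to u^-1 eta. If h fixes both
    ends, it commutes with g, and a translation part of at most half that of g bounds its size by a
    multiple of the square root of T = lam^m. Commutation gives B xi (h xi) = T^-2 B v (h v) for v =
    u^-1 xi, so the product in [end_gap] is of order 1/T. Hence it is 0: h fixes an end of x,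
    commutes with x by [core_conj], and then with u. If h exchanges P and Q it inverts g, and the
    same argument with the ends of x exchanged applies to k = u h. *)
Lemma shift_axis : exists g lg P Q, [/\ C g, lox g lg P Q,
  forall h a, Lam h -> 0 < a -> lg^-1 <= a ^+ 2 <= lg -> h *m P = a *: P -> h *m Q = a^-1 *: Q ->
    h *m x = x *m h /\ h *m u = u *m h &
  forall h a, Lam h -> 0 < a -> lg^-1 <= a ^+ 2 <= lg -> h *m P = a *: Q -> h *m Q = a^-1 *: P ->
    exists k, [/\ Lam k, k *m x = invmx x *m k & k *m u = invmx u *m k]].
Proof.
have Lx := CL Cx.
have [s1 s10 gap1] := end_gap dL Lx hx xe (or_introl (conj erefl erefl)).
have [s2 s20 gap2] := end_gap dL Lx hx xe (or_intror (conj erefl erefl)).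
have lVu := lorV lu.
pose v := invmx u *m xi; have nv : null v by exact: lor_null.
pose ze := invmx u *m eta; have nz : null ze by exact: lor_null.
have nue : null (u *m eta) by exact: lor_null.
pose X := 2^-1 *: xi + eta.
have hX : hyp X by apply: hyp_end => //; [exact: nullZ|rewrite minkZl xe mulrN1].
have [_ tx] := nx; have [_ te] := ne; have [_ tv] := nv; have [_ tz] := nz; have [_ tue] := nue.
have [_ tX] := hX.
pose u00 : R := u ord0 ord0.
have u00p : 0 < u00 by rewrite /u00 -tc_mul; have [_] := lor_e0 lu.
(* The separation at infinity of xi and u^-1 eta, positive by [u2]. Through [chordal] it will keep P
   and Q apart: - B P Q is at least ka / 8, independently of m. *)
pose ka := - B xi ze / (tc xi * tc ze).
have ka0 : 0 < ka.
  rewrite divr_gt0 ?mulr_gt0// lt_neqAle null_mink_le0// andbT eq_sym oppr_eq0.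
  by rewrite minkC /ze lor_adj.
pose K1 := 4 * (4 * tc X ^+ 2) * u00.
pose K2 := 2 * tc v / tc xi; pose K3 := 2 * tc eta / tc ze.
pose w0 := 5 + 4 / ka; pose K5 := (4 * w0 ^+ 3) ^+ 2 * K1.
pose E2 := 16 * (tc v * tc v) * (tc eta * tc eta) * K5.
pose E3 := 64 * (tc (u *m eta) * tc v) * (tc xi * tc eta) * u00 ^+ 2 * K5.
(* The three summands serve in turn to separate P from Q and to undercut the gaps s1 and s2 of the
   two cases. *)
have [m hm] := geom_unbounded (2 * (2 * K2 + 4 * K3) / ka + E2 / s1 + E3 / s2) l1.
set T := lam ^+ m in hm.
have T0 : 0 < T by rewrite exprn_gt0.
have K20 : 0 <= K2 by rewrite !mulr_ge0 ?invr_ge0 ?ltW.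
have K30 : 0 <= K3 by rewrite !mulr_ge0 ?invr_ge0 ?ltW.
have K10 : 0 <= K1 by rewrite !mulr_ge0 ?ltW.
have K50 : 0 <= K5 by rewrite mulr_ge0// sqr_ge0.
have E20 : 0 <= E2 by rewrite /E2; apply: mulr_ge0 => //; rewrite !mulr_ge0 ?ltW.
have E30 : 0 <= E3.
  by rewrite /E3; apply: mulr_ge0 => //; apply: mulr_ge0; rewrite ?sqr_ge0// !mulr_ge0 ?ltW.
have [c1 c2 c3] : [/\ 2 * (2 * K2 + 4 * K3) <= ka * T, E2 < s1 * T & E3 < s2 * T].
  have p1 : 0 <= 2 * (2 * K2 + 4 * K3) / ka by rewrite divr_ge0 ?(ltW ka0)//; lra.
  have p2 : 0 <= E2 / s1 by rewrite divr_ge0// ltW.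
  have p3 : 0 <= E3 / s2 by rewrite divr_ge0// ltW.
  move: p1 p2 p3 hm; set a1 := _ / ka; set a2 := _ / s1; set a3 := _ / s2 => p1 p2 p3 hm.
  by split; [rewrite (mulrC ka) -ler_pdivrMr// -/a1|rewrite (mulrC s1) -ltr_pdivrMr// -/a2|
    rewrite (mulrC s2) -ltr_pdivrMr// -/a3]; clearbody a1 a2 a3; lra.
pose g := pw x m *m u.
have Cxm : C (pw x m) by exact: gr_pw gC Cx.
have Cg : C g by exact: grM gC Cxm Cu.
have lxm := lC Cxm; have lg_ := lC Cg.
have xmx : pw x m *m xi = T *: xi by apply: pw_eig; case: hx.
have xme : pw x m *m eta = T^-1 *: eta by rewrite -exprVn; apply: pw_eig; case: hx.
have T0' : T != 0 by rewrite gt_eqF.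
have axi (y : 'cV[R]_(1 + n)) : B xi (pw x m *m y) = T^-1 * B xi y by exact: eig_adj.
have aeta (y : 'cV[R]_(1 + n)) : B eta (pw x m *m y) = T * B eta y by rewrite (eig_adj _ lxm xme) ?invrK// invr_eq0.
have [g1|[lg [P0 [Q0 hg0]]]] := free_lox dG cG fG (core_sub dL Cg).
  have := axi (u *m xi); rewrite mulmxA -/g g1 mul1mx; have [-> _] := nx.
  by move=> /eqP; rewrite eq_sym mulf_eq0 invr_eq0 (negPf T0') (negPf u1).
have [_ [_ tP0] [_ tQ0] _ _] := hg0.
have tP0' : 0 < (tc P0)^-1 by rewrite invr_gt0.
have tQ0' : 0 < (tc Q0)^-1 by rewrite invr_gt0.
have hg := lox_scale tP0' tQ0' hg0.
set P := _ *: P0 in hg; set Q := _ *: Q0 in hg.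
have tP : tc P = 1 by rewrite tcZ mulVf// gt_eqF.
have tQ : tc Q = 1 by rewrite tcZ mulVf// gt_eqF.
have [lg1 nP nQ gP gQ] := hg.
have lg0 : 0 < lg by exact: lt_trans lg1.
clearbody P Q; clear hg0 tP0 tQ0 tP0' tQ0'.
have xm00 : (pw x m) ord0 ord0 <= 4 * tc X ^+ 2 * T.
  apply: le_trans (lor_disp_bound lxm hX) _; rewrite ler_wpM2l ?mulr_ge0 ?(ltW tX)//.
  rewrite /X mulmxDr -scalemxAr xmx xme !(minkDl, minkDr, minkZl, minkZr).
  have [-> _] := nx; have [-> _] := ne; rewrite (minkC eta xi) xe.
  have : T^-1 <= T by apply: le_trans (_ : 1 <= _); rewrite ?invf_le1// exprn_ege1// ltW.
  lra.
have lgK : lg <= K1 * T.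
  have e : tc (g *m P) = lg by rewrite gP tcZ tP mulr1.
  rewrite -e; apply: le_trans (lor_tc_ub lg_ (null_causal nP)) _; rewrite tP mulr1.
  have := lor_tcM lxm lu; rewrite -/g -/u00 => h1.
  have h2 : (pw x m) ord0 ord0 * u00 <= 4 * tc X ^+ 2 * T * u00 by rewrite ler_pM2r.
  by rewrite /K1; lra.
have eps1 : - B (xi) P * T <= 2 * tc v.
  have e : lg * B xi P * T = B v P.
    by rewrite -minkZr -gP /g -mulmxA axi mulrC mulrA mulfV// mul1r /v lor_adj.
  have := causal_ub (null_causal nv) (null_causal nP); rewrite -e tP mulr1.
  exact: eps_bound1 (null_mink_le0 nx nP).
have eps2 : - B ze Q * T <= 2 * tc eta.
  have e : B ze Q * T = lg^-1 * B eta Q.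
    by rewrite -minkZr -gQ /g -mulmxA aeta mulrC /ze lor_adj.
  have := causal_ub (null_causal ne) (null_causal nQ); rewrite mulNr e tQ mulr1.
  have q1 : lg^-1 <= 1 by rewrite invf_le1// ltW.
  by move=> h; apply: le_trans h; rewrite -mulrN; apply: ler_piMl => //; exact: null_mink_le0.
have be : ka / 8 <= - B P Q.
  have nxh : null ((tc xi)^-1 *: xi) by apply: nullZ; rewrite ?invr_gt0.
  have nzh : null ((tc ze)^-1 *: ze) by apply: nullZ; rewrite ?invr_gt0.
  have txh : tc ((tc xi)^-1 *: xi) = 1 by rewrite tcZ mulVf// gt_eqF.
  have tzh : tc ((tc ze)^-1 *: ze) = 1 by rewrite tcZ mulVf// gt_eqF.
  have h1 := chordal nxh nP nzh txh tP tzh.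
  have h2 := chordal nP nQ nzh tP tQ tzh.
  have e1 : - B ((tc xi)^-1 *: xi) P * T <= K2.
    rewrite minkZl; have -> : - ((tc xi)^-1 * B xi P) * T = - B xi P * T / tc xi by ring.
    by rewrite /K2 ler_pM2r ?invr_gt0.
  have e2 : - B Q ((tc ze)^-1 *: ze) * T <= K3.
    rewrite minkZr (minkC Q); have -> : - ((tc ze)^-1 * B ze Q) * T = - B ze Q * T / tc ze by ring.
    by rewrite /K3 ler_pM2r ?invr_gt0.
  have e3 : - B ((tc xi)^-1 *: xi) ((tc ze)^-1 *: ze) = ka.
    by rewrite minkZl minkZr /ka invfM; ring.
  rewrite e3 in h1; move: h1 h2 e1 e2 c1.
  move: (B ((tc xi)^-1 *: xi) P) (B P ((tc ze)^-1 *: ze)) (B Q ((tc ze)^-1 *: ze)) (B P Q) => a b c d.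
  move=> h1 h2 e1 e2 c1; rewrite -(ler_pM2r T0).
  have : ka * T <= (2 * - a + 2 * (2 * - d + 2 * - c)) * T by rewrite ler_pM2r//; lra.
  lra.
have be2 : - B P Q <= 2 by have := causal_ub (null_causal nP) (null_causal nQ); rewrite tP tQ !mulr1.
have be0 : 0 < - B P Q by apply: lt_le_trans be; rewrite divr_gt0.
(* cc P + Q is a point of the axis of g, and its time coordinate is at most w0, independently of m.
   The size of h is measured by its displacement there. *)
pose cc := (2 * - B P Q)^-1.
have cB : cc * B P Q = - 2^-1 by rewrite /cc; field; rewrite -oppr_eq0 gt_eqF.
have cc0 : 0 < cc by rewrite invr_gt0 mulr_gt0.
have ccw : cc <= 4 / ka.
  by rewrite /cc ler_pdivlMr// mulrC ler_pdivrMr ?mulr_gt0//; lra.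
have ccw' : cc^-1 <= 4 by rewrite invrK; lra.
have w5 : 5 <= w0 by rewrite /w0 lerDl divr_ge0// ltW.
have cw : cc <= w0 by rewrite /w0; apply: le_trans ccw _; rewrite lerDr.
have cw' : cc^-1 <= w0 by apply: le_trans ccw' (le_trans _ w5); rewrite ler_nat.
have w1 : 1 <= w0 by apply: le_trans w5; rewrite ler1n.
have hW : hyp (cc *: P + Q) by apply: hyp_end => //; [exact: nullZ|rewrite minkZl].
have size h a : Lam h -> 0 < a -> lg^-1 <= a ^+ 2 <= lg ->
    (h *m P = a *: P /\ h *m Q = a^-1 *: Q) \/ (h *m P = a *: Q /\ h *m Q = a^-1 *: P) ->
    0 < h ord0 ord0 /\ h ord0 ord0 ^+ 2 <= K5 * T.
  move=> Lh a0 /andP[ha1 ha2] hh; have lh := lL Lh.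
  have h0 : 0 < h ord0 ord0 by case: lh.
  split=> //; have ai0 : 0 < a^-1 by rewrite invr_gt0.
  have d : - B (cc *: P + Q) (h *m (cc *: P + Q)) <= w0 * ((a + a^-1) / 2).
    have [PP _] := nP; have [QQ _] := nQ.
    rewrite mulmxDr -scalemxAr; case: hh => -[-> ->];
      rewrite !(minkDl, minkDr, minkZl, minkZr) (minkC Q P) PP QQ.
      by have [] := disp_bound cB cc0 a0 ai0 cw cw' w1.
    by have [] := disp_bound cB cc0 a0 ai0 cw cw' w1.
  have tW : tc (cc *: P + Q) <= w0 by rewrite tcD tcZ tP tQ mulr1 /w0 addrC lerD// ler1n.
  have tW0 : 0 < tc (cc *: P + Q) by case: hW.
  have w00 : 0 < w0 by exact: lt_le_trans w1.
  have h00 : h ord0 ord0 <= 4 * w0 ^+ 3 * ((a + a^-1) / 2).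
    apply: le_trans (lor_disp_bound lh hW) _.
    have -> : 4 * w0 ^+ 3 * ((a + a^-1) / 2) = 4 * w0 ^+ 2 * (w0 * ((a + a^-1) / 2)) by ring.
    have sq : 4 * tc (cc *: P + Q) ^+ 2 <= 4 * w0 ^+ 2.
      by rewrite ler_pM2l// ler_pXn2r// nnegrE ltW.
    apply: ler_pM => //; first by rewrite mulr_ge0 ?sqr_ge0.
    by rewrite oppr_ge0; apply: causal_le0; apply: hyp_causal => //; exact: lor_hyp.
  have aq : ((a + a^-1) / 2) ^+ 2 <= lg.
    have e : a * a^-1 = 1 by rewrite mulfV// gt_eqF.
    have e' : a^-1 ^+ 2 <= lg by rewrite exprVn -[lg]invrK lef_pV2 ?posrE ?invr_gt0 ?exprn_gt0.
    exact: half_sum_sqr.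
  have p0 : 0 < 4 * w0 ^+ 3 by rewrite mulr_gt0// exprn_gt0.
  apply: le_trans (_ : (4 * w0 ^+ 3 * ((a + a^-1) / 2)) ^+ 2 <= _).
    by rewrite ler_pXn2r// ?nnegrE ?(ltW h0)// mulr_ge0 ?(ltW p0)// divr_ge0// addr_ge0 ?ltW.
  rewrite exprMn /K5 -mulrA ler_wpM2l ?sqr_ge0//; exact: le_trans lgK.
have small (q1 q2 a b h2 E s : R) : 0 <= q1 -> q1 * T ^+ 2 <= a -> 0 <= q2 -> q2 <= b ->
    0 <= a -> a * b = E * h2 -> 0 <= E -> h2 <= K5 * T -> E * K5 < s * T -> q1 * q2 < s.
  move=> q10 h1 q20 hb a0 ab E0 hh hE.
  have T2 : 0 < T ^+ 2 by rewrite exprn_gt0.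
  rewrite -(ltr_pM2r T2); apply: le_lt_trans (_ : a * b < _).
    by have := ler_pM (mulr_ge0 q10 (ltW T2)) q20 h1 hb; rewrite mulrAC.
  rewrite ab; apply: le_lt_trans (ler_wpM2l E0 hh) _.
  have -> : E * (K5 * T) = E * K5 * T by ring.
  have -> : s * T ^+ 2 = s * T * T by ring.
  by rewrite ltr_pM2r.
exists g, lg, P, Q; split => //.
- move=> h a Lh a0 ha hP hQ; have lh := lL Lh.
  have [h0 h2] := size h a Lh a0 ha (or_introl (conj hP hQ)).
  have hg' : h *m g = g *m h.
    by apply: (core_conj Lh Cg Cg nP _ _ hP gP gP); rewrite gt_eqF.
  have uv : u *m v = xi by rewrite /v mulKVmx ?lor_unit.
  have e : B xi (h *m xi) * T ^+ 2 = B v (h *m v).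
    have e1 : T * B xi (h *m xi) = T^-1 * B v (h *m v).
      have gv : g *m v = T *: xi by rewrite /g -mulmxA uv xmx.
      rewrite -minkZr scalemxAr -gv mulmxA hg' -mulmxA /g -mulmxA axi; congr (_ * _).
      by rewrite [in RHS]/v lor_adj.
    exact: sq_shift e1.
  have cv := null_causal nv; have ce := null_causal ne.
  have b1 := lor_entry_ub lh cv cv; have b2 := lor_entry_ub lh ce ce.
  have z : B xi (h *m xi) * B eta (h *m eta) = 0.
    apply: gap1 => //; rewrite -mulrNN.
    apply: (small _ _ (4 * (tc v * tc v) * h ord0 ord0) (4 * (tc eta * tc eta) * h ord0 ord0)
      (h ord0 ord0 ^+ 2) (16 * (tc v * tc v) * (tc eta * tc eta))) => //.
    - by apply: null_mink_le0 => //; exact: lor_null.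
    - by rewrite mulNr e.
    - by apply: null_mink_le0 => //; exact: lor_null.
    - by rewrite mulr_ge0 ?(ltW h0)// !mulr_ge0 ?ltW.
    - by ring.
    - by rewrite !mulr_ge0 ?ltW.
  have lam0 : lam != 0 by rewrite gt_eqF.
  have hxc : h *m x = x *m h.
    have [_ _ _ xxi xeta] := hx; move/eqP: z; rewrite mulf_eq0 => /orP[]/eqP.
      move=> /(zero_eig lh nx)[b b0 hb]; exact: (core_conj Lh Cx Cx nx b0 lam0 hb xxi xxi).
    move=> /(zero_eig lh ne)[b b0 hb]; apply: (core_conj Lh Cx Cx ne b0 _ hb xeta xeta).
    by rewrite invr_eq0.
  split => //; have uxm := lor_unit lxm; apply: (can_inj (mulKmx uxm)).
  by rewrite mulmxA (pw_comm m (esym hxc)) -mulmxA -/g hg' /g !mulmxA.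
- move=> h a Lh a0 ha hP hQ; have lh := lL Lh.
  have [h0 h2] := size h a Lh a0 ha (or_intror (conj hP hQ)).
  have CgV := grV gC Cg; have ug := lor_unit lg_.
  have gVQ : invmx g *m Q = lg *: Q.
    apply: (can_inj (mulKmx ug)); rewrite mulKVmx// -scalemxAr gQ scalerA mulfV ?scale1r// gt_eqF//.
  have hg' : h *m g = invmx g *m h.
    by apply: (core_conj Lh Cg CgV nQ _ _ hP gP gVQ); rewrite gt_eqF.
  pose k := u *m h; have Lk : Lam k by apply: grM gL (CL Cu) Lh.
  have lk := lL Lk.
  have uxm := lor_unit lxm; have uu := lor_unit lu.
  have kg : k *m pw x m *m u = invmx (pw x m) *m invmx u *m k.
    have gV : invmx g = invmx u *m invmx (pw x m).
      by apply: (can_inj (mulKmx ug)); rewrite mulmxV// /g -!mulmxA mulKVmx// mulmxV.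
    rewrite /k -!mulmxA -/g hg' gV -!mulmxA mulKVmx// mulKmx//.
  have uv : u *m v = xi by rewrite /v mulKVmx ?lor_unit.
  have e : B eta (k *m xi) * T ^+ 2 = B (u *m eta) (k *m v).
    have e1 : T * B eta (k *m xi) = T^-1 * B (u *m eta) (k *m v).
      have gv : g *m v = T *: xi by rewrite /g -mulmxA uv xmx.
      rewrite -minkZr scalemxAr -gv /g !mulmxA kg -!mulmxA.
      have lVx := lorV lxm.
      have xVe : invmx (pw x m) *m eta = T *: eta.
        by apply: (can_inj (mulKmx uxm)); rewrite mulKVmx// -scalemxAr xme scalerA mulfV// scale1r.
      by rewrite (eig_adj _ lVx xVe)// minkC lor_adj// minkC.
    exact: sq_shift e1.
  have cv := null_causal nv; have ce := null_causal ne; have cx := null_causal nx.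
  have cue := null_causal nue.
  have k0 : 0 < k ord0 ord0 by case: lk.
  have kh : k ord0 ord0 <= 2 * u00 * h ord0 ord0 by exact: lor_tcM.
  have b1 := lor_entry_ub lk cue cv; have b2 := lor_entry_ub lk cx ce.
  have z : B eta (k *m xi) * B xi (k *m eta) = 0.
    apply: gap2 => //; rewrite -mulrNN.
    apply: (small _ _ (4 * (tc (u *m eta) * tc v) * (2 * u00 * h ord0 ord0))
      (4 * (tc xi * tc eta) * (2 * u00 * h ord0 ord0))
      (h ord0 ord0 ^+ 2) (64 * (tc (u *m eta) * tc v) * (tc xi * tc eta) * u00 ^+ 2)) => //.
    - by apply: null_mink_le0 => //; exact: lor_null.
    - rewrite mulNr e; apply: le_trans b1 _; rewrite ler_wpM2l// !mulr_ge0 ?ltW//.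
    - by apply: null_mink_le0 => //; exact: lor_null.
    - by apply: le_trans b2 _; rewrite ler_wpM2l// !mulr_ge0 ?ltW.
    - by rewrite mulr_ge0 ?mulr_ge0 ?ltW.
    - by ring.
    - by rewrite mulr_ge0 ?sqr_ge0// !mulr_ge0 ?ltW.
  have lam0 : lam != 0 by rewrite gt_eqF.
  have CxV := grV gC Cx.
  have [_ _ _ xxi xeta] := hx; have [_ _ _ xVeta xVxi] := lox_inv lx hx.
  have kx : k *m x = invmx x *m k.
    have nkx := lor_null lk nx; have nke := lor_null lk ne.
    move/eqP: z; rewrite mulf_eq0 => /orP[]/eqP z.
      have kb := null_perp ne nkx z; have [_ tk] := nkx.
      apply: (core_conj Lk Cx CxV ne _ lam0 kb xxi xVeta).
      by rewrite mulf_neq0// ?invr_eq0 gt_eqF.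
    have kb := null_perp nx nke z; have [_ tk] := nke.
    apply: (core_conj Lk Cx CxV nx _ _ kb xeta xVxi); rewrite ?invr_eq0//.
    by rewrite mulf_neq0// ?invr_eq0 gt_eqF.
  exists k; split => //.
  have kxm : k *m pw x m = invmx (pw x m) *m k.
    have ux := lor_unit lx; rewrite pw_inv//; elim: (m) => [|j IH]; first by rewrite mulmx1 mul1mx.
    by rewrite !pwS mulmxA kx -mulmxA IH mulmxA.
  move: kg; rewrite kxm -!mulmxA => /(congr1 (mulmx (pw x m))).
  by rewrite !mulKVmx.
Qed.
End Main.
End Axis.

(** * Growth of coefficients, and elements commuting with a loxodromic one *)

Section Growth.
Context {R : realType} {n : nat}.
Implicit Types (v w xi eta X : 'cV[R]_(1 + n)) (A h x : 'M[R]_(1 + n)) (D G : set 'M[R]_(1 + n)).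
Local Notation B := (@mink R n).

Lemma pw_bounds A (lam : R) xi eta v w : lorentz A -> lox A lam xi eta -> B w eta != 0 -> B v xi != 0 ->
  exists c C k0, [/\ 0 < c, 0 < C & forall k, (k0 <= k)%N ->
    lam ^+ k * c <= `|B v (pw A k *m w)| <= lam ^+ k * C].
Proof.
move=> lA hA w0 v0; have [C hC] := pw_growth v w lA hA; have [l1 _ _ _ _] := hA.
have x0 : B xi eta != 0 by rewrite lt_eqF// (lox_neg hA).
set c := _ / _ in hC; have c0 : 0 < `|c| by rewrite normr_gt0 /c !mulf_neq0// invr_eq0.
have [k0 hk0] := geom_unbounded (2 * `|C| / `|c|) l1.
exists (`|c| / 2), (`|c| + `|C|), k0; split; [by rewrite divr_gt0|by rewrite ltr_wpDr|].
move=> k kk; have T1 : 1 <= lam ^+ k by rewrite exprn_ege1// ltW.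
have big : 2 * `|C| <= lam ^+ k * `|c|.
  by rewrite -ler_pdivrMr//; apply: (le_trans (ltW hk0)); rewrite ler_weXn2l// ltW.
have hk : `|B v (pw A k *m w) - lam ^+ k * c| <= `|C| by apply: le_trans (hC k) (ler_norm _).
have nT : `|lam ^+ k * c| = lam ^+ k * `|c| by rewrite normrM ger0_norm// (le_trans ler01).
have h1 := lerB_normD (lam ^+ k * c) (B v (pw A k *m w) - lam ^+ k * c).
have h2 := ler_normD (lam ^+ k * c) (B v (pw A k *m w) - lam ^+ k * c).
rewrite (addrC (lam ^+ k * c)) subrK nT in h1; rewrite (addrC (lam ^+ k * c)) subrK nT in h2.
have CT : `|C| <= lam ^+ k * `|C| by apply: ler_peMl.
by apply/andP; split; lra.
Qed.

Lemma comm_eig A (lam : R) xi eta h : lorentz A -> lox A lam xi eta -> B xi eta = -1 -> lorentz h ->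
  h *m A = A *m h -> exists2 c : R, 0 < c & h *m xi = c *: xi /\ h *m eta = c^-1 *: eta.
Proof.
move=> lA hA xe lh hh; have [l1 nx ne Ax Ae] := hA; have l0 : 0 < lam by exact: lt_trans l1.
have ll : lam != lam^-1.
  by rewrite gt_eqF//; apply: (lt_trans _ l1); rewrite invf_lt1.
have nhx := lor_null lh nx; have nhe := lor_null lh ne.
have e1 : A *m (h *m xi) = lam *: (h *m xi) by rewrite mulmxA -hh -mulmxA Ax -scalemxAr.
have e2 : A *m (h *m eta) = lam^-1 *: (h *m eta) by rewrite mulmxA -hh -mulmxA Ae -scalemxAr.
have [[_ hx]|[e _]] := lox_null lA hA nhx e1; last by move/eqP: ll.
have [[e _]|[_ he]] := lox_null lA hA nhe e2; first by move/eqP: ll; rewrite e.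
have [_ tx] := nx; have [_ te] := ne; have [_ thx] := nhx; have [_ the] := nhe.
set c := _ / _ in hx; set c' := _ / _ in he.
have c0 : 0 < c by rewrite divr_gt0.
have cc : c * c' = 1.
  by have := lor_mink xi eta lh; rewrite hx he minkZl minkZr xe mulrA mulrN1 => /oppr_inj.
by exists c => //; split=> //; rewrite he; congr (_ *: _); rewrite -[c'](mulKf (lt0r_neq0 c0)) cc mulr1.
Qed.

Lemma scalar_lor h (c : R) : lorentz h -> (forall v, h *m v = c *: v) -> h = 1%:M.
Proof.
move=> lh hc; have hs : h = c%:M by apply: mulmx_ext => v; rewrite hc mul_scalar_mx.
have c0 : 0 < c by case: lh => _; rewrite hs mxE eqxx.
have := lor_mink e0 e0 lh; rewrite hc minkZl minkZr; have [-> _] := hyp_e0 (R := R) (n := n) => e.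
by rewrite hs; congr (_%:M); nra.
Qed.
Lemma index_cocpt D G r0 : mx_subgroup D -> mx_subgroup G -> G `<=` lorentz -> finite_index D G ->
  cocpt G r0 -> exists r1, cocpt D r1.
Proof.
move=> gD gG lG iD cG; have [f [s [fs hf]]] := index_rep gD gG iD.
pose rep t := get [set A | G A /\ f A = t].
have hr A : G A -> G (rep (f A)) /\ f (rep (f A)) = f A.
  by move=> GA; apply: (@getI _ [set A' | G A' /\ f A' = f A] A).
pose M := \sum_(t <- s) `|(rep t) ord0 ord0|.
exists (2 * (M * r0)) => X hX; have [A GA hA] := cG X hX.
have [Gr fr] := hr A GA; have lr := lG _ Gr; have lA := lG _ GA.
exists (invmx (rep (f A)) *m A); first exact: hf.
rewrite -mulmxA; apply: le_trans (lor_tc_ub (lorV lr) (hyp_causal (lor_hyp lA hX))) _.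
rewrite lor_tcV// ler_pM2l//.
have rM : (rep (f A)) ord0 ord0 <= M.
  rewrite /M (big_rem _ (fs A GA)) /=; apply: le_trans (ler_norm _) _.
  by rewrite lerDl; apply: sumr_ge0.
have t0 := hyp_tc1 (lor_hyp lA hX).
have r00 : 0 < (rep (f A)) ord0 ord0 by case: lr.
by apply: ler_pM => //; [exact: ltW|exact: le_trans t0].
Qed.
End Growth.

(** * An axis with trivial pointwise stabiliser *)

Section Choice.
Context {R : realType} {n : nat}.
Implicit Types (v w X Y P Q xi eta : 'cV[R]_(1 + n)) (A c f g h k u x y : 'M[R]_(1 + n)).
Local Notation B := (@mink R n).
Variables (G Lam : set 'M[R]_(1 + n)) (r0 : R).
Hypotheses (dG : disc G) (cG : cocpt G r0) (n1 : (1 < n)%N).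
Hypothesis fG : forall A X, G A -> hyp X -> A *m X = X -> A = 1%:M.
Hypotheses (dL : disc Lam) (GL : G `<=` Lam).
Local Notation C := (core G Lam).
Let gG : mx_subgroup G. Proof. by case: dG. Qed.
Let lG : G `<=` lorentz. Proof. by case: dG. Qed.
Let gL : mx_subgroup Lam. Proof. by case: dL. Qed.
Let lL : Lam `<=` lorentz. Proof. by case: dL. Qed.
Let gC : mx_subgroup C. Proof. exact (core_group dG dL). Qed.
Let CG : C `<=` G. Proof. exact: core_sub dL. Qed.
Let CL : C `<=` Lam. Proof. by move=> x /CG/GL. Qed.
Let lC : C `<=` lorentz. Proof. by move=> x /CL/lL. Qed.

Lemma core_disc : disc C.
Proof.
split=> // r; apply: (@sub_finite_set _ _ [set A | G A /\ A ord0 ord0 <= r]).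
  by move=> A [/CG].
by case: dG.
Qed.

Lemma core_cocpt : exists r1, cocpt C r1.
Proof. exact: index_cocpt gC gG lG (core_index dG cG dL GL) cG. Qed.

Let fC A X : C A -> hyp X -> A *m X = X -> A = 1%:M.
Proof. by move=> /CG; exact: fG. Qed.

(** f commutes with a loxodromic x, so the end xi of x is an eigenvector of f. The C-orbit of xi
    consists of eigenvectors for the same eigenvalue and spans the space, so f is scalar. *)
Lemma core_centralizer f : lorentz f -> (forall c, C c -> f *m c = c *m f) -> f = 1%:M.
Proof.
move=> lf hf; have [r1 cC] := core_cocpt.
have [x [lam [xi [eta [Cx hx xe]]]]] := exists_lox core_disc cC n1 fC.
have [c c0 [fx _]] := comm_eig (lC Cx) hx xe lf (hf x Cx).
apply: (scalar_lor (c := c^-1) lf) => v; apply/eqP; rewrite -subr_eq0; apply/eqP.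
apply: (end_orbit_spans core_disc cC n1 Cx hx) => d Cd.
have e : f *m (d *m xi) = c *: (d *m xi) by rewrite mulmxA hf// -mulmxA fx -scalemxAr.
rewrite minkBl minkZl -(lor_mink v (d *m xi) lf) e minkZr mulrA mulVf ?mul1r ?subrr//.
exact: lt0r_neq0.
Qed.

Definition rigid xi eta := forall h, Lam h -> h *m xi = xi -> h *m eta = eta -> h = 1%:M.

Section OneAxis.
Variables (x : 'M[R]_(1 + n)) (lam : R) (xi eta : 'cV[R]_(1 + n)).
Hypotheses (Cx : C x) (hx : lox x lam xi eta) (xe : B xi eta = -1).
Let lx : lorentz x. Proof. exact: lC. Qed.
Let nx : null xi. Proof. by case: hx. Qed.
Let ne : null eta. Proof. by case: hx. Qed.
Let l1 : 1 < lam. Proof. by case: hx. Qed.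
Let l0 : 0 < lam. Proof. exact: lt_trans l1. Qed.

(** If u maps xi to the direction of eta, it conjugates x to its inverse and thus exchanges the
    ends, and u u fixes xi. By freeness u u = 1, whereas a nontrivial element of G is loxodromic and
    of infinite order. *)
Lemma core_no_flip u : C u -> B eta (u *m xi) != 0.
Proof.
move=> Cu; apply/negP => /eqP z; have lu := lC Cu.
have nux := lor_null lu nx; have hb := null_perp ne nux z; have [_ tux] := nux; have [_ te] := ne.
set b := _ / _ in hb; have b0 : b != 0 by rewrite mulf_neq0// ?invr_eq0 gt_eqF.
have [_ _ _ xx xeta] := hx; have [_ _ _ xVeta xVxi] := lox_inv lx hx.
have CxV := grV gC Cx; have lam0 : lam != 0 by rewrite gt_eqF.
have ux := core_conj dG cG fG dL (CL Cu) Cx CxV ne b0 lam0 hb xx xVeta.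
have nue := lor_null lu ne.
have xue : x *m (u *m eta) = lam *: (u *m eta).
  apply: (can_inj (mulKmx (lor_unit (lC CxV)))).
  by rewrite mulKmx ?lor_unit// -scalemxAr mulmxA -ux -mulmxA xeta -scalemxAr scalerA mulfV// scale1r.
have ll : lam != lam^-1 by rewrite gt_eqF//; apply: (lt_trans _ l1); rewrite invf_lt1.
have [[_ hc]|[e _]] := lox_null lx hx nue xue; last by move/eqP: ll.
set c := _ / _ in hc.
have bc : b * c = 1.
  have := lor_mink xi eta lu; rewrite hb hc minkZl minkZr (minkC eta) xe mulrA mulrN1.
  by move=> /oppr_inj.
have uu : u *m u = 1%:M.
  apply: (core_fix dG cG fG dL (grM gC Cu Cu) nx).
  by rewrite -mulmxA hb -scalemxAr hc scalerA bc scale1r.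
have [e|[mu [P [Q [m1 nP _ uP _]]]]] := free_lox dG cG fG (CG Cu).
  have := hb; rewrite e mul1mx => h; have := xe; rewrite h minkZl; have [-> _] := ne.
  by rewrite mulr0 => /eqP; rewrite eq_sym oppr_eq0 oner_eq0.
have := congr1 (mulmx^~ P) uu; rewrite -mulmxA uP -scalemxAr uP scalerA mul1mx => /(congr1 tc).
have [_ tP] := nP; rewrite tcZ => e; have : mu * mu = 1 by apply: (mulIf (lt0r_neq0 tP)); rewrite e mul1r.
move=> e2; have mu1 : mu <= 1 by nra.
by move: m1; rewrite ltNge mu1.
Qed.

Lemma moving_end f u : Lam f -> f *m xi = xi -> C u -> f *m u != u *m f -> B xi (u *m xi) != 0.
Proof.
move=> Lf fx Cu; apply: contra_neq => z.
have [b b0 ub] := zero_eig (lC Cu) nx z.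
have fx1 : f *m xi = 1 *: xi by rewrite scale1r.
exact: (core_conj dG cG fG dL Lf Cu Cu nx (oner_neq0 _) b0 fx1 ub ub).
Qed.

Lemma comm_fix h u : lorentz h -> h *m x = x *m h -> h *m u = u *m h -> lorentz u -> B xi (u *m xi) != 0 ->
  h *m xi = xi /\ h *m eta = eta.
Proof.
move=> lh hx' hu lu u0; have [c c0 [hxi he]] := comm_eig lx hx xe lh hx'.
have c1 : c = 1.
  have := lor_mink xi (u *m xi) lh; rewrite hxi mulmxA hu -mulmxA hxi -scalemxAr minkZl minkZr mulrA => e.
  have cc : c * c = 1 by apply: (mulIf u0); rewrite e mul1r.
  nra.
by rewrite hxi he c1 invr1 !scale1r.
Qed.
End OneAxis.

(** If some f != 1 in Lam fixes both ends, there is u in C not commuting with f. By [shift_axis] the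
    elements of Lam that fix the ends of the new axis commute with x and u; they therefore belong to
    the old stabiliser, and f is not among them, so the bound N drops. *)
Lemma rigid_axis N x lam xi eta : C x -> lox x lam xi eta -> B xi eta = -1 ->
  (exists2 s : seq 'M[R]_(1 + n), (size s <= N)%N &
    forall f, Lam f -> f *m xi = xi -> f *m eta = eta -> f \in s) ->
  exists x' lam' xi' eta', [/\ C x', lox x' lam' xi' eta', B xi' eta' = -1 & rigid xi' eta'].
Proof.
elim: N x lam xi eta => [|N IH] x lam xi eta Cx hx xe [s sN hs].
  by exists x, lam, xi, eta; split => // f Lf fx fe; have := hs f Lf fx fe; move: sN; case: (s).
have [r|/existsNP[f /not_implyP[Lf /not_implyP[fx /not_implyP[fe f1]]]]] := pselect (rigid xi eta).
  by exists x, lam, xi, eta.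
have [u Cu fu] : exists2 u, C u & f *m u != u *m f.
  apply/not_exists2P => h; apply: f1; apply: core_centralizer; first exact: lL.
  by move=> c Cc; apply/eqP; have [//|/negP/negPn] := h c.
have u1 := moving_end hx Lf fx Cu fu.
have u2 := core_no_flip Cx hx xe Cu.
have [g [lg [P [Q [Cg hg hc _]]]]] := shift_axis dG cG fG dL GL Cx hx xe Cu u1 u2.
have b0 : 0 < - B P Q by rewrite oppr_gt0 (lox_neg hg).
have hg' := lox_scale (a := (- B P Q)^-1) (b := 1) _ ltr01 hg; rewrite invr_gt0 scale1r in hg'.
apply: (IH g lg ((- B P Q)^-1 *: P) Q Cg (hg' b0)).
  by rewrite minkZl; field; rewrite -oppr_eq0 gt_eqF.
have [lg1 _ _ _ _] := hg.
have key h : Lam h -> h *m ((- B P Q)^-1 *: P) = (- B P Q)^-1 *: P -> h *m Q = Q ->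
    h *m x = x *m h /\ h *m u = u *m h.
  move=> Lh hP hQ; apply: (hc h 1) => //.
  - by rewrite expr1n (ltW lg1) invf_le1 ?(ltW lg1)// (lt_trans ltr01).
  - have := congr1 (fun v => - B P Q *: v) hP.
    by rewrite scalemxAr !scalerA mulfV ?(gt_eqF b0)// !scale1r.
  - by rewrite invr1 scale1r.
exists (rem f s).
  have fs : f \in s by exact: hs.
  by rewrite size_rem// -ltnS (leq_trans _ sN)// prednK//; case: (s) fs.
move=> h Lh hP hQ; have [c1 c2] := key h Lh hP hQ.
have [hxi he] := comm_fix Cx hx xe (lL Lh) c1 c2 (lC Cu) u1.
apply/negPn/negP => hr; have := hs h Lh hxi he; have [ef|nf] := eqVneq h f.
  by move: fu; rewrite -ef c2 eqxx.
by move=> hin; case/negP: hr; move: hin; rewrite (perm_mem (perm_to_rem (hs f Lf fx fe))) inE (negPf nf).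
Qed.

End Choice.

Lemma le_add1_sqr (R : realDomainType) (a : R) : a <= 1 + a ^+ 2.
Proof. by nra. Qed.

(** * An axis whose ends are not exchanged *)

Section Choice.
Context {R : realType} {n : nat}.
Implicit Types (v w X Y P Q xi eta : 'cV[R]_(1 + n)) (A c f g h k u x y : 'M[R]_(1 + n)).
Local Notation B := (@mink R n).
Variables (G Lam : set 'M[R]_(1 + n)) (r0 : R).
Hypotheses (dG : disc G) (cG : cocpt G r0) (n1 : (1 < n)%N).
Hypothesis fG : forall A X, G A -> hyp X -> A *m X = X -> A = 1%:M.
Hypotheses (dL : disc Lam) (GL : G `<=` Lam).
Local Notation C := (core G Lam).
Let gG : mx_subgroup G. Proof. by case: dG. Qed.
Let lG : G `<=` lorentz. Proof. by case: dG. Qed.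
Let gL : mx_subgroup Lam. Proof. by case: dL. Qed.
Let lL : Lam `<=` lorentz. Proof. by case: dL. Qed.
Let gC : mx_subgroup C. Proof. exact (core_group dG dL). Qed.
Let CG : C `<=` G. Proof. exact: core_sub dL. Qed.
Let CL : C `<=` Lam. Proof. by move=> x /CG/GL. Qed.
Let lC : C `<=` lorentz. Proof. by move=> x /CL/lL. Qed.

Let fC A X : C A -> hyp X -> A *m X = X -> A = 1%:M.
Proof. by move=> /CG; exact: fG. Qed.

Lemma exists_rigid : exists x lam xi eta, [/\ C x, lox x lam xi eta, B xi eta = -1 & rigid Lam xi eta].
Proof.
have dC := core_disc dG dL GL; have [r1 cC] := core_cocpt dG cG dL GL.
have [x [lam [xi [eta [Cx hx xe]]]]] := exists_lox dC cC n1 fC.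
have [_ nx ne _ _] := hx.
have hX : hyp (2^-1 *: xi + eta) by apply: hyp_end => //; [exact: nullZ|rewrite minkZl xe mulrN1].
have [s hs] := disc_seq (4 * tc (2^-1 *: xi + eta) ^+ 2 * 1) dL.
apply: (rigid_axis dG cG n1 fG dL GL (N := size s) Cx hx xe); exists s => // f Lf fx fe.
apply/hs; split => //; apply: le_trans (lor_disp_bound (lL Lf) hX) _.
by rewrite mulmxDr -scalemxAr fx fe; have [-> _] := hX; rewrite opprK.
Qed.

Section OneAxis.
Variables (x : 'M[R]_(1 + n)) (lam : R) (xi eta : 'cV[R]_(1 + n)).
Hypotheses (Cx : C x) (hx : lox x lam xi eta) (xe : B xi eta = -1).
Let lx : lorentz x. Proof. exact: lC. Qed.
Let nx : null xi. Proof. by case: hx. Qed.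
Let ne : null eta. Proof. by case: hx. Qed.
Let l1 : 1 < lam. Proof. by case: hx. Qed.
Let l0 : 0 < lam. Proof. exact: lt_trans l1. Qed.

Definition inverts k u := k *m x = invmx x *m k /\ k *m u = invmx u *m k.

Lemma share_end u : C u -> B xi (u *m xi) != 0 -> B eta (u *m eta) != 0.
Proof.
move=> Cu; apply: contra_neq => z; have [b _ ub] := zero_eig (lC Cu) ne z.
have := lox_share dL (CL (grV gC Cx)) (CL Cu) (lox_inv lx hx) ub => ->.
by rewrite minkZr; have [-> _] := nx; rewrite mulr0.
Qed.

(** u is loxodromic and neither xi nor eta is one of its ends, so both factors grow like powers of
    its eigenvalue mu. *)
Lemma long_power u M : C u -> B xi (u *m xi) != 0 ->
  exists q, [/\ M < B xi (pw u q *m xi) * B eta (pw u q *m eta) & B eta (pw u q *m eta) != 0].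
Proof.
move=> Cu u1; have lu := lC Cu; have u2 := share_end Cu u1.
have [e|[mu [P [Q hu]]]] := free_lox dG cG fG (CG Cu).
  by move: u1; rewrite e mul1mx; have [-> _] := nx; rewrite eqxx.
have [m1 nP nQ uP uQ] := hu.
have ends e p a : null e -> null p -> u *m p = a *: p -> B e (u *m e) != 0 -> B e p != 0.
  move=> n_e np up; apply: contra_neq => z.
  have ep := null_perp np n_e (etrans (minkC _ _) z).
  by rewrite ep -scalemxAr up !minkZr minkZl; have [-> _] := np; rewrite !mulr0.
have [c1 [C1 [k1 [c10 _ h1]]]] := pw_bounds lu hu (ends _ _ _ nx nQ uQ u1) (ends _ _ _ nx nP uP u1).
have [c2 [C2 [k2 [c20 _ h2]]]] := pw_bounds lu hu (ends _ _ _ ne nQ uQ u2) (ends _ _ _ ne nP uP u2).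
have [j hj] := geom_unbounded (`|M| / (c1 * c2)) m1.
pose q := (j + (k1 + k2))%N; exists q.
have /andP[a1 _] := h1 q (leq_trans (leq_addr _ _) (leq_addl _ _)).
have /andP[a2 _] := h2 q (leq_trans (leq_addl _ _) (leq_addl _ _)).
have m0 : 0 < mu by exact: lt_trans m1.
have q0 : 0 < mu ^+ q by rewrite exprn_gt0.
have q1 : 1 <= mu ^+ q by rewrite exprn_ege1// ltW.
have jq : mu ^+ j <= mu ^+ q by rewrite ler_weXn2l ?leq_addr// ltW.
have lq := pw_lor q lu.
have p1 := null_mink_le0 nx (lor_null lq nx); have p2 := null_mink_le0 ne (lor_null lq ne).
rewrite ler0_norm -?oppr_ge0// in a1; rewrite ler0_norm -?oppr_ge0// in a2.
have pos2 : 0 < mu ^+ q * c2 by rewrite mulr_gt0.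
split; last by rewrite -oppr_eq0 gt_eqF// (lt_le_trans pos2).
apply: le_lt_trans (ler_norm M) _; rewrite -mulrNN.
rewrite ltr_pdivrMr ?mulr_gt0// in hj; apply: (lt_le_trans hj).
apply: le_trans (_ : mu ^+ q * c1 * (mu ^+ q * c2) <= _); last first.
  by apply: ler_pM => //; rewrite ltW// mulr_gt0.
have -> : mu ^+ q * c1 * (mu ^+ q * c2) = mu ^+ q * (mu ^+ q) * (c1 * c2) by ring.
rewrite ler_pM2r ?mulr_gt0//; apply: le_trans jq _; exact: ler_peMl (ltW q0) q1.
Qed.

(** Otherwise each word W a = u x^a u^q, for a large, is inverted together with x by some element of
    Lam. Composing it with an element that inverts x and u gives t in Lam which commutes with x and
    conjugates the reversed word W' a to W a. Comparing coefficients at eta bounds t, so one t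
    serves two exponents; then u^q t u^-1 commutes with a power of x, and u^q has the same product
    of coefficients at xi and eta as u. The exponent q was chosen to prevent this. *)
Lemma not_inverted : exists u, [/\ C u, B xi (u *m xi) != 0 & forall k, Lam k -> ~ inverts k u].
Proof.
apply: contrapT => none.
have inv u : C u -> B xi (u *m xi) != 0 -> exists2 k, Lam k & inverts k u.
  move=> Cu u1; apply/not_exists2P => h; apply: none; exists u; split => // k Lk ik.
  by have [/(_ Lk)|/(_ ik)] := h k.
have dC := core_disc dG dL GL; have [r1 cC] := core_cocpt dG cG dL GL.
have [u Cu u1] := orbit_moves_end dC cC n1 Cx hx.
have lu := lC Cu; have uu := lor_unit lu.
have [q [hq q2]] := long_power (B xi (u *m xi) * B eta (u *m eta)) Cu u1.
have Cq : C (pw u q) by exact: gr_pw gC Cu.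
have lq := lC Cq; have uq := lor_unit lq.
have u2 := share_end Cu u1.
have nf := core_no_flip dG cG fG dL GL Cx hx xe.
have [k0 Lk0 [k0x k0u]] := inv u Cu u1.
pose W a := u *m pw x a *m pw u q; pose W' a := pw u q *m pw x a *m u.
have CW a : C (W a) by rewrite /W; do ![apply: grM gC _ _ => //]; exact: gr_pw gC Cx.
have BW v w a : B v (W a *m w) = B (invmx u *m v) (pw x a *m (pw u q *m w)).
  by rewrite lor_adj// /W !mulmxA.
have BW' v w a : B v (W' a *m w) = B (invmx (pw u q) *m v) (pw x a *m (u *m w)).
  by rewrite lor_adj// /W' !mulmxA.
have s1 := pw_bounds (v := invmx u *m xi) (w := pw u q *m xi) lx hx.
rewrite (minkC _ eta) lor_adj// in s1.
have [c1 [C1 [m1 [c10 C10 h1]]]] := s1 (nf _ Cq) u1.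
have s2 := pw_bounds (v := invmx u *m eta) (w := pw u q *m eta) lx hx.
rewrite (minkC _ eta) lor_adj// in s2.
have [c2 [C2 [m2 [c20 C20 h2]]]] := s2 q2 (nf _ Cu).
have s3 := pw_bounds (v := invmx (pw u q) *m eta) (w := u *m eta) lx hx.
rewrite (minkC _ eta) lor_adj// in s3.
have [c3 [C3 [m3 [c30 C30 h3]]]] := s3 u2 (nf _ Cq).
pose a0 := (m1 + (m2 + m3))%N.
have hX : hyp (2^-1 *: xi + eta) by apply: hyp_end => //; [exact: nullZ|rewrite minkZl xe mulrN1].
set X := _ + _ in hX.
pose r := 4 * tc X ^+ 2 * (2 + C2 / c3 + C3 / c2).
have ex a : exists t, [/\ Lam t, t *m x = x *m t, t *m W' (a0 + a)%N = W (a0 + a)%N *m t & t ord0 ord0 <= r].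
  set b := (a0 + a)%N.
  have ab : (a0 <= b)%N by exact: leq_addr.
  have b1 : (m1 <= b)%N by exact: leq_trans (leq_addr _ _) ab.
  have b2 : (m2 <= b)%N by exact: leq_trans (leq_trans (leq_addr m3 m2) (leq_addl m1 _)) ab.
  have b3 : (m3 <= b)%N by exact: leq_trans (leq_trans (leq_addl m2 m3) (leq_addl m1 _)) ab.
  have T0 : 0 < lam ^+ b by rewrite exprn_gt0.
  have [k Lk [kx kW]] : exists2 k, Lam k & inverts k (W b).
    apply: inv => //; rewrite BW -normr_gt0; have /andP[h _] := h1 b b1.
    by apply: lt_le_trans h; rewrite mulr_gt0.
  pose t := k *m k0; have Lt : Lam t by exact: grM gL Lk Lk0.
  have ux := lor_unit lx; have uW := lor_unit (lC (CW b)).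
  have k0xV : k0 *m invmx x = x *m k0.
    by apply: (can_inj (mulmxK ux)); rewrite mulmxKV// -mulmxA k0x mulKVmx.
  have tx : t *m x = x *m t.
    have kxV : k *m invmx x = x *m k.
      by apply: (can_inj (mulmxK ux)); rewrite mulmxKV// -mulmxA kx mulKVmx.
    by rewrite /t -mulmxA k0x (mulmxA k) kxV !mulmxA.
  have k0pw A j : A \in unitmx -> k0 *m A = invmx A *m k0 -> k0 *m pw A j = invmx (pw A j) *m k0.
    move=> uA hA; rewrite pw_inv//; elim: j => [|j IH]; first by rewrite mulmx1 mul1mx.
    by rewrite !pwS mulmxA hA -mulmxA IH mulmxA.
  have k0W : W b *m (k0 *m W' b) = k0.
    have uxb : pw x b \in unitmx by apply: lor_unit; exact: pw_lor.
    have -> : k0 *m W' b = invmx (pw u q) *m (invmx (pw x b) *m (invmx u *m k0)).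
      rewrite /W' (mulmxA k0) (mulmxA k0) (k0pw u q uu k0u) -(mulmxA _ k0) (k0pw x b ux k0x).
      by rewrite -!mulmxA k0u.
    by rewrite /W -!mulmxA mulKVmx// mulKVmx// mulKVmx.
  have tW : t *m W' b = W b *m t.
    have e : k0 *m W' b = invmx (W b) *m k0 by rewrite -{2}k0W mulKmx.
    have kWV : k *m invmx (W b) = W b *m k.
      by apply: (can_inj (mulmxK uW)); rewrite mulmxKV// -mulmxA kW mulKVmx.
    by rewrite /t -mulmxA e (mulmxA k) kWV !mulmxA.
  exists t; split => //; have lt_ := lL Lt.
  have [ta ta0 [txi teta]] := comm_eig lx hx xe lt_ tx.
  have tne : ta != 0 by rewrite gt_eqF.
  have rel : ta * B eta (W' b *m eta) = ta^-1 * B eta (W b *m eta).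
    have e : t *m (W' b *m eta) = ta^-1 *: (W b *m eta) by rewrite mulmxA tW -mulmxA teta -scalemxAr.
    have := congr1 (B eta) e; rewrite minkZr => <-.
    by rewrite (eig_adj _ lt_ teta) ?invrK// invr_eq0.
  have rel2 : ta ^+ 2 * `|B eta (W' b *m eta)| = `|B eta (W b *m eta)|.
    rewrite -[ta ^+ 2]ger0_norm ?sqr_ge0// -normrM; congr `|_|.
    by rewrite expr2 -mulrA rel mulrA mulfV// mul1r.
  have /andP[i1 i2] := h2 b b2; have /andP[i3 i4] := h3 b b3.
  rewrite -BW in i1 i2; rewrite -BW' in i3 i4.
  have t2 : ta ^+ 2 <= C2 / c3.
    rewrite ler_pdivlMr// -(ler_pM2r T0); apply: le_trans (_ : `|B eta (W b *m eta)| <= _); last by rewrite mulrC.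
    by rewrite -rel2 -mulrA (mulrC c3) ler_pM2l// exprn_gt0.
  have t2' : ta^-1 ^+ 2 <= C3 / c2.
    rewrite exprVn ler_pdivlMr// mulrC ler_pdivrMr ?exprn_gt0// -(ler_pM2r T0).
    apply: le_trans (_ : `|B eta (W b *m eta)| <= _); first by rewrite mulrC.
    rewrite -rel2; have -> : C3 * ta ^+ 2 * lam ^+ b = ta ^+ 2 * (lam ^+ b * C3) by ring.
    by rewrite ler_pM2l ?exprn_gt0.
  have tX : 0 <= tc X by case: hX => _ /ltW.
  apply: le_trans (lor_disp_bound lt_ hX) _; rewrite /r ler_wpM2l ?mulr_ge0//.
  rewrite /X mulmxDr -scalemxAr txi teta !(minkDl, minkDr, minkZl, minkZr).
  have [-> _] := nx; have [-> _] := ne; rewrite (minkC eta xi) xe.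
  have j1 := le_add1_sqr ta; have j2 := le_add1_sqr ta^-1.
  have j3 := sqr_ge0 ta; have j4 := sqr_ge0 ta^-1.
  move: t2 t2' j1 j2 j3 j4; move: (C2 / c3) (C3 / c2) (ta^-1) (ta^-1 ^+ 2) (ta ^+ 2) => p1 p2 p3 p4 p5 *; lra.
have [f hf] := choice ex.
have [i [j [ij e]]] := disc_pigeon dL (fun a => let: And4 h _ _ _ := hf a in h)
  (fun a => let: And4 _ _ _ h := hf a in h).
have [Lt tx tWi _] := hf i; have [_ _ tWj _] := hf j; rewrite -e in tWj.
set t := f i in Lt tx tWi tWj.
have lt_ := lL Lt; have [ta ta0 [txi teta]] := comm_eig lx hx xe lt_ tx.
pose c := (j - i)%N; have c0 : (0 < c)%N by rewrite subn_gt0.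
have ji : (a0 + j)%N = ((a0 + i) + c)%N by rewrite -addnA subnKC// ltnW.
pose s := pw u q *m t *m invmx u.
have uxa : pw x (a0 + i) \in unitmx by apply: lor_unit; exact: pw_lor.
have sx : s *m pw x c = pw x c *m s.
  have e1 : t *m (pw u q *m pw x (a0 + i)) = u *m pw x (a0 + i) *m (pw u q *m t *m invmx u).
    by apply: (can_inj (mulmxK uu)); rewrite -!mulmxA (mulVmx uu) mulmx1 !mulmxA -[RHS]tWi /W' !mulmxA.
  move: tWj; rewrite ji /W' /W pwD => e2.
  have e3 : u *m pw x (a0 + i) *m (s *m pw x c *m u) = u *m pw x (a0 + i) *m (pw x c *m s *m u).
    have su' : s *m u = pw u q *m t by rewrite /s mulmxKV.
    rewrite -/s in e1; move: s e1 su' => s' e1 su'.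
    rewrite -(mulmxA (pw x c)) su' (mulmxA _ (s' *m _)) (mulmxA _ s') -e1 !mulmxA.
    by rewrite !mulmxA in e2; rewrite -e2.
  apply: (can_inj (mulmxK uu)); apply: (can_inj (mulKmx uxa)); apply: (can_inj (mulKmx uu)).
  by rewrite !mulmxA in e3 *; exact: e3.
have ls : lorentz s by apply: lorM; [exact: lorM|exact: lorV].
have [sg sg0 [sxi seta]] := comm_eig (pw_lor c lx) (lox_pw hx c0) xe ls sx.
have su : pw u q *m t = s *m u by rewrite /s mulmxKV.
have f1 : ta * B xi (pw u q *m xi) = sg^-1 * B xi (u *m xi).
  have e1 : ta *: (pw u q *m xi) = s *m (u *m xi) by rewrite (mulmxA s) -su -mulmxA txi -scalemxAr.
  have := congr1 (B xi) e1; rewrite minkZr => ->.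
  by rewrite (eig_adj _ ls sxi)// gt_eqF.
have f2 : ta^-1 * B eta (pw u q *m eta) = sg * B eta (u *m eta).
  have e1 : ta^-1 *: (pw u q *m eta) = s *m (u *m eta) by rewrite (mulmxA s) -su -mulmxA teta -scalemxAr.
  have := congr1 (B eta) e1; rewrite minkZr => ->.
  by rewrite (eig_adj _ ls seta) ?invrK// invr_eq0 gt_eqF.
have : B xi (pw u q *m xi) * B eta (pw u q *m eta) = B xi (u *m xi) * B eta (u *m eta).
  have -> : B xi (pw u q *m xi) * B eta (pw u q *m eta) =
    (ta * B xi (pw u q *m xi)) * (ta^-1 * B eta (pw u q *m eta)) by field; rewrite gt_eqF.
  by rewrite f1 f2; field; rewrite gt_eqF.
by move=> eq; rewrite eq ltxx in hq.
Qed.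

End OneAxis.

(** Multiplying h by a power of g brings its translation part into the range allowed in
    [shift_axis]. If the product fixes the ends, it commutes with x and u, fixes xi and eta for the
    rigid axis of x, and is 1. If it exchanges them, some element of Lam would invert both x and
    u. *)
Lemma exists_axis : exists g lam xi eta, [/\ C g, lox g lam xi eta, B xi eta = -1 &
  forall h a, Lam h -> a != 0 -> preserves xi eta h a -> cyc g h].
Proof.
have [x [lam [xi [eta [Cx hx xe rig]]]]] := exists_rigid.
have [u [Cu u1 ninv]] := not_inverted Cx hx xe.
have u2 := core_no_flip dG cG fG dL GL Cx hx xe Cu.
have [g [lg [P [Q [Cg hg hc hf]]]]] := shift_axis dG cG fG dL GL Cx hx xe Cu u1 u2.
have b0 : 0 < - B P Q by rewrite oppr_gt0 (lox_neg hg).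
pose c := (- B P Q)^-1; have c0 : 0 < c by rewrite invr_gt0.
have cne : c != 0 by rewrite gt_eqF.
have hg' := lox_scale c0 ltr01 hg; rewrite scale1r in hg'.
exists g, lg, (c *: P), Q; split => //.
  by rewrite minkZl /c; field; rewrite -oppr_eq0 gt_eqF.
have [lg1 nP nQ gP gQ] := hg; have lg0 : 0 < lg by exact: lt_trans lg1.
have lgg := lC Cg.
have [_ tP] := nP; have [_ tQ] := nQ.
have cycV y : cyc g y -> cyc g (invmx y).
  move=> [j [->|->]]; exists j; [right|left]; first by rewrite pw_inv// lor_unit.
  by rewrite -pw_inv ?invmxK// ?lor_unit.
have Lcyc y : cyc g y -> Lam y by move=> cy; exact: cyc_group gL (CL Cg) cy.
have norm (a : R) : 0 < a -> exists y mu, [/\ cyc g y, 0 < mu, y *m P = mu *: P, y *m Q = mu^-1 *: Q &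
    lg^-1 <= (mu * a) ^+ 2 <= lg].
  move=> a0; have w0 : 0 < a ^+ 2 * lg by rewrite mulr_gt0// exprn_gt0.
  have [y [mu [cy mu0 yP yQ /andP[m1 m2]]]] := balance lgg hg (isT : (0 < 2)%N) w0.
  exists y, mu; split => //; rewrite exprMn; apply/andP; split.
    by rewrite -[_^-1]mul1r ler_pdivrMr// -mulrA.
  by rewrite -(ler_pM2r lg0) -mulrA -expr2.
move=> h a Lh a0 hpr; have lh := lL Lh.
have [/= hp|hp] := hpr.
  have [h1 h2] := hp.
  have hP : h *m P = a *: P.
    apply: (can_inj (scalerK cne)); rewrite scalemxAr h1 scalerA mulrC -scalerA//.
  have ap : 0 < a.
    have [_] := lor_null lh nP; rewrite hP tcZ pmulr_lgt0//.
  have [y [mu [cy mu0 yP yQ hmu]]] := norm a ap.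
  have Ly := Lcyc y cy.
  have e1 : h *m y *m P = (mu * a) *: P by rewrite -mulmxA yP -scalemxAr hP scalerA.
  have e2 : h *m y *m Q = (mu * a)^-1 *: Q by rewrite -mulmxA yQ -scalemxAr h2 scalerA invfM.
  have [k1 k2] := hc _ _ (grM gL Lh Ly) (mulr_gt0 mu0 ap) hmu e1 e2.
  have [hx1 hx2] := comm_fix dL GL Cx hx xe (lL (grM gL Lh Ly)) k1 k2 (lC Cu) u1.
  have hy := rig _ (grM gL Lh Ly) hx1 hx2.
  have -> : h = invmx y by rewrite -[h](mulmxK (gr_unit gL Ly)) hy mul1mx.
  exact: cycV.
have [h1 h2] := hp.
have hP : h *m P = (c^-1 * a) *: Q.
  by apply: (can_inj (scalerK cne)); rewrite scalemxAr h1 scalerA mulVKf.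
have hQ : h *m Q = (c^-1 * a)^-1 *: P by rewrite h2 scalerA invfM invrK mulrC.
have ap : 0 < c^-1 * a.
  by have [_] := lor_null lh nP; rewrite hP tcZ pmulr_lgt0.
have [y [mu [cy mu0 yP yQ hmu]]] := norm _ ap.
have Ly := Lcyc y cy.
have e1 : h *m y *m P = (mu * (c^-1 * a)) *: Q by rewrite -mulmxA yP -scalemxAr hP scalerA.
have e2 : h *m y *m Q = (mu * (c^-1 * a))^-1 *: P by rewrite -mulmxA yQ -scalemxAr hQ scalerA -invfM.
have [k [Lk kx ku]] := hf _ _ (grM gL Lh Ly) (mulr_gt0 mu0 ap) hmu e1 e2.
by case: (ninv k Lk).
Qed.

End Choice.

(** * The hyperboloid chart *)

Section Lift.
Context {R : realType} {n : nat}.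
Implicit Types (x y u v w : 'cV[R]_n) (X Y U V W : 'cV[R]_(1 + n)) (A D : 'M[R]_(1 + n)).
Local Notation B := (@mink R n).
Local Notation lift := (@lift_hyperboloid R n).

Lemma sp_lift x : sp (lift x) = x.
Proof. by rewrite /sp /lift_hyperboloid col_mxKd. Qed.

Lemma tc_lift x : tc (lift x) = Num.sqrt (1 + dot x x).
Proof. by rewrite tcE /lift_hyperboloid col_mxKu mxE eqxx. Qed.

Lemma lift_hyp x : hyp (lift x).
Proof.
have p : 0 < 1 + dot x x by rewrite ltr_pwDl// dot_ge0.
by split; [rewrite minkE sp_lift tc_lift -expr2 sqr_sqrtr ?ltW//; ring|rewrite tc_lift sqrtr_gt0].
Qed.

Lemma lift_sp X : hyp X -> lift (sp X) = X.
Proof.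
move=> hX; apply: mink_ext; last exact: sp_lift.
have [_ t0] := hX; rewrite tc_lift (hyp_sp hX) addrC subrK sqrtr_sqr ger0_norm ?ltW//.
Qed.

Lemma lift_inj x y : lift x = lift y -> x = y.
Proof. by move=> /(congr1 (@sp R n)); rewrite !sp_lift. Qed.

Lemma lift_hact A x : lorentz A -> lift (hact A x) = A *m lift x.
Proof. by move=> lA; apply: lift_sp; apply: lor_hyp lA (lift_hyp x). Qed.

Lemma hact1 x : hact 1%:M x = x.
Proof. by rewrite /hact mul1mx; exact: sp_lift. Qed.

Lemma hactM A D x : lorentz A -> lorentz D -> hact (A *m D) x = hact A (hact D x).
Proof. by move=> lA lD; rewrite /hact -/(hact D x) lift_hact// mulmxA. Qed.

(* the differential of lift_hyperboloid *)
Definition dlift x u : 'cV[R]_(1 + n) := col_mx (dot x u / Num.sqrt (1 + dot x x))%:M u.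

Lemma sp_dlift x u : sp (dlift x u) = u.
Proof. by rewrite /sp /dlift col_mxKd. Qed.

Lemma tc_dlift x u : tc (dlift x u) = dot x u / tc (lift x).
Proof. by rewrite tcE /dlift col_mxKu mxE eqxx tc_lift. Qed.

Lemma dlift_perp x u : B (lift x) (dlift x u) = 0.
Proof.
have [_ t0] := lift_hyp x.
by rewrite minkE sp_lift sp_dlift tc_dlift mulrC divfK ?subrr// gt_eqF.
Qed.

Lemma dlift_uniq x W : B (lift x) W = 0 -> dlift x (sp W) = W.
Proof.
move=> e; apply: mink_ext; last exact: sp_dlift.
have [_ t0] := lift_hyp x; move: e; rewrite minkE sp_lift tc_dlift => /eqP.
by rewrite subr_eq0 => /eqP ->; rewrite mulrC mulKf// gt_eqF.
Qed.

(** From here on metric computations in the chart are carried out with the Minkowski form on the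
    hyperboloid. *)
Lemma inner_dlift x u v : inner hmetric x u v = B (dlift x u) (dlift x v).
Proof.
have [_ t0] := lift_hyp x.
have t2 : tc (lift x) ^+ 2 = 1 + dot x x by rewrite tc_lift sqr_sqrtr// addr_ge0// dot_ge0.
rewrite minkE !sp_dlift !tc_dlift /inner /hmetric mulmxBr mulmxBl mulmx1 mxE; congr (_ + _).
rewrite -/(dot x x) -t2 mxE; congr (- _).
have -> : u^T *m ((tc (lift x) ^+ 2)^-1 *: (x *m x^T)) *m v = (tc (lift x) ^+ 2)^-1 *: ((u^T *m x) *m (x^T *m v)).
  by rewrite -scalemxAr -scalemxAl !mulmxA.
rewrite mxE [in X in _ * X]mxE big_ord1 -/(dot u x) -/(dot x v) (dotC u x).
by field; rewrite gt_eqF.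
Qed.

Lemma hnorm_dlift x w : hnorm x w ^+ 2 = B (dlift x w) (dlift x w).
Proof.
rewrite /hnorm inner_dlift sqr_sqrtr//.
exact: perp_ge0 (hyp_causal (lift_hyp x)) (dlift_perp x w).
Qed.

Lemma hnorm_ge0 x w : 0 <= hnorm x w. Proof. exact: sqrtr_ge0. Qed.

Lemma hnorm0 x w : hnorm x w = 0 -> w = 0.
Proof.
move=> h; have := hnorm_dlift x w; rewrite h expr0n /= => /esym e.
have := perp_eq0 (lift_hyp x) (dlift_perp x w) e.
by move=> /(congr1 (@sp R n)); rewrite sp_dlift => ->; rewrite /sp linear0.
Qed.

Lemma cosh_sinh (t : R) : cosh t ^+ 2 - sinh t ^+ 2 = 1.
Proof.
have e : expR t * expR (- t) = 1 by rewrite -expRD subrr expR0.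
rewrite /cosh /sinh; move: (expR t) (expR (- t)) e => a b e.
have -> : ((a + b) / 2) ^+ 2 - ((a - b) / 2) ^+ 2 = a * b by field.
exact: e.
Qed.

Lemma cosh_ge1 (t : R) : 1 <= cosh t.
Proof.
have e : expR t * expR (- t) = 1 by rewrite -expRD subrr expR0.
have := expR_gt0 t; have := expR_gt0 (- t).
rewrite /cosh; move: (expR t) (expR (- t)) e => a b e b0 a0.
by rewrite ler_pdivlMr// mul1r; have := sqr_ge0 (a - b); nra.
Qed.

Lemma cosh_gt0 (t : R) : 0 < cosh t. Proof. exact: lt_le_trans ltr01 (cosh_ge1 t). Qed.

Lemma sinh_ge0 (t : R) : 0 <= t -> 0 <= sinh t.
Proof. by move=> t0; rewrite /sinh divr_ge0// subr_ge0 ler_expR; lra. Qed.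

Lemma coshDsinh (t : R) : cosh t + sinh t = expR t.
Proof. by rewrite /cosh /sinh; field. Qed.
Lemma coshBsinh (t : R) : cosh t - sinh t = expR (- t).
Proof. by rewrite /cosh /sinh; field. Qed.

Lemma cosh_inj (s t : R) : 0 <= s -> 0 <= t -> cosh s = cosh t -> s = t.
Proof.
move=> s0 t0 e; have := cosh_sinh s; rewrite e -(cosh_sinh t) => /(congr1 (fun x : R => cosh t ^+ 2 - x)).
rewrite !opprB !addrA ![cosh t ^+ 2 + _]addrC !addrK => h.
have {}h : sinh s = sinh t.
  by apply/eqP; rewrite -(eqrXn2 (isT : (0 < 2)%N)) ?sinh_ge0// h.
by apply: expR_inj; rewrite -!coshDsinh e h.
Qed.

Lemma hyp_future X Y : hyp X -> B Y Y = -1 -> B X Y < 0 -> hyp Y.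
Proof.
move=> hX YY XY; split=> //; rewrite ltNge; apply/negP; rewrite le_eqVlt => /orP[/eqP t0|t0].
  by have := dot_ge0 (sp Y); have := YY; rewrite minkE t0; lra.
have : B X (- Y) <= 0.
  apply: causal_le0; first exact: hyp_causal.
  by split; [rewrite minkNl minkNr opprK YY lerN10|rewrite tcN oppr_gt0].
by rewrite minkNr oppr_le0 leNgt XY.
Qed.

Lemma lift_hexp x w : lift (hexp x w) = cosh (hnorm x w) *: lift x + (sinh (hnorm x w) / hnorm x w) *: dlift x w.
Proof.
set r := hnorm x w; set Y := RHS.
have sY : sp Y = hexp x w by rewrite /Y spD !spZ sp_lift sp_dlift.
have [XX _] := lift_hyp x.
rewrite -sY; apply: lift_sp; apply: hyp_future (lift_hyp x) _ _.
  rewrite /Y !(minkDl, minkDr, minkZl, minkZr) (minkC (dlift x w)) dlift_perp -hnorm_dlift -/r XX.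
  have [r0|r0] := eqVneq r 0.
    have e : cosh 0 = 1 :> R by rewrite /cosh oppr0 expR0; field.
    by rewrite r0 invr0 e; ring.
  rewrite -[RHS]opprK -[in RHS](cosh_sinh r); field.
  exact: r0.
by rewrite /Y minkDr !minkZr dlift_perp XX mulr0 addr0 mulrN1 oppr_lt0 cosh_gt0.
Qed.

End Lift.

(** * Differentials *)

Section Calculus.
Context {R : realType}.

Lemma is_diff_sum (V W : normedModType R) m (f df : 'I_m -> V -> W) x :
  (forall i, is_diff x (f i) (df i)) ->
  is_diff x (fun y => \sum_i f i y) (fun u => \sum_i df i u).
Proof.
elim: m f df => [|m IH] f df h.
  have -> : (fun y => \sum_(i < 0) f i y) = cst 0 by apply/funext => y; rewrite big_ord0.
  have -> : (fun y => \sum_(i < 0) df i y) = 0 by apply/funext => y; rewrite big_ord0.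
  exact: is_diff_cst.
have -> : (fun y => \sum_(i < m.+1) f i y) = f ord0 + (fun y => \sum_(i < m) f (lift ord0 i) y).
  by apply/funext => y; rewrite big_ord_recl.
have -> : (fun y => \sum_(i < m.+1) df i y) = df ord0 + (fun y => \sum_(i < m) df (lift ord0 i) y).
  by apply/funext => y; rewrite big_ord_recl.
by apply: is_diffD; apply: IH.
Qed.

Lemma is_diff_scalel_fun (V W : normedModType R) (k dk : V -> R) (e : W) x :
  is_diff x k dk -> is_diff x (fun y => k y *: e) (fun u => dk u *: e).
Proof.
move=> h; apply: DiffDef; first exact: differentiableZl.
by rewrite diffZl// diff_val.
Qed.

Lemma is_diff_cV (V : normedModType R) m (f df : V -> 'cV[R]_m) x :
  (forall i, is_diff x (fun y => f y i ord0 : R) (fun u => df u i ord0 : R)) -> is_diff x f df.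
Proof.
move=> h.
have e (g : V -> 'cV[R]_m) : g = (fun y => \sum_i g y i ord0 *: delta_mx i ord0).
  apply/funext => y; rewrite {1}(matrix_sum_delta (g y)).
  by apply: eq_bigr => i _; rewrite big_ord1.
rewrite (e f) (e df); apply: is_diff_sum => i; exact: is_diff_scalel_fun.
Qed.

Lemma is_diff_coord k (x : 'cV[R]_k) i :
  is_diff x (fun y : 'cV[R]_k => y i ord0 : R) (fun u => u i ord0 : R).
Proof.
have lin : linear (fun y : 'cV[R]_k => y i ord0 : R) by move=> a u v; rewrite !mxE.
pose m := GRing.isLinear.Build _ _ _ _ _ lin.
pose L : {linear 'cV[R]_k -> R} := HB.pack (fun y : 'cV[R]_k => y i ord0 : R) m.
have c : continuous L by exact: coord_continuous.
by apply: (@DiffDef _ _ _ _ _ L L); [exact: linear_differentiable|exact: diff_lin].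
Qed.

Lemma is_diff_mulmx k m (A : 'M[R]_(m, k)) (x : 'cV[R]_k) :
  is_diff x (fun y : 'cV[R]_k => A *m y) (fun u => A *m u).
Proof.
apply: is_diff_cV => i.
have -> : (fun y : 'cV[R]_k => (A *m y) i ord0 : R) = (fun y => \sum_j A i j *: (y j ord0 : R)).
  by apply/funext => y; rewrite mxE.
apply: is_diff_sum => j.
exact: (@is_diffZ _ _ _ (fun y : 'cV[R]_k => y j ord0 : R) (fun u => u j ord0) (A i j) x (is_diff_coord x j)).
Qed.

Lemma is_diff_dot k (x : 'cV[R]_k) : is_diff x (fun y => dot y y) (fun u => 2 * dot x u).
Proof.
have -> : (fun y : 'cV[R]_k => dot y y) = (fun y => \sum_i (y i ord0 * y i ord0 : R)).
  by apply/funext => y; rewrite dotE.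
have -> : (fun u : 'cV[R]_k => 2 * dot x u) = (fun u => \sum_i (x i ord0 * u i ord0 + x i ord0 * u i ord0 : R)).
  by apply/funext => y; rewrite dotE mulr_sumr; apply: eq_bigr => i _; ring.
apply: is_diff_sum => i.
exact: (@is_diffM _ _ _ _ _ _ x (is_diff_coord x i) (is_diff_coord x i)).
Qed.

Lemma is_diff_sqrt (t : R) : 0 < t -> is_diff t Num.sqrt (fun u => u / (2 * Num.sqrt t)).
Proof.
move=> t0; have h := is_derive1_sqrt t0.
have d : derivable (Num.sqrt : R -> R) t 1 by apply: ex_derive.
apply: DiffDef; first exact/derivable1_diffP.
rewrite deriv1E// derive1E; apply/funext => u; congr (u * _); exact: derive_val.
Qed.

Lemma is_diff_lift n (x : 'cV[R]_n) : is_diff x (@lift_hyperboloid R n) (dlift x).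
Proof.
apply: is_diff_cV => i; rewrite -(splitK i); case: (fintype.split i) => j; rewrite [unsplit _]/=.
  have -> : (fun y : 'cV[R]_n => lift_hyperboloid y (lshift n j) ord0 : R) = Num.sqrt \o (fun y => 1 + dot y y).
    by apply/funext => y; rewrite /lift_hyperboloid col_mxEu mxE (ord1 j) mulr1n.
  have -> : (fun u : 'cV[R]_n => dlift x u (lshift n j) ord0 : R) = (fun u => u / (2 * Num.sqrt (1 + dot x x))) \o (fun u => 0 + 2 * dot x u).
    apply/funext => u; rewrite /dlift col_mxEu mxE (ord1 j) /= add0r mulr1n.
    by rewrite invfM mulrA [2 * _]mulrC mulfK// pnatr_eq0.
  apply: is_diff_comp.
    have H : is_diff x (cst (1 : R) + (fun y : 'cV[R]_n => dot y y) : 'cV[R]_n -> R) (0 + (fun u => 2 * dot x u) : 'cV[R]_n -> R).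
      by apply: is_diffD; exact: is_diff_dot.
    exact: H.
  by apply: is_diff_sqrt; rewrite ltr_pwDl// dot_ge0.
have -> : (fun y : 'cV[R]_n => lift_hyperboloid y (rshift 1 j) ord0 : R) = (fun y => y j ord0).
  by apply/funext => y; rewrite /lift_hyperboloid col_mxEd.
have -> : (fun u : 'cV[R]_n => dlift x u (rshift 1 j) ord0 : R) = (fun y => y j ord0).
  by apply/funext => u; rewrite /dlift col_mxEd.
exact: is_diff_coord.
Qed.

Lemma is_diff_hact n (A : 'M[R]_(1 + n)) (x : 'cV[R]_n) :
  is_diff x (hact A) (fun u => sp (A *m dlift x u)).
Proof.
have h : is_diff x ((fun y => A *m y) \o (@lift_hyperboloid R n)) ((fun y => A *m y) \o dlift x).
  by apply: is_diff_comp; [exact: is_diff_lift|exact: is_diff_mulmx].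
apply: is_diff_cV => i.
have -> : (fun y : 'cV[R]_n => hact A y i ord0 : R) = (fun z : 'cV[R]_(1 + n) => z (rshift 1 i) ord0) \o ((fun y => A *m y) \o (@lift_hyperboloid R n)).
  by apply/funext => y; rewrite /hact mxE.
have -> : (fun y : 'cV[R]_n => sp (A *m dlift x y) i ord0 : R) = (fun z : 'cV[R]_(1 + n) => z (rshift 1 i) ord0) \o ((fun y => A *m y) \o (dlift x)).
  by apply/funext => y; rewrite /sp mxE.
by apply: is_diff_comp; exact: is_diff_coord.
Qed.

Lemma is_derive_line (V W : normedModType R) (f : V -> W) y v s :
  derivable f (y + s *: v) v ->
  is_derive s 1 (fun t : R => f (y + t *: v)) ('D_v f (y + s *: v)).
Proof.
move=> d.
have e : (fun h => h^-1 *: (((fun t : R => f (y + t *: v)) \o shift s) (h *: 1) - f (y + s *: v))) =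
    (fun h : R => h^-1 *: ((f \o shift (y + s *: v)) (h *: v) - f (y + s *: v))).
  apply/funext => h /=; congr (_ *: (f _ - _)).
  by rewrite [h%:A]mulr1 scalerDl addrCA.
by split; rewrite /derivable /derive e.
Qed.

Lemma mvt_line (V : normedModType R) (f : V -> R) y v t c e :
  (forall s, derivable f (y + s *: v) v) ->
  (forall s, `|s| <= `|t| -> `|'D_v f (y + s *: v) - c| <= e) ->
  `|f (y + t *: v) - f y - t * c| <= e * `|t|.
Proof.
move=> d b; pose g s := f (y + s *: v); pose dg s := 'D_v f (y + s *: v).
have D s : is_derive s (1 : R) g (dg s : R) by exact: is_derive_line.
have C s : {for s, continuous g}.
  by apply: differentiable_continuous; apply/derivable1_diffP; apply: ex_derive.
have key a a' : a <= a' -> exists2 s, a <= s <= a' & g a' - g a = dg s * (a' - a).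
  move=> aa; have [s] := MVT_segment aa (fun s _ => D s) (continuous_subspaceT C).
  by rewrite in_itv /= => h1 h2; exists s.
have g0 : g 0 = f y by rewrite /g scale0r addr0.
rewrite -g0 -/(g t).
have [s st ->] : exists2 s, `|s| <= `|t| & g t - g 0 = dg s * t.
  have [t0|/ltW t0] := leP 0 t.
    have [s /andP[s0 st] h] := key _ _ t0; exists s; last by rewrite h subr0.
    by rewrite !ger0_norm.
  have [s /andP[s0 st] h] := key _ _ t0; exists s; first by rewrite !ler0_norm// lerN2.
  by rewrite -[LHS]opprB h sub0r mulrN opprK.
by rewrite [t * c]mulrC -mulrBl normrM ler_wpM2r// b.
Qed.

(** [smooth] speaks only of iterated partial derivatives, so differentiability has to be derived
    from their continuity: the increment is telescoped over the coordinates and [mvt_line] is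
    applied to each step. *)
Lemma C1_differentiable n (f : 'cV[R]_n -> R) (x : 'cV[R]_n) :
  (forall i y, derivable f y (delta_mx i ord0)) ->
  (forall i, continuous (fun y => 'D_(delta_mx i ord0) f y : R)) ->
  differentiable f x.
Proof.
move=> d c; pose D i := 'D_(delta_mx i ord0) f x : R.
pose df (u : 'cV[R]_n) : R := \sum_i u i ord0 * D i.
have lin : linear df.
  move=> a u v; rewrite /df scaler_sumr -big_split /=; apply: eq_bigr => i _.
  by rewrite !mxE mulrDl -[RHS]/(a * _ + _) mulrA.
pose m := GRing.isLinear.Build _ _ _ _ _ lin.
pose L : {linear 'cV[R]_n -> R} := HB.pack df m.
have cL : continuous L.
  move=> u; apply: differentiable_continuous.
  have : is_diff u (fun u => \sum_i u i ord0 *: (D i : R)) (fun u => \sum_i u i ord0 *: (D i : R)).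
    by apply: is_diff_sum => i; apply: is_diff_scalel_fun; exact: is_diff_coord.
  by case.
have main : f \o shift x = cst (f x) + L +o_ (0 : 'cV[R]_n) id.
  apply/eqaddoP => _/posnumP[eps].
  (* The n coordinate steps contribute at most n e <= eps in total; the successor keeps the
     denominator nonzero. *)
  pose e := eps%:num / n.+1%:R.
  have e0 : 0 < e by rewrite divr_gt0.
  have : nbhs x (fun y : 'cV[R]_n => forall i : 'I_n, `|('D_(delta_mx i ord0) f y : R) - D i| <= e).
    apply: (@filter_forall _ _ (fun i y => `|('D_(delta_mx i ord0) f y : R) - D i| <= e) (nbhs x)) => i; have /cvgrPdist_le := c i x => /(_ _ e0).
    by apply: filterS => y; rewrite distrC.
  move=> /nbhs_ballP[r /= r0 br].
  apply/nbhs_ballP; exists r => //= h [_ bh].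
  have bh' i : `|h i ord0| < r by have := bh i ord0; rewrite /ball /= mxE sub0r normrN.
  pose y k : 'cV[R]_n := x + \col_j (if (j < k)%N then h j ord0 else 0).
  have yS (i : 'I_n) : y i.+1 = y i + h i ord0 *: delta_mx i ord0.
    apply/colP => j; rewrite !mxE ltnS -addrA; congr (_ + _).
    case: (ltngtP j i) => [ji|ij|/val_inj ->]; rewrite ?eqxx ?mulr1 ?add0r//.
      by rewrite -val_eqE/= (ltn_eqF ji) mulr0 addr0.
    by rewrite -val_eqE/= (gtn_eqF ij) mulr0.
  have y0 : y 0%N = x by apply/colP => j; rewrite !mxE addr0.
  have yn : y n = h + x by apply/colP => j; rewrite !mxE ltn_ord addrC.
  have -> : (f \o shift x - (cst (f x) + L)) h = \sum_(i < n) (f (y i.+1) - f (y i) - h i ord0 * D i).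
    rewrite sumrB -/(df h) -(big_mkord xpredT (fun i => f (y i.+1) - f (y i))).
    by rewrite telescope_sumr// y0 yn -[LHS]/(f (h + x) - (f x + df h)) opprD addrA.
  have hb i : `|h i ord0| <= `|h|.
    by rewrite [leRHS]/Num.Def.normr/= mx_normrE; exact: (le_bigmax _ _ (i, ord0)).
  apply: (@le_trans _ _ (\sum_(i < n) e * `|h|)).
    apply: (le_trans (ler_norm_sum _ _ _)); apply: ler_sum => i _.
    apply: (@le_trans _ _ (e * `|h i ord0|)); last by rewrite ler_pM2l.
    rewrite yS; apply: mvt_line => [s|s sh]; first exact: d.
    apply: br; split=> // j k; rewrite ord1 {k} /ball /= !mxE opprD addrA opprD addrA subrr add0r.
    case: (eqVneq j i) => [->|_].
      by rewrite ltnn oppr0 add0r mulr1 normrN (le_lt_trans sh).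
    rewrite mulr0 oppr0 addr0; case: ifP => _; first by rewrite normrN.
    by rewrite oppr0 normr0.
  rewrite sumr_const card_ord -mulr_natr -mulrA mulrC mulrA -mulrA [leRHS]mulrC /=.
  by rewrite -mulrA ler_wpM2l// mulrCA ler_piMr// ler_pdivrMr// mul1r ler_nat.
by apply/diff_locallyP; rewrite (diff_unique cL main).
Qed.

Lemma smooth_differentiable n m (phi : 'cV[R]_n -> 'cV[R]_m) (x : 'cV[R]_n) :
  smooth phi -> differentiable phi x.
Proof.
move=> sm; have [_ d] := sm [::].
suff h i : differentiable (fun y => phi y i ord0 : R) x.
  have H : is_diff x phi (fun u => \col_i ('d (fun y => phi y i ord0 : R) x u)).
    apply: is_diff_cV => i; have -> : (fun u => (\col_j ('d (fun y => phi y j ord0 : R) x u)) i ord0) = 'd (fun y => phi y i ord0 : R) x.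
      by apply/funext => u; rewrite mxE.
    exact: differentiableP.
  exact: ex_diff.
have dc j y : derivable phi y (delta_mx j ord0) by exact: d.
apply: C1_differentiable => [j y|j].
  by have /derivable_mxP := dc j y; apply.
have [c _] := sm [:: j].
have -> : (fun y => 'D_(delta_mx j ord0) (fun z => phi z i ord0 : R) y : R) =
    (fun M : 'cV[R]_m => M i ord0) \o (fun y => 'D_(delta_mx j ord0) phi y).
  by apply/funext => y /=; rewrite derive_mx// mxE.
by move=> y; apply: continuous_comp; [exact: c|exact: coord_continuous].
Qed.

Lemma smooth_id n : smooth (@id 'cV[R]_n).
Proof.
have st (s : seq 'I_n) : (s = [::] /\ iter_partial s id = id :> ('cV[R]_n -> 'cV[R]_n)) \/ exists c, iter_partial s id = cst c :> ('cV[R]_n -> 'cV[R]_n).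
  elim: s => [|i s [[-> _]|[c IH]]]; [by left| |]; right.
    by exists (delta_mx i ord0); apply/funext => y; rewrite /= /partial derive_id.
  by exists 0; apply/funext => y; rewrite /= IH /partial derive_cst.
move=> s; case: (st s) => [[_ ->]|[c ->]]; split=> [|i x].
- by move=> x; exact: cvg_id.
- exact: derivable_id.
- exact: cst_continuous.
- exact: derivable_cst.
Qed.

End Calculus.

(** * Riemannian isometries are Lorentz transformations *)

Section HyperbolicFunctions.
Context {R : realType}.

Lemma cosh_arcosh (c : R) : 1 <= c -> exists2 d : R, 0 <= d & cosh d = c.
Proof.
move=> c1; pose q := c + Num.sqrt (c ^+ 2 - 1).
have c2 : 0 <= c ^+ 2 - 1 by rewrite subr_ge0 exprn_ege1.
have q1 : 1 <= q by rewrite /q; have := sqrtr_ge0 (c ^+ 2 - 1); lra.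
have q0 : 0 < q by lra.
exists (ln q); first exact: ln_ge0.
rewrite /cosh expRN lnK ?posrE//; apply/eqP; rewrite -subr_eq0; apply/eqP.
have -> : (q + q^-1) / 2 - c = ((q - c) ^+ 2 - (c ^+ 2 - 1)) / (2 * q) by field; rewrite gt_eqF.
have -> : q - c = Num.sqrt (c ^+ 2 - 1) by rewrite /q; ring.
by rewrite sqr_sqrtr// subrr mul0r.
Qed.

Lemma sinh_le (s t : R) : s <= t -> sinh s <= sinh t.
Proof. by move=> h; rewrite /sinh ler_pM2r ?invr_gt0// lerB// ler_expR// lerN2. Qed.

Lemma cosh_le (s t : R) : 0 <= s -> s <= t -> cosh s <= cosh t.
Proof.
move=> s0 st; have h := sinh_le st; have h0 := sinh_ge0 s0.
rewrite -(@ler_pXn2r _ 2)// ?nnegrE ?(ltW (cosh_gt0 _))//.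
have := cosh_sinh s; have := cosh_sinh t.
have : sinh s ^+ 2 <= sinh t ^+ 2 by rewrite ler_pXn2r// nnegrE// (le_trans h0).
by lra.
Qed.

Lemma is_derive_cosh (t : R) : is_derive t (1 : R) (@cosh R) (sinh t).
Proof.
have -> : @cosh R = (fun s => (2^-1 : R) *: (expR s + expR (- s))).
  by apply/funext => s; rewrite /cosh mulrC.
apply: is_derive_eq; rewrite /sinh [RHS]mulrC.
by congr (_ *: (_ + _)); rewrite mulrN1.
Qed.

Lemma is_derive_sinh (t : R) : is_derive t (1 : R) (@sinh R) (cosh t).
Proof.
have -> : @sinh R = (fun s => (2^-1 : R) *: (expR s - expR (- s))).
  by apply/funext => s; rewrite /sinh mulrC.
apply: is_derive_eq; rewrite /cosh [RHS]mulrC.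
by congr (_ *: (_ + _)); rewrite mulrN1 opprK.
Qed.

Lemma is_derive_diff (f : R -> R) (t a : R) : is_derive t 1 f a -> is_diff t f (fun u => u * a).
Proof.
move=> h; have d : derivable f t 1 by apply: ex_derive.
apply: DiffDef; first exact/derivable1_diffP.
rewrite deriv1E// derive1E; apply/funext => u; congr (u * _); exact: derive_val.
Qed.

Lemma is_diff_derive (V : normedModType R) (f : R -> V) (t : R) (df : R -> V) :
  is_diff t f df -> is_derive t 1 f (df 1).
Proof.
move=> h; have d : differentiable f t by apply: ex_diff.
by split; [exact/derivable1_diffP|rewrite deriveE// diff_val].
Qed.

End HyperbolicFunctions.

Section Geodesic.
Context {R : realType} {n : nat}.
Implicit Types (x y u : 'cV[R]_n) (X Y U W Z nu : 'cV[R]_(1 + n)).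
Local Notation B := (@mink R n).
Local Notation lift := (@lift_hyperboloid R n).

(** The logarithm of - B nu is a Busemann function, with gradient of norm 1; this is the resulting
    bound for its slope in the unit tangent direction W at Z. *)
Lemma null_slope nu Z W : null nu -> hyp Z -> B Z W = 0 -> B W W = 1 ->
  `|B nu W| <= - B nu Z.
Proof.
move=> hnu hZ ZW WW; have [nn _] := hnu; have [ZZ _] := hZ.
pose u := nu + B nu Z *: Z.
have Zu : B Z u = 0 by rewrite /u minkDr minkZr ZZ (minkC Z); ring.
have := perp_CS (hyp_causal hZ) Zu ZW; rewrite WW mulr1.
have -> : B u W = B nu W by rewrite /u minkDl minkZl ZW mulr0 addr0.
have -> : B u u = (- B nu Z) ^+ 2 by rewrite /u !(minkDl, minkDr, minkZl, minkZr) nn ZZ (minkC Z); ring.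
have h : 0 <= - B nu Z by rewrite oppr_ge0; apply: causal_le0; [exact: null_causal|exact: hyp_causal].
by rewrite -[X in X <= _]real_normK ?num_real// ler_pXn2r ?nnegrE.
Qed.

Lemma hyp_geodesic X U t : hyp X -> B X U = 0 -> B U U = 1 ->
  hyp (cosh t *: X + sinh t *: U).
Proof.
move=> hX XU UU; have [XX _] := hX; apply: hyp_future hX _ _.
  rewrite !(minkDl, minkDr, minkZl, minkZr) (minkC U) XU XX UU.
  by rewrite -[RHS]opprK -[in RHS](cosh_sinh t); ring.
by rewrite minkDr !minkZr XX XU mulr0 addr0 mulrN1 oppr_lt0 cosh_gt0.
Qed.

Lemma geodesic_between X Y : hyp X -> hyp Y -> X != Y ->
  exists t U, [/\ 0 <= t, B X U = 0, B U U = 1, Y = cosh t *: X + sinh t *: U & cosh t = - B X Y].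
Proof.
move=> hX hY XY; have [XX _] := hX; have [YY _] := hY.
have c1 : 1 <= - B X Y by have := hyp_mink hX hY; lra.
have [d d0 hd] := cosh_arcosh c1.
have s0 : sinh d != 0.
  apply/eqP => s0; have := cosh_sinh d; rewrite s0 expr0n subr0 => /eqP.
  rewrite sqrf_eq1 hd => /orP[/eqP e|/eqP e]; last by move: c1; rewrite e; lra.
  by move/eqP: XY; apply; apply: hyp_mink_eq => //; rewrite -[LHS]opprK e.
exists d, ((sinh d)^-1 *: (Y - cosh d *: X)); split => //.
- by rewrite minkZr minkBr minkZr XX mulrN1 opprK -[B X Y]opprK -hd addNr mulr0.
- rewrite !(minkZl, minkZr, minkBl, minkBr) XX YY (minkC Y) -[B X Y]opprK -hd.
  have h : sinh d ^+ 2 = cosh d ^+ 2 - 1 by rewrite -(cosh_sinh d); ring.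
  have -> : (sinh d)^-1 * ((sinh d)^-1 * (- (1) - cosh d * - cosh d - cosh d * (- cosh d - cosh d * - (1)))) = (cosh d ^+ 2 - 1) / sinh d ^+ 2 by field.
  by rewrite -h divff// expf_neq0.
- by rewrite scalerA divff// scale1r addrC subrK.
Qed.

Section Isometry.
Variable phi : 'cV[R]_n -> 'cV[R]_n.
Hypothesis dphi : forall x, differentiable phi x.
Hypothesis iphi : pullback_eq phi hmetric hmetric 1.

(* For a null vector nu, f t = - B nu (lift (phi (c t))) along a unit speed geodesic c satisfies |f'| <= f. *)
Lemma growth nu X U t : null nu -> hyp X -> B X U = 0 -> B U U = 1 -> 0 <= t ->
  - B nu (lift (phi (sp (cosh t *: X + sinh t *: U)))) <= expR t * - B nu (lift (phi (sp X))).
Proof.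
move=> hnu hX XU UU t0.
pose C s := cosh s *: X + sinh s *: U; pose dC s := sinh s *: X + cosh s *: U.
have hC s : hyp (C s) by exact: hyp_geodesic.
have CdC s : B (C s) (dC s) = 0.
  have [XX _] := hX; rewrite /C /dC !(minkDl, minkDr, minkZl, minkZr) (minkC U) XU XX UU; ring.
have dCdC s : B (dC s) (dC s) = 1.
  have [XX _] := hX; rewrite /dC !(minkDl, minkDr, minkZl, minkZr) (minkC U) XU XX UU.
  by rewrite -[RHS](cosh_sinh s); ring.
pose c s := sp (C s).
have dc s : is_diff s c (fun h : R => h *: sp (dC s)).
  have -> : c = (fun s => cosh s *: sp X) + (fun s => sinh s *: sp U).
    by apply/funext => r; rewrite /c /C spD !spZ.
  have -> : (fun h : R => h *: sp (dC s)) = (fun h => (h * sinh s) *: sp X) + (fun h => (h * cosh s) *: sp U).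
    by apply/funext => r; rewrite /dC spD !spZ scalerDr !scalerA.
  apply: is_diffD; apply: is_diff_scalel_fun; apply: is_derive_diff.
    exact: is_derive_cosh.
  exact: is_derive_sinh.
pose W s := dlift (phi (c s)) ('d phi (c s) (sp (dC s))).
have lc s : lift (c s) = C s by exact: lift_sp.
have WW s : B (W s) (W s) = 1.
  rewrite /W -inner_dlift iphi mul1r inner_dlift dlift_uniq ?dCdC//.
  by rewrite lc CdC.
pose F s : R := B nu (lift (phi (c s))).
have dF s : is_derive s (1 : R) F (B nu (W s)).
  pose M := nu^T *m lorentz_form.
  have H1 : is_diff s (phi \o c) ('d phi (c s) \o (fun h : R => h *: sp (dC s))).
    by apply: is_diff_comp; apply: differentiableP.
  have H2 : is_diff s (lift \o (phi \o c)) (dlift (phi (c s)) \o ('d phi (c s) \o (fun h : R => h *: sp (dC s)))).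
    by apply: is_diff_comp; exact: is_diff_lift.
  have H3 : is_diff s ((fun y : 'cV[R]_(1 + n) => M *m y) \o (lift \o (phi \o c))) ((fun y : 'cV[R]_(1 + n) => M *m y) \o (dlift (phi (c s)) \o ('d phi (c s) \o (fun h : R => h *: sp (dC s))))).
    by apply: is_diff_comp; exact: is_diff_mulmx.
  have H4 := @is_diff_comp _ _ _ _ _ _ _ _ s H3 (is_diff_coord (M *m lift (phi (c s))) ord0).
  have := is_diff_derive H4.
  by rewrite /= scale1r.
have key s : `|B nu (W s)| <= - F s.
  by apply: null_slope (WW s) => //; [exact: lift_hyp|exact: dlift_perp].
pose f s : R := - F s * expR (- s).
have df s : is_derive s (1 : R) f ((- B nu (W s) + F s) * expR (- s)).
  rewrite /f; apply: is_derive_eq.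
  rewrite -[LHS]/(- F s * (expR (- s) * -1) + expR (- s) * - B nu (W s)).
  ring.
have h : f t <= f 0.
  apply: (@ler0_derive1_nincr _ f 0 t) => //.
  - move=> s _; have [_ hd] := df s; rewrite derive1E hd.
    rewrite pmulr_lle0 ?expR_gt0//; have := key s; rewrite ler_norml; lra.
  - apply: continuous_subspaceT => s; apply: differentiable_continuous.
    by apply/derivable1_diffP; have [] := df s.
move: h; rewrite /f oppr0 expR0 mulr1 /F /c /C.
have -> : sinh 0 = 0 :> R by rewrite /sinh oppr0 subrr mul0r.
have -> : cosh 0 = 1 :> R by rewrite /cosh oppr0 expR0; field.
rewrite scale1r scale0r addr0 => h.
by rewrite mulrC -ler_pdivrMr ?expR_gt0// -expRN.
Qed.

(** Horofunctions take the place of lengths of curves. For nu the end of the geodesic from phi y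
    through phi x, the values of - B nu at phi y and phi x differ exactly by the factor exp s, where
    s is the distance of the images; [growth] bounds this factor by exp t, where t is the distance
    of x and y. *)
Lemma contraction x y : - B (lift (phi x)) (lift (phi y)) <= - B (lift x) (lift y).
Proof.
have hX := lift_hyp x; have hY := lift_hyp y.
have hX' := lift_hyp (phi x); have hY' := lift_hyp (phi y).
have [->|XY] := eqVneq x y; first by have [-> _] := lift_hyp (phi y); have [-> _] := hY.
have [->|X'Y'] := eqVneq (lift (phi x)) (lift (phi y)).
  by have [-> _] := hY'; have := hyp_mink hX hY; lra.
have [|t [U [t0 XU UU YE tcE]]] := geodesic_between hX hY.
  by apply: contra XY => /eqP /lift_inj ->.
have [s [V [s0 XV VV Y'E sc]]] := geodesic_between hX' hY' X'Y'.
rewrite -sc -tcE; apply: cosh_le => //.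
have sp0 : 0 < sinh s.
  rewrite lt_neqAle sinh_ge0// andbT; apply/negP => /eqP e.
  move/eqP: X'Y'; apply; rewrite Y'E -e scale0r addr0.
  have := cosh_sinh s; rewrite -e expr0n subr0 => /eqP; rewrite sqrf_eq1 => /orP[/eqP f|/eqP f].
    by rewrite f scale1r.
  by exfalso; have := cosh_gt0 s; rewrite f oppr_gt0 ltr10.
(* the end of the geodesic from phi y to phi x *)
pose nu := expR s *: lift (phi x) - lift (phi y).
have [XX _] := hX'; have [YY _] := hY'.
have XY' : B (lift (phi x)) (lift (phi y)) = - cosh s by rewrite sc opprK.
have ee : expR s * expR (- s) = 1 by rewrite -expRD subrr expR0.
have hnu : null nu.
  apply: future hX' _ _.
    rewrite /nu !(minkBl, minkBr, minkZl, minkZr) (minkC (lift (phi y))) XX YY XY' /cosh.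
    have -> : expR s * (expR s * -1 - - ((expR s + expR (- s)) / 2)) - (expR s * - ((expR s + expR (- s)) / 2) - -1) = expR s * expR (- s) - 1 by field.
    by rewrite ee subrr.
  by rewrite /nu minkBr minkZr XX XY' -(coshDsinh s); lra.
have := growth hnu hX XU UU t0; rewrite -YE !sp_lift.
rewrite /nu !(minkBl, minkZl) (minkC (lift (phi y)) (lift (phi x))) XX YY XY'.
have -> : - (expR s * - cosh s - -1) = expR s * sinh s.
  have : cosh s * expR s - 1 = expR s * sinh s by rewrite -ee /cosh /sinh; field.
  lra.
have -> : - (expR s * -1 - - cosh s) = sinh s by rewrite -(coshDsinh s); ring.
by rewrite ler_pM2r// ler_expR.
Qed.

End Isometry.

(** phi and its inverse are both contractions, so B is preserved on the hyperboloid. Each vector v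
    is a point of the hyperboloid minus a multiple of [e0], which extends phi to a map T preserving
    B. The values of T on the standard basis are the columns of A, and nondegeneracy of B identifies
    A with phi. *)
Lemma isometry_lorentz phi psi : (forall x, differentiable phi x) -> (forall x, differentiable psi x) ->
  cancel phi psi -> cancel psi phi -> pullback_eq phi hmetric hmetric (1 : R) ->
  exists2 A, lorentz A & phi = hact A.
Proof.
move=> dphi dpsi c1 c2 iphi.
have ipsi : pullback_eq psi hmetric hmetric (1 : R).
  move=> x u v; rewrite mul1r.
  have E w : 'd phi (psi x) ('d psi x w) = w.
    have h := diff_comp (dpsi x) (dphi (psi x)).
    have h2 : phi \o psi = id by apply/funext => y /=; rewrite c2.
    have := congr1 (fun f : 'cV[R]_n -> 'cV[R]_n => f w) h.
    by rewrite h2 /= => <-; have -> := @diff_val _ _ _ _ _ _ _ (is_diff_id x).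
  have aux (L L' : 'cV[R]_n -> 'cV[R]_n) : (forall w, L (L' w) = w) ->
      (forall u v, inner hmetric (phi (psi x)) (L u) (L v) = 1 * inner hmetric (psi x) u v) ->
      inner hmetric (psi x) (L' u) (L' v) = inner hmetric x u v.
    by move=> {}E h; have := h (L' u) (L' v); rewrite mul1r (E u) (E v) c2 => <-.
  exact: (aux _ _ E (iphi (psi x))).
pose Phi x := lift (phi x).
have BP x y : B (Phi x) (Phi y) = B (lift x) (lift y).
  apply/eqP; rewrite -eqr_opp eq_le (contraction dphi iphi) /=.
  by have := contraction dpsi ipsi (phi x) (phi y); rewrite !c1.
have e0E' := @e0E R n.
have e0E : e0 = lift 0 :> 'cV[R]_(1 + n) by rewrite -(lift_sp hyp_e0) sp_e0.
pose k v : R := tc (lift (sp v)) - tc v.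
pose T v := Phi (sp v) - k v *: Phi 0.
have vE v : v = lift (sp v) - k v *: lift 0.
  apply: mink_ext; last by rewrite spD -scaleNr spZ !sp_lift scaler0 addr0.
  by rewrite tcD tcN tcZ -e0E tc_e0 /k; ring.
have BT (a b : 'cV[R]_(1 + n)) : B (T a) (T b) = B a b.
  rewrite [in RHS](vE a) [in RHS](vE b) /T !(minkBl, minkBr, minkZl, minkZr) !BP.
  by [].
pose A : 'M[R]_(1 + n) := \matrix_(i, j) T (delta_mx j ord0) i ord0.
have Ae j : A *m delta_mx j ord0 = T (delta_mx j ord0).
  by rewrite -colE; apply/colP => i; rewrite !mxE.
have gram : A^T *m lorentz_form *m A = lorentz_form.
  apply/matrixP => i j.
  have ent (M : 'M[R]_(1 + n)) : M i j = (delta_mx (ord0 : 'I_1) i *m M *m delta_mx j (ord0 : 'I_1)) ord0 ord0.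
    by rewrite -rowE -colE !mxE.
  rewrite ent [RHS]ent -[delta_mx ord0 i]trmx_delta.
  have := BT (delta_mx i ord0) (delta_mx j ord0); rewrite -!Ae /mink trmx_mul => <-.
  by rewrite !mulmxA.
have Te0 : T e0 = Phi 0.
  by rewrite /T /k sp_e0 -e0E subrr scale0r subr0.
have lA : lorentz A.
  split; first exact: gram.
  have [_] := lift_hyp (phi 0); rewrite -/(Phi 0) -Te0 e0E' -Ae.
  by rewrite -e0E' tc_mul.
exists A => //; apply/funext => x; apply: lift_inj; rewrite lift_hact//.
apply/eqP; rewrite -subr_eq0; apply/eqP; set W := _ - _.
have h j : B (invmx A *m W) (delta_mx j ord0) = 0.
  rewrite lor_adj// /W minkBl lor_mink// Ae.
  set v := delta_mx j ord0.
  by rewrite [in X in _ - X](vE v) /T !(minkBr, minkZr) !BP subrr.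
have W0 : invmx A *m W = 0.
  apply: mink_nondeg => v; rewrite (matrix_sum_delta v) mink_sumr big1// => i _.
  by rewrite big_ord1 minkZr h mulr0.
by rewrite -[W]mul1mx -(lor_AV lA) -mulmxA W0 mulmx0.
Qed.

End Geodesic.

(** * Closed hyperbolic manifolds and their geodesics *)

Section ClosedManifolds.
Context {R : realType} {n : nat}.
Implicit Types (x y : 'cV[R]_n) (X Y Z : 'cV[R]_(1 + n)) (A C D M : 'M[R]_(1 + n)).
Implicit Types (G H : set 'M[R]_(1 + n)).
Local Notation B := (@mink R n).
Local Notation lift := (@lift_hyperboloid R n).

Lemma mprojP G x y : mx_subgroup G -> G `<=` lorentz ->
  mproj G x = mproj G y <-> exists2 A, G A & y = hact A x.
Proof.
move=> gG lG; split=> [e|[A GA ->]].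
  have : horbit G y y by exists 1%:M; [exact: gr1|rewrite hact1].
  by rewrite -[horbit G y]/(sval (mproj G y)) -e => -[A GA ->]; exists A.
apply: eq_exist; apply/seteqP; split=> z [C GC ->].
  exists (C *m invmx A); first by apply: grM => //; exact: grV.
  by rewrite -hactM ?lor_VAi -?mulmxA ?lor_VAi ?mulmx1//; apply: lG => //; apply: grM => //; exact: grV.
by exists (C *m A); [exact: grM|rewrite hactM//; exact: lG].
Qed.

Lemma mproj_onto G (m : manifold G) : exists x, m = mproj G x.
Proof. by case: m => S [x e]; exists x; exact: eq_exist. Qed.

Lemma hact_fix A x : lorentz A -> hact A x = x <-> A *m lift x = lift x.
Proof.
move=> lA; rewrite -lift_hact//; split=> [->//|]; exact: lift_inj.
Qed.

Lemma lor_disp A X : lorentz A -> hyp X -> A ord0 ord0 <= 2 * tc X * tc (A *m X).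
Proof.
move=> lA hX; have := hyp_tri hyp_e0 (lor_hyp lA hX) (lor_e0 lA).
by rewrite lor_mink// !mink_e0 tc_mul opprK [B X _]minkC mink_e0; lra.
Qed.

Lemma closed_disc G : closed_hyperbolic G -> disc G.
Proof.
move=> [[gG lG] _ fin _]; split=> // r.
apply: sub_finite_set (fin _ (@cV_box_compact R n `|r|)) => A [GA Ar]; split=> //.
have lA := lG _ GA; have h0 := lor_e0 lA; have t1 := hyp_tc1 h0; rewrite tc_mul in t1.
exists (hact A 0); split.
  by exists 0 => // i; rewrite mxE in_itv /= oppr_le0 normr_ge0.
move=> i; rewrite in_itv /= -ler_norml -(@ler_pXn2r _ 2)// ?nnegrE//.
rewrite !real_normK ?num_real//.
apply: (le_trans (entry_dot _ i)).
have -> : hact A 0 = sp (A *m e0) by rewrite -(lift_sp hyp_e0) sp_e0.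
rewrite (hyp_sp h0) tc_mul; have : A ord0 ord0 ^+ 2 <= r ^+ 2 by rewrite ler_pXn2r ?nnegrE//; lra.
by lra.
Qed.

Lemma closed_cocpt G : closed_hyperbolic G -> exists r0, cocpt G r0.
Proof.
move=> [[gG lG] _ _ [K [cK covK]]].
have [M [_ bM]] := compact_bounded cK.
pose N := M + 1; have {}bM x : K x -> `|x| <= N by apply: bM; rewrite /N; lra.
exists (1 + n%:R * N ^+ 2) => X hX; have [A GA KA] := covK (sp X); exists A => //.
have lA := lG _ GA; rewrite -(lift_sp hX) -lift_hact//; set y := hact _ _ in KA *.
have hd : dot y y <= n%:R * N ^+ 2.
  rewrite dotE -[n in n%:R]card_ord mulr_natl -sumr_const; apply: ler_sum => i _.
  rewrite -expr2 -real_normK ?num_real// ler_pXn2r ?nnegrE//.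
    apply: le_trans (bM _ KA); rewrite [leRHS]/Num.Def.normr/= mx_normrE; exact: (le_bigmax _ _ (i, ord0)).
  exact: le_trans (bM _ KA).
have t1 := hyp_tc1 (lift_hyp y); have := hyp_sp (lift_hyp y); rewrite sp_lift => h.
have : 0 <= (tc (lift y) - 1) * tc (lift y) by rewrite mulr_ge0//; lra.
by rewrite mulrBl mul1r -expr2; lra.
Qed.

Lemma closed_free G A X : closed_hyperbolic G -> G A -> hyp X -> A *m X = X -> A = 1%:M.
Proof.
move=> [[gG lG] fr _ _] GA hX e; apply: (fr _ (sp X)) => //.
by apply/hact_fix; [exact: lG|rewrite lift_sp].
Qed.

Lemma closed_index G H : closed_hyperbolic G -> mx_subgroup H -> finite_index H G -> closed_hyperbolic H.
Proof.
move=> cG gH iH; have [[gG lG] fr fin _] := cG; have [HG _] := iH.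
have [r0 c0] := closed_cocpt cG; have [r1 c1] := index_cocpt gH gG lG iH c0.
split; first by split=> // A /HG/lG.
- by move=> A x /HG; exact: fr.
- move=> K cK; apply: sub_finite_set (fin K cK) => A [/HG GA h]; by split.
- exists [set v : 'cV[R]_n | forall i, v i ord0 \in `[- `|r1|, `|r1|]]; split; first exact: cV_box_compact.
  move=> x; have [A HA tA] := c1 _ (lift_hyp x); exists A => // i.
  have lA := lG _ (HG _ HA); have hy := lor_hyp lA (lift_hyp x); have t1 := hyp_tc1 hy.
  rewrite in_itv /= -ler_norml -(@ler_pXn2r _ 2)// ?nnegrE// !real_normK ?num_real//.
  apply: (le_trans (entry_dot _ i)); rewrite -[hact A x]/(sp (A *m lift x)) (hyp_sp hy).
  have : tc (A *m lift x) ^+ 2 <= r1 ^+ 2 by rewrite ler_pXn2r ?nnegrE//; lra.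
  by lra.
Qed.

Lemma hyp_normalize Y : B Y Y < 0 -> 0 < tc Y -> hyp ((Num.sqrt (- B Y Y))^-1 *: Y).
Proof.
move=> b t; have s0 : 0 < Num.sqrt (- B Y Y) by rewrite sqrtr_gt0 oppr_gt0.
split; last by rewrite tcZ mulr_gt0 ?invr_gt0.
rewrite minkZl minkZr; have := sqr_sqrtr (ltW (_ : 0 < - B Y Y)); rewrite oppr_gt0 => /(_ b) h.
move: (Num.sqrt _) s0 h => s s0 h; have -> : B Y Y = - s ^+ 2 by rewrite h opprK.
by field; rewrite gt_eqF.
Qed.

(** The lift of a diffeomorphism is only known to respect orbits, so the element of G that agrees
    with M may vary with the point. Divide by an element of G to fix [e0]. On the segment from [e0]
    towards Z, discreteness gives two points at which the same element of G agrees; it then agrees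
    on the whole plane, fixes [e0], and is 1 by freeness. *)
Lemma same_orbits G M : disc G -> (forall A X, G A -> hyp X -> A *m X = X -> A = 1%:M) -> lorentz M ->
  (forall X, hyp X -> exists2 D, G D & M *m X = D *m X) -> G M.
Proof.
move=> dG fG lM hM; have [gG lG _] := dG.
have [D0 GD0 e] := hM _ hyp_e0; pose N := invmx D0 *m M.
have lD0 := lG _ GD0; have lN : lorentz N by apply: lorM => //; exact: lorV.
have Ne0 : N *m e0 = e0 by rewrite /N -mulmxA e mulmxA lor_VAi// mul1mx.
have hN X : hyp X -> exists2 D, G D & N *m X = D *m X.
  move=> /hM[D GD h]; exists (invmx D0 *m D); first by apply: grM => //; exact: grV.
  by rewrite /N -!mulmxA h.
have NZ Z : hyp Z -> N *m Z = Z.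
  move=> hZ; have [ZZ tZ] := hZ.
  pose Y (k : nat) := e0 + (k.+1%:R : R)^-1 *: Z.
  have YY k : B (Y k) (Y k) <= -1.
    have e00 : 0 < (k.+1%:R : R)^-1 by rewrite invr_gt0.
    have [ee _] := @hyp_e0 R n; rewrite /Y !(minkDl, minkDr, minkZl, minkZr) ee ZZ (minkC Z) mink_e0.
    by move: (k.+1%:R^-1 : R) e00 => eps e00; nra.
  have tY k : 0 < tc (Y k) <= 1 + tc Z.
    have e00 : 0 < (k.+1%:R : R)^-1 by rewrite invr_gt0.
    have e1 : (k.+1%:R : R)^-1 <= 1 by rewrite invf_le1// ler1n.
    rewrite /Y tcD tcZ tc_e0; move: (k.+1%:R^-1 : R) e00 e1 => eps e00 e1; nra.
  have ex k : exists D, [/\ G D, N *m Y k = D *m Y k & D ord0 ord0 <= 4 * (1 + tc Z) ^+ 2 * N ord0 ord0].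
    have /andP[t0 t1] := tY k; have b := YY k.
    have hX := hyp_normalize (ltac:(lra) : B (Y k) (Y k) < 0) t0.
    have s1 : 1 <= Num.sqrt (- B (Y k) (Y k)) by rewrite -[leLHS]sqrtr1; apply: ler_wsqrtr; lra.
    move: (Num.sqrt _) s1 hX => s s1 hX.
    have s0 : s^-1 != 0 by rewrite invr_eq0 gt_eqF//; lra.
    have [D GD h] := hN _ hX; exists D; split=> //.
      by apply: (scalerI s0); rewrite !scalemxAr h.
    have tX : tc (s^-1 *: Y k) <= 1 + tc Z.
      rewrite tcZ; apply: le_trans t1; rewrite ger_pMl// invf_le1//; lra.
    apply: (le_trans (lor_disp (lG _ GD) hX)); rewrite -h.
    have := lor_tc_ub lN (hyp_causal hX); have [_] := hX; have [_] := lor_hyp lN hX.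
    have [_] := lor_e0 lN; rewrite tc_mul.
    move: (tc (s^-1 *: _)) (tc (N *m _)) (tc Z) (N _ _) tX {t1} => a b' z c tX c0 b0 a0 h1.
    have h2 : a * b' <= a * (2 * (c * a)) by rewrite ler_pM2l.
    have h3 : c * a ^+ 2 <= c * (1 + z) ^+ 2 by rewrite ler_pM2l// ler_pXn2r// nnegrE; lra.
    by nra.
  (* Infinitely many of the Y k, which lie on a segment from e0, are moved by N as by one element of G. *)
have [Ds hDs] := choice ex.
  have [i [j [ij e1]]] := disc_pigeon dG (fun k => let: And3 a _ _ := hDs k in a) (fun k => let: And3 _ _ c := hDs k in c).
  have [GD h1 _] := hDs i; have [_ h2 _] := hDs j; rewrite -e1 in h2.
  move: h1 h2; rewrite /Y !mulmxDr -!scalemxAr Ne0 => h1 h2.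
  have ne : (i.+1%:R : R)^-1 - (j.+1%:R)^-1 != 0.
    by rewrite subr_eq0; apply/eqP => /invr_inj/eqP; rewrite eqr_nat eqSS (ltn_eqF ij).
  have NZ : N *m Z = Ds i *m Z.
    apply: (scalerI ne); rewrite !scalerBl.
    have : (e0 + i.+1%:R^-1 *: (N *m Z)) - (e0 + j.+1%:R^-1 *: (N *m Z)) =
      (Ds i *m e0 + i.+1%:R^-1 *: (Ds i *m Z)) - (Ds i *m e0 + j.+1%:R^-1 *: (Ds i *m Z)) by rewrite h1 h2.
    by rewrite !opprD !addrA !(addrAC _ _ (- e0)) !(addrAC _ _ (- (_ *m e0))) !subrr !add0r.
  rewrite NZ in h1; move/addIr: h1 => /esym h1.
  by rewrite NZ (fG _ _ GD hyp_e0 h1) mul1mx.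
have N1 : N = 1%:M.
  apply: mulmx_ext => u; rewrite mul1mx.
  have -> : u = lift (sp u) - (tc (lift (sp u)) - tc u) *: e0.
    apply: mink_ext; first by rewrite tcD tcN tcZ tc_e0; ring.
    by rewrite spD -scaleNr spZ sp_lift sp_e0 scaler0 addr0.
  by rewrite mulmxBr -scalemxAr Ne0 (NZ _ (lift_hyp _)).
have -> : M = D0 *m N by rewrite /N mulmxA lor_AV// mul1mx.
by rewrite N1 mulmx1.
Qed.

End ClosedManifolds.

(** * The neighbourhood of an axis *)

Section Tube.
Context {R : realType} {n : nat}.
Implicit Types (x w : 'cV[R]_n) (X Z v : 'cV[R]_(1 + n)) (A C : 'M[R]_(1 + n)).
Local Notation B := (@mink R n).
Local Notation lift := (@lift_hyperboloid R n).
Variables (G : set 'M[R]_(1 + n)) (g : 'M[R]_(1 + n)) (lam : R) (P Q : 'cV[R]_(1 + n)).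
Hypotheses (dG : disc G) (Gg : G g) (hg : lox g lam P Q) (PQ : B P Q = - 2^-1).
Let gG : mx_subgroup G. Proof. by case: dG. Qed.
Let lG : G `<=` lorentz. Proof. by case: dG. Qed.
Let nP : null P. Proof. by case: hg. Qed.
Let nQ : null Q. Proof. by case: hg. Qed.
Let l1 : 1 < lam. Proof. by case: hg. Qed.
Let l0 : 0 < lam. Proof. exact: lt_trans l1. Qed.
Let PP : B P P = 0. Proof. by case: nP. Qed.
Let QQ : B Q Q = 0. Proof. by case: nQ. Qed.
Let QP : B Q P = - 2^-1. Proof. by rewrite minkC. Qed.

(** With B P Q = - 1/2 this parametrises the axis on the hyperboloid with unit speed, and [axis_vel]
    is its velocity. *)
Definition axis_pt (t : R) : 'cV[R]_(1 + n) := expR t *: P + expR (- t) *: Q.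
Definition axis_vel (t : R) : 'cV[R]_(1 + n) := expR t *: P - expR (- t) *: Q.

Let ee (t : R) : expR t * expR (- t) = 1. Proof. by rewrite -expRD subrr expR0. Qed.
Let eneq0 (t : R) : expR t != 0. Proof. by rewrite gt_eqF// expR_gt0. Qed.

Lemma axis_hyp t : hyp (axis_pt t).
Proof.
split; last by rewrite tcD !tcZ addr_gt0// mulr_gt0 ?expR_gt0//; [case: nP|case: nQ].
rewrite /axis_pt !(minkDl, minkDr, minkZl, minkZr) PP QQ PQ QP.
transitivity (- (expR t * expR (- t))); first by field.
by rewrite ee.
Qed.

Lemma axis_perp t v : B P v = 0 -> B Q v = 0 -> B (axis_pt t) v = 0.
Proof. by move=> p q; rewrite /axis_pt minkDl !minkZl p q !mulr0 addr0. Qed.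

Lemma axis_vel_perp t v : B P v = 0 -> B Q v = 0 -> B (axis_vel t) v = 0.
Proof. by move=> p q; rewrite /axis_vel minkBl !minkZl p q !mulr0 subrr. Qed.

Lemma axis_tangent t : B (axis_pt t) (axis_vel t) = 0.
Proof. by rewrite /axis_pt /axis_vel !(minkDl, minkBr, minkZl, minkZr) PP QQ PQ QP; ring. Qed.

Lemma axis_normal t v : B (axis_pt t) v = 0 -> B (axis_vel t) v = 0 -> B P v = 0 /\ B Q v = 0.
Proof.
rewrite /axis_pt /axis_vel minkBl minkDl !minkZl => h1 h2.
have p : expR t * B P v = 0 by lra.
have q : expR (- t) * B Q v = 0 by lra.
move/eqP: p; rewrite mulf_eq0 (negPf (eneq0 _)) /= => /eqP p.
by move/eqP: q; rewrite mulf_eq0 (negPf (eneq0 _)) /= => /eqP q.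
Qed.

Definition base : 'cV[R]_n := sp (axis_pt 0).
Definition dir : 'cV[R]_n := sp (axis_vel 0).
Definition len : R := ln lam.

Lemma len_gt0 : 0 < len. Proof. exact: ln_gt0. Qed.

Lemma lift_base : lift base = axis_pt 0. Proof. exact/lift_sp/axis_hyp. Qed.

Lemma dlift_base (t : R) : dlift base (t *: dir) = t *: axis_vel 0.
Proof. by rewrite /dir -spZ dlift_uniq// lift_base minkZr axis_tangent mulr0. Qed.

Lemma base_unit : inner hmetric base dir dir = 1.
Proof.
rewrite inner_dlift -[dir]scale1r dlift_base scale1r /axis_vel !(minkBl, minkBr, minkZl, minkZr) PP QQ PQ QP.
by rewrite oppr0 expR0; field.
Qed.

Lemma lift_line t : lift (hgeodesic base dir t) = axis_pt t.
Proof.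
rewrite /hgeodesic lift_hexp dlift_base lift_base.
have -> : hnorm base (t *: dir) = `|t|.
  rewrite /hnorm inner_dlift dlift_base minkZl minkZr.
  have -> : B (axis_vel 0) (axis_vel 0) = 1 by rewrite -base_unit inner_dlift -[dir]scale1r dlift_base scale1r.
  by rewrite mulr1 -expr2 sqrtr_sqr.
have -> : cosh `|t| = cosh t.
  have [_|_] := ger0P t; first by [].
  by rewrite /cosh opprK addrC.
have -> : (sinh `|t| / `|t|) *: (t *: axis_vel 0) = sinh t *: axis_vel 0.
  have [->|t0] := eqVneq t 0; first by rewrite scale0r scaler0 /sinh oppr0 subrr mul0r scale0r.
  rewrite scalerA; congr (_ *: _); have [h|h] := ger0P t; first by field.
  by rewrite /sinh opprK; field.
rewrite /axis_pt /axis_vel oppr0 expR0 !scale1r scalerDr scalerBr addrACA -scalerDl -scalerBl.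
by rewrite coshDsinh coshBsinh.
Qed.

Lemma lineE t : hgeodesic base dir t = sp (axis_pt t).
Proof. by rewrite -lift_line sp_lift. Qed.

Lemma derive_line t : (hgeodesic base dir)^`()%classic t = sp (axis_vel t).
Proof.
have -> : hgeodesic base dir = (fun t => expR t *: sp P) + (fun t => expR (- t) *: sp Q).
  by apply/funext => s; rewrite lineE spD !spZ.
have h1 : is_diff t (fun t => expR t *: sp P) (fun u : R => (u * expR t) *: sp P).
  apply: is_diff_scalel_fun; exact: is_derive_diff.
have h2 : is_diff t (fun t => expR (- t) *: sp Q) (fun u : R => (u * - expR (- t)) *: sp Q).
  apply: is_diff_scalel_fun; apply: is_derive_diff; apply: is_derive_eq; rewrite mulrN1//.
have [_] := is_diff_derive (is_diffD h1 h2).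
rewrite derive1E => ->; rewrite /= /axis_vel spD -scaleNr !spZ.
by rewrite -[LHS]/((1 * expR t) *: sp P + (1 * - expR (- t)) *: sp Q) !mul1r.
Qed.

Lemma line_normal t w : inner hmetric (hgeodesic base dir t) ((hgeodesic base dir)^`()%classic t) w = 0 <->
  B P (dlift (hgeodesic base dir t) w) = 0 /\ B Q (dlift (hgeodesic base dir t) w) = 0.
Proof.
rewrite inner_dlift derive_line dlift_uniq; last by rewrite lift_line axis_tangent.
split=> [h|[p q]]; last exact: axis_vel_perp.
by apply: (axis_normal (t := t)) => //; rewrite -lift_line dlift_perp.
Qed.

Lemma expR_len (j : nat) : expR (j%:R * len) = lam ^+ j.
Proof. by rewrite expRM_natl lnK ?posrE. Qed.

Lemma shift_pw (z : int) : exists A, [/\ G A, A *m P = expR (z%:~R * len) *: P & A *m Q = expR (- (z%:~R * len)) *: Q].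
Proof.
have [_ _ _ gP gQ] := hg; have lg := lG Gg; have gV := grV gG Gg.
have V (c : R) v : c != 0 -> g *m v = c *: v -> invmx g *m v = c^-1 *: v.
  move=> c0 e; apply: (scalerI c0); rewrite scalerA divff// scale1r scalemxAr -e mulmxA lor_VAi// mul1mx.
  by [].
have ln0 : lam != 0 by rewrite gt_eqF.
have VP := V _ _ ln0 gP; have VQ := V _ _ (invr_neq0 ln0) gQ; rewrite invrK in VQ.
case: z => j.
  exists (pw g j); rewrite -[(Posz j)%:~R]/(j%:R : R) expRN expR_len -exprVn; split; first exact: gr_pw.
    exact: pw_eig.
  exact: pw_eig.
exists (pw (invmx g) j.+1); rewrite NegzE mulrNz -[(Posz j.+1)%:~R]/(j.+1%:R : R) mulNr opprK expRN expR_len -exprVn.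
split; [exact: gr_pw|exact: pw_eig|exact: pw_eig].
Qed.

Lemma cyc_shift A : cyc g A -> exists z : int, A *m P = expR (z%:~R * len) *: P /\ A *m Q = expR (- (z%:~R * len)) *: Q.
Proof.
have [_ _ _ gP gQ] := hg; have lg := lG Gg; have gV := grV gG Gg.
have V (c : R) v : c != 0 -> g *m v = c *: v -> invmx g *m v = c^-1 *: v.
  move=> c0 e; apply: (scalerI c0); rewrite scalerA divff// scale1r scalemxAr -e mulmxA lor_VAi// mul1mx.
  by [].
have ln0 : lam != 0 by rewrite gt_eqF.
have VP := V _ _ ln0 gP; have VQ := V _ _ (invr_neq0 ln0) gQ; rewrite invrK in VQ.
case=> j [->|->].
  exists (Posz j); rewrite -[(Posz j)%:~R]/(j%:R : R) expRN expR_len -exprVn.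
  by split; exact: pw_eig.
exists (- Posz j)%R; rewrite mulrNz -[(Posz j)%:~R]/(j%:R : R) mulNr opprK expRN expR_len -exprVn.
by split; exact: pw_eig.
Qed.

Lemma axis_shift A (s t : R) : A *m P = expR s *: P -> A *m Q = expR (- s) *: Q -> A *m axis_pt t = axis_pt (t + s).
Proof.
move=> p q; rewrite /axis_pt mulmxDr -!scalemxAr p q !scalerA -!expRD.
by rewrite opprD.
Qed.

Lemma reduce (s : R) : exists A, [/\ G A, exists z : int, A *m P = expR (z%:~R * len) *: P /\ A *m Q = expR (- (z%:~R * len)) *: Q &
  exists2 s', A *m axis_pt s = axis_pt s' & tc (axis_pt s') <= lam * tc P + tc Q].
Proof.
pose z := - Num.floor (s / len).
have [A [GA p q]] := shift_pw z; exists A; split=> //; first by exists z.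
exists (s + z%:~R * len); first exact: axis_shift.
have f1 := Num.Theory.floor_le (s / len).
have f2 : s / len < (Num.floor (s / len) + 1)%:~R by rewrite -floor_lt_int ltzD1.
have L0 := len_gt0; rewrite intrD mulr1z ltr_pdivrMr// in f2; rewrite ler_pdivlMr// in f1.
have b1 : 0 <= s + z%:~R * len by rewrite /z intrN mulNr; lra.
have b2 : s + z%:~R * len <= len by rewrite /z intrN mulNr; lra.
have [_ tP] := nP; have [_ tQ] := nQ; rewrite /axis_pt tcD !tcZ; apply: lerD.
- by rewrite ler_pM2r// -[leRHS]lnK ?posrE// ler_expR.
- by rewrite ger_pMl// -[leRHS]expR0 ler_expR oppr_le0.
Qed.

(** A bound for the time coordinate of the axis over one period of g. *)
Definition span0 : R := lam * tc P + tc Q.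
Variable c : R.
Hypothesis tile : forall A, G A -> A ord0 ord0 <= 8 * span0 ^+ 2 * c ^+ 2 -> cyc g A.

Lemma tube_core A (s t : R) Z : G A -> hyp Z -> - B (axis_pt s) Z <= c -> - B (axis_pt t) (A *m Z) <= c ->
  exists z : int, A *m P = expR (z%:~R * len) *: P /\ A *m Q = expR (- (z%:~R * len)) *: Q.
Proof.
move=> GA hZ c1 c2; have lA := lG GA.
have [C1 [G1 [z1 [p1 q1]] [s1 e1 b1]]] := reduce s.
have [C2 [G2 [z2 [p2 q2]] [s2 e2 b2]]] := reduce t.
have l1' := lG G1; have l2' := lG G2.
have bd C X Y (r : R) : lorentz C -> hyp X -> hyp Y -> C *m X = axis_pt r -> tc (axis_pt r) <= span0 ->
    - B X Y <= c -> tc (C *m Y) <= 2 * span0 * c.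
  move=> lC hX hY e b h.
  have := hyp_tri hyp_e0 (axis_hyp r) (lor_hyp lC hY); rewrite -[in X in _ <= _ * X]e lor_mink// !mink_e0 opprK.
  have := hyp_mink hX hY; have [_] := axis_hyp r.
  by move: (tc (axis_pt r)) (B X Y) (tc (C *m Y)) span0 b h => a b d k h1 h2 h3 h4 h5; nra.
have h1 := bd _ _ _ _ l1' (axis_hyp s) hZ e1 b1 c1.
have h2 := bd _ _ _ _ l2' (axis_hyp t) (lor_hyp lA hZ) e2 b2 c2.
pose D := C2 *m A *m invmx C1.
have GD : G D by apply: grM => //; [exact: grM|exact: grV].
have AE : A = invmx C2 *m D *m C1.
  by rewrite /D !mulmxA lor_VAi// mul1mx -mulmxA lor_VAi// mulmx1.
have hZ1 := lor_hyp l1' hZ.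
have : D ord0 ord0 <= 8 * span0 ^+ 2 * c ^+ 2.
  apply: (le_trans (lor_disp (lG GD) hZ1)).
  have -> : D *m (C1 *m Z) = C2 *m (A *m Z) by rewrite /D -!mulmxA (mulmxA (invmx C1)) lor_VAi// mul1mx.
  have [_ t1] := hZ1; have [_ t2] := lor_hyp l2' (lor_hyp lA hZ).
  move: (tc (C1 *m Z)) (tc (C2 *m _)) t1 t2 h1 h2 => a b a0 b0 h1 h2.
  have : a * b <= (2 * span0 * c) * (2 * span0 * c) by apply: ler_pM => //; exact: ltW.
  by lra.
move=> /(tile GD) /cyc_shift[z [p q]].
clearbody D; exists (z + z1 - z2).
have inv (C : 'M[R]_(1 + n)) (k : R) v : lorentz C -> C *m v = expR k *: v -> invmx C *m v = expR (- k) *: v.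
  move=> lC e; apply: (scalerI (eneq0 k)); rewrite scalerA ee scale1r scalemxAr -e mulmxA lor_VAi// mul1mx.
  by [].
have sh (k1 k2 k : R) v : C1 *m v = expR k1 *: v -> C2 *m v = expR k2 *: v -> D *m v = expR k *: v ->
    A *m v = expR (k + k1 - k2) *: v.
  move=> f1 f2 f3; rewrite AE -!mulmxA f1 -scalemxAr f3 -!scalemxAr (inv _ _ _ l2' f2) !scalerA -!expRD.
  by congr (expR _ *: _); ring.
have -> : (z + z1 - z2)%:~R = z%:~R + z1%:~R - z2%:~R :> R by rewrite intrB intrD.
split; first by rewrite (sh _ _ _ _ p1 p2 p); congr (expR _ *: _); ring.
by rewrite (sh _ _ _ _ q1 q2 q); congr (expR _ *: _); ring.
Qed.

End Tube.

Lemma lor_invM (R : realType) n (A C : 'M[R]_(1 + n)) : lorentz A -> lorentz C ->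
  invmx (A *m C) = invmx C *m invmx A.
Proof.
move=> lA lC; have l := lorM lA lC.
have e : invmx C *m invmx A *m (A *m C) = 1%:M.
  by rewrite -!mulmxA (mulmxA (invmx A)) lor_VAi// mul1mx lor_VAi.
by rewrite -[LHS]mul1mx -e -!mulmxA (mulmxA A) lor_AV// mulmx1.
Qed.

Lemma dhact (R : realType) n (A : 'M[R]_(1 + n)) (x u : 'cV[R]_n) :
  'd (hact A) x u = sp (A *m dlift x u).
Proof. by have := @diff_val _ _ _ _ _ _ _ (is_diff_hact A x) => /(congr1 (fun f : 'cV[R]_n -> 'cV[R]_n => f u)). Qed.

(** * Frames of the normal bundle *)

Section Frame.
Context {R : realType}.

(** [adapted_basis] is normalised by B xi eta = -1; rescaling P and Q by the square root of 2
    reaches it, and accounts for the factors 2 in the expansion. *)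
Lemma orthonormal_frame n (P Q : 'cV[R]_(1 + n)) : (0 < n)%N -> null P -> null Q -> mink P Q = - 2^-1 ->
  exists vs : 'I_n.-1 -> 'cV[R]_(1 + n),
    [/\ forall i j, mink (vs i) (vs j) = (i == j)%:R,
        forall i, mink P (vs i) = 0, forall i, mink Q (vs i) = 0 &
        forall u, u = (- 2 * mink Q u) *: P + ((- 2 * mink P u) *: Q + \sum_i mink (vs i) u *: vs i)].
Proof.
move=> n0 hP hQ PQ; pose k := Num.sqrt 2 : R.
have k0 : 0 < k by rewrite sqrtr_gt0.
have kk : k * k = 2 by rewrite -expr2 sqr_sqrtr.
have e : mink (k *: P) (k *: Q) = -1.
  by rewrite minkZl minkZr PQ mulrA kk mulrN divff.
have [vs [vv vx ve dec]] := adapted_basis n0 (nullZ k0 hP) (nullZ k0 hQ) e.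
have kn : k != 0 by rewrite gt_eqF.
exists vs; split=> //.
- by move=> i; rewrite minkC; have /eqP := vx i; rewrite minkZr mulf_eq0 (negPf kn) => /eqP.
- by move=> i; rewrite minkC; have /eqP := ve i; rewrite minkZr mulf_eq0 (negPf kn) => /eqP.
- move=> u; rewrite {1}(dec u) !minkZl !scalerA addrA; congr (_ + _).
  have -> : - (k * mink Q u) * k = - 2 * mink Q u by rewrite -kk; ring.
  have -> : k * mink P u * k = 2 * mink P u by rewrite -kk; ring.
  by rewrite [- 2 * mink P u]mulNr scaleNr.
Qed.

(** In the basis P, Q, vs the matrix of A is block diagonal with blocks a, 1/a and the rotation, so
    only the rotation contributes to the determinant. *)
Lemma frame_det n (A : 'M[R]_(1 + n)) P Q (vs : 'I_n.-1 -> 'cV[R]_(1 + n)) (a : R) : (0 < n)%N ->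
  (forall u, u = (- 2 * mink Q u) *: P + ((- 2 * mink P u) *: Q + \sum_i mink (vs i) u *: vs i)) ->
  a != 0 -> A *m P = a *: P -> A *m Q = a^-1 *: Q ->
  (forall j, A *m vs j = \sum_i mink (vs i) (A *m vs j) *: vs i) ->
  \det (\matrix_(i, j) mink (vs i) (A *m vs j)) = \det A.
Proof.
case: n A P Q vs => [//|n] A P Q vs _ dec a0 AP AQ AV.
pose M : 'M[R]_n := \matrix_(i, j) mink (vs i) (A *m vs j).
pose V : 'M[R]_(1 + n.+1, n) := \matrix_(i, j) vs j i ord0.
have colV j : col j V = vs j by apply/colP => i; rewrite !mxE.
pose W : 'M[R]_(1 + (1 + n)) := row_mx P (row_mx Q V).
pose N : 'M[R]_(1 + (1 + n)) := col_mx (- 2 *: (Q^T *m lorentz_form))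
  (col_mx (- 2 *: (P^T *m lorentz_form)) (V^T *m lorentz_form)).
have mx11 (b : 'M[R]_1) (p : 'cV[R]_(1 + n.+1)) : p *m b = b ord0 ord0 *: p.
  by apply/colP => i; rewrite !mxE big_ord1 mulrC.
have WN : W *m N = 1%:M.
  apply: mulmx_ext => u; rewrite mul1mx -mulmxA /N /W !mul_col_mx !mul_row_col.
  rewrite [RHS]dec; congr (_ + (_ + _)).
  - by rewrite mx11 -!scalemxAl mxE.
  - by rewrite mx11 -!scalemxAl mxE.
  - rewrite -[V *m _]/(V *m (V^T *m lorentz_form *m u)).
    set y := V^T *m lorentz_form *m u.
    have ye i : y i ord0 = mink (vs i) u.
      rewrite /y -mulmxA mxE /mink -mulmxA mxE; apply: eq_bigr => l _.
      by congr (_ * _); rewrite !mxE.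
    apply/colP => i; rewrite mxE summxE; apply: eq_bigr => l _.
    by rewrite ye mxE [RHS]mxE mulrC.
pose D : 'M[R]_(1 + (1 + n)) := block_mx a%:M 0 0 (block_mx a^-1%:M 0 0 M).
have AW : (A : 'M[R]_(1 + (1 + n))) *m W = W *m D.
  rewrite /W /D mul_row_block mul_mx_row mul_mx_row mul_row_block !mulmx0 !addr0 !add0r.
  rewrite !mul_mx_scalar -AP -AQ; congr (row_mx _ (row_mx _ _)).
  apply/row_matrixP => i; apply/rowP => j; rewrite !mxE.
  have := congr1 (fun v : 'cV[R]_(1 + n.+1) => v i ord0) (AV j); rewrite mxE summxE => e.
  transitivity (\sum_l A i l * vs j l ord0); first by apply: eq_bigr => l _; rewrite mxE.
  by rewrite e; apply: eq_bigr => l _; rewrite !mxE mulrC.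
have [uW _] := mulmx1_unit WN.
have dW : \det W != 0 by rewrite -unitfE -unitmxE.
have := congr1 (fun X : 'M[R]_(1 + (1 + n)) => \det X) AW.
rewrite !det_mulmx mulrC => /(mulfI dW) ->.
by rewrite /D det_ublock det_ublock !det_scalar1 mulrA divff// mul1r.
Qed.

End Frame.

(** * The closed geodesic, its tube and its symmetries *)

Section Geodesic.
Context {R : realType} {n : nat}.
Implicit Types (x w : 'cV[R]_n) (X Z v : 'cV[R]_(1 + n)) (A C h : 'M[R]_(1 + n)).
Local Notation B := (@mink R n).
Local Notation lift := (@lift_hyperboloid R n).
Variables (G : set 'M[R]_(1 + n)) (g : 'M[R]_(1 + n)) (lam : R) (P Q : 'cV[R]_(1 + n)).
Hypotheses (dG : disc G) (Gg : G g) (hg : lox g lam P Q) (PQ : B P Q = - 2^-1).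
Variable a : R.
Hypothesis a0 : 0 < a.
Hypothesis tile : forall A, G A -> A ord0 ord0 <= 8 * span0 lam P Q ^+ 2 * cosh a ^+ 2 -> cyc g A.
Let gG : mx_subgroup G. Proof. by case: dG. Qed.
Let lG : G `<=` lorentz. Proof. by case: dG. Qed.
Let nP : null P. Proof. by case: hg. Qed.
Let nQ : null Q. Proof. by case: hg. Qed.
Let PP : B P P = 0. Proof. by case: nP. Qed.
Let QQ : B Q Q = 0. Proof. by case: nQ. Qed.
Let QP : B Q P = - 2^-1. Proof. by rewrite minkC. Qed.
Local Notation line := (hgeodesic (base P Q) (dir P Q)).
Local Notation axis := (axis_pt P Q).
Let L t : lift (line t) = axis t. Proof. exact: lift_line hg PQ t. Qed.
Let hL t : hyp (axis t). Proof. exact: axis_hyp hg PQ t. Qed.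

Lemma minkP_axis t : B P (axis t) = - (expR (- t) / 2).
Proof. by rewrite /axis_pt minkDr !minkZr PP PQ; ring. Qed.
Lemma minkQ_axis t : B Q (axis t) = - (expR t / 2).
Proof. by rewrite /axis_pt minkDr !minkZr QQ QP; ring. Qed.

Lemma axis_inj s t : axis s = axis t -> s = t.
Proof. by move=> /(congr1 (B Q)); rewrite !minkQ_axis => e; apply: expR_inj; lra. Qed.

Lemma mproj_lift x w : mproj G x = mproj G w <-> exists2 A, G A & lift w = A *m lift x.
Proof.
rewrite mprojP//; split=> -[A GA e]; exists A => //.
  by rewrite e lift_hact//; exact: lG.
by apply: lift_inj; rewrite e lift_hact//; exact: lG.
Qed.

Lemma line_embedded s t : mproj G (line s) = mproj G (line t) <-> exists z : int, t - s = z%:~R * len lam.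
Proof.
rewrite mproj_lift !L; split=> [[A GA e]|[z e]].
  have c1 r : - B (axis r) (axis r) <= cosh a by have [-> _] := hL r; have := cosh_ge1 a; lra.
  have [|z [p q]] := tube_core dG Gg hg PQ tile GA (hL s) (c1 s) (t := t); first by rewrite -e.
  exists z; move: e; rewrite (axis_shift s p q) => /axis_inj ->; ring.
have [A [GA p q]] := shift_pw dG Gg hg z; exists A => //.
by rewrite (axis_shift s p q) -e addrC subrK.
Qed.

Definition axis_geodesic : closed_geodesic G :=
  ClosedGeodesic (base_unit hg PQ) (len_gt0 hg) line_embedded.

(** [tube_core] applies with c = cosh a, which bounds - B between a point of the axis and a point of
    the tube above it. Comparing components along P and Q yields equal radii and then t = s + k;
    what remains is the equality of the normal vectors. *)
Lemma axis_geodesic_tube : normal_tube axis_geodesic a.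
Proof.
move=> s t w w' /(line_normal hg PQ) [Pw Qw] /(line_normal hg PQ) [Pw' Qw'].
rewrite -![cg_line _ _]/(line _) => wa wa' /mproj_lift[A GA].
have lA := lG GA.
have E1 := lift_hexp (line s) w; have E2 := lift_hexp (line t) w'.
have hZ := lift_hyp (hexp (line s) w).
rewrite {}E2; rewrite {}E1 in hZ *; rewrite !L in hZ *.
set om := dlift (line s) w in Pw Qw hZ *; set om' := dlift (line t) w' in Pw' Qw' *.
set r := hnorm (line s) w in wa hZ *; set r' := hnorm (line t) w' in wa' *.
move=> e.
have r0 : 0 <= r by exact: hnorm_ge0.
have r0' : 0 <= r' by exact: hnorm_ge0.
have c1 : - B (axis s) (cosh r *: axis s + (sinh r / r) *: om) <= cosh a.
  rewrite minkDr !minkZr (axis_perp s Pw Qw); have [-> _] := hL s.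
  by rewrite mulr0 addr0 mulrN1 opprK cosh_le// ltW.
have c2 : - B (axis t) (A *m (cosh r *: axis s + (sinh r / r) *: om)) <= cosh a.
  rewrite -e minkDr !minkZr (axis_perp t Pw' Qw'); have [-> _] := hL t.
  by rewrite mulr0 addr0 mulrN1 opprK cosh_le// ltW.
have [z [p q]] := tube_core dG Gg hg PQ tile GA hZ c1 c2.
pose k := z%:~R * len lam; rewrite -/k in p q.
have AE := axis_shift s p q.
have orth v v' (b : R) : A *m v = expR b *: v -> B v v' = 0 -> B v (A *m v') = 0.
  move=> e1 e2; have := lor_mink v v' lA; rewrite e1 e2 minkZl => /eqP.
  by rewrite mulf_eq0 gt_eqF ?expR_gt0//= => /eqP.
have PA := orth _ _ _ p Pw; have QA := orth _ _ _ q Qw.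
move: e; rewrite mulmxDr -!scalemxAr AE => e.
have bil u v1 v2 (k1 k2 : R) : B u (k1 *: v1 + k2 *: v2) = k1 * B u v1 + k2 * B u v2.
  by rewrite minkDr !minkZr.
have eP : cosh r' * expR (- t) = cosh r * expR (- (s + k)).
  have := congr1 (B P) e; rewrite (bil P (axis t)) (bil P (axis (s + k))) Pw' PA !minkP_axis !mulr0 !addr0.
  by move: (expR (- t)) (expR (- (s + k))) (cosh r) (cosh r') => *; lra.
have eQ : cosh r' * expR t = cosh r * expR (s + k).
  have := congr1 (B Q) e; rewrite (bil Q (axis t)) (bil Q (axis (s + k))) Qw' QA !minkQ_axis !mulr0 !addr0.
  by move: (expR t) (expR (s + k)) (cosh r) (cosh r') => *; lra.
have er : r' = r.
  apply: cosh_inj => //; apply/eqP; rewrite -(eqrXn2 (isT : (0 < 2)%N)) ?ltW ?cosh_gt0//; apply/eqP.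
  have E (b : R) : expR b * expR (- b) = 1 by rewrite -expRD subrr expR0.
  rewrite -[LHS]mulr1 -(E t) -[RHS]mulr1 -(E (s + k)) !expr2.
  have -> : cosh r' * cosh r' * (expR t * expR (- t)) = (cosh r' * expR t) * (cosh r' * expR (- t)) by ring.
  by rewrite eP eQ; ring.
have et : t = s + k.
  by apply: expR_inj; move: eQ; rewrite er => /(mulfI (lt0r_neq0 (cosh_gt0 r))).
have eo : A *m om = om'.
  have [h0|h0] := eqVneq r 0.
    have z0 (x : 'cV[R]_n) : dlift x 0 = 0.
      by have := @dlift_uniq R n x 0 (mink0r _); rewrite /sp linear0.
    by rewrite /om /om' (hnorm0 (etrans er h0)) (hnorm0 h0) !z0 mulmx0.
  move: e; rewrite er et => /addrI.
  have s0 : sinh r / r != 0.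
    rewrite mulf_neq0 ?invr_eq0//; apply/eqP => s0.
    have := cosh_sinh r; rewrite s0 expr0n subr0 => /eqP; rewrite sqrf_eq1 => /orP[/eqP c|/eqP c].
      have c0 : cosh 0 = 1 :> R by rewrite /cosh oppr0 expR0; field.
      by move/eqP: h0; apply; apply: cosh_inj => //; rewrite c c0.
    by have := cosh_gt0 r; rewrite c oppr_gt0 ltr10.
  by move=> /(scalerI s0).
exists A; split=> //.
- by apply: lift_inj; rewrite lift_hact// !L AE et.
- by rewrite dhact -/om eo /om' sp_dlift.
Qed.

Lemma axis_geodesic_width : (a%:E <= cg_width axis_geodesic)%E.
Proof.
by apply: ereal_sup_ubound; exists a => //; split=> //; exact: axis_geodesic_tube.
Qed.

(** A constant frame works: a vector orthogonal to P and Q is normal to the axis at all its points,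
    and in the chart it has the same space part everywhere. A deck transformation preserving the
    axis acts on this frame with determinant 1 by [frame_det]. *)
Lemma axis_geodesic_orientable : (0 < n)%N -> (forall A, G A -> \det A = 1) ->
  orientable_normal_bundle axis_geodesic.
Proof.
move=> n0 det1; have [vs [vv Pv Qv dec]] := orthonormal_frame n0 nP nQ PQ.
have dl t v : B P v = 0 -> B Q v = 0 -> dlift (line t) (sp v) = v.
  by move=> p q; apply: dlift_uniq; rewrite L; exact: axis_perp.
pose E : 'M[R]_(n, n.-1) := \matrix_(i, j) sp (vs j) i ord0.
have colE' j : col j E = sp (vs j) by apply/colP => i; rewrite !mxE.
exists (fun=> E); split; first exact: cst_continuous.
- move=> t; split; last first.
    by move=> j; apply/(line_normal hg PQ); rewrite colE' dl.
  rewrite -mxrank_tr; apply/eqP; rewrite -/(row_free _) -kermx_eq0; apply/eqP/row_matrixP => i; rewrite row0.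
  have /sub_kermxP := row_sub i (kermx E^T).
  set u := row i _ => uE.
  pose v := \sum_j u ord0 j *: vs j.
  have sv : sp v = 0.
    have -> : sp v = \sum_j u ord0 j *: sp (vs j).
      by rewrite /sp /v linear_sum; apply: eq_bigr => j _; rewrite linearZ.
    apply/colP => l; have := congr1 (fun M : 'rV[R]_n => M ord0 l) uE.
    rewrite mxE [RHS]mxE [in X in _ -> _ = X]mxE => <-; rewrite summxE; apply: eq_bigr => j _.
    by rewrite mxE [E^T _ _]mxE [E _ _]mxE.
  have pv W : (forall j, B W (vs j) = 0) -> B W v = 0.
    by move=> h; rewrite /v mink_sumr big1// => j _; rewrite minkZr h mulr0.
  have v0 : v = 0.
    have := dl 0 v (pv _ Pv) (pv _ Qv); rewrite sv => <-.
    by have := @dlift_uniq R n (line 0) 0 (mink0r _); rewrite /sp linear0.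
  apply/rowP => j; rewrite [RHS]mxE.
  have := mink0r (vs j); rewrite -v0 /v mink_sumr (bigD1 j)//= minkZr vv eqxx mulr1 big1 ?addr0// => l lj.
  by rewrite minkZr vv eq_sym (negPf lj) mulr0.
- move=> A s t GA; rewrite -![cg_line _ _]/(line _) => e.
  have lA := lG GA; have {}e : axis t = A *m axis s by rewrite -!L -e lift_hact.
  have c1 r : - B (axis r) (axis r) <= cosh a by have [-> _] := hL r; have := cosh_ge1 a; lra.
  have [|z [p q]] := tube_core dG Gg hg PQ tile GA (hL s) (c1 s) (t := t); first by rewrite -e.
  have orth v v' (b : R) : A *m v = expR b *: v -> B v v' = 0 -> B v (A *m v') = 0.
    move=> e1 e2; have := lor_mink v v' lA; rewrite e1 e2 minkZl => /eqP.
    by rewrite mulf_eq0 gt_eqF ?expR_gt0//= => /eqP.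
  have Av j : A *m vs j = \sum_i B (vs i) (A *m vs j) *: vs i.
    rewrite {1}(dec (A *m vs j)) (orth _ _ _ p (Pv j)) (orth _ _ _ q (Qv j)).
    by rewrite !mulr0 !scale0r !add0r.
  exists (\matrix_(i, j) B (vs i) (A *m vs j)); split.
    by rewrite expRN in q; rewrite (frame_det n0 dec (lt0r_neq0 (expR_gt0 _)) p q Av) det1.
  move=> j; rewrite colE' dhact dl// Av /sp linear_sum; apply/colP => i.
  rewrite !mxE summxE; apply: eq_bigr => l _; rewrite linearZ /= !mxE mulrC; congr (_ * _).
Qed.

Hypothesis fG : forall A X, G A -> hyp X -> A *m X = X -> A = 1%:M.
Hypothesis selfnorm : forall h b, lorentz h -> b != 0 -> preserves P Q h b ->
  (forall C, G C -> G (h *m C *m invmx h)) -> (forall C, G C -> G (invmx h *m C *m h)) -> cyc g h.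

Lemma span_preserves h (s t s' t' : R) : lorentz h -> s != t ->
  h *m axis s = axis s' -> h *m axis t = axis t' -> exists2 b, b != 0 & preserves P Q h b.
Proof.
move=> lh st e1 e2.
pose d := expR s ^+ 2 - expR t ^+ 2.
have d0 : d != 0.
  rewrite subr_eq0 eqrXn2// ?ltW ?expR_gt0//; apply: contra st => /eqP /expR_inj ->//.
have E (r : R) : expR r * expR (- r) = 1 by rewrite -expRD subrr expR0.
have PE : d *: P = expR s *: axis s - expR t *: axis t.
  rewrite /axis_pt !scalerDr !scalerA !E opprD addrACA subrr addr0 -scalerBl /d !expr2//.
have QE : Q = expR s *: axis s - expR s ^+ 2 *: P.
  by rewrite /axis_pt !scalerDr !scalerA !E scale1r -expr2 addrAC subrr add0r.
have sp1 v1 v2 (b1 b2 c1 c2 k1 k2 : R) : v1 = b1 *: P + b2 *: Q -> v2 = c1 *: P + c2 *: Q ->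
    k1 *: v1 - k2 *: v2 = (k1 * b1 - k2 * c1) *: P + (k1 * b2 - k2 * c2) *: Q.
  by move=> -> ->; rewrite !scalerDr !scalerA opprD addrACA -!scalerBl.
have hP : d *: (h *m P) = expR s *: axis s' - expR t *: axis t'.
  by rewrite scalemxAr PE mulmxBr -!scalemxAr e1 e2.
have [al [be hPE]] : exists al be, h *m P = al *: P + be *: Q.
  exists (d^-1 * (expR s * expR s' - expR t * expR t')), (d^-1 * (expR s * expR (- s') - expR t * expR (- t'))).
  have -> : h *m P = d^-1 *: (d *: (h *m P)) by rewrite scalerA mulVf// scale1r.
  by rewrite hP -!scalerA -scalerDr; congr (_ *: _); exact: sp1.
have [ga [de hQE]] : exists ga de, h *m Q = ga *: P + de *: Q.
  exists (expR s * expR s' - expR s ^+ 2 * al), (expR s * expR (- s') - expR s ^+ 2 * be).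
  rewrite {1}QE mulmxBr -!scalemxAr e1; exact: sp1.
have h1 : al * be = 0.
  have := lor_mink P P lh; rewrite hPE !(minkDl, minkDr, minkZl, minkZr) PP QQ PQ QP.
  by move: al be {hPE} => b1 b2; lra.
have h2 : ga * de = 0.
  have := lor_mink Q Q lh; rewrite hQE !(minkDl, minkDr, minkZl, minkZr) PP QQ PQ QP.
  by move: ga de {hQE} => b1 b2; lra.
have h3 : al * de + be * ga = 1.
  have := lor_mink P Q lh; rewrite hPE hQE !(minkDl, minkDr, minkZl, minkZr) PP QQ PQ QP.
  by move: al be ga de {hPE hQE h1 h2} => b1 b2 b3 b4; lra.
move/eqP: h1; rewrite mulf_eq0 => /orP[/eqP z|/eqP z]; move: h3; rewrite z mul0r ?add0r ?addr0 => h3.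
  have b0 : be != 0 by apply: contra_eq_neq h3 => ->; rewrite mul0r eq_sym oner_neq0.
  have g0 : ga != 0 by apply: contra_eq_neq h3 => ->; rewrite mulr0 eq_sym oner_neq0.
  move/eqP: h2; rewrite mulf_eq0 (negPf g0) /= => /eqP z2.
  exists be => //; right; split; first by rewrite hPE z scale0r add0r.
  by rewrite hQE z2 scale0r addr0; congr (_ *: _); apply: (mulfI b0); rewrite divff.
have b0 : al != 0 by apply: contra_eq_neq h3 => ->; rewrite mul0r eq_sym oner_neq0.
have g0 : de != 0 by apply: contra_eq_neq h3 => ->; rewrite mulr0 eq_sym oner_neq0.
move/eqP: h2; rewrite mulf_eq0 (negPf g0) orbF => /eqP z2.
exists al => //; left; split; first by rewrite hPE z scale0r addr0.
by rewrite hQE z2 scale0r add0r; congr (_ *: _); apply: (mulfI b0); rewrite divff.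
Qed.

(** A maps each point of the axis to some G-translate of the axis, which may depend on the point. By
    discreteness two of the points with parameter 1/(k + 1) go to the same translate C; then C^-1 A
    preserves the axis by [span_preserves] and normalises G, so it is a power of g. *)
Lemma normalizer_axis A : lorentz A ->
  (forall C, G C -> G (A *m C *m invmx A)) -> (forall C, G C -> G (invmx A *m C *m A)) ->
  (forall t, exists s, exists2 C, G C & A *m axis t = C *m axis s) -> G A.
Proof.
move=> lA N1 N2 im.
pose tk (k : nat) : R := k.+1%:R^-1.
have tk01 k : 0 <= tk k <= 1 by rewrite invr_ge0 ler0n invf_le1 ?ler1n.
have tP : 0 < tc P by case: nP.
have tQ : 0 < tc Q by case: nQ.
pose T := expR 1 * tc P + tc Q.
have tT k : tc (axis (tk k)) <= T.
  have /andP[t0 t1] := tk01 k; rewrite /axis_pt tcD !tcZ; apply: lerD.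
    by rewrite ler_pM2r// ler_expR.
  by rewrite ger_pMl// -[leRHS]expR0 ler_expR oppr_le0.
have ex k : exists p : 'M[R]_(1 + n) * R, [/\ G p.1, A *m axis (tk k) = p.1 *m axis p.2 &
    p.1 ord0 ord0 <= 2 * span0 lam P Q * (2 * (A ord0 ord0 * T))].
  have [s [C GC e]] := im (tk k).
  have [D [GD _ [s' e' b]]] := reduce dG Gg hg s.
  have lC := lG GC; have lD := lG GD.
  have GE : G (C *m invmx D) by apply: grM => //; exact: grV.
  have eE : A *m axis (tk k) = C *m invmx D *m axis s'.
    by rewrite -e' -!mulmxA (mulmxA (invmx D)) lor_VAi// mul1mx.
  exists (C *m invmx D, s'); split=> //=.
  apply: (le_trans (lor_disp (lG GE) (hL s'))); rewrite -eE.
  have h1 := lor_tc_ub lA (hyp_causal (hL (tk k))); have h2 := tT k.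
  have [_ h3] := lor_hyp lA (hL (tk k)); have [_ h4] := hL s'; have [_] := lor_e0 lA; rewrite tc_mul.
  rewrite -/(span0 lam P Q) in b.
  move: (tc (axis s')) (tc (axis (tk k))) (tc (A *m _)) (span0 _ _ _) (A _ _) T b h1 h2 h3 h4 {tT eE GE} => x1 x2 x3 k0 y T' b h1 h2 h3 h4 y0.
  have h5 : x3 <= 2 * (y * T') by apply: (le_trans h1); rewrite ler_pM2l// ler_pM2l.
  apply: ler_pM => //; [lra|exact: ltW|lra].
have [f hf] := choice ex.
have hf1 k : G (f k).1 by have [] := hf k.
have hf2 k : (f k).1 ord0 ord0 <= 2 * span0 lam P Q * (2 * (A ord0 ord0 * T)) by have [] := hf k.
have [i [j [ij e]]] := disc_pigeon dG hf1 hf2.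
have [GC e1 _] := hf i; have [_ e2 _] := hf j; rewrite -e in e2.
move: (f i).1 (f i).2 (f j).2 GC e1 e2 => C s1 s2 GC e1 e2 {e hf hf1 hf2 f ex}.
have lC := lG GC; pose h := invmx C *m A.
have lh : lorentz h by apply: lorM => //; exact: lorV.
have he t s : A *m axis t = C *m axis s -> h *m axis t = axis s.
  by move=> e; rewrite /h -mulmxA e mulmxA lor_VAi// mul1mx.
have ne : tk i != tk j by apply/eqP => /invr_inj/eqP; rewrite eqr_nat eqSS (ltn_eqF ij).
have [b b0 pb] := span_preserves lh ne (he _ _ e1) (he _ _ e2).
have hi : invmx h = invmx A *m C.
  rewrite /h lor_invM//; last exact: lorV.
  congr (_ *m _); have lV := lorV lC.
  by rewrite -[LHS]mul1mx -(lor_AV lC) -mulmxA lor_AV// mulmx1.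
have GVC := grV gG GC.
have : cyc g h.
  apply: (selfnorm lh b0 pb) => x Gx; rewrite hi.
    have -> : h *m x *m (invmx A *m C) = invmx C *m (A *m x *m invmx A) *m C by rewrite /h !mulmxA.
    by apply: grM => //; apply: grM => //; exact: N1.
  have -> : invmx A *m C *m x *m h = invmx A *m (C *m x *m invmx C) *m A by rewrite /h !mulmxA.
  by apply: N2; exact: gr_conj.
move=> /(cyc_group gG Gg) Gh.
have -> : A = C *m h by rewrite /h mulmxA lor_AV// mul1mx.
exact: grM.
Qed.

(** For a lift A of a symmetry and C in G, both A C A^-1 and A^-1 C A map every point into its
    G-orbit, so they belong to G by [same_orbits]. Then [normalizer_axis] puts A itself in G, and A
    induces the identity. *)
Lemma axis_geodesic_symmetries : cg_symmetries axis_geodesic = 1%N.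
Proof.
rewrite /cg_symmetries.
set S := [set f | _].
have did (x u : 'cV[R]_n) : 'd id x u = u.
  by have := @diff_val _ _ _ _ _ _ _ (is_diff_id x) => /(congr1 (fun f : 'cV[R]_n -> 'cV[R]_n => f u)).
have -> : S = [set (id : {classic (manifold G -> manifold G)})].
  apply/seteqP; split=> [f [[phi [[sphi [psi [spsi c1 c2]] orb] iphi fphi]] im]|f ->] /=; last first.
    split; last by rewrite image_id.
    exists id; split=> //.
      by split=> //; [exact: smooth_id|exists id; split=> //; exact: smooth_id].
    by move=> x u v; rewrite !did mul1r.
  have [A lA phiE] := isometry_lorentz (fun x => smooth_differentiable x sphi) (fun x => smooth_differentiable x spsi) c1 c2 iphi.
  have GA : G A.
    apply: normalizer_axis => //.
    - move=> C GC; have lC := lG GC.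
      apply: (same_orbits dG fG); first by apply: lorM; [exact: lorM|exact: lorV].
      move=> X hX; have hY := lor_hyp (lorV lA) hX.
      pose x := sp (invmx A *m X); have xE : lift x = invmx A *m X by exact: lift_sp.
      have /orb/mproj_lift[D GD] : mproj G x = mproj G (hact C x).
        by apply/mproj_lift; exists C => //; rewrite lift_hact.
      rewrite phiE !lift_hact// xE => e; exists D => //.
      by rewrite -!mulmxA e (mulmxA A) lor_AV// mul1mx.
    - move=> C GC; have lC := lG GC.
      apply: (same_orbits dG fG); first by apply: lorM => //; apply: lorM => //; exact: lorV.
      move=> X hX; pose x := sp X; have xE : lift x = X by exact: lift_sp.
      pose y := sp (invmx A *m C *m A *m X).
      have yE : lift y = invmx A *m C *m A *m X.
        by apply: lift_sp; apply: lor_hyp => //; apply: lorM => //; apply: lorM => //; exact: lorV.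
      have /(proj2 (orb x y))/mproj_lift[D GD] : mproj G (phi x) = mproj G (phi y).
        apply/mproj_lift; exists C => //; rewrite phiE !lift_hact// xE yE.
        by rewrite !mulmxA lor_AV// mul1mx.
      by rewrite xE yE => ->; exists D.
    - move=> t; have : cg_image axis_geodesic (f (mproj G (line t))).
        by rewrite -im; exists (mproj G (line t)) => //; exists t.
      move=> [s _]; rewrite fphi phiE => /mproj_lift[C GC].
      by rewrite lift_hact// -[cg_line _ s]/(line s) !L => ->; exists s, C.
  apply/funext => m; have [x ->] := mproj_onto m.
  rewrite fphi phiE; symmetry; apply/mproj_lift; exists A => //; rewrite lift_hact//.
by rewrite fset_set1 cardfs1.
Qed.

End Geodesic.

(** * Existence of a cover with a k-good geodesic *)

Theorem theorem1 (R : realType) (r : nat -> nat -> R -> R)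
    (hr : property_R r) (n k : nat) (G : set 'M[R]_(1 + n))
    (hM : closed_hyperbolic G) (hna : ~ arithmetic_lattice G)
    (hk : dim_condition k n) :
  exists G' : set 'M[R]_(1 + n), finite_cover G' G /\ has_k_good r k G'.
Proof.
have n3 : (3 < n)%N.
  case: hk => [[_ h]|[_ h]|[p [_ _ _ h]]]; apply: leq_trans h => //.
  by rewrite -[4%N]add0n leq_add.
have n1 : (1 < n)%N by exact: ltn_trans n3.
have n0 : (0 < n)%N by exact: ltn_trans n3.
have dG := closed_disc hM; have [r0 cG] := closed_cocpt hM.
have fG A X : G A -> hyp X -> A *m X = X -> A = 1%:M by exact: closed_free.
have [Lam [dL GL maxL]] := maximal_disc dG cG n1 fG.
have [g [lam [xi [eta [Cg hg xe axg]]]]] := exists_axis dG cG n1 fG dL GL.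
(* Passes from B xi eta = -1, used for the tile, to B P Q = - 1/2, which gives the axis unit
   speed. *)
pose s := (Num.sqrt 2)^-1 : R.
have s0 : 0 < s by rewrite invr_gt0 sqrtr_gt0.
have ss : s * s = 2^-1 by rewrite -expr2 exprVn sqr_sqrtr.
pose P := s *: xi; pose Q := s *: eta.
have [l1 nx ne gx ge] := hg.
have hg' : lox g lam P Q.
  split=> //; [exact: nullZ|exact: nullZ| |]; rewrite /P /Q -scalemxAr ?gx ?ge !scalerA mulrC //.
have PQ : mink P Q = - 2^-1 by rewrite /P /Q minkZl minkZr xe mulrN1 mulrN ss.
(* The length [len lam] is known before the cover is chosen and stays the length of the geodesic,
   because g lies in G'. The maximum with 1 makes the radius positive. *)
pose a := Num.max (r n k (len lam)) 1.
have a0 : 0 < a by rewrite lt_max ltr01 orbT.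
have [G' [[gG' G'C iG' G'g tile] selfn]] := exists_tile dG cG n3 fG dL GL maxL
  (8 * span0 lam P Q ^+ 2 * cosh a ^+ 2) Cg hg xe axg.
have G'G : G' `<=` G by move=> A /G'C /(core_sub dL).
have dG' : disc G'.
  have [_ lG fin] := dG; split=> // [A /G'G /lG//|q].
  by apply: sub_finite_set (fin q) => A [/G'G GA h]; split.
have fG' A X : G' A -> hyp X -> A *m X = X -> A = 1%:M by move=> /G'G; exact: fG.
have selfn' h b : lorentz h -> b != 0 -> preserves P Q h b ->
    (forall C, G' C -> G' (h *m C *m invmx h)) -> (forall C, G' C -> G' (invmx h *m C *m h)) -> cyc g h.
  move=> lh b0 pb; apply: (selfn h b) => //.
  have cancel_s (u v : 'cV[R]_(1 + n)) (e : R) : h *m (s *: u) = e *: (s *: v) -> h *m u = e *: v.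
    rewrite -scalemxAr scalerA mulrC -scalerA; apply: scalerI; by rewrite gt_eqF.
  by case: pb => -[/cancel_s e1 /cancel_s e2]; [left|right].
exists G'; split; first by split=> //; exact: closed_index hM gG' iG'.
exists (axis_geodesic dG' G'g hg' PQ tile).
have sym := axis_geodesic_symmetries dG' G'g hg' PQ tile fG' selfn'.
split.
- by apply: axis_geodesic_orientable => // A /G'C[].
- apply: le_trans (axis_geodesic_width dG' G'g hg' PQ a0 tile).
  by rewrite lee_fin le_max lexx.
- by rewrite sym.
- by move=> p pp p2 _; rewrite sym; split=> //; rewrite dvdn1; case: p pp p2 => [|[|p]].
Qed.
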